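(* Let $d\ge1$, $\beta>0$, and let $V:\mathbb{R}^d\to\mathbb{R}$ be a smooth confining potential such that, for some constants $D$ and $C_4>0$, $\|\nabla V(x)-\nabla V(y)\|\le D\|x-y\|$ for all $x,y\in\mathbb{R}^d$ and $\left|\sum_{i=1}^d\partial_{x_i}^2V(x)\right|\le C_4(1+\|x\|^2)$ for all $x\in\mathbb{R}^d$. Let $g:\mathbb{R}^d\to\mathbb{R}$ be a twice differentiable function such that: (1) there is $C_1>0$ with $|g(x)-g(y)|\le C_1\|x-y\|$ for all $x,y\in\mathbb{R}^d$; (2) there is $C_2>0$ with $\|\nabla g(x)-\nabla g(y)\|\le C_2\|x-y\|$ for all $x,y\in\mathbb{R}^d$; (3) there are constants $0<m_1<M_1$ with $m_1<g(x)<M_1$ for all $x\in\mathbb{R}^d$; (4) there is $C_3>0$ with $\|\nabla V(x)g(x)-\nabla V(y)g(y)\|\le C_3\|x-y\|$ for all $x,y\in\mathbb{R}^d$; (5) there are constants $M_2,M_3>0$ with $\|\nabla g(x)\|<M_2$ and $|\partial_{x_j}g(x)|<M_3$ for all $x\in\mathbb{R}^d$ and $j=1,\dots,d$; (6) there is a constant $M_4>0$ with $|\partial^2_{x_i}g(x)|<M_4$ for all $x\in\mathbb{R}^d$ and $i=1,\dots,d$. Then the SDE $$dx=-g(x)\nabla V(x)\,dt+\beta^{-1}\nabla g(x)\,dt+\sqrt{2\beta^{-1}g(x)}\,dW$$ has as its unique invariant distribution the probability measure on $\mathbb{R}^d$ with density $$\rho_{\rm eq}(x)=\frac1Z\exp(-\beta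 V(x)),\qquad Z=\int_{\mathbb{R}^d}\exp(-\beta V(x))\,dx .$$
   Context: $\|\cdot\|$ is the Euclidean norm; $W$ is a standard $d$-dimensional Brownian motion; the SDE is in the Itô sense, and the scalar diffusion coefficient $\sqrt{2\beta^{-1}g(x)}$ multiplies the $d$-dimensional increment $dW$ (i.e. it stands for $\sqrt{2\beta^{-1}g(x)}$ times the identity matrix). A potential $V$ is confining if $V(x)\to+\infty$ as $\|x\|\to\infty$ and $e^{-\beta V}\in L^1(\mathbb{R}^d)$ for all $\beta>0$. An invariant distribution of an SDE is a probability measure that is preserved by the Markov semigroup of its solution. *)

(* Defs.v *)
From HB Require Import structures.
From mathcomp Require Import all_boot all_order all_algebra.
From mathcomp Require Import all_classical all_reals all_analysis.

Set Implicit Arguments.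
Unset Strict Implicit.
Unset Printing Implicit Defensive.

Import Order.TTheory GRing.Theory Num.Theory.
Import numFieldNormedType.Exports.

Local Open Scope classical_set_scope.
Local Open Scope ring_scope.

(* Points of R^d are row vectors.  Their library topology is the product one,
   and `|x| is the sup norm, hence the separate Euclidean norm below. *)

Section calculus.
Context {R : realType} {d : nat}.
Implicit Types (f : 'rV[R]_d -> R) (x : 'rV[R]_d).

Definition enorm x : R := Num.sqrt (\sum_(i < d) x 0 i ^+ 2).

Definition partial (i : 'I_d) f : 'rV[R]_d -> R :=
  fun x => 'D_(delta_mx 0 i) f x.

Definition grad f x : 'rV[R]_d := \row_i partial i f x.

Definition twice_differentiable f : Prop :=
  (forall x, differentiable f x) /\
  (forall i x, differentiable (partial i f) x).

(* C^oo: every iterated partial derivative, of any order, is differentiable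
   (hence continuous). *)
Definition smooth f : Prop :=
  forall (s : seq 'I_d) x, differentiable (foldr partial f s) x.

End calculus.

(* 'rV[R]_d carries the sigma-algebra generated by the coordinates, i.e. the
   Borel sigma-algebra of R^d. *)
Definition rV_display : measure_display.
Proof. exact: default_measure_display. Qed.

Section rV_measurable.
Context {R : realType}.
Variable d : nat.

Definition rV_coord (i : 'I_d) (x : 'rV[R]_d) : measurableTypeR R := x 0 i.

Let rV_set0 : g_sigma_preimage rV_coord set0.
Proof. exact: sigma_algebra0. Qed.

Let rV_setC A : g_sigma_preimage rV_coord A -> g_sigma_preimage rV_coord (~` A).
Proof. exact: sigma_algebraC. Qed.

Let rV_bigcup (F : (set 'rV[R]_d)^nat) :
  (forall i, g_sigma_preimage rV_coord (F i)) ->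
  g_sigma_preimage rV_coord (\bigcup_i (F i)).
Proof. exact: sigma_algebra_bigcup. Qed.

HB.instance Definition _ := @isMeasurable.Build rV_display
  'rV[R]_d (g_sigma_preimage rV_coord) rV_set0 rV_setC rV_bigcup.

End rV_measurable.

Section rV_measurable_fun.
Context {R : realType}.

Lemma measurable_rV_coord d (i : 'I_d) :
  measurable_fun [set: 'rV[R]_d] (rV_coord i).
Proof.
move=> _ Y mY; rewrite setTI; apply: sub_sigma_algebra => /=.
rewrite -bigcup_seq/=; exists i => /=; first by rewrite mem_index_enum.
by exists Y => //; rewrite setTI.
Qed.

Lemma measurable_to_rV disp (T : measurableType disp) d (f : T -> 'rV[R]_d) :
  (forall i, measurable_fun [set: T] (rV_coord i \o f)) ->
  measurable_fun [set: T] f.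
Proof.
move=> mf _ A mA.
suff : preimage_set_system [set: T] f (g_sigma_preimage (@rV_coord R d))
    `<=` measurable by apply; exists A.
rewrite -g_sigma_preimage_comp.
apply: smallest_sub; first exact: sigma_algebra_measurable.
rewrite -bigcup_seq; apply: bigcup_sub => i _.
by move=> B [C mC <-]; exact: mf.
Qed.

End rV_measurable_fun.

Section lebesgue_rV.
Context {R : realType}.

Definition cons_rV d (p : measurableTypeR R * 'rV[R]_d) : 'rV[R]_d.+1 :=
  row_mx (const_mx p.1 : 'rV[R]_1) p.2.

Definition uncons_rV d (v : 'rV[R]_d.+1) : measurableTypeR R * 'rV[R]_d :=
  (v 0 0, @rsubmx _ 1 1 d v).

Lemma cons_rVK d : cancel (@cons_rV d) (@uncons_rV d).
Proof.
move=> [t v]; rewrite /uncons_rV /cons_rV row_mxKr; congr pair.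
have -> : (0 : 'I_d.+1) = lshift d (0 : 'I_1) by exact: val_inj.
by rewrite (@row_mxEl _ 1 1 d) mxE.
Qed.

Lemma measurable_cons_rV d : measurable_fun setT (@cons_rV d).
Proof.
apply: measurable_to_rV => i; case: (@splitP 1 d i) => j ij.
  rewrite (_ : _ \o _ = fst) //; apply/funext => p /=.
  rewrite /rV_coord /cons_rV (_ : i = lshift d j); last exact: val_inj.
  by rewrite (@row_mxEl _ 1 1 d) mxE.
rewrite (_ : _ \o _ = @rV_coord R d j \o snd).
  apply: measurableT_comp; [exact: measurable_rV_coord | exact: measurable_snd].
apply/funext => p /=.
rewrite /rV_coord /cons_rV (_ : i = rshift 1 j); last exact: val_inj.
by rewrite (@row_mxEr _ 1 1 d).
Qed.

Lemma measurable_uncons_rV d : measurable_fun setT (@uncons_rV d).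
Proof.
apply/measurable_fun_pairP; split; first exact: (measurable_rV_coord 0).
apply: measurable_to_rV => i.
rewrite (_ : _ \o _ = @rV_coord R d.+1 (rshift 1 i)).
  exact: measurable_rV_coord.
by apply/funext => v; rewrite /rV_coord /= mxE.
Qed.

Section step.
Variables (d : nat) (mu : {sigma_finite_measure set 'rV[R]_d -> \bar R}).

Definition cons_measure : set 'rV[R]_d.+1 -> \bar R :=
  pushforward (@lebesgue_measure R \x mu)%E (@cons_rV d).

Let cons_measureE A :
  cons_measure A = (@lebesgue_measure R \x mu)%E (@cons_rV d @^-1` A).
Proof. by []. Qed.

Let cons_measure0 : cons_measure set0 = 0%E.
Proof. by rewrite cons_measureE preimage_set0 measure0. Qed.

Let cons_measure_ge0 A : (0 <= cons_measure A)%E.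
Proof. by rewrite cons_measureE measure_ge0. Qed.

Let measurable_preimage_cons A :
  measurable A -> measurable (@cons_rV d @^-1` A).
Proof.
by move=> mA; rewrite -[X in measurable X]setTI; exact: measurable_cons_rV.
Qed.

Let cons_measure_sigma_additive : semi_sigma_additive cons_measure.
Proof.
move=> F mF tF mUF; rewrite /cons_measure /pushforward preimage_bigcup.
apply: measure_semi_sigma_additive.
- by move=> n; exact: measurable_preimage_cons.
- apply/trivIsetP => /= i j _ _ ij; rewrite -preimage_setI.
  by move/trivIsetP : tF => /(_ _ _ _ _ ij) ->//; rewrite preimage_set0.
- by rewrite -preimage_bigcup; exact: measurable_preimage_cons.
Qed.

HB.instance Definition _ := isMeasure.Build _ _ _ cons_measure
  cons_measure0 cons_measure_ge0 cons_measure_sigma_additive.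

Let cons_measure_sigma_finite : sigma_finite setT cons_measure.
Proof.
have /sigma_finiteP[F [TF ndF Foo]] := sigma_finiteT (@lebesgue_measure R).
have /sigma_finiteP[G [TG ndG Goo]] := sigma_finiteT mu.
exists (fun n => @uncons_rV d @^-1` (F n `*` G n)).
  rewrite -preimage_bigcup; apply/esym/seteqP; split=> // v _.
  have [n _ Fn] : (\bigcup_n F n) (uncons_rV v).1 by rewrite -TF.
  have [k _ Gk] : (\bigcup_n G n) (uncons_rV v).2 by rewrite -TG.
  exists (maxn n k) => //; split.
    by move: Fn; exact/subsetPset/ndF/leq_maxl.
  by move: Gk; exact/subsetPset/ndG/leq_maxr.
move=> n; have [mF Fn] := Foo n; have [mG Gn] := Goo n; split.
  rewrite -[X in measurable X]setTI; apply: measurable_uncons_rV => //.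
  exact: measurableX.
rewrite cons_measureE -comp_preimage (_ : _ \o _ = id); last first.
  by apply/funext => p; exact: cons_rVK.
by rewrite preimage_id product_measure1E// lte_mul_pinfty// ge0_fin_numE.
Qed.

HB.instance Definition _ := @Measure_isSigmaFinite.Build _ _ _ cons_measure
  cons_measure_sigma_finite.

End step.

(* Lebesgue measure on R^d, as an iterated product. *)
Fixpoint lebesgue_rV (d : nat) : {sigma_finite_measure set 'rV[R]_d -> \bar R} :=
  match d with
  | 0 => \d_(0 : 'rV[R]_0)
  | d'.+1 => cons_measure (lebesgue_rV d')
  end.

End lebesgue_rV.

Definition confining {R : realType} {d : nat} (V : 'rV[R]_d -> R) : Prop :=
  (forall M : R, exists r : R, forall x, r < enorm x -> M < V x) /\
  (forall b : R, 0 < b ->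
    (lebesgue_rV d).-integrable setT (fun x => (expR (- (b * V x)))%:E)).

Definition gibbs_density {R : realType} {d : nat} (beta : R)
    (V : 'rV[R]_d -> R) (x : 'rV[R]_d) : R :=
  expR (- (beta * V x)) / \int[lebesgue_rV d]_y expR (- (beta * V y)).

Definition has_density {R : realType} {d : nat}
    (mu : probability 'rV[R]_d R) (rho : 'rV[R]_d -> R) : Prop :=
  forall A, measurable A ->
    mu A = (\int[lebesgue_rV d]_(x in A) (rho x)%:E)%E.

(* Processes are families indexed by R; only times t >= 0 are meaningful, and
   every condition below is restricted to them. *)
Section stochastic_basis.
Context {R : realType} {disp : measure_display} {Omega : measurableType disp}.
Variable P : probability Omega R.

(* Null events are required to lie in F 0; right-continuity of F is not
   needed. *)
Definition is_filtration (F : R -> set (set Omega)) : Prop :=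
  [/\ forall t, 0 <= t -> sigma_algebra setT (F t),
      forall t, 0 <= t -> F t `<=` measurable,
      forall s t, 0 <= s -> s <= t -> F s `<=` F t &
      forall N, measurable N -> P N = 0%E -> F 0 N].

Variable F : R -> set (set Omega).

Definition adapted {d : nat} (X : R -> Omega -> 'rV[R]_d) : Prop :=
  forall t, 0 <= t -> forall A, measurable A -> F t (X t @^-1` A).

Definition continuous_path {d : nat} (x : R -> 'rV[R]_d) : Prop :=
  {within [set t : R | 0 <= t], continuous x}.

(* The last clause says at once that W t - W s is independent of F s and that
   its coordinates are independent centred Gaussians of variance t - s
   (the second parameter of normal_prob is the standard deviation). *)
Definition is_brownian_motion {d : nat} (W : R -> Omega -> 'rV[R]_d) : Prop :=
  [/\ {ae P, forall w, W 0 w = 0},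
      {ae P, forall w, continuous_path (W ^~ w)},
      adapted W &
      forall s t, 0 <= s -> s < t ->
      forall (A : set Omega) (B : 'I_d -> set (measurableTypeR R)),
        F s A -> (forall i, measurable (B i)) ->
        P (A `&` [set w | forall i, B i ((W t w - W s w) 0 i)]) =
        (P A * (\prod_(i < d)
                 fine (normal_prob 0 (Num.sqrt (t - s)) (B i)))%:E)%E].

Definition cvg0_in_probability (Y : nat -> Omega -> \bar R) : Prop :=
  forall e : R, 0 < e ->
    P [set w | (e%:E <= Y n w)%E] @[n --> \oo] --> 0%E.

(* The simple process
     sum_(k < simple_size) simple_val k * 1_]simple_time k, simple_time k.+1]. *)
Record simple_process := SimpleProcess {
  simple_size : nat;
  simple_time : nat -> R;
  simple_val : nat -> Omega -> R }.

Definition is_simple_process (t : R) (S : simple_process) : Prop :=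
  [/\ simple_time S 0%N = 0,
      simple_time S (simple_size S) = t,
      forall k, (k < simple_size S)%N -> simple_time S k <= simple_time S k.+1,
      forall k, (k < simple_size S)%N ->
        forall B : set (measurableTypeR R), measurable B ->
          F (simple_time S k) (simple_val S k @^-1` B) &
      exists M : R, forall k w, (k < simple_size S)%N ->
        `|simple_val S k w| <= M].

Definition simple_fun (S : simple_process) (s : R) (w : Omega) : R :=
  \sum_(k < simple_size S)
    simple_val S k w * \1_(`]simple_time S k, simple_time S k.+1]%classic) s.

Definition simple_integral (S : simple_process) (w : R -> Omega -> R)
    (om : Omega) : R :=
  \sum_(k < simple_size S)
    simple_val S k om * (w (simple_time S k.+1) om - w (simple_time S k) om).

(* I is (a version of) the Ito integral of H against the scalar Brownian
   motion w over [0, t]: the limit in probability of the integrals of simple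
   processes S n such that the integral of (S n - H)^2 over [0, t] tends to 0
   in probability. *)
Definition is_ito_integral (w : R -> Omega -> R) (H : R -> Omega -> R)
    (t : R) (I : Omega -> R) : Prop :=
  exists S : nat -> simple_process,
    [/\ forall n, is_simple_process t (S n),
        cvg0_in_probability (fun n om =>
          \int[lebesgue_measure]_(s in `[0%R, t])
            ((simple_fun (S n) s om - H s om) ^+ 2)%:E)%E &
        cvg0_in_probability (fun n om =>
          (`|simple_integral (S n) w om - I om|)%:E)].

Section sde.
Context {d : nat}.
Variables (W : R -> Omega -> 'rV[R]_d).
(* The SDE dX = b(X) dt + sigma(X) dW with a scalar diffusion coefficient. *)
Variables (b : 'rV[R]_d -> 'rV[R]_d) (sigma : 'rV[R]_d -> R).

Definition is_solution (x : 'rV[R]_d) (X : R -> Omega -> 'rV[R]_d) : Prop :=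
  [/\ adapted X,
      forall w, continuous_path (X ^~ w),
      forall w, X 0 w = x &
      forall t, 0 <= t -> forall i : 'I_d,
        is_ito_integral (fun s w => W s w 0 i) (fun s w => sigma (X s w)) t
          (fun w => X t w 0 i - x 0 i
             - \int[lebesgue_measure]_(s in `[0, t]) b (X s w) 0 i)].

(* p t x is the law at time t of the solution started at x; that solution is
   required to exist and to be unique in law. *)
Definition is_markov_semigroup (p : R -> R.-pker 'rV[R]_d ~> 'rV[R]_d) : Prop :=
  forall x, (exists X, is_solution x X) /\
    (forall X, is_solution x X -> forall t, 0 <= t ->
       forall A, measurable A -> p t x A = P (X t @^-1` A)).

Definition invariant_distribution (mu : probability 'rV[R]_d R) : Prop :=
  exists2 p : R -> R.-pker 'rV[R]_d ~> 'rV[R]_d, is_markov_semigroup p &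
    forall t, 0 <= t -> forall A, measurable A ->
      (\int[mu]_x p t x A)%E = mu A.

End sde.
End stochastic_basis.

(* Main.v *)
(** Under the Lipschitz and ellipticity hypotheses Euler's scheme produces, by the isometry for
 simple integrals, a maximal inequality and Borel-Cantelli, a strong solution in the sense of
 Defs; Gronwall's lemma makes it unique in law and at distance O(h^(1/2)) in L^2 from the scheme
 of step h.

 Invariance of [mu ~ exp(-beta V)] does not use the generator.  One Euler step of length [h = s^2]
 is coupled, through the same Gaussian, to the Metropolis chain with proposal
 [x + s sigma(x) v], which is exactly [mu]-reversible.  The mean displacement of the Metropolis
 move is [h b(x) + O(s^3)] (this is where [beta^-1 grad g] is needed), so one coupled step costs
 [O(s^3 N^4)] in squared distance, with [N = 1 + sum |d_i V|].  Exponential moments of [grad V]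
 under [mu] come from translating Lebesgue measure, as [V] is within [O(1)] of its Taylor expansion.
 Summed over [t/h] steps the cost vanishes with [h].

 For uniqueness, replacing the end of an Euler path by one Gaussian step shows that [P_t f],
 [t > 0], has a modulus of continuity uniform over [0 <= f <= 1].  If [nu] were another invariant
 law, iterating the kernel on a Hahn set of [mu - nu] would give a set [A] with
 [P_t(x, A) = 0] off [A]; then [P_t(., A)] is continuous and [mu]-almost surely in {0, 1}, hence
 constant, as [mu] has full support and R^d is connected: a contradiction. *)

Require Import Defs.
From HB Require Import structures.
From mathcomp Require Import all_boot all_order all_algebra.
From mathcomp Require Import all_classical all_reals all_analysis.
From mathcomp Require Import measurable_realfun borel_hierarchy.
From mathcomp Require Import ring lra.

Set Implicit Arguments.
Unset Strict Implicit.
Unset Printing Implicit Defensive.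

Import Order.TTheory GRing.Theory Num.Theory.
Import numFieldNormedType.Exports.

Local Open Scope classical_set_scope.
Local Open Scope ring_scope.

Local Notation meas := (measurable_fun setT).
Local Notation mcomp := measurableT_comp.

Definition nsq {R : realType} {d : nat} (x : 'rV[R]_d) : R := \sum_(i < d) x 0 i ^+ 2.

Section nsq.
Context {R : realType} {d : nat}.
Implicit Types x y : 'rV[R]_d.

Lemma nsq_ge0 x : 0 <= nsq x.
Proof. by apply: sumr_ge0 => i _; rewrite sqr_ge0. Qed.

Lemma enormE x : enorm x = Num.sqrt (nsq x).
Proof. by []. Qed.

Lemma enorm_ge0 x : 0 <= enorm x.
Proof. exact: sqrtr_ge0. Qed.

Lemma sqr_enorm x : enorm x ^+ 2 = nsq x.
Proof. by rewrite sqr_sqrtr// nsq_ge0. Qed.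

Lemma nsqN x : nsq (- x) = nsq x.
Proof. by apply: eq_bigr => i _; rewrite mxE sqrrN. Qed.

Lemma nsqZ a x : nsq (a *: x) = a ^+ 2 * nsq x.
Proof. by rewrite /nsq mulr_sumr; apply: eq_bigr => i _; rewrite mxE exprMn. Qed.

Lemma nsq0 : nsq (0 : 'rV[R]_d) = 0.
Proof. by rewrite /nsq big1// => i _; rewrite mxE expr0n. Qed.

Lemma nsqD x y : nsq (x + y) <= 2 * nsq x + 2 * nsq y.
Proof.
rewrite /nsq !mulr_sumr -big_split; apply: ler_sum => i _ /=; rewrite mxE.
have := sqr_ge0 (x 0 i - y 0 i); rewrite sqrrB sqrrD; lra.
Qed.

Lemma nsqB x y : nsq (x - y) <= 2 * nsq x + 2 * nsq y.
Proof. by rewrite -(nsqN y) nsqD. Qed.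

Lemma nsqC x y : nsq (x - y) = nsq (y - x).
Proof. by rewrite -nsqN opprB. Qed.

Lemma nsqD3 x y z : nsq (x + y + z) <= 3 * nsq x + 3 * nsq y + 3 * nsq z.
Proof.
rewrite /nsq !mulr_sumr -!big_split; apply: ler_sum => i _ /=; rewrite !mxE.
have := sqr_ge0 (x 0 i - y 0 i); have := sqr_ge0 (x 0 i - z 0 i).
have := sqr_ge0 (y 0 i - z 0 i).
rewrite !sqrrB !sqrrD; nra.
Qed.

Lemma sqr_coord_le x i : x 0 i ^+ 2 <= nsq x.
Proof. by rewrite /nsq (bigD1 i)//= lerDl sumr_ge0// => j _; rewrite sqr_ge0. Qed.

Lemma normr_coord_le x i : `|x 0 i| <= enorm x.
Proof. by rewrite -sqrtr_sqr ler_wsqrtr// sqr_coord_le. Qed.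

Lemma enorm_le_eps x (e : R) : 0 < e -> enorm x <= e + nsq x / (4 * e).
Proof.
move=> e0; rewrite -sqr_enorm -subr_ge0.
have -> : e + enorm x ^+ 2 / (4 * e) - enorm x = (enorm x / 2 - e) ^+ 2 / e.
 by field; rewrite gt_eqF.
by rewrite divr_ge0 ?sqr_ge0// ltW.
Qed.

Lemma le_nsq_of_enorm (e : nat) (x : 'rV[R]_d) (y : 'rV[R]_e) (C : R) :
 enorm x <= C * enorm y -> nsq x <= C ^+ 2 * nsq y.
Proof.
move=> xy; rewrite -(sqr_enorm x) (_ : nsq y = enorm y ^+ 2); last by rewrite sqr_sqrtr// sumr_ge0// => i _; rewrite sqr_ge0.
rewrite -exprMn ler_sqr// nnegrE ?enorm_ge0//.
by rewrite (le_trans _ xy)// sqrtr_ge0.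
Qed.

Lemma enorm_le_of_nsq (x : 'rV[R]_d) (C : R) : 0 <= C -> nsq x <= C ^+ 2 -> enorm x <= C.
Proof.
move=> C0 h; rewrite -(@ler_sqr _ (enorm x)) ?nnegrE ?enorm_ge0//.
by rewrite sqr_enorm.
Qed.

Lemma norm_le_enorm x : `|x| <= enorm x.
Proof.
rewrite [`|x|]mx_normrE; apply: bigmax_le => [|[i j] _]; first exact: enorm_ge0.
by rewrite /= (ord1 i) normr_coord_le.
Qed.

Lemma normr_coord_le_norm x i : `|x 0 i| <= `|x|.
Proof.
rewrite [leRHS]mx_normrE.
by apply: (le_trans _ (le_bigmax _ _ ((0, i) : 'I_1 * 'I_d))).
Qed.

Lemma nsq_le_norm x : nsq x <= d%:R * `|x| ^+ 2.
Proof.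
apply: (@le_trans _ _ (\sum_(i < d) `|x| ^+ 2)).
 apply: ler_sum => i _; rewrite -(real_normK (num_real (x 0 i))).
 by rewrite ler_sqr ?nnegrE//; exact: normr_coord_le_norm.
by rewrite sumr_const card_ord mulr_natl.
Qed.

End nsq.

Lemma meas_EFin disp (T : measurableType disp) (R : realType) (D : set T) (f : T -> R) :
 measurable_fun D f -> measurable_fun D (fun x => (f x)%:E).
Proof. by move=> mf; exact/measurable_EFinP. Qed.

Section rV_measurability.
Context {R : realType}.

Lemma meas_coord {d} (i : 'I_d) :
 measurable_fun [set: 'rV[R]_d] (fun x : 'rV[R]_d => x 0 i).
Proof. exact: measurable_rV_coord. Qed.

Lemma meas_coordf disp (T : measurableType disp) {d} (f : T -> 'rV[R]_d)
 (i : 'I_d) : meas f ->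
 meas (fun x => f x 0 i).
Proof. by move=> mf; exact: (mcomp (meas_coord i)). Qed.

Lemma meas_rVP disp (T : measurableType disp) {d} (f : T -> 'rV[R]_d) :
 (forall i, meas (fun x => f x 0 i)) ->
 meas f.
Proof. by move=> h; apply: measurable_to_rV => i; exact: h. Qed.

Lemma meas_rVD disp (T : measurableType disp) {d} (f g : T -> 'rV[R]_d) :
 meas f -> meas g ->
 meas (fun x => f x + g x).
Proof.
move=> mf mg; apply: meas_rVP => i.
under eq_fun do rewrite mxE.
by apply: measurable_funD; exact: meas_coordf.
Qed.

Lemma meas_rVZ disp (T : measurableType disp) {d} (a : T -> R) (g : T -> 'rV[R]_d) :
 meas a -> meas g ->
 meas (fun x => a x *: g x).
Proof.
move=> mf mg; apply: meas_rVP => i.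
under eq_fun do rewrite mxE.
by apply: measurable_funM => //; exact: meas_coordf.
Qed.

Lemma meas_rVN disp (T : measurableType disp) {d} (g : T -> 'rV[R]_d) :
 meas g -> meas (fun x => - g x).
Proof.
move=> mg; apply: meas_rVP => i.
under eq_fun do rewrite mxE.
by apply: measurable_funN => //; exact: meas_coordf.
Qed.

Lemma meas_rVB disp (T : measurableType disp) {d} (f g : T -> 'rV[R]_d) :
 meas f -> meas g ->
 meas (fun x => f x - g x).
Proof. by move=> mf mg; apply: meas_rVD => //; exact: meas_rVN. Qed.

Lemma meas_nsq {d} : measurable_fun [set: 'rV[R]_d] (@nsq R d).
Proof.
apply: measurable_sum => i; apply: measurable_funX; exact: meas_coord.
Qed.

Lemma meas_nsqf disp (T : measurableType disp) {d} (f : T -> 'rV[R]_d) :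
 meas f -> meas (fun x => nsq (f x)).
Proof. by move=> mf; exact: (mcomp meas_nsq). Qed.

Definition box {d} (B : 'I_d -> set (measurableTypeR R)) : set 'rV[R]_d :=
 [set x | forall i, B i (x 0 i)].

Lemma boxE {d} (B : 'I_d -> set (measurableTypeR R)) :
 box B = \bigcap_(i in [set: 'I_d]) (rV_coord i @^-1` B i).
Proof. by apply/seteqP; split=> x /= h i; [move=> _|]; exact: h. Qed.

Lemma meas_box {d} (B : 'I_d -> set (measurableTypeR R)) :
 (forall i, measurable (B i)) -> measurable (box B).
Proof.
move=> mB; rewrite boxE; apply: fin_bigcap_measurable => [|i _]; first exact: finite_finset.
by rewrite -[X in measurable X]setTI; exact: measurable_rV_coord.
Qed.

Lemma measure_box_unique {d} (m1 m2 : {measure set 'rV[R]_d -> \bar R}) :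
 (m1 setT < +oo)%E ->
 (forall B : 'I_d -> set (measurableTypeR R), (forall i, measurable (B i)) ->
   m1 (box B) = m2 (box B)) ->
 forall A, measurable A -> m1 A = m2 A.
Proof.
move=> m1oo m12.
pose G := [set A : set 'rV[R]_d | exists2 B : 'I_d -> set (measurableTypeR R),
 (forall i, measurable (B i)) & A = box B].
have GT : G setT by exists (fun=> setT) => //; apply/seteqP; split.
apply: (measure_unique G (fun=> setT)) => //.
- apply/seteqP; split.
  apply: smallest_sub; first exact: smallest_sigma_algebra.
  rewrite -bigcup_seq => A [i _ [B mB <-]]; apply: sub_sigma_algebra.
  exists (fun j => if j == i then B else setT); first by move=> j; case: ifP.
  rewrite setTI; apply/seteqP; split=> x /=; first by move=> Bx j; case: eqP => // ->.
  by move/(_ i); rewrite eqxx.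
 apply: smallest_sub; first exact: sigma_algebra_measurable.
 by move=> A [B mB ->]; exact: meas_box.
- move=> _ _ [A mA ->] [B mB ->]; exists (fun i => A i `&` B i).
  by move=> i; exact: measurableI.
 by apply/seteqP; split=> [x [] Ax Bx i|x h]; split; [exact: Ax|exact: Bx|move=> i; exact: (h i).1|move=> i; exact: (h i).2].
- by apply/seteqP; split=> // x _; exists 0%N.
- by move=> _ [B mB ->]; exact: m12.
Qed.

Definition rVround {d} (n : nat) (x : 'rV[R]_d) : 'rV[R]_d :=
 \row_i ((Num.floor (n.+1%:R * x 0 i))%:~R / n.+1%:R).

Lemma rVround_close {d} n (x : 'rV[R]_d) : `|rVround n x - x| <= n.+1%:R^-1.
Proof.
rewrite [`|_|]mx_normrE; apply: bigmax_le => [|[i j] _]; first by rewrite invr_ge0.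
rewrite /= (ord1 i) !mxE.
set y := n.+1%:R * _.
have -> : x 0 j = y / n.+1%:R by rewrite /y [_ * x 0 j]mulrC mulfK.
rewrite -mulrBl normrM [X in _ * X]ger0_norm ?invr_ge0//.
rewrite ler_piMl ?invr_ge0// distrC ger0_norm ?subr_ge0 ?floor_le//.
by have := floorD1_gt y; rewrite -[(_ + 1)]/(_ + 1) intrD; lra.
Qed.

Lemma rVround_cvg {d} (x : 'rV[R]_d) : rVround n x @[n --> \oo] --> x.
Proof.
apply/cvgrPdist_le => e e0; near=> n.
rewrite distrC (le_trans (rVround_close n x))//.
near: n; move/cvgrPdist_le: (@cvg_harmonic R) => /(_ _ e0).
by apply: filterS => n; rewrite sub0r normrN ger0_norm// invr_ge0.
Unshelve. all: by end_near. Qed.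

Lemma meas_fun_rVround {d} n (f : 'rV[R]_d -> R) :
 meas (f \o rVround n).
Proof.
move=> _ B mB; rewrite setTI.
pose g (z : 'rV[int]_d) : 'rV[R]_d := \row_i ((z 0 i)%:~R / n.+1%:R).
pose A (z : 'rV[int]_d) : set 'rV[R]_d :=
 box (fun i => [set t : R | Num.floor (n.+1%:R * t) = z 0 i]).
have -> : (f \o rVround n) @^-1` B = \bigcup_(z in [set z | B (f (g z))]) A z.
 apply/seteqP; split=> x.
  move=> Bx; exists (\row_i Num.floor (n.+1%:R * x 0 i)); last by move=> i; rewrite /= mxE.
  rewrite /=; move: Bx; rewrite /preimage/= => Bx.
  by rewrite (_ : g _ = rVround n x)//; apply/rowP => i; rewrite !mxE.
 move=> [z Bz Ax]; rewrite /preimage/=.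
 rewrite (_ : rVround n x = g z)//; apply/rowP => i; rewrite !mxE.
 by congr (_ %:~R / _); exact: Ax.
rewrite bigcup_mkcond; apply: countable_bigcupT_measurable => [|z]; first exact: countableP.
case: ifP => _ //.
apply: meas_box => i.
rewrite (_ : [set _ | _] = `[ (z 0 i)%:~R / n.+1%:R, ((z 0 i) + 1)%:~R / n.+1%:R [%classic).
 exact: measurable_itv.
apply/seteqP; split=> t /=; rewrite in_itv/= ler_pdivrMr// ltr_pdivlMr// mulrC.
 by move=> <-; rewrite floor_le floorD1_gt.
move=> h; apply/floor_def; exact: h.
Qed.

Lemma meas_continuous {d} (f : 'rV[R]_d -> R) :
 continuous f -> meas f.
Proof.
move=> cf; apply: (@measurable_fun_cvg _ _ _ _ (fun n => f \o rVround n)).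
 by move=> n; exact: meas_fun_rVround.
by move=> x _; apply: (@continuous_cvg _ _ _ _ _ _ f); [exact: cf|exact: rVround_cvg].
Qed.

End rV_measurability.

Ltac nneg :=
 first [ done | exact: ltW |
 lazymatch goal with
 | |- is_true (Order.le _ (GRing.mul _ _)) => apply: mulr_ge0; nneg
 | |- is_true (Order.le _ (GRing.inv _)) => rewrite invr_ge0; nneg
 | |- is_true (Order.le _ (GRing.exp _ 2)) => exact: sqr_ge0
 | |- is_true (Order.le _ (GRing.exp _ _)) => first [exact: exprn_even_ge0 | apply: exprn_ge0; nneg]
 | |- is_true (Order.le _ (expR _)) => exact: expR_ge0
 | |- is_true (Order.le _ (nsq _)) => exact: nsq_ge0
 | |- is_true (Order.le _ (enorm _)) => exact: enorm_ge0
 | |- is_true (Order.le _ (EFin _)) => rewrite lee_fin; nneg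
 | |- is_true (Order.le _ (mule _ _)) => apply: mule_ge0; nneg
 | |- is_true (Order.le _ (adde _ _)) => apply: adde_ge0; nneg
 | |- is_true (Order.le _ (GRing.add _ (GRing.opp _))) => rewrite subr_ge0; nneg
 | |- is_true (Order.le _ (GRing.add _ _)) => apply: addr_ge0; nneg
 | |- is_true (Order.le _ (bigop.body _ _ _)) => apply: sumr_ge0 => ? _; nneg
 | |- is_true (Order.le _ (integral _ _ _)) => apply: integral_ge0 => ? _; nneg
 | |- is_true (Order.lt _ (GRing.mul _ _)) => apply: mulr_gt0; nneg
 | |- is_true (Order.lt _ (GRing.inv _)) => rewrite invr_gt0; nneg
 | |- is_true (Order.lt _ (GRing.exp _ _)) => apply: exprn_gt0; nneg
 | |- is_true (Order.lt _ (expR _)) => exact: expR_gt0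
 | |- is_true (Order.lt _ (GRing.add _ _)) => first [apply: ltr_wpDl; nneg | apply: ltr_pwDl; nneg]
 | |- is_true (negb _) => rewrite gt_eqF//; nneg
 | |- forall _, _ => move=> ?; nneg
 end ].

Ltac mble :=
 first [ done | exact: measurable_cst | exact: measurable_id |
 first [ apply: meas_EFin | apply: meas_nsqf | apply: meas_coordf
    | apply: meas_rVB | apply: meas_rVD | apply: meas_rVZ
    | apply: measurable_funB | apply: measurable_funD | apply: measurable_funM
    | apply: emeasurable_funM | apply: emeasurable_funD
    | apply: measurable_indic | apply: measurable_sum => ? | apply: measurable_funX | move=> ? ]; mble ].

Section density_measure.
Context disp (T : measurableType disp) (R : realType) (m : {measure set T -> \bar R}) (f : T -> R).

Definition dens_prob (mf : meas f) (f0 : forall x, 0 <= f x)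
 (f1 : (\int[m]_x (f x)%:E = 1)%E) (A : set T) : \bar R :=
 (\int[m]_(x in A) (f x)%:E)%E.

Section inst.
Context (mf : meas f) (f0 : forall x, 0 <= f x) (f1 : (\int[m]_x (f x)%:E = 1)%E).

Let dens0 : dens_prob mf f0 f1 set0 = 0%E.
Proof. by rewrite /dens_prob integral_set0. Qed.

Let dens_ge0 A : (0 <= dens_prob mf f0 f1 A)%E.
Proof. by apply: integral_ge0 => x _; rewrite lee_fin. Qed.

Let dens_sigma_additive : semi_sigma_additive (dens_prob mf f0 f1).
Proof.
by apply: semi_sigma_additive_nng_induced; [exact/measurable_EFinP|move=> x; rewrite lee_fin].
Qed.

HB.instance Definition _ := isMeasure.Build _ _ _ (dens_prob mf f0 f1)
 dens0 dens_ge0 dens_sigma_additive.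

Let dens_setT : dens_prob mf f0 f1 setT = 1%E.
Proof. exact: f1. Qed.

HB.instance Definition _ := @Measure_isProbability.Build _ _ R (dens_prob mf f0 f1) dens_setT.

Import HBNNSimple.

Lemma integral_dens_prob (g : T -> \bar R) : meas g ->
 (forall x, 0 <= g x)%E ->
 (\int[dens_prob mf f0 f1]_x g x = \int[m]_x (g x * (f x)%:E))%E.
Proof.
move=> mg g0; pose h := nnsfun_approx measurableT mg.
have mfE : meas (EFin \o f) by mble.
have gE x : g x = limn (fun n => (h n x)%:E).
 by apply/esym/cvg_lim => //; exact: cvg_nnsfun_approx.
transitivity (limn (fun n => \int[dens_prob mf f0 f1]_x (h n x)%:E)%E).
 rewrite -monotone_convergence//=; last 3 first.
 - by mble.
 - by nneg.
 - by move=> x _ a b ab; rewrite lee_fin; exact/lefP/nd_nnsfun_approx.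
 by apply: eq_integral => x _; exact: gE.
transitivity (limn (fun n => \int[m]_x ((h n x)%:E * (f x)%:E))%E); last first.
 rewrite -monotone_convergence//=; last 3 first.
 - by mble.
 - by nneg.
 - by move=> x _ a b ab; rewrite lee_wpmul2r// lee_fin//; exact/lefP/nd_nnsfun_approx.
 apply: eq_integral => x _; apply/cvg_lim => //.
 by apply: cvgeZr => //; exact: cvg_nnsfun_approx.
congr (limn _); apply/funext => n.
transitivity (\int[dens_prob mf f0 f1]_x
  (\sum_(y \in range (h n)) (y * \1_(h n @^-1` [set y]) x)%:E))%E.
 by apply: eq_integral => t _; rewrite /= fimfunE -fsumEFin.
rewrite ge0_integral_fsum//; last 2 first.
- by mble.
- by move=> y x _; exact: nnfun_muleindic_ge0.
transitivity (\int[m]_x (\sum_(y \in range (h n))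
  (y * \1_(h n @^-1` [set y]) x)%:E * (f x)%:E))%E; last first.
 apply: eq_integral => x _.
 rewrite -ge0_mule_fsuml => [|y]; last exact: nnfun_muleindic_ge0.
 by rewrite fsumEFin// -(fimfunE _ x).
rewrite ge0_integral_fsum//; last 2 first.
- by mble.
- by move=> y x _; rewrite mule_ge0 ?lee_fin// -lee_fin nnfun_muleindic_ge0.
apply: eq_fsbigr => r rhn.
have r0 : 0 <= r by move: rhn; rewrite inE => -[t _ <-].
under eq_integral do rewrite EFinM.
rewrite ge0_integralZl//; last exact: meas_EFin.
under [RHS]eq_integral do rewrite EFinM -muleA.
rewrite ge0_integralZl//; last 2 first.
- by mble.
- by nneg.
congr (_ * _)%E; rewrite integral_indic//= setIT /dens_prob.
rewrite [LHS]integral_mkcond; apply: eq_integral => x _.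
by rewrite epatch_indic muleC.
Qed.

End inst.
End density_measure.

Section affine1.
Context {R : realType}.

Lemma ge0_integral_affine1 (c a : R) (f : R -> \bar R) : 0 < c ->
 meas f -> (forall x, 0 <= f x)%E ->
 (c%:E * \int[lebesgue_measure]_x f (c * x + a)%R = \int[lebesgue_measure]_x f x)%E.
Proof.
move=> c0 mf f0.
pose phi (x : measurableTypeR R) : measurableTypeR R := c * x + a.
have mphi : meas phi.
 by mble.
pose nu0 : {measure set (measurableTypeR R) -> \bar R} := pushforward (@lebesgue_measure R) phi.
pose nu : {measure set (measurableTypeR R) -> \bar R} := mscale (NngNum (ltW c0)) (nu0 mphi).
have nuE A : measurable A -> (lebesgue_measure A = nu A)%E.
 apply: lebesgue_measure_unique => _ [[x y]] _ <-.
 transitivity (c%:E * lebesgue_measure (phi @^-1` `]x, y]))%E; last by [].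
 rewrite (_ : phi @^-1` _ = `](x - a) / c, (y - a) / c]%classic); last first.
  apply/seteqP; split=> z /=; rewrite /phi !in_itv/= ltr_pdivrMr// ler_pdivlMr//;
  rewrite ltrBlDr lerBrDr mulrC//.
 rewrite !lebesgue_measure_itv/= !lte_fin ltr_pdivrMr// divfK ?gt_eqF// ltrD2r.
 case: ifP => _; last by rewrite mule0.
 by rewrite -!EFinD -EFinM; congr EFin; field; rewrite gt_eqF.
transitivity (\int[nu]_x f x)%E.
 rewrite /nu ge0_integral_mscale//=; congr (_ * _)%E.
 by rewrite ge0_integral_pushforward.
by apply: eq_measure_integral => A mA _; rewrite -nuE.
Qed.

End affine1.

Section lebesgue_rV.
Context {R : realType}.

Lemma ge0_integral_cons {d} (f : 'rV[R]_d.+1 -> \bar R) :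
 meas f -> (forall x, 0 <= f x)%E ->
 (\int[lebesgue_rV d.+1]_x f x =
  \int[lebesgue_measure]_t \int[lebesgue_rV d]_v f (cons_rV (t, v)))%E.
Proof.
move=> mf f0.
transitivity (\int[(@lebesgue_measure R \x lebesgue_rV d)%E]_p f (cons_rV p))%E.
 by rewrite /= /cons_measure ge0_integral_pushforward//=; exact: measurable_cons_rV.
rewrite fubini_tonelli1//.
by apply: mcomp => //; exact: measurable_cons_rV.
Qed.

Lemma meas_cons_r {d} (t : R) : meas (fun v : 'rV[R]_d => cons_rV (t, v)).
Proof.
apply: (mcomp (@measurable_cons_rV R d)).
by mble.
Qed.

Lemma cons_rVE0 {d} (t : R) (v : 'rV[R]_d) : cons_rV (t, v) 0 ord0 = t.
Proof. by have := @cons_rVK R d (t, v); rewrite /uncons_rV => -[]. Qed.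

Lemma cons_rVES {d} (t : R) (v : 'rV[R]_d) i : cons_rV (t, v) 0 (lift ord0 i) = v 0 i.
Proof.
have := @cons_rVK R d (t, v); rewrite /uncons_rV => -[_] /rowP/(_ i).
by rewrite mxE => <-; congr (_ _ _); exact: val_inj.
Qed.

Lemma rV_consP {d} (x y : 'rV[R]_d.+1) : x 0 ord0 = y 0 ord0 ->
 (forall i, x 0 (lift ord0 i) = y 0 (lift ord0 i)) -> x = y.
Proof. by move=> h0 hS; apply/rowP => i; case: (unliftP ord0 i) => [j ->|->]. Qed.

Lemma ge0_integral_affine {d} (c : R) (a : 'rV[R]_d) (f : 'rV[R]_d -> \bar R) : 0 < c ->
 meas f -> (forall x, 0 <= f x)%E ->
 ((c ^+ d)%:E * \int[lebesgue_rV d]_x f (c *: x + a)%R = \int[lebesgue_rV d]_x f x)%E.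
Proof.
move=> c0; elim: d a f => [|d IH] a f mf f0.
 rewrite expr0 mul1e; apply: eq_integral => x _; congr f.
 by apply/rowP => -[].
have maff n (b : 'rV[R]_n) : meas (fun x : 'rV[R]_n => c *: x + b).
 by mble.
rewrite !ge0_integral_cons//; last exact: (mcomp mf (maff _ _)).
pose a0 := a 0 ord0; pose a' : 'rV[R]_d := \row_i a 0 (lift ord0 i).
pose F t := (\int[lebesgue_rV d]_v f (cons_rV (t, v)))%E.
have F0 t : (0 <= F t)%E by exact: integral_ge0.
have mF : meas F.
 apply: (measurable_fun_fubini_tonelli_F (m2 := lebesgue_rV d) (fun p => f (cons_rV p))).
  by apply: mcomp => //; exact: measurable_cons_rV.
 by [].
rewrite -[RHS](ge0_integral_affine1 a0 c0 mF F0).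
rewrite exprS EFinM -muleA; congr (_ * _)%E.
rewrite -ge0_integralZl//; last first.
- by nneg.
- by nneg.
- apply: (measurable_fun_fubini_tonelli_F (m2 := lebesgue_rV d)
   (fun p => f (c *: cons_rV p + a))) => [|x]; last exact: f0.
 apply: (mcomp mf); apply: (mcomp (maff _ _)); exact: measurable_cons_rV.
apply: eq_integral => t _; rewrite /F -[RHS](IH a' (fun v => f (cons_rV (c * t + a0, v)))); last 2 first.
- by apply: (mcomp mf); exact: meas_cons_r.
- by [].
congr (_ * _)%E; apply: eq_integral => v _; congr f.
have E n (x b : 'rV[R]_n) j : (c *: x + b) 0 j = c * x 0 j + b 0 j by rewrite !mxE.
apply: rV_consP => [|i]; rewrite E; first by rewrite !cons_rVE0.
by rewrite [in LHS]cons_rVES [RHS]cons_rVES E [a' _ _]mxE.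
Qed.

Lemma ge0_integral_translate {d} (a : 'rV[R]_d) (f : 'rV[R]_d -> \bar R) :
 meas f -> (forall x, 0 <= f x)%E ->
 (\int[lebesgue_rV d]_x f (x + a)%R = \int[lebesgue_rV d]_x f x)%E.
Proof.
move=> mf f0; rewrite -[RHS](ge0_integral_affine a ltr01 mf f0) expr1n mul1e.
by apply: eq_integral => x _; rewrite scale1r.
Qed.

Lemma ge0_integral_prod {d} (f : 'I_d -> R -> R) (c : 'I_d -> R) :
 (forall i, meas (f i)) -> (forall i t, 0 <= f i t) ->
 (forall i, (\int[lebesgue_measure]_t (f i t)%:E = (c i)%:E)%E) ->
 (\int[lebesgue_rV d]_x (\prod_i f i (x 0 i))%:E = (\prod_i c i)%:E)%E.
Proof.
have c0 n (g : 'I_n -> R -> R) (k : 'I_n -> R) : (forall i t, 0 <= g i t) ->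
 (forall i, (\int[lebesgue_measure]_t (g i t)%:E = (k i)%:E)%E) -> forall i, 0 <= k i.
 by move=> g0 gk i; rewrite -lee_fin -gk integral_ge0// => t _; rewrite lee_fin.
elim: d f c => [|d IH] f c mf f0 fc.
 rewrite big_ord0 /=; under eq_integral do rewrite big_ord0.
 by rewrite integral_cst//= mul1e diracE mem_set.
have mprod n (g : 'I_n -> R -> R) : (forall i, meas (g i)) ->
  meas (fun x : 'rV[R]_n => \prod_i g i (x 0 i)).
 move=> mg; apply: measurable_prod => i _.
 by apply: (mcomp (mg i)); exact: meas_coord.
rewrite ge0_integral_cons; last 2 first.
- by apply/measurable_EFinP; exact: mprod.
- by move=> x; rewrite lee_fin prodr_ge0.
transitivity (\int[lebesgue_measure]_t ((f ord0 t)%:E * (\prod_(i < d) c (lift ord0 i))%:E))%E.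
 apply: eq_integral => t _.
 rewrite -(IH (fun i => f (lift ord0 i)) (fun i => c (lift ord0 i)))//.
 rewrite -ge0_integralZl//; last first.
 - by nneg.
 - by move=> x _; rewrite lee_fin prodr_ge0.
 - by apply/measurable_EFinP; exact: (mprod _ (fun i => f (lift ord0 i))).
 apply: eq_integral => v _; rewrite -EFinM big_ord_recl cons_rVE0.
 congr (_ * _)%:E; apply: eq_bigr => i _; congr (f _ _); exact: cons_rVES.
rewrite ge0_integralZr//.
- by rewrite fc -EFinM big_ord_recl.
- exact: (meas_EFin (mf ord0)).
- by nneg.
- by rewrite lee_fin prodr_ge0// => i _; exact: (c0 _ f).
Qed.

End lebesgue_rV.

Section normal_moments.
Context {R : realType}.
Local Notation leb := (@lebesgue_measure R).

Lemma std_normal_pdfE (t : R) : normal_pdf 0 1 t = normal_peak 1 * expR (- (t ^+ 2 / 2)).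
Proof. by rewrite normal_pdfE ?oner_neq0// /normal_fun subr0 expr1n mulNr. Qed.

Lemma normal_pdfN (s t : R) : s != 0 -> normal_pdf 0 s (- t) = normal_pdf 0 s t.
Proof. by move=> s0; rewrite !normal_pdfE// /normal_fun !subr0 sqrrN. Qed.

Lemma derive_normal_primitive (k : nat) (t : R) :
 is_derive t 1 (fun t : R => - (t ^+ k.+1 * normal_pdf 0 1 t))
  (t ^+ k.+2 * normal_pdf 0 1 t - k.+1%:R * (t ^+ k * normal_pdf 0 1 t)).
Proof.
pose q : R -> R := - ((@id R) ^+ 2 * cst 2^-1).
have dq : is_derive t (1 : R) q (- t).
 apply: is_derive_eq; rewrite /GRing.scale/= !mulr0 add0r expr1 mulr1; lra.
rewrite (_ : (fun t : R => _) =
  - ((@id R) ^+ k.+1 * (cst (normal_peak 1) * (expR \o q)))); last first.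
 by apply/funext => s; rewrite std_normal_pdfE !fctE.
apply: is_derive_eq; rewrite std_normal_pdfE /GRing.scale/= !fctE/=.
have -> : q t = - (t ^+ 2 / 2) by [].
set E := expR _; set n := k.+1%:R; rewrite !exprS; ring.
Qed.

Lemma continuous_pow_normal (k : nat) : continuous (fun t : R => t ^+ k * normal_pdf 0 1 t).
Proof.
move=> t; apply: cvgM; first exact: exprn_continuous.
by apply: continuous_normal_pdf; rewrite oner_eq0.
Qed.

Lemma meas_pow_normal (k : nat) : meas (fun t : R => t ^+ k * normal_pdf 0 1 t).
Proof. by apply: continuous_measurable_fun; exact: continuous_pow_normal. Qed.

Lemma expR_ge_pow (k : nat) (x : R) : 0 <= x -> x ^+ k.+1 / (k.+1)`!%:R <= expR x.
Proof. by move=> x0; apply: le_trans (expR_ge1Dxn k x0); rewrite lerDr. Qed.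

Lemma pow_expRN_le (k : nat) (x : R) : 0 < x -> x ^+ k * expR (- x) <= (k.+1)`!%:R / x.
Proof.
move=> x0; have f0 : (0 : R) < (k.+1)`!%:R by nneg.
rewrite ler_pdivlMr// mulrAC -exprSr expRN ler_pdivrMr ?expR_gt0//.
by rewrite mulrC -ler_pdivrMr// expR_ge_pow// ltW.
Qed.

Lemma cvg_pow_normal (k : nat) : (n%:R ^+ k * normal_pdf 0 1 n%:R : R) @[n --> \oo] --> (0 : R).
Proof.
pose C : R := normal_peak 1 * expR (3 / 2) * (k.+1)`!%:R.
apply: (@squeeze_cvgr _ _ _ _ (cst 0) (fun n => C * n.+1%:R^-1)).
- near=> n; apply/andP; split; first by rewrite mulr_ge0 ?exprn_ge0// normal_pdf_ge0.
 rewrite std_normal_pdfE mulrCA /C -!mulrA ler_wpM2l ?normal_peak_ge0//.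
 apply: (@le_trans _ _ (expR (3 / 2) * (n.+1%:R ^+ k * expR (- n.+1%:R)))).
  rewrite [leRHS]mulrCA; apply: ler_pM; rewrite ?exprn_ge0 ?expR_ge0//.
   by rewrite lerXn2r ?nnegrE// ler_nat.
  rewrite -expRD ler_expR (_ : (1 *- n.+1 : R) = - (n%:R + 1)); last by rewrite natr1.
  by have := sqr_ge0 (n%:R - 1 : R); rewrite sqrrB1 expr2; lra.
 by rewrite ler_wpM2l ?expR_ge0// pow_expRN_le.
- exact: cvg_cst.
- rewrite -[X in _ --> X](mulr0 C); apply: cvgMr; exact: cvg_harmonic.
Unshelve. all: by end_near. Qed.

Lemma normal_moment_step (k : nat) (m : R) : ~~ odd k ->
 (\int[leb]_t (t ^+ k * normal_pdf 0 1 t)%:E = m%:E)%E ->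
 (\int[leb]_t (t ^+ k.+2 * normal_pdf 0 1 t)%:E = (k.+1%:R * m)%:E)%E.
Proof.
move=> ek; pose f j (t : R) := t ^+ j * normal_pdf 0 1 t.
have f0 j t : ~~ odd j -> 0 <= f j t.
 by move=> ej; rewrite mulr_ge0 ?normal_pdf_ge0// exprn_even_ge0.
have sym j : ~~ odd j -> (\int[leb]_t (f j t)%:E = 2%:E * \int[leb]_(t in `[0%R, +oo[) (f j t)%:E)%E.
 move=> ej; rewrite ge0_symfun_integralT; last 3 first.
 - by move=> t; exact: f0.
 - exact: continuous_pow_normal.
 - move=> t; rewrite /f /= normal_pdfN ?oner_neq0// exprNn -signr_odd (negbTE ej).
  by rewrite expr0 mul1r.
 by rewrite set_itvcy.
have ekk : ~~ odd k.+2 by rewrite /= negbK.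
rewrite (sym k ek) (sym k.+2 ekk) => hm.
set I := (\int[leb]_(t in `[0%R, +oo[) (f k t)%:E)%E in hm.
set J := (\int[leb]_(t in `[0%R, +oo[) (f k.+2 t)%:E)%E.
have IE : I = (m / 2)%:E.
 move: hm; case: I => [r|/=|/=].
 - by rewrite -EFinM => -[<-]; congr EFin; lra.
 - by rewrite mulry gtr0_sg// mul1e.
 - by rewrite mulrNy gtr0_sg// mul1e.
have mf j : meas (f j) by exact: meas_pow_normal.
have cI : (\int[leb]_(t in `[0%R, n%:R]) (f k t)%:E)%E @[n --> \oo] --> I.
 by apply: ge0_cvgn_integral => // t; exact: f0.
have cJ : (\int[leb]_(t in `[0%R, n%:R]) (f k.+2 t)%:E)%E @[n --> \oo] --> J.
 by apply: ge0_cvgn_integral => // t; exact: f0.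
pose F t : R := - (t ^+ k.+1 * normal_pdf 0 1 t).
pose J' := (k.+1%:R%:E * I)%E.
have cJ' : (\int[leb]_(t in `[0%R, n%:R]) (f k.+2 t)%:E)%E @[n --> \oo] --> J'.
 rewrite -cvg_shiftS/=.
 have -> : (fun n : nat => (\int[leb]_(t in `[0%R, n.+1%:R]) (f k.+2 t)%:E)%E) =
   (fun n => k.+1%:R%:E * \int[leb]_(t in `[0%R, n.+1%:R]) (f k t)%:E + (F n.+1%:R)%:E)%E.
  apply/funext => n.
  have int j : leb.-integrable `[0%R, n.+1%:R] (EFin \o f j).
   apply: continuous_compact_integrable; first exact: segment_compact.
   by apply: continuous_subspaceT; exact: continuous_pow_normal.
  have := @continuous_FTC2 R (fun t => f k.+2 t - k.+1%:R * f k t) F 0 n.+1%:R.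
  rewrite (_ : F 0 = 0); last by rewrite /F expr0n/= mul0r oppr0.
  rewrite ltr0n sube0 => /(_ isT) <-.
  - have i1 : leb.-integrable `[0, n.+1%:R] (fun t => k.+1%:R%:E * (f k t)%:E)%E.
    by apply: integrableZl => //; exact: int.
   have i2 : leb.-integrable `[0, n.+1%:R] (fun t => (f k.+2 t)%:E - k.+1%:R%:E * (f k t)%:E)%E.
    by apply: integrableB => //; exact: int.
   rewrite -(integralZl _ (int k))//.
   transitivity (\int[leb]_(t in `[0%R, n.+1%:R])
     ((k.+1%:R%:E * (f k t)%:E) + ((f k.+2 t)%:E - k.+1%:R%:E * (f k t)%:E)))%E.
    by apply: eq_integral => t _; rewrite -EFinM -EFinB -EFinD; congr EFin; rewrite addrC subrK.
   by rewrite integralD.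
  - apply: continuous_subspaceT => t; apply: cvgB; first exact: continuous_pow_normal.
   by apply: cvgMr; exact: continuous_pow_normal.
  - have dF (t : R) : derivable F t 1 by case: (derive_normal_primitive k t).
   split; first by [].
    apply: cvg_at_right_filter; apply: differentiable_continuous; exact/derivable1_diffP.
   apply: cvg_at_left_filter; apply: differentiable_continuous; exact/derivable1_diffP.
  - by move=> t _; rewrite derive1E; have [_ ->] := derive_normal_primitive k t.
 rewrite -[J']adde0; apply: cvgeD => //.
 - by rewrite /J' IE.
 - by apply: cvgeZl => //; rewrite (cvg_shiftS (fun n => _)).
 - apply: cvg_EFin; first by near=> n.
  rewrite -oppr0; apply: cvgN.
  by have := @cvg_pow_normal k.+1; rewrite -cvg_shiftS.
have -> : J = J' by apply: (cvg_unique _ cJ cJ').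
rewrite /J' IE -!EFinM; congr EFin; lra.
Unshelve. all: by end_near. Qed.

Lemma normal_moment0 : (\int[leb]_t (t ^+ 0 * normal_pdf 0 1 t)%:E = 1%:E)%E.
Proof.
by under eq_integral do rewrite expr0 mul1r; rewrite integral_normal_pdf.
Qed.

Lemma normal_moment2 : (\int[leb]_t (t ^+ 2 * normal_pdf 0 1 t)%:E = 1%:E)%E.
Proof. by rewrite (normal_moment_step _ normal_moment0)// mulr1. Qed.

Lemma normal_moment4 : (\int[leb]_t (t ^+ 4 * normal_pdf 0 1 t)%:E = 3%:E)%E.
Proof. by rewrite (normal_moment_step _ normal_moment2)// mulr1. Qed.

Lemma normal_pdf_scale (c s t : R) : 0 < c -> s != 0 ->
 c * normal_pdf 0 (c * s) (c * t) = normal_pdf 0 s t.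
Proof.
move=> c0 s0; have cn0 : c != 0 by nneg.
rewrite !normal_pdfE ?mulf_neq0// /normal_fun /normal_peak !subr0 mulrA; congr (_ * expR _).
 have -> : (c * s) ^+ 2 * pi *+ 2 = c ^+ 2 * (s ^+ 2 * pi *+ 2) by ring.
 by rewrite sqrtrM ?sqr_ge0// sqrtr_sqr gtr0_norm// invfM mulrA mulfV// mul1r.
by field; rewrite s0 cn0.
Qed.

Lemma normal_probN (s : R) (B : set (measurableTypeR R)) : s != 0 -> measurable B ->
 normal_prob 0 s (-%R @^-1` B) = normal_prob 0 s B.
Proof.
move=> s0 mB; rewrite /normal_prob [LHS]integral_mkcond [RHS]integral_mkcond/=.
have mN : measurable_fun [set: measurableTypeR R] (-%R : _ -> measurableTypeR R).
 by mble.
pose nu0 : {measure set (measurableTypeR R) -> \bar R} := pushforward leb (-%R : _ -> measurableTypeR R).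
rewrite [RHS](@eq_measure_integral _ _ _ setT (nu0 mN)); last first.
 by move=> A mA _; rewrite /nu0 /= lebesgue_measureN.
rewrite /nu0 ge0_integral_pushforward//=; last 2 first.
- apply/measurable_restrict => //.
 by rewrite setTI; apply: measurable_funTS; apply: meas_EFin; exact: measurable_normal_pdf.
- by move=> x _; rewrite erestrict_ge0// => y _; rewrite lee_fin normal_pdf_ge0.
apply: eq_integral => x _; rewrite /= !patchE/= normal_pdfN//.
Qed.

End normal_moments.

Section gaussian.
Context {R : realType} {d : nat}.
Implicit Types s : R.

Definition gauss_pdf s (x : 'rV[R]_d) : R := \prod_i normal_pdf 0 s (x 0 i).

Lemma gauss_pdf_ge0 s x : 0 <= gauss_pdf s x.
Proof. by apply: prodr_ge0 => i _; exact: normal_pdf_ge0. Qed.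

Lemma meas_gauss_pdf s : meas (gauss_pdf s).
Proof.
apply: measurable_prod => i _.
by apply: (mcomp (measurable_normal_pdf 0 s)); exact: meas_coord.
Qed.

Lemma integral_gauss_pdf s : (\int[lebesgue_rV d]_x (gauss_pdf s x)%:E = 1)%E.
Proof.
have := @ge0_integral_prod R d (fun=> normal_pdf 0 s) (fun=> 1).
rewrite big1//; apply.
- by move=> i; exact: measurable_normal_pdf.
- by move=> i t; exact: normal_pdf_ge0.
- by move=> i; exact: integral_normal_pdf.
Qed.

Definition gauss s : probability 'rV[R]_d R :=
 dens_prob (meas_gauss_pdf s) (gauss_pdf_ge0 s) (integral_gauss_pdf s).

Lemma integral_gauss s (f : 'rV[R]_d -> \bar R) : meas f ->
 (forall x, 0 <= f x)%E ->
 (\int[gauss s]_x f x = \int[lebesgue_rV d]_x (f x * (gauss_pdf s x)%:E))%E.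
Proof. by move=> mf f0; rewrite integral_dens_prob. Qed.

Lemma integral_gauss_prod s (f : 'I_d -> R -> R) (c : 'I_d -> R) :
 (forall i, meas (f i)) -> (forall i t, 0 <= f i t) ->
 (forall i, (\int[lebesgue_measure]_t (f i t * normal_pdf 0 s t)%:E = (c i)%:E)%E) ->
 (\int[gauss s]_x (\prod_i f i (x 0 i))%:E = (\prod_i c i)%:E)%E.
Proof.
move=> mf f0 fc; rewrite integral_gauss; last 2 first.
- apply: meas_EFin; apply: measurable_prod => i _.
 by apply: (mcomp (mf i)); exact: meas_coord.
- by move=> x; rewrite lee_fin prodr_ge0.
rewrite -(ge0_integral_prod _ _ fc).
- by apply: eq_integral => x _; rewrite -EFinM -big_split.
- by move=> i; apply: measurable_funM => //; exact: measurable_normal_pdf.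
- by move=> i t; rewrite mulr_ge0 ?normal_pdf_ge0.
Qed.

Lemma gauss_box s (B : 'I_d -> set (measurableTypeR R)) : (forall i, measurable (B i)) ->
 gauss s (box B) = (\prod_i fine (normal_prob 0 s (B i)))%:E.
Proof.
move=> mB; rewrite -(integral_gauss_prod (s := s) (f := fun i => \1_(B i))); last 3 first.
- by move=> i; apply: measurable_indic; exact: mB.
- by [].
- move=> i; rewrite fineK ?fin_num_measure// /normal_prob [RHS]integral_mkcond.
 by apply: eq_integral => t _; rewrite epatch_indic -EFinM mulrC.
transitivity (\int[gauss s]_x (\1_(box B) x)%:E)%E.
 by rewrite integral_indic ?setIT//; exact: meas_box.
apply: eq_integral => x _; congr EFin; rewrite indicE.
have [/set_mem Bx|/negP nBx] := boolP (x \in box B).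
 by rewrite big1// => i _; rewrite indicE mem_set//; exact: Bx.
have /existsNP[i Bi] : ~ box B x by move=> h; apply: nBx; rewrite inE.
by rewrite (bigD1 i)//= indicE memNset// mul0r.
Qed.

Lemma integral_gauss_scale s (f : 'rV[R]_d -> \bar R) : 0 < s ->
 meas f -> (forall x, 0 <= f x)%E ->
 (\int[gauss s]_x f x = \int[gauss 1]_x f (s *: x))%E.
Proof.
move=> s0 mf f0; have mfs : meas (fun x : 'rV[R]_d => f (s *: x)).
 by apply: (mcomp mf); exact: meas_rVZ.
rewrite (integral_gauss s mf f0) (integral_gauss 1 mfs (fun x => f0 _)).
have mg : meas (EFin \o gauss_pdf s).
 by apply: meas_EFin; exact: meas_gauss_pdf.
rewrite -(ge0_integral_affine 0 s0); last 2 first.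
- by mble.
- by move=> x; rewrite mule_ge0// lee_fin gauss_pdf_ge0.
rewrite -ge0_integralZl//; last 3 first.
- apply: (mcomp (f := fun x => f x * (gauss_pdf s x)%:E)%E).
  exact: emeasurable_funM.
 by mble.
- by move=> x _; rewrite mule_ge0// lee_fin gauss_pdf_ge0.
- by nneg.
apply: eq_integral => x _; rewrite addr0 muleCA; congr (_ * _)%E.
rewrite -EFinM; congr EFin; rewrite /gauss_pdf.
rewrite -[X in _ ^+ X](card_ord d) -prodr_const -big_split/=; apply: eq_bigr => i _.
by rewrite mxE -{2}(mulr1 s) normal_pdf_scale// oner_neq0.
Qed.

Lemma integral_gauss_signs (e : 'I_d -> bool) (f : 'rV[R]_d -> \bar R) :
 meas f -> (forall x, 0 <= f x)%E ->
 (\int[gauss 1]_x f x = \int[gauss 1]_x f (\row_i ((-1) ^+ e i * x 0%R i)%R))%E.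
Proof.
move=> mf f0; pose S (x : 'rV[R]_d) : 'rV[R]_d := \row_i ((-1) ^+ e i * x 0 i).
have mS : meas S.
 apply: meas_rVP => i; under eq_fun do rewrite mxE.
 by mble.
pose nu0 : {measure set 'rV[R]_d -> \bar R} := pushforward (gauss 1) S.
transitivity (\int[nu0 mS]_x f x)%E; last by rewrite /nu0 ge0_integral_pushforward.
apply: eq_measure_integral => A mA _; apply: measure_box_unique => //.
 by rewrite [X in (X < _)%E](probability_setT (gauss 1)) ltry.
move=> B mB; rewrite /nu0 /= /pushforward.
pose B' i : set (measurableTypeR R) := if e i then -%R @^-1` B i else B i.
have -> : S @^-1` box B = box B'.
 apply/seteqP; split=> x /= h i; have := h i; rewrite /B' mxE;
  by case: (e i); rewrite ?expr1 ?expr0 ?mulN1r ?mul1r.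
have mB' i : measurable (B' i).
 rewrite /B'; case: (e i) => //; rewrite -[X in measurable X]setTI.
 by apply: oppr_measurable => //; exact: mB.
rewrite !gauss_box//; congr EFin; apply: eq_bigr => i _; rewrite /B'; case: (e i) => //.
by rewrite normal_probN ?oner_neq0.
Qed.

End gaussian.

Section filtration.
Context {R : realType} {disp} {Omega : measurableType disp} (P : probability Omega R) (F : R -> set (set Omega))
 (hF : is_filtration P F).

Definition Fmeas (s : R) {d'} {T : measurableType d'} (Z : Omega -> T) : Prop :=
 measurable_fun [set: g_sigma_algebraType (F s)] (Z : g_sigma_algebraType (F s) -> T).

Lemma F_sigma_algebraE s : 0 <= s -> <<s F s >> = F s.
Proof.
move=> s0; apply/seteqP; split; last exact: sub_gen_smallest.
by apply: smallest_sub => //; case: hF => /(_ _ s0).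
Qed.

Lemma FmeasP s d' (T : measurableType d') (Z : Omega -> T) : 0 <= s ->
 Fmeas s Z <-> (forall A, measurable A -> F s (Z @^-1` A)).
Proof.
move=> s0; rewrite -(F_sigma_algebraE s0); split=> h.
 by move=> A mA; have := h measurableT A mA; rewrite setTI.
by move=> _ A mA; rewrite setTI; exact: h.
Qed.

Lemma F_measurable s A : 0 <= s -> F s A -> measurable A.
Proof. by move=> s0; case: hF => _ h _ _; exact: (h s s0). Qed.

Lemma F_mono s t A : 0 <= s -> s <= t -> F s A -> F t A.
Proof. by move=> s0 st; case: hF => _ _ h _; exact: (h s t s0 st). Qed.

Lemma Fmeas_mono s t d' (T : measurableType d') (Z : Omega -> T) : 0 <= s -> s <= t ->
 Fmeas s Z -> Fmeas t Z.
Proof.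
move=> s0 st /(FmeasP _ s0) h; apply/FmeasP; first exact: le_trans st.
by move=> A mA; apply: F_mono (h A mA).
Qed.

Lemma Fmeas_meas s d' (T : measurableType d') (Z : Omega -> T) : 0 <= s ->
 Fmeas s Z -> meas Z.
Proof.
by move=> s0 /(FmeasP _ s0) h _ A mA; rewrite setTI; apply: F_measurable (h A mA).
Qed.

Lemma Fmeas_comp s d' (T : measurableType d') d'' (T' : measurableType d'')
  (f : T -> T') (Z : Omega -> T) : meas f -> Fmeas s Z ->
 Fmeas s (fun w => f (Z w)).
Proof. by move=> mf mZ; exact: mcomp. Qed.

Lemma Fmeas_indic s A : 0 <= s -> F s A -> Fmeas s (\1_A : Omega -> R).
Proof.
move=> s0 FA; apply: measurable_indic.
by rewrite /measurable/= F_sigma_algebraE.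
Qed.

Lemma adapted_Fmeas d (X : R -> Omega -> 'rV[R]_d) t : 0 <= t -> adapted F X -> Fmeas t (X t).
Proof. by move=> t0 aX; apply/FmeasP => // A mA; exact: aX. Qed.

Lemma Fmeas_adapted d (X : R -> Omega -> 'rV[R]_d) : (forall t, 0 <= t -> Fmeas t (X t)) -> adapted F X.
Proof. by move=> h t t0; apply/FmeasP => //; exact: h. Qed.

End filtration.

Section brownian.
Context {R : realType} {d : nat} {disp} {Omega : measurableType disp} (P : probability Omega R) (F : R -> set (set Omega))
 (hF : is_filtration P F) (W : R -> Omega -> 'rV[R]_d) (hW : is_brownian_motion P F W).

Lemma Fmeas_W t : 0 <= t -> Fmeas F t (W t).
Proof. by move=> t0; apply: (adapted_Fmeas hF t0); case: hW. Qed.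

Lemma meas_W t : 0 <= t -> meas (W t).
Proof. by move=> t0; apply: (Fmeas_meas hF t0); exact: Fmeas_W. Qed.

Lemma Fmeas_dW a b t : 0 <= a -> 0 <= b -> a <= t -> b <= t -> Fmeas F t (fun w => W b w - W a w).
Proof.
move=> a0 b0 at' bt; apply: meas_rVB; apply: (Fmeas_mono hF _ _ (Fmeas_W _)) => //.
Qed.

Lemma meas_dW a b : 0 <= a -> 0 <= b -> meas (fun w => W b w - W a w).
Proof. by move=> a0 b0; apply: meas_rVB; exact: meas_W. Qed.

Lemma joint_law_box (s t : R) A (B : set 'rV[R]_d) : 0 <= s -> s < t -> F s A -> measurable B ->
 (P (A `&` ((fun w => (W t w - W s w)%R) @^-1` B)) = P A * gauss (Num.sqrt (t - s)) B)%E.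
Proof.
move=> s0 st FA mB.
have t0 : 0 <= t by exact: ltW (le_lt_trans s0 st).
have mA : measurable A by apply: (F_measurable hF s0).
pose V w := W t w - W s w.
have mV : meas V by exact: meas_dW.
pose PA : {measure set Omega -> \bar R} := mrestr P mA.
pose m1 : {measure set 'rV[R]_d -> \bar R} := pushforward PA V.
have PAfin : P A = (fine (P A))%:E by rewrite fineK// fin_num_measure.
have PA0 : 0 <= fine (P A) by rewrite fine_ge0.
pose m2 : {measure set 'rV[R]_d -> \bar R} := mscale (NngNum PA0) (gauss (Num.sqrt (t - s))).
have := @measure_box_unique R d (m1 mV) m2 _ _ B mB.
rewrite {1 2}/m1 /= /pushforward /PA/= /mrestr /= => h.
rewrite setIC; rewrite h.
- by rewrite /m2/= /mscale/= -PAfin.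
- by rewrite preimage_setT setTI PAfin ltry.
- move=> C mC; rewrite /m2/= /mscale/= -PAfin.
 case: hW => _ _ _ /(_ s t s0 st A C FA mC); rewrite setIC => ->.
 by congr (_ * _)%E; rewrite -gauss_box.
Qed.

Lemma joint_law (s t : R) d' (T : measurableType d') (Z : Omega -> T) (f : T * 'rV[R]_d -> \bar R) :
 0 <= s -> s < t -> Fmeas F s Z -> meas f -> (forall p, 0 <= f p)%E ->
 (\int[P]_w f (Z w, W t w - W s w)%R =
  \int[P]_w \int[gauss (Num.sqrt (t - s))]_v f (Z w, v))%E.
Proof.
move=> s0 st FZ mf f0.
have t0 : 0 <= t by exact: ltW (le_lt_trans s0 st).
have mZ : meas Z by exact: (Fmeas_meas hF s0 FZ).
pose V w := W t w - W s w.
have mV : meas V by exact: meas_dW.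
pose Zp : {mfun Omega >-> T} := HB.pack Z (isMeasurableFun.Build _ _ _ _ Z mZ).
pose g := gauss (d := d) (Num.sqrt (t - s)).
pose m1 : {measure set (T * 'rV[R]_d) -> \bar R} := pushforward P (fun w => (Z w, V w)).
have mZV : meas (fun w => (Z w, V w)) by exact: measurable_fun_pair.
transitivity (\int[m1 mZV]_p f p)%E.
 by rewrite /m1 ge0_integral_pushforward.
transitivity (\int[(distribution P Zp \x g)%E]_p f p)%E.
 apply: eq_measure_integral => X mX _; apply/esym; apply: product_measure_unique => // A B mA mB.
 rewrite /m1 /= /pushforward.
 rewrite (_ : _ @^-1` _ = (Z @^-1` A) `&` (V @^-1` B))//.
 by apply: joint_law_box => //; exact: (proj1 (FmeasP hF Z s0) FZ).
rewrite fubini_tonelli1// ge0_integral_distribution//.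
- exact: measurable_fun_fubini_tonelli_F.
- by move=> x; exact: integral_ge0.
Qed.

End brownian.

Section gaussian_moments.
Context {R : realType} {d : nat}.

Lemma integral_gauss_coord (i : 'I_d) (f : R -> R) (c : R) :
 meas f -> (forall t, 0 <= f t) ->
 (\int[lebesgue_measure]_t (f t * normal_pdf 0 1 t)%:E = c%:E)%E ->
 (\int[@gauss R d 1]_x (f (x 0%R i))%:E = c%:E)%E.
Proof.
move=> mf f0 fc.
rewrite [RHS](_ : _ = (\prod_j (if j == i then c else 1))%:E); last first.
 by rewrite (bigD1 i)//= eqxx big1 ?mulr1// => j /negbTE ->.
rewrite -(integral_gauss_prod (s := 1) (f := fun j => if j == i then f else cst 1)).
- apply: eq_integral => x _; congr EFin.
 by rewrite (bigD1 i)//= eqxx big1 ?mulr1// => j /negbTE ->.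
- by move=> j; case: ifP.
- by move=> j t; case: ifP.
- move=> j; case: ifP => // _.
 by under eq_integral do rewrite mul1r; rewrite integral_normal_pdf.
Qed.

Lemma integral_gauss_sqr (i : 'I_d) : (\int[@gauss R d 1]_x ((x 0%R i) ^+ 2)%:E = 1%E)%E.
Proof.
apply: (integral_gauss_coord i (f := fun t => t ^+ 2) (c := 1)) => //.
- by nneg.
- exact: normal_moment2.
Qed.

Lemma integral_gauss_affine_sqr (i : 'I_d) (s a b : R) : 0 < s ->
 (\int[@gauss R d s]_x ((a + b * x 0%R i)%R ^+ 2)%:E = (a ^+ 2 + b ^+ 2 * s ^+ 2)%:E)%E.
Proof.
move=> s0.
have mlin (c e : R) : measurable_fun [set: 'rV[R]_d] (fun x : 'rV[R]_d => ((c + e * x 0%R i)%R ^+ 2)%:E).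
 apply: meas_EFin; apply: measurable_funX; apply: measurable_funD => //.
 by mble.
rewrite integral_gauss_scale//; last by nneg.
under eq_integral do rewrite mxE mulrA.
set c := b * s.
set I := LHS.
have I2 : I = (\int[@gauss R d 1]_x ((a + - c * x 0%R i)%R ^+ 2)%:E)%E.
 rewrite /I (integral_gauss_signs (fun=> true)) => [|//|x]; last by nneg.
 by apply: eq_integral => x _; rewrite mxE expr1 mulN1r mulrNN.
have : (I + I = (2 * (a ^+ 2 + c ^+ 2))%:E)%E.
 rewrite {2}I2 /I -ge0_integralD//; last 2 first.
 - by nneg.
 - by nneg.
 transitivity (\int[@gauss R d 1]_x ((2 * a ^+ 2)%:E + (2 * c ^+ 2)%:E * ((x 0%R i) ^+ 2)%:E))%E.
  by apply: eq_integral => x _; rewrite -EFinM -!EFinD; congr EFin; ring.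
 have msq : measurable_fun [set: 'rV[R]_d] (fun x : 'rV[R]_d => ((x 0%R i) ^+ 2)%:E).
  by mble.
 rewrite ge0_integralD//; last 3 first.
 - by nneg.
 - by nneg.
 - by apply: emeasurable_funM.
 rewrite integral_cst// ge0_integralZl//; last 2 first.
 - by nneg.
 - by nneg.
 rewrite integral_gauss_sqr [X in ((_ * X)%E + _)%E](probability_setT (gauss 1)) !mule1 -EFinD.
 by congr EFin; ring.
case: I {I2} => [r|//|//]; rewrite -EFinD => -[rE]; congr EFin.
rewrite -exprMn -/c; lra.
Qed.

End gaussian_moments.

Section discrete_isometry.
Context {R : realType} {d : nat} {disp} {Omega : measurableType disp} (P : probability Omega R) (F : R -> set (set Omega))
 (hF : is_filtration P F) (W : R -> Omega -> 'rV[R]_d) (hW : is_brownian_motion P F W) (i : 'I_d).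

Lemma isometry_step (a b : R) (m phi : Omega -> R) : 0 <= a -> a <= b ->
 Fmeas F a m -> Fmeas F a phi ->
 (\int[P]_w ((m w + phi w * (W b w 0%R i - W a w 0%R i))%R ^+ 2)%:E =
  \int[P]_w ((m w) ^+ 2)%:E + (b - a)%:E * \int[P]_w ((phi w) ^+ 2)%:E)%E.
Proof.
move=> a0; rewrite le_eqVlt => /orP[/eqP <-|ab] Fm Fphi.
 rewrite subrr mul0e adde0; apply: eq_integral => w _.
 by rewrite subrr mulr0 addr0.
have mm := Fmeas_meas hF a0 Fm; have mphi := Fmeas_meas hF a0 Fphi.
pose f (p : (R * R) * 'rV[R]_d) : \bar R := ((p.1.1 + p.1.2 * p.2 0%R i)%R ^+ 2)%:E.
have mf : meas f.
 apply: meas_EFin; apply: measurable_funX; apply: measurable_funD.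
  by apply: (mcomp (f := fst)); [exact: measurable_fst|exact: measurable_fst].
 apply: measurable_funM.
  by apply: (mcomp (f := snd)); [exact: measurable_snd|exact: measurable_fst].
 by mble.
have f0 p : (0 <= f p)%E by rewrite lee_fin sqr_ge0.
have FZ : Fmeas F a (fun w => (m w, phi w)) by apply: measurable_fun_pair.
transitivity (\int[P]_w f ((m w, phi w), (W b w - W a w)%R))%E.
 by apply: eq_integral => w _; rewrite /f/= !mxE.
rewrite (joint_law hF hW a0 ab FZ mf f0).
have sq0 : 0 < Num.sqrt (b - a) by rewrite sqrtr_gt0 subr_gt0.
transitivity (\int[P]_w (((m w) ^+ 2)%:E + (b - a)%:E * ((phi w) ^+ 2)%:E))%E.
 apply: eq_integral => w _; rewrite /f /= integral_gauss_affine_sqr//.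
 rewrite sqr_sqrtr ?subr_ge0 ?(ltW ab)// -EFinM -EFinD; congr EFin; ring.
rewrite ge0_integralD//.
- rewrite ge0_integralZl//.
 + by mble.
 + by nneg.
 + by nneg.
- by nneg.
- by mble.
- by nneg.
- by mble.
Qed.

Definition dsum (tau : nat -> R) (phi : nat -> Omega -> R) (n : nat) (w : Omega) : R :=
 \sum_(j < n) phi j w * (W (tau j.+1) w 0 i - W (tau j) w 0 i).

Lemma Fmeas_dsum tau phi n : 0 <= tau 0%N -> (forall j, (j < n)%N -> tau j <= tau j.+1) ->
 (forall j, (j < n)%N -> Fmeas F (tau j) (phi j)) -> Fmeas F (tau n) (dsum tau phi n).
Proof.
move=> t0 tS Fphi.
have tle k : (k <= n)%N -> 0 <= tau k /\ tau k <= tau n.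
 elim: n tS {Fphi} k => [|n IH] tS k; first by rewrite leqn0 => /eqP ->.
 have [a b] := IH (fun j jn => tS j (ltnW jn)) n (leqnn n).
 rewrite leq_eqVlt => /orP[/eqP ->|]; first by split => //; exact: le_trans a (tS n _).
 rewrite ltnS => /(IH (fun j jn => tS j (ltnW jn))) [c e]; split => //.
 exact: le_trans e (tS n _).
apply: measurable_sum => j.
have [c e] := tle j (ltnW (ltn_ord j)); have [c' e'] := tle j.+1 (ltn_ord j).
apply: measurable_funM; first exact: (Fmeas_mono hF c e (Fphi j (ltn_ord j))).
by apply: measurable_funB; apply: meas_coordf; apply: (Fmeas_mono hF _ _ (Fmeas_W hF hW _)).
Qed.

Lemma dsum_isometry tau phi n : 0 <= tau 0%N -> (forall j, (j < n)%N -> tau j <= tau j.+1) ->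
 (forall j, (j < n)%N -> Fmeas F (tau j) (phi j)) ->
 (\int[P]_w ((dsum tau phi n w) ^+ 2)%:E =
  \sum_(j < n) (tau j.+1 - tau j)%:E * \int[P]_w ((phi j w) ^+ 2)%:E)%E.
Proof.
move=> t0; elim: n => [|n IH] tS Fphi.
 rewrite big_ord0; apply: integral0_eq => w _; rewrite /dsum big_ord0 expr0n//.
rewrite big_ord_recr/= -IH; last 2 first.
- by move=> j jn; apply: tS; exact: ltnW.
- by move=> j jn; apply: Fphi; exact: ltnW.
have tn0 : 0 <= tau n.
 elim: n {IH Fphi} tS => // n IH tS; apply: le_trans (tS n _) => //.
 by apply: IH => j jn; apply: tS; exact: ltnW.
rewrite -isometry_step//; last 3 first.
- exact: tS.
- apply: Fmeas_dsum => // j jn; [apply: tS|apply: Fphi]; exact: ltnW.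
- exact: Fphi.
by apply: eq_integral => w _; rewrite /dsum big_ord_recr.
Qed.

End discrete_isometry.

Section telescoping.
Context {R : realType}.
Implicit Types (tau : nat -> R) (n : nat).

Lemma ndec_upto tau n : (forall j, (j < n)%N -> tau j <= tau j.+1) ->
 forall j k, (j <= k)%N -> (k <= n)%N -> tau j <= tau k.
Proof.
move=> tS j; elim=> [|k IH]; first by rewrite leqn0 => /eqP ->.
rewrite leq_eqVlt => /orP[/eqP -> //|jk kn].
by apply: le_trans (tS k kn); apply: IH => //; exact: ltnW.
Qed.

Lemma sum_telescope_upto (f : nat -> R) n : \sum_(j < n) (f j.+1 - f j) = f n - f 0%N.
Proof. by rewrite -(big_mkord xpredT (fun j => f j.+1 - f j)) telescope_sumr. Qed.

Lemma telescope_interval tau n (a b : nat) (f : R -> R) :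
 (forall j, (j < n)%N -> tau j <= tau j.+1) -> (a <= b)%N -> (b <= n)%N ->
 \sum_(j < n) \1_(`]tau a, tau b]%classic) (tau j.+1) * (f (tau j.+1) - f (tau j)) =
 f (tau b) - f (tau a).
Proof.
move=> tS ab bn; have tle := ndec_upto tS.
pose cl j := f (tau (maxn a (minn b j))).
rewrite [RHS](_ : _ = cl n - cl 0%N); last first.
 by rewrite /cl (minn_idPl bn) (maxn_idPr ab) minn0 maxn0.
rewrite -sum_telescope_upto; apply: eq_bigr => -[j jn] _ /=; rewrite /cl.
rewrite indicE mem_setE in_itv/=.
have [ja|aj] := leqP j.+1 a.
 rewrite (maxn_idPl _) ?(maxn_idPl _)//; last 2 first.
 - by rewrite geq_min (ltnW ja) orbT.
 - by rewrite geq_min ja orbT.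
 by rewrite ltNge (tle _ _ ja (leq_trans ab bn))/= mul0r subrr.
have [bj|jb] := leqP b j.
 rewrite (minn_idPl (leqW bj)) subrr.
 have [jb'|_] := boolP (tau j.+1 <= tau b); last by rewrite andbF mul0r.
 have -> : tau j.+1 = tau j.
  apply/eqP; rewrite eq_le tS// andbT (le_trans jb')// tle//.
  exact: ltnW.
 by rewrite subrr mulr0.
rewrite (minn_idPr jb) (maxn_idPr (ltnW aj)) (maxn_idPr (_ : a <= j)%N)//.
rewrite (tle _ _ jb bn) andbT.
have [taj|] := boolP (tau a < tau j.+1); first by rewrite mul1r.
rewrite -leNgt => taj; have -> : tau j.+1 = tau j.
 by apply/eqP; rewrite eq_le tS// andbT (le_trans taj)// tle// ltnW.
by rewrite subrr mulr0.
Qed.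

Lemma ge0_integral_piecewise_constant tau n (G : R -> R) :
 (forall j, (j < n)%N -> tau j <= tau j.+1) ->
 meas G -> (forall s, 0 <= G s) ->
 (forall j s, (j < n)%N -> tau j < s -> s <= tau j.+1 -> G s = G (tau j.+1)) ->
 (\int[lebesgue_measure]_(s in `[tau 0%N, tau n]) (G s)%:E =
  \sum_(j < n) ((tau j.+1 - tau j)%:E * (G (tau j.+1))%:E))%E.
Proof.
move=> tS mG G0 Gc; have mGE D : measurable_fun D (EFin \o G).
 by apply: measurable_funTS; exact: meas_EFin.
rewrite -integral_itv_obnd_cbnd//.
elim: n tS Gc => [|n IH] tS Gc.
 by rewrite big_ord0 set_itvoc0 integral_set0.
have tn : tau n <= tau n.+1 by exact: tS.
have t0n : tau 0%N <= tau n.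
 by apply: (ndec_upto tS) => //; exact: leqnSn.
rewrite big_ord_recr/= -IH => [|j jn|j s jn]; last 2 first.
- by apply: tS; exact: ltnW.
- by apply: Gc; exact: ltnW.
rewrite (@itv_bndbnd_setU _ _ _ (BRight (tau n))); last 2 first.
- by [].
- by [].
rewrite ge0_integral_setU//=; last 2 first.
- by nneg.
- apply/disj_setPS => x [] /=; rewrite !in_itv/= => /andP[_ h1] /andP[h2 _].
 by have := lt_le_trans h2 h1; rewrite ltxx.
congr (_ + _)%E.
rewrite (eq_integral (cst (G (tau n.+1))%:E)) => [|s]; last first.
 by rewrite inE/= in_itv/= => /andP[h1 h2]; rewrite (Gc n s)// ltnSn.
rewrite integral_cst//= [LHS]muleC lebesgue_measure_itv/= lte_fin.
case: ltP => [_|h]; first by [].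
by have /eqP -> : tau n == tau n.+1 by [rewrite eq_le tn]; rewrite subrr mul0e.
exact: mGE.
Qed.

End telescoping.

Section simple_processes.
Context {R : realType} {disp} {Omega : measurableType disp} (P : probability Omega R) (F : R -> set (set Omega))
 (hF : is_filtration P F) (t : R) (t0 : 0 <= t).
Implicit Types S : simple_process (R := R) (Omega := Omega).

Lemma meas_simple_fun S om : meas (fun s => simple_fun S s om).
Proof.
by mble.
Qed.

Lemma simple_time_le S : is_simple_process F t S ->
 forall j k, (j <= k)%N -> (k <= simple_size S)%N -> simple_time S j <= simple_time S k.
Proof. by case=> _ _ tS _ _; exact: ndec_upto. Qed.

Lemma stime_ge0 S : is_simple_process F t S ->
 forall k, (k <= simple_size S)%N -> 0 <= simple_time S k.
Proof.
by move=> sS k kS; have := simple_time_le sS (leq0n k) kS; case: sS => ->.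
Qed.

Definition refines (tau : nat -> R) (n : nat) S :=
 forall k, (k <= simple_size S)%N -> exists2 j, (j <= n)%N & simple_time S k = tau j.

Section refinement.
Context (tau : nat -> R) (n : nat) (S : simple_process (R := R) (Omega := Omega))
 (tS : forall j, (j < n)%N -> tau j < tau j.+1) (rS : refines tau n S) (sS : is_simple_process F t S).

Let tS' j : (j < n)%N -> tau j <= tau j.+1. Proof. by move=> /tS/ltW. Qed.

Lemma refines_idx k : (k < simple_size S)%N -> exists a b, [/\ (a <= b)%N, (b <= n)%N,
 simple_time S k = tau a & simple_time S k.+1 = tau b].
Proof.
move=> kS; have [a an ka] := rS (ltnW kS); have [b bn kb] := rS kS.
have [ab|ba] := leqP a b; first by exists a, b.
exists a, a; split => //; apply/eqP; rewrite eq_le; apply/andP; split.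
 by rewrite kb; exact: (ndec_upto tS' (ltnW ba) an).
by rewrite -ka; exact: (simple_time_le sS).
Qed.

Lemma simple_integral_refine (w : R -> Omega -> R) om :
 simple_integral S w om =
 \sum_(j < n) simple_fun S (tau j.+1) om * (w (tau j.+1) om - w (tau j) om).
Proof.
rewrite /simple_integral /simple_fun.
under [RHS]eq_bigr do rewrite mulr_suml.
rewrite exchange_big/=; apply: eq_bigr => k _.
have [a [b [ab bn -> ->]]] := refines_idx (ltn_ord k).
rewrite -(telescope_interval (fun s => w s om) tS' ab bn) mulr_sumr.
by apply: eq_bigr => j _; rewrite mulrA.
Qed.

Lemma simple_fun_const om j s : (j < n)%N -> tau j < s -> s <= tau j.+1 ->
 simple_fun S s om = simple_fun S (tau j.+1) om.
Proof.
move=> jn js sj; apply: eq_bigr => k _; congr (_ * _).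
have [a [b [ab bn -> ->]]] := refines_idx (ltn_ord k).
have tle := ndec_upto tS'.
rewrite !indicE !mem_setE !in_itv/=; congr (nat_of_bool _)%:R.
have [aj|ja] := leqP a j.
 rewrite (le_lt_trans (tle _ _ aj (ltnW jn)) js).
 rewrite (le_lt_trans (tle _ _ aj (ltnW jn)) (tS jn))/=.
 have [jb|bj] := leqP j.+1 b.
  by rewrite (tle _ _ jb bn) (le_trans sj (tle _ _ jb bn)).
 have tbj := tle _ _ (bj : (b <= j)%N) (ltnW jn).
 by rewrite !leNgt (le_lt_trans tbj js) (le_lt_trans tbj (tS jn)).
have tja := tle _ _ ja (leq_trans ab bn).
by rewrite !ltNge tja (le_trans sj tja).
Qed.

Lemma Fmeas_simple_fun j : (j < n)%N -> 0 <= tau 0%N -> Fmeas F (tau j) (simple_fun S (tau j.+1)).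
Proof.
move=> jn t00; apply: measurable_sum => k.
have [a [b [ab bn ka kb]]] := refines_idx (ltn_ord k).
have tle := ndec_upto tS'.
have [aj|ja] := leqP a j.
 apply: measurable_funM => //.
 have k0 : 0 <= simple_time S k by apply: stime_ge0 => //; exact: ltnW.
 apply: (Fmeas_mono hF (s := simple_time S k)) => //.
  by rewrite ka; apply: tle => //; exact: ltnW.
 by apply/(FmeasP hF) => // A mA; case: sS => _ _ _ h _; exact: h.
rewrite (_ : (fun _ => _) = cst 0)//; apply/funext => om.
rewrite indicE mem_setE in_itv/= ka ltNge (tle _ _ ja (leq_trans ab bn)) mulr0//.
Qed.

End refinement.

Lemma common_refinement S S' : is_simple_process F t S -> is_simple_process F t S' ->
 exists tau n, [/\ tau 0%N = 0, tau n = t, (forall j, (j < n)%N -> tau j < tau j.+1),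
  refines tau n S & refines tau n S'].
Proof.
move=> sS sS'.
pose ts S := [seq simple_time S k | k <- iota 0 (simple_size S).+1].
pose L := sort <=%R (undup (ts S ++ ts S')).
have inL x : (x \in L) = (x \in ts S) || (x \in ts S') by rewrite mem_sort mem_undup mem_cat.
have sL : sorted <%R L by rewrite sort_lt_sorted undup_uniq.
have L0 : 0 \in L.
 rewrite inL; apply/orP; left; apply/mapP; exists 0%N; first by [].
 by case: sS => ->.
have Lt : t \in L.
 rewrite inL; apply/orP; left; apply/mapP; exists (simple_size S); first by rewrite mem_iota/=.
 by case: sS => _ ->.
have Lbnd x : x \in L -> 0 <= x <= t.
 rewrite inL => /orP[] /mapP[k]; rewrite mem_iota/= add0n ltnS => kS ->.
  rewrite stime_ge0//=; have := simple_time_le sS kS (leqnn _); by case: sS => _ ->.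
 rewrite stime_ge0//=; have := simple_time_le sS' kS (leqnn _); by case: sS' => _ ->.
have sizeL : (0 < size L)%N by case: L L0 {inL sL Lt Lbnd}.
pose tau j := nth 0 L j; pose n := (size L).-1.
have nE : size L = n.+1 by rewrite /n prednK.
have tS j : (j < n)%N -> tau j < tau j.+1.
 move=> jn; have /(sortedP 0) := sL; apply; rewrite nE ltnS//.
have tle := ndec_upto (fun j jn => ltW (tS j jn)).
have idx x : x \in L -> exists2 j, (j <= n)%N & x = tau j.
 by move=> xL; exists (index x L); [rewrite -ltnS -nE index_mem|rewrite /tau nth_index].
exists tau, n; split => //.
- have [j jn tj] := idx _ L0.
 apply/eqP; rewrite eq_le {1}tj tle//=.
 by have /andP[] := Lbnd _ (mem_nth 0 sizeL).
- have [j jn tj] := idx _ Lt.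
 apply/eqP; rewrite eq_le {2}tj tle// andbT.
 by have nL : (n < size L)%N by [rewrite nE]; have /andP[] := Lbnd _ (mem_nth 0 nL).
- move=> k kS; apply: idx; rewrite inL; apply/orP; left; apply/mapP; exists k => //.
 by rewrite mem_iota.
- move=> k kS; apply: idx; rewrite inL; apply/orP; right; apply/mapP; exists k => //.
 by rewrite mem_iota.
Qed.

End simple_processes.

Section simple_isometry.
Context {R : realType} {d : nat} {disp} {Omega : measurableType disp} (P : probability Omega R) (F : R -> set (set Omega))
 (hF : is_filtration P F) (W : R -> Omega -> 'rV[R]_d) (hW : is_brownian_motion P F W) (i : 'I_d) (t : R) (t0 : 0 <= t).
Local Notation w := (fun s om => W s om 0 i).

Lemma simple_isometry (S S' : simple_process (R := R) (Omega := Omega)) :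
 is_simple_process F t S -> is_simple_process F t S' ->
 (\int[P]_om ((simple_integral S w om - simple_integral S' w om)%R ^+ 2)%:E =
  \int[P]_om \int[lebesgue_measure]_(s in `[0%R, t])
   ((simple_fun S s om - simple_fun S' s om)%R ^+ 2)%:E)%E.
Proof.
move=> sS sS'; have [tau [n [tau0 taun tS rS rS']]] := common_refinement sS sS'.
have tS' j : (j < n)%N -> tau j <= tau j.+1 by move=> /tS/ltW.
have t00 : 0 <= tau 0%N by rewrite tau0.
pose phi j om := simple_fun S (tau j.+1) om - simple_fun S' (tau j.+1) om.
have Fphi j : (j < n)%N -> Fmeas F (tau j) (phi j).
 by move=> jn; apply: measurable_funB; [apply: (Fmeas_simple_fun hF tS rS sS)|apply: (Fmeas_simple_fun hF tS rS' sS')].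
have tj0 j : (j <= n)%N -> 0 <= tau j by move=> jn; rewrite -tau0; apply: (ndec_upto tS').
transitivity (\int[P]_om ((dsum W i tau phi n om) ^+ 2)%:E)%E.
 apply: eq_integral => om _; congr (_ ^+ 2)%:E.
 rewrite (simple_integral_refine tS rS sS) (simple_integral_refine tS rS' sS') /dsum -sumrB.
 by apply: eq_bigr => j _; rewrite /phi mulrBl.
rewrite (dsum_isometry hF hW)//.
transitivity (\int[P]_om (\sum_(j < n) (tau j.+1 - tau j)%:E * ((phi j om) ^+ 2)%:E))%E.
 rewrite ge0_integral_sum//.
 - apply: eq_bigr => j _; rewrite ge0_integralZl//.
  + apply: meas_EFin; apply: measurable_funX.
   exact: (Fmeas_meas hF (tj0 j (ltnW (ltn_ord j))) (Fphi j (ltn_ord j))).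
  + by nneg.
  + by rewrite lee_fin subr_ge0 tS'.
 - move=> j; apply: emeasurable_funM => //; apply: meas_EFin; apply: measurable_funX.
  exact: (Fmeas_meas hF (tj0 j (ltnW (ltn_ord j))) (Fphi j (ltn_ord j))).
 - by move=> j om _; rewrite -EFinM lee_fin mulr_ge0 ?sqr_ge0// subr_ge0 tS'.
apply: eq_integral => om _; rewrite -{1}tau0 -taun.
rewrite ge0_integral_piecewise_constant//.
- by apply: measurable_funX; apply: measurable_funB; exact: meas_simple_fun.
- by nneg.
- move=> j s jn js sj.
 by rewrite (simple_fun_const tS rS sS om jn js sj) (simple_fun_const tS rS' sS' om jn js sj).
Qed.

End simple_isometry.

Section truncation.
Context {R : realType} {d : nat} {disp} {Omega : measurableType disp} (P : probability Omega R) (F : R -> set (set Omega))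
 (hF : is_filtration P F) (t : R) (t0 : 0 <= t) (K : R) (K0 : 0 <= K) (S : simple_process (R := R) (Omega := Omega))
 (sS : is_simple_process F t S).

Definition simple_energy (k : nat) (om : Omega) : R :=
 \sum_(j < k) simple_val S j om ^+ 2 * (simple_time S j.+1 - simple_time S j).

Definition simple_trunc : simple_process :=
 SimpleProcess (simple_size S) (simple_time S)
  (fun k om => simple_val S k om * \1_[set om | simple_energy k.+1 om <= K] om).

Lemma Fmeas_simple_val k : (k < simple_size S)%N -> Fmeas F (simple_time S k) (simple_val S k).
Proof.
move=> kS; apply/(FmeasP hF) => [|A mA]; first by apply: (stime_ge0 sS); exact: ltnW.
by case: sS => _ _ _ h _; exact: h.
Qed.

Lemma Fmeas_simple_energy k : (k < simple_size S)%N -> Fmeas F (simple_time S k) (simple_energy k.+1).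
Proof.
move=> kS; apply: measurable_sum => -[j jk]; apply: measurable_funM => //.
apply: measurable_funX; have jS := leq_ltn_trans (jk : (j <= k)%N) kS.
apply: (Fmeas_mono hF _ _ (Fmeas_simple_val jS)).
 by apply: (stime_ge0 sS); exact: ltnW.
by apply: (simple_time_le sS) => //; exact: ltnW.
Qed.

Lemma is_simple_process_trunc : is_simple_process F t simple_trunc.
Proof.
have [S0 St tS Sm [M SM]] := sS; split => //=.
 move=> k kS; apply/FmeasP => //; first exact: hF.
  by apply: (stime_ge0 sS); exact: ltnW.
 apply: measurable_funM; first exact: Fmeas_simple_val.
 apply: measurable_indic.
 rewrite (_ : [set om | _] = simple_energy k.+1 @^-1` `]-oo, K]%classic); last first.
  by [].
 rewrite -[X in measurable X]setTI.
 by apply: (Fmeas_simple_energy kS) => //; exact: measurable_itv.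
exists M => k om kS; rewrite normrM [X in _ * X]ger0_norm// (le_trans _ (SM k om kS))//.
by rewrite ler_piMr// indicE lern1 leq_b1.
Qed.

Lemma simple_energy_le k l om : (k <= l)%N -> (l <= simple_size S)%N ->
 simple_energy k om <= simple_energy l om.
Proof.
move=> kl lS; rewrite /simple_energy -(subnKC kl) big_split_ord/= lerDl sumr_ge0// => j _.
rewrite mulr_ge0 ?sqr_ge0// subr_ge0; case: sS => _ _ h _ _; apply: h.
by apply: leq_trans lS; rewrite -[X in (_ < X)%N](subnKC kl) ltn_add2l.
Qed.

Lemma simple_truncE om : simple_energy (simple_size S) om <= K ->
 forall k, (k < simple_size S)%N -> simple_val simple_trunc k om = simple_val S k om.
Proof.
move=> h k kS; rewrite /= indicE mem_set ?mulr1//=.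
by apply: le_trans h; exact: simple_energy_le.
Qed.

Lemma integral_simple_fun_sqr (S' : simple_process (R := R) (Omega := Omega)) om :
 is_simple_process F t S' ->
 (\int[lebesgue_measure]_(s in `[0%R, t]) ((simple_fun S' s om) ^+ 2)%:E =
  (\sum_(j < simple_size S') simple_val S' j om ^+ 2 * (simple_time S' j.+1 - simple_time S' j))%:E)%E.
Proof.
move=> sS'; have [S0 St tS Sm _] := sS'.
have jS (j s : _) : (j < simple_size S')%N -> simple_time S' j < s -> s <= simple_time S' j.+1 ->
  simple_fun S' s om = simple_val S' j om.
 move=> jn js sj; rewrite /simple_fun (bigD1 (Ordinal jn))//= indicE mem_set/=; last first.
  by rewrite in_itv/= js sj.
 rewrite mulr1 big1 ?addr0// => k kj; rewrite indicE memNset ?mulr0//= in_itv/= => /andP[ks sk].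
 have tle := ndec_upto tS.
 have [kj'|jk|kj'] := ltngtP k j; last by move: kj; rewrite -(inj_eq val_inj)/= kj' eqxx.
  have := le_lt_trans (le_trans sk (tle _ _ kj' (ltnW jn))) js; by rewrite ltxx.
 have := lt_le_trans ks (le_trans sj (tle _ _ jk (ltnW (ltn_ord k)))); by rewrite ltxx.
rewrite -{1}S0 -{1}St ge0_integral_piecewise_constant//.
- rewrite -sumEFin; apply: eq_bigr => j _; rewrite -EFinM; congr EFin.
 have := tS j (ltn_ord j); rewrite le_eqVlt => /orP[/eqP ->|js].
  by rewrite subrr mulr0 mul0r.
 by rewrite mulrC (jS j).
- by apply: measurable_funX; exact: meas_simple_fun.
- by nneg.
- move=> j s jn js sj; rewrite !(jS j)//; exact: lt_le_trans js sj.
Qed.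

Lemma integral_simple_trunc_le om :
 (\int[lebesgue_measure]_(s in `[0%R, t]) ((simple_fun simple_trunc s om) ^+ 2)%:E <= K%:E)%E.
Proof.
rewrite (integral_simple_fun_sqr _ is_simple_process_trunc) lee_fin.
suff h m : (m <= simple_size S)%N -> \sum_(j < m) simple_val simple_trunc j om ^+ 2 *
  (simple_time S j.+1 - simple_time S j) <= K /\
  ((\sum_(j < m) simple_val simple_trunc j om ^+ 2 *
  (simple_time S j.+1 - simple_time S j)) <= simple_energy m om).
 by have [] := h _ (leqnn _).
elim: m => [|m IH] mS; first by rewrite /simple_energy !big_ord0.
have [h1 h2] := IH (ltnW mS).
have d0 : 0 <= simple_time S m.+1 - simple_time S m by rewrite subr_ge0; case: sS => _ _ h _ _; exact: h.
rewrite big_ord_recr/= indicE; split.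
 have [/set_mem/= hK|_] := boolP (_ \in _); last by rewrite mulr0 expr0n/= mul0r addr0.
 by rewrite mulr1 (le_trans _ hK)// [leRHS]/simple_energy [leRHS]big_ord_recr/= lerD2r; exact: h2.
rewrite {2}/simple_energy [leRHS]big_ord_recr/= lerD// ler_wpM2r//.
rewrite exprMn ler_piMr ?sqr_ge0//.
by case: (_ \in _); rewrite ?expr1n// expr0n.
Qed.

End truncation.

Ltac mfun := repeat first
 [ assumption | exact: measurable_cst
 | apply: meas_EFin | apply: measurable_funD | apply: measurable_funB
 | apply: measurable_funM | apply: measurable_funX | apply: measurable_funN ].

Section nonneg_integrals.
Context {disp} {T : measurableType disp} {R : realType} (m : {measure set T -> \bar R}).
Implicit Types (f g : T -> R).

Definition nnm f := meas f /\ forall x, 0 <= f x.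

Lemma nnmD f g : nnm f -> nnm g -> nnm (fun x => f x + g x).
Proof. by move=> [mf f0] [mg g0]; split; [mfun|move=> x; rewrite addr_ge0]. Qed.

Lemma nnmZ (c : R) f : 0 <= c -> nnm f -> nnm (fun x => c * f x).
Proof. by move=> c0 [mf f0]; split; [mfun|move=> x; rewrite mulr_ge0]. Qed.

Lemma nnmM f g : nnm f -> nnm g -> nnm (fun x => f x * g x).
Proof. by move=> [mf f0] [mg g0]; split; [mfun|move=> x; rewrite mulr_ge0]. Qed.

Lemma nnm_sqr f : meas f -> nnm (fun x => f x ^+ 2).
Proof. by move=> mf; split; [mfun|move=> x; rewrite sqr_ge0]. Qed.

Lemma nnm_cst (c : R) : 0 <= c -> nnm (fun=> c).
Proof. by []. Qed.

Lemma nnm_indic A : measurable A -> nnm (\1_A).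
Proof. by mble. Qed.

Lemma nnm_sum (I : Type) (r : seq I) (f : I -> T -> R) : (forall i, nnm (f i)) ->
 nnm (fun x => \sum_(i <- r) f i x).
Proof.
move=> h; split; first by apply: measurable_sum => i; case: (h i).
by move=> x; apply: sumr_ge0 => i _; case: (h i).
Qed.

Definition nint f : \bar R := (\int[m]_x (f x)%:E)%E.

Lemma nint_ge0 f : (forall x, 0 <= f x) -> (0 <= nint f)%E.
Proof. by move=> f0; apply: integral_ge0 => x _; rewrite lee_fin. Qed.

Lemma le_nint f g : nnm f -> nnm g -> (forall x, f x <= g x) -> (nint f <= nint g)%E.
Proof.
move=> [mf f0] [mg g0] fg; apply: ge0_le_integral => //; [|by mfun..|].
- by nneg.
- by nneg.
Qed.

Lemma nintD f g : nnm f -> nnm g -> nint (fun x => f x + g x) = (nint f + nint g)%E.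
Proof.
move=> [mf f0] [mg g0]; rewrite /nint -ge0_integralD//; try by mfun.
- by nneg.
- by nneg.
Qed.

Lemma nintZ (c : R) f : 0 <= c -> nnm f -> nint (fun x => c * f x) = (c%:E * nint f)%E.
Proof.
move=> c0 [mf f0]; rewrite /nint -ge0_integralZl//; first by mfun.
by move=> x _; rewrite lee_fin.
Qed.

Lemma nint_sum (I : Type) (r : seq I) (f : I -> T -> R) : (forall i, nnm (f i)) ->
 nint (fun x => \sum_(i <- r) f i x) = (\sum_(i <- r) nint (f i))%E.
Proof.
move=> h; elim: r => [|i r IH].
 by rewrite big_nil; apply: integral0_eq => x _; rewrite big_nil.
rewrite big_cons -IH -nintD//; last exact: nnm_sum.
by apply: eq_integral => x _; rewrite big_cons.
Qed.

Lemma nint_indic A : measurable A -> nint (\1_A) = m A.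
Proof. by move=> mA; rewrite /nint integral_indic// setIT. Qed.

Lemma eq_nint f g : f =1 g -> nint f = nint g.
Proof. by move=> fg; apply: eq_integral => x _; rewrite fg. Qed.

Lemma nint_le_lin2E f (a b : R) g h : nnm f -> nnm g -> nnm h ->
 0 <= a -> 0 <= b -> (forall w, f w <= a * g w + b * h w) ->
 (nint f <= a%:E * nint g + b%:E * nint h)%E.
Proof.
move=> nf ng nh a0 b0 fgh; rewrite -!nintZ// -nintD; try exact: nnmZ.
by apply: le_nint => //; apply: nnmD; exact: nnmZ.
Qed.

Lemma nint_le_lin3E f (a b c : R) g h k : nnm f -> nnm g -> nnm h -> nnm k ->
 0 <= a -> 0 <= b -> 0 <= c -> (forall w, f w <= a * g w + b * h w + c * k w) ->
 (nint f <= a%:E * nint g + b%:E * nint h + c%:E * nint k)%E.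
Proof.
move=> nf ng nh nk a0 b0 c0 fgh; rewrite -!nintZ// -!nintD; try by [exact: nnmZ|apply: nnmD; exact: nnmZ].
by apply: le_nint => //; apply: nnmD; [apply: nnmD|]; exact: nnmZ.
Qed.

Lemma nint_le_lin1 f (a : R) g (x : R) : nnm f -> nnm g -> 0 <= a ->
 (forall w, f w <= a * g w) -> (nint g <= x%:E)%E -> (nint f <= (a * x)%:E)%E.
Proof.
move=> nf ng a0 fg gx; apply: (@le_trans _ _ (nint (fun w => a * g w))).
 by apply: le_nint => //; exact: nnmZ.
by rewrite nintZ// EFinM lee_wpmul2l// lee_fin.
Qed.

Lemma nint_le_lin2 f (a b : R) g h (x y : R) : nnm f -> nnm g -> nnm h ->
 0 <= a -> 0 <= b -> (forall w, f w <= a * g w + b * h w) ->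
 (nint g <= x%:E)%E -> (nint h <= y%:E)%E -> (nint f <= (a * x + b * y)%:E)%E.
Proof.
move=> nf ng nh a0 b0 fgh gx hy.
apply: le_trans (nint_le_lin2E nf ng nh a0 b0 fgh) _.
by rewrite EFinD !EFinM leeD// lee_wpmul2l// lee_fin.
Qed.

Lemma nint_le_lin3 f (a b c : R) g h k (x y z : R) : nnm f -> nnm g -> nnm h -> nnm k ->
 0 <= a -> 0 <= b -> 0 <= c -> (forall w, f w <= a * g w + b * h w + c * k w) ->
 (nint g <= x%:E)%E -> (nint h <= y%:E)%E -> (nint k <= z%:E)%E ->
 (nint f <= (a * x + b * y + c * z)%:E)%E.
Proof.
move=> nf ng nh nk a0 b0 c0 fgh gx hy kz.
apply: le_trans (nint_le_lin3E nf ng nh nk a0 b0 c0 fgh) _.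
by rewrite !EFinD !EFinM !leeD// lee_wpmul2l// lee_fin.
Qed.

Lemma nint_markov f (a : R) : nnm f -> 0 < a ->
 (a%:E * m [set x | (a <= f x)%R] <= nint f)%E.
Proof.
move=> nf a0; have [mf f0] := nf.
have mA : measurable [set x | a <= f x].
 rewrite (_ : [set x | _] = f @^-1` `[a, +oo[%classic).
  by rewrite -[X in measurable X]setTI; exact: mf.
 by apply/seteqP; split=> x; rewrite /= in_itv/= andbT.
rewrite -(nint_indic mA) -(nintZ (ltW a0) (nnm_indic mA)).
apply: le_nint => //; first by apply: nnmZ; [exact: ltW|exact: (nnm_indic mA)].
move=> x; rewrite indicE; have [/set_mem/= h|_] := boolP (x \in _); first by rewrite mulr1.
by rewrite mulr0.
Qed.

(* Truncating by level sets avoids any a priori finiteness of the integral. *)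
Lemma nint_le_level f (c : \bar R) : nnm f ->
 (forall k : nat, (\int[m]_(x in [set x | (f x <= k%:R)%R]) (f x)%:E <= c)%E) -> (nint f <= c)%E.
Proof.
move=> [mf f0] h.
have mA k : measurable [set x | f x <= k%:R].
 rewrite (_ : [set x | _] = f @^-1` `]-oo, k%:R]%classic).
  by rewrite -[X in measurable X]setTI; exact: mf.
 by [].
have cv : (\int[m]_(x in [set x | (f x <= k%:R)%R]) (EFin \o f) x)%E @[k --> \oo] -->
  (\int[m]_(x in \bigcup_k [set x | (f x <= k%:R)%R]) (EFin \o f) x)%E.
 apply: ge0_nondecreasing_set_cvg_integral => //.
 - by move=> a b ab; apply/subsetPset => x /= /le_trans; apply; rewrite ler_nat.
 - by move=> k; apply: measurable_funTS; mfun.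
 - by move=> k x _; rewrite lee_fin.
rewrite /nint (_ : [set: T] = \bigcup_k [set x | f x <= k%:R]); last first.
 apply/seteqP; split=> // x _; exists (Num.truncn (f x)).+1 => //=.
 exact/ltW/truncnS_gt.
rewrite -(cvg_lim _ cv)//; apply: lime_le; first by apply: cvgP; exact: cv.
by near=> k; exact: h.
Unshelve. all: by end_near. Qed.

End nonneg_integrals.

Section ereal_cvg0.
Context {R : realType}.

Lemma cvge0P (u : nat -> \bar R) : (forall n, 0 <= u n)%E ->
 (u n @[n --> \oo] --> 0%E) <-> (forall e : R, 0 < e -> exists N, forall n, (N <= n)%N -> (u n <= e%:E)%E).
Proof.
move=> u0; split.
 move=> /fine_cvgP[fin /cvgrPdist_le cv] e e0.
 have [N _ hN] : \forall n \near \oo, (u n <= e%:E)%E.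
  near=> n.
  have fn : u n \is a fin_num by near: n.
  rewrite -(fineK fn) lee_fin -[leLHS]ger0_norm ?fine_ge0// -normrN -[_ (fine _)]add0r.
  by near: n; exact: cv.
 by exists N => n; exact: hN.
move=> h; apply/fine_cvgP.
have fin : \forall n \near \oo, u n \is a fin_num.
 have [N hN] := h 1 ltr01; exists N => // n Nn.
 by rewrite ge0_fin_numE//; apply: le_lt_trans (hN n Nn) (ltry _).
split => //; apply/cvgrPdist_le => e e0; have [N hN] := h e e0.
near=> n; have fn : u n \is a fin_num by near: n.
rewrite sub0r normrN ger0_norm ?fine_ge0// -lee_fin fineK//.
by apply: hN; near: n; exact: nbhs_infty_ge.
Unshelve. all: by end_near. Qed.

End ereal_cvg0.

Section ito.
Context {R : realType} {d : nat} {disp} {Omega : measurableType disp} (P : probability Omega R) (F : R -> set (set Omega))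
 (hF : is_filtration P F) (W : R -> Omega -> 'rV[R]_d) (hW : is_brownian_motion P F W) (i : 'I_d) (t : R) (t0 : 0 <= t).
Local Notation w := (fun s om => W s om 0 i).
Local Notation leb := (@lebesgue_measure R).
Implicit Types S : simple_process (R := R) (Omega := Omega).

Definition jmeas (H : R -> Omega -> R) : Prop :=
 meas (fun p : measurableTypeR R * Omega => H p.1 p.2).

Lemma jmeas_fst (f : measurableTypeR R -> R) : meas f -> jmeas (fun s _ => f s).
Proof.
move=> mf; apply: (@measurableT_comp _ _ _ _ (measurableTypeR R) _ f _ fst) => //.
Qed.

Lemma jmeas_snd (f : Omega -> R) : meas f -> jmeas (fun _ om => f om).
Proof.
move=> mf; apply: (@measurableT_comp _ _ _ _ Omega _ f _ snd) => //.
Qed.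

Lemma jmeas_section H om : jmeas H -> meas ((H ^~ om) : measurableTypeR R -> R).
Proof.
move=> mH; apply: (@measurableT_comp _ _ _ _ (measurableTypeR R * Omega)%type _
 (fun p : measurableTypeR R * Omega => H p.1 p.2) _ (fun s => (s, om))) => //.
Qed.

Lemma jmeas_simple_fun S : is_simple_process F t S -> jmeas (simple_fun S).
Proof.
move=> sS; apply: measurable_sum => k.
have k0 : 0 <= simple_time S k by apply: (stime_ge0 sS); exact: ltnW.
apply: measurable_funM; first apply: jmeas_snd.
 exact: (Fmeas_meas hF k0 (Fmeas_simple_val hF sS (ltn_ord k))).
by apply: jmeas_fst; exact: measurable_indic.
Qed.

Definition psub (H K : R -> Omega -> R) s om : R := H s om - K s om.

Lemma jmeasB H K : jmeas H -> jmeas K -> jmeas (psub H K).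
Proof. by mble. Qed.

Definition sqtime (H : R -> Omega -> R) (om : Omega) (s : measurableTypeR R) : R :=
 (H s om) ^+ 2 * \1_(`[0%R, t]%classic) s.

Definition l2time (H : R -> Omega -> R) (om : Omega) : \bar R := nint leb (sqtime H om).

Lemma l2timeE H om :
 (\int[leb]_(s in `[0%R, t]) ((H s om) ^+ 2)%:E)%E = l2time H om.
Proof.
rewrite /l2time integral_mkcond; apply: eq_integral => s _.
by rewrite epatch_indic EFinM.
Qed.

Lemma nnm_sqtime H om : meas ((H ^~ om) : measurableTypeR R -> R) -> nnm (sqtime H om).
Proof.
move=> mH; split=> [|s]; last by rewrite mulr_ge0// sqr_ge0.
by mble.
Qed.

Lemma meas_l2time H : jmeas H -> meas (l2time H).
Proof.
move=> mH; apply: (measurable_fun_fubini_tonelli_G (m1 := leb)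
 (fun p : measurableTypeR R * Omega => (((H p.1 p.2) ^+ 2 * \1_(`[0%R, t]%classic) p.1)%R)%:E)).
 apply: meas_EFin; apply: measurable_funM; first exact: measurable_funX.
 by apply: jmeas_fst; exact: measurable_indic.
by nneg.
Qed.

Lemma l2time_ge0 H om : (0 <= l2time H om)%E.
Proof. by apply: nint_ge0 => s; rewrite mulr_ge0// sqr_ge0. Qed.

Lemma l2time_le (C : R) (H : R -> Omega -> R) om :
 meas ((H ^~ om) : measurableTypeR R -> R) ->
 (forall s, 0 <= s -> s <= t -> `|H s om| <= C) -> (l2time H om <= (C ^+ 2 * t)%:E)%E.
Proof.
move=> mH HC; apply: (nint_le_lin1 (a := C ^+ 2) (x := t) (g := \1_(`[0%R, t]%classic) : measurableTypeR R -> R)).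
- exact: nnm_sqtime.
- exact: nnm_indic.
- exact: sqr_ge0.
- move=> s; rewrite /sqtime indicE; have [/set_mem/=|] := boolP (_ \in _); last by rewrite !mulr0.
 rewrite in_itv/= => /andP[s0 st]; rewrite !mulr1 -(real_normK (num_real (H s om))).
 by rewrite lerXn2r ?nnegrE//; [exact: le_trans (HC s s0 st)|exact: HC].
- rewrite nint_indic// [X in (X <= _)%E]lebesgue_measure_itv/= lte_fin.
 by case: ltP => _; rewrite ?sube0// lee_fin.
Qed.

Lemma l2time_le3 (H K L M : R -> Omega -> R) om :
 meas ((H ^~ om) : measurableTypeR R -> R) ->
 meas ((K ^~ om) : measurableTypeR R -> R) ->
 meas ((L ^~ om) : measurableTypeR R -> R) ->
 meas ((M ^~ om) : measurableTypeR R -> R) ->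
 (forall s, 0 <= s -> s <= t -> H s om = K s om + L s om + M s om) ->
 (l2time H om <= 3%:E * l2time K om + 3%:E * l2time L om + 3%:E * l2time M om)%E.
Proof.
move=> mH mK mL mM HE; apply: nint_le_lin3E => //; try exact: nnm_sqtime.
move=> s; rewrite /sqtime !mulrA -!mulrDl indicE.
have [/set_mem/=|] := boolP (_ \in _); last by rewrite !mulr0.
rewrite in_itv/= => /andP[s0 st]; rewrite !mulr1 HE//.
have := sqr_ge0 (K s om - L s om); have := sqr_ge0 (K s om - M s om).
have := sqr_ge0 (L s om - M s om); rewrite !sqrrB !sqrrD; nra.
Qed.

Lemma eq_l2time (H K : R -> Omega -> R) om :
 (forall s, 0 <= s -> s <= t -> H s om = K s om) -> l2time H om = l2time K om.
Proof.
move=> HK; apply: eq_nint => s; rewrite /sqtime indicE.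
have [/set_mem/=|] := boolP (_ \in _); last by rewrite !mulr0.
by rewrite in_itv/= => /andP[s0 st]; rewrite HK.
Qed.

(* Stopping [S n] once its energy exceeds [K] only changes it on an event of vanishing
  probability, and makes the time-integrated squared error bounded. *)
Lemma ito_l2_approx (C : R) (H : R -> Omega -> R) (I : Omega -> R) : 0 <= C ->
 jmeas H -> (forall s om, 0 <= s -> s <= t -> `|H s om| <= C) -> meas I ->
 is_ito_integral P F w H t I ->
 forall e : R, 0 < e -> exists S, [/\ is_simple_process F t S,
  (\int[P]_om l2time (psub (simple_fun S) H) om <= e%:E)%E &
  (P [set om | (e <= `|simple_integral S w om - I om|)%R] <= e%:E)%E].
Proof.
move=> C0 mH HC mI [S [sS hS hI]] e e0.
pose K : R := 3 + 3 * (C ^+ 2 * t).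
have K0 : 0 <= K by rewrite addr_ge0 ?mulr_ge0 ?sqr_ge0.
pose D n := l2time (psub (simple_fun (S n)) H).
have mD n : meas (D n).
 by apply: meas_l2time; apply: jmeasB => //; exact: jmeas_simple_fun.
pose B : R := 3 * K + 3 * (C ^+ 2 * t).
have B0 : 0 <= B by rewrite addr_ge0 ?mulr_ge0 ?sqr_ge0.
pose T n := simple_trunc K (S n).
have sT n : is_simple_process F t (T n) by apply: (is_simple_process_trunc hF).
have TS n om : (D n om < 1)%E -> forall k, (k < simple_size (S n))%N ->
  simple_val (T n) k om = simple_val (S n) k om.
 move=> Dn; apply: (simple_truncE (sS n)).
 rewrite -lee_fin -(integral_simple_fun_sqr om (sS n)) l2timeE.
 have mS := jmeas_section om (jmeas_simple_fun (sS n)).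
 have mHo := jmeas_section om mH.
 have h := @l2time_le3 (simple_fun (S n)) (psub (simple_fun (S n)) H) H (fun _ _ => 0) om mS.
 apply: le_trans (h _ mHo _ _) _ => //.
 - by apply: measurable_funB.
 - by move=> s _ _; rewrite subrK addr0.
 have -> : l2time (fun _ _ => 0) om = 0%E.
  by apply: integral0_eq => s _; rewrite /sqtime expr0n mul0r.
 have -> : K%:E = (3%:E + (3 * (C ^+ 2 * t))%:E)%E by [].
 rewrite mule0 adde0; apply: leeD.
  by rewrite -[leRHS]mule1 lee_wpmul2l// ltW.
 rewrite EFinM lee_wpmul2l//; apply: l2time_le => //.
 by move=> s; exact: HC.
pose DT n := l2time (psub (simple_fun (T n)) H).
have DTB n om : (DT n om <= B%:E)%E.
 have mS := jmeas_section om (jmeas_simple_fun (sT n)).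
 have mHo := jmeas_section om mH.
 have h := @l2time_le3 (psub (simple_fun (T n)) H) (simple_fun (T n)) (fun s om => - H s om) (fun _ _ => 0) om.
 apply: le_trans (h _ _ _ _ _) _ => //.
 - by apply: measurable_funB.
 - by apply: measurable_funN.
 - by move=> s _ _; rewrite addr0.
 have -> : l2time (fun _ _ => 0) om = 0%E.
  by apply: integral0_eq => s _; rewrite /sqtime expr0n mul0r.
 have -> : B%:E = ((3 * K)%:E + (3 * (C ^+ 2 * t))%:E)%E by [].
 rewrite mule0 adde0; apply: leeD.
  by rewrite EFinM lee_wpmul2l// -l2timeE; apply: (integral_simple_trunc_le hF).
 rewrite EFinM lee_wpmul2l//; apply: l2time_le => //; first by apply: measurable_funN.
 by move=> s s0 st; rewrite normrN; exact: HC.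
pose e1 : R := Num.min (e / 2) (1 / 2).
have e10 : 0 < e1 by rewrite lt_min divr_gt0//= divr_gt0.
have e1e : e1 <= e / 2 by rewrite ge_min lexx.
have e11 : e1 < 1 by rewrite gt_min orbC; apply/orP; left; lra.
have mA n (c : R) : measurable [set om | (c%:E <= D n om)%E].
 by rewrite -[X in measurable X]setTI; apply: emeasurable_fun_c_infty.
have mIS n : meas (simple_integral (S n) w).
 apply: measurable_sum => k; have [kS k0] := (ltn_ord k, stime_ge0 (sS n) (ltnW (ltn_ord k))).
 apply: measurable_funM.
  exact: (Fmeas_meas hF k0 (Fmeas_simple_val hF (sS n) kS)).
 by apply: measurable_funB; apply: meas_coordf; apply: (meas_W hF hW) => //; exact: (stime_ge0 (sS n)).
pose Y n om : \bar R := (`|simple_integral (S n) w om - I om|)%:E.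
have mY n : meas (Y n).
 by apply: meas_EFin; apply: mcomp => //; exact: measurable_funB.
have mY' n (c : R) : measurable [set om | (c%:E <= Y n om)%E].
 by rewrite -[X in measurable X]setTI; apply: emeasurable_fun_c_infty.
have hD c : 0 < c -> P [set om | (c%:E <= D n om)%E] @[n --> \oo] --> 0%E.
 move=> c0; have := hS c c0; rewrite (_ : (fun n => P _) = (fun n => P [set om | (c%:E <= D n om)%E]))//.
 by apply/funext => n; congr (P _); apply/funext => om /=; rewrite /D -l2timeE.
have P0 (A : nat -> set Omega) : (forall n, 0 <= P (A n))%E by [].
have e2B0 : 0 < e / (2 * (B + 1)) by nneg.
have min0 : 0 < Num.min (e / (2 * (B + 1))) (e / 2) by rewrite lt_min e2B0 divr_gt0.
have [N1 hN1] := (cvge0P (P0 _)).1 (hD e1 e10) _ min0.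
have e20 : 0 < e / 2 by nneg.
have [N2 hN2] := (cvge0P (P0 _)).1 (hI e e0) _ e20.
pose n := maxn N1 N2.
have {}hN1 := hN1 n (leq_maxl _ _); have {}hN2 := hN2 n (leq_maxr _ _).
exists (T n); split => //.
- apply: (@le_trans _ _ (\int[P]_om ((e1%:E + B%:E * (\1_[set om | (e1%:E <= D n om)%E] om)%:E)))%E).
  apply: ge0_le_integral => //.
  + by move=> om _; exact: l2time_ge0.
  + by apply: meas_l2time; apply: jmeasB => //; exact: jmeas_simple_fun.
  + apply: emeasurable_funD => //; apply: emeasurable_funM => //.
   by mble.
  move=> om _; rewrite indicE; have [_|/negP h] := boolP (_ \in _).
   by rewrite mule1 -[leLHS]add0e leeD ?lee_fin ?(ltW e10)//; exact: DTB.
  rewrite mule0 adde0.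
  have De1 : (D n om < e1%:E)%E by rewrite ltNge; apply/negP => h'; apply: h; rewrite inE.
  have D1 : (D n om < 1)%E by apply: lt_trans De1 _; rewrite lte_fin.
  apply: le_trans (ltW De1); rewrite /D.
  rewrite (eq_l2time (K := fun s om => simple_fun (S n) s om - H s om))// => s _ _.
  by congr (_ - _); apply: eq_bigr => k _; rewrite TS.
 rewrite ge0_integralD//; last 3 first.
 + by move=> om _; rewrite lee_fin ltW.
 + by move=> om _; rewrite mule_ge0// lee_fin.
 + by apply: emeasurable_funM => //; apply: meas_EFin; exact: measurable_indic.
 rewrite integral_cst// [X in (_ * X + _)%E]probability_setT mule1.
 rewrite ge0_integralZl//; last by mble.
 rewrite integral_indic// setIT.
 apply: (@le_trans _ _ (e1%:E + B%:E * (e / (2 * (B + 1)))%:E)%E).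
  rewrite leeD2l// lee_wpmul2l ?lee_fin//; apply: le_trans hN1 _.
  by rewrite lee_fin ge_min lexx.
 rewrite -EFinM -EFinD lee_fin.
 have : B * (e / (2 * (B + 1))) <= e / 2.
  rewrite mulrA ler_pdivrMr ?mulr_gt0 ?ltr_wpDl//; nra.
 lra.
- apply: (@le_trans _ _ (P ([set om | (e1%:E <= D n om)%E] `|` [set om | (e%:E <= Y n om)%E]))).
  apply: le_measure; rewrite ?inE//.
  + rewrite (_ : [set om | _] = (fun om => `|simple_integral (T n) w om - I om|) @^-1` `[e, +oo[%classic); last first.
    by apply/seteqP; split=> om; rewrite /= in_itv/= andbT.
   rewrite -[X in measurable X]setTI.
   have mT : meas (fun om => `|simple_integral (T n) w om - I om|).
    apply: mcomp => //; apply: measurable_funB => //.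
    apply: measurable_sum => k; have [kS k0] := (ltn_ord k, stime_ge0 (sT n) (ltnW (ltn_ord k))).
    apply: measurable_funM.
     exact: (Fmeas_meas hF k0 (Fmeas_simple_val hF (sT n) kS)).
    by apply: measurable_funB; apply: meas_coordf; apply: (meas_W hF hW) => //; exact: (stime_ge0 (sT n)).
   by apply: mT => //; exact: measurable_itv.
  + exact: measurableU.
  move=> om /= he; have [|De1] := leP e1%:E (D n om); [by left|right].
  have D1 : (D n om < 1)%E by apply: lt_trans De1 _; rewrite lte_fin.
  rewrite /Y lee_fin (le_trans he)// le_eqVlt; apply/orP; left; apply/eqP.
  by congr (`|_ - _|); apply: eq_bigr => k _; rewrite TS.
 apply: le_trans (measureU2 _ _ _) _ => //.
 rewrite [leRHS](_ : _ = ((e / 2)%:E + (e / 2)%:E)%E); last by rewrite -EFinD; congr EFin; lra.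
 by rewrite leeD//; apply: le_trans hN1 _; rewrite lee_fin ge_min lexx orbT.
Qed.

Lemma ito_isometry_le (C : R) (H K : R -> Omega -> R) (I J : Omega -> R) : 0 <= C ->
 jmeas H -> (forall s om, 0 <= s -> s <= t -> `|H s om| <= C) -> meas I ->
 jmeas K -> (forall s om, 0 <= s -> s <= t -> `|K s om| <= C) -> meas J ->
 is_ito_integral P F w H t I -> is_ito_integral P F w K t J ->
 (nint P (fun om => (I om - J om) ^+ 2)%R <= 9%:E * \int[P]_om l2time (psub H K) om)%E.
Proof.
move=> C0 mH HC mI mK KC mJ hI hJ.
pose f om := (I om - J om) ^+ 2.
have nf : nnm f by apply: nnm_sqr; exact: measurable_funB.
apply: nint_le_level => // m; apply/lee_addgt0Pr => eta eta0.
pose c : R := 6 + 6 + 9 + 9 + m%:R + m%:R.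
have c0 : 0 < c by rewrite /c ltr_pwDl// ltr_pwDl.
pose e : R := Num.min 1 (eta / c).
have e0 : 0 < e by rewrite lt_min ltr01 divr_gt0.
have e1 : e <= 1 by rewrite ge_min lexx.
have ee2 : e ^+ 2 <= e by rewrite expr2 ler_piMl// ltW.
have [S [sS HS IS]] := ito_l2_approx C0 mH HC mI hI e0.
have [T [sT KT JT]] := ito_l2_approx C0 mK KC mJ hJ e0.
pose A := simple_integral S w; pose B := simple_integral T w.
have mA : meas A.
 apply: measurable_sum => k; have [kS k0] := (ltn_ord k, stime_ge0 sS (ltnW (ltn_ord k))).
 apply: measurable_funM; first exact: (Fmeas_meas hF k0 (Fmeas_simple_val hF sS kS)).
 by apply: measurable_funB; apply: meas_coordf; apply: (meas_W hF hW) => //; exact: (stime_ge0 sS).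
have mB : meas B.
 apply: measurable_sum => k; have [kS k0] := (ltn_ord k, stime_ge0 sT (ltnW (ltn_ord k))).
 apply: measurable_funM; first exact: (Fmeas_meas hF k0 (Fmeas_simple_val hF sT kS)).
 by apply: measurable_funB; apply: meas_coordf; apply: (meas_W hF hW) => //; exact: (stime_ge0 sT).
have mset (g h : Omega -> R) : meas g -> meas h ->
  measurable [set om | e <= `|g om - h om|].
 move=> mg mh; rewrite (_ : [set om | _] = (fun om => `|g om - h om|) @^-1` `[e, +oo[%classic); last first.
  by apply/seteqP; split=> om; rewrite /= in_itv/= andbT.
 rewrite -[X in measurable X]setTI.
 have mT : meas (fun om => `|g om - h om|) by apply: mcomp => //; exact: measurable_funB.
 by apply: mT => //; exact: measurable_itv.
pose EA := [set om | e <= `|A om - I om|]; pose EB := [set om | e <= `|B om - J om|].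
have mEA : measurable EA by exact: mset.
have mEB : measurable EB by exact: mset.
pose q := (\int[P]_om l2time (psub H K) om)%E.
have hAB : (nint P (fun om => (A om - B om) ^+ 2)%R <= 3%:E * e%:E + 3%:E * q + 3%:E * e%:E)%E.
 rewrite /nint (simple_isometry hF hW i sS sT).
 apply: (@le_trans _ _ (\int[P]_om (3%:E * l2time (psub (simple_fun S) H) om + 3%:E * l2time (psub H K) om
   + 3%:E * l2time (psub K (simple_fun T)) om))%E).
  have jS := jmeas_simple_fun sS; have jT := jmeas_simple_fun sT.
  apply: ge0_le_integral => //.
  - by nneg.
  - by under eq_fun do rewrite (l2timeE (psub (simple_fun S) (simple_fun T))); apply: meas_l2time; exact: jmeasB.
  - by do 2 ?[apply: emeasurable_funD]; apply: emeasurable_funM => //; apply: meas_l2time; exact: jmeasB.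
  move=> om _; rewrite (l2timeE (psub (simple_fun S) (simple_fun T))).
  apply: l2time_le3; try by apply: measurable_funB; exact: jmeas_section.
  by move=> s _ _; rewrite /psub; lra.
 have jS := jmeas_simple_fun sS; have jT := jmeas_simple_fun sT.
 have ml H1 H2 : jmeas H1 -> jmeas H2 -> meas (l2time (psub H1 H2)).
  by move=> h1 h2; apply: meas_l2time; exact: jmeasB.
 have ml3 H1 H2 : jmeas H1 -> jmeas H2 -> meas (fun om => 3%:E * l2time (psub H1 H2) om)%E.
  by move=> h1 h2; apply: emeasurable_funM => //; exact: ml.
 have p3 H1 om : (0 <= 3%:E * l2time H1 om)%E by rewrite mule_ge0// l2time_ge0.
 rewrite !ge0_integralD//; try by [exact: ml3 | move=> om _; exact: p3 | move=> om _; rewrite adde_ge0//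
   | apply: emeasurable_funD; exact: ml3].
 rewrite !ge0_integralZl//; try by [exact: ml | move=> om _; exact: l2time_ge0].
 have KT' : (\int[P]_om l2time (psub K (simple_fun T)) om <= e%:E)%E.
  rewrite (eq_integral (l2time (psub (simple_fun T) K)))// => om _.
  by apply: eq_nint => s; rewrite /sqtime /psub -sqrrN opprB.
 apply: leeD; [apply: leeD|].
 - by apply: lee_wpmul2l; [rewrite lee_fin|exact: HS].
 - by [].
 - by apply: lee_wpmul2l; [rewrite lee_fin|exact: KT'].
have q0 : (0 <= q)%E by apply: integral_ge0 => om _; exact: l2time_ge0.
apply: (@le_trans _ _ (nint P (fun om => 3 * (A om - B om) ^+ 2 + (6 * e) + (m%:R * \1_EA om + m%:R * \1_EB om)))).
 rewrite /nint [leLHS]integral_mkcond; apply: ge0_le_integral => //.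
 - by move=> om _; apply: erestrict_ge0 => x _; rewrite lee_fin sqr_ge0.
 - apply/(measurable_restrictT (EFin \o f)); last by apply: measurable_funTS; apply: meas_EFin; case: nf.
  rewrite (_ : [set om | _] = f @^-1` `]-oo, m%:R]%classic).
   by rewrite -[X in measurable X]setTI; case: nf => mf _; exact: mf.
  by apply/seteqP; split=> x; rewrite /= in_itv.
 - by mfun; exact: measurable_indic.
 move=> om _; rewrite patchE; case: ifPn => [/set_mem/= fm|_]; last first.
  have -> : (point : \bar R) = 0%E by [].
  rewrite lee_fin; apply: addr_ge0; apply: addr_ge0; apply: mulr_ge0 => //; first exact: sqr_ge0.
  exact: ltW.
 rewrite lee_fin !indicE.
 have ab0 : 0 <= 3 * (A om - B om) ^+ 2 by rewrite mulr_ge0 ?sqr_ge0.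
 have [_|/negP hA] := boolP (om \in EA).
  by rewrite mulr1; move: fm; rewrite /f => fm; have : 0 <= (m%:R : R) * (om \in EB)%:R by []; lra.
 have [_|/negP hB] := boolP (om \in EB); first by rewrite mulr1 mulr0; move: fm; rewrite /f; lra.
 rewrite !mulr0 !addr0.
 have {}hA : `|A om - I om| < e by rewrite ltNge; apply/negP => h; apply: hA; rewrite inE.
 have {}hB : `|B om - J om| < e by rewrite ltNge; apply/negP => h; apply: hB; rewrite inE.
 have sA : (A om - I om) ^+ 2 <= e by apply: le_trans ee2; rewrite -(real_normK (num_real (A om - I om))) lerXn2r ?nnegrE ?(ltW e0)// ltW.
 have sB : (B om - J om) ^+ 2 <= e by apply: le_trans ee2; rewrite -(real_normK (num_real (B om - J om))) lerXn2r ?nnegrE ?(ltW e0)// ltW.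
 move: sA sB; rewrite /f; set a := A om; set b := B om; set x := I om; set y := J om.
 move=> sA sB.
 have := sqr_ge0 ((x - a) - (a - b)); have := sqr_ge0 ((x - a) - (b - y)); have := sqr_ge0 ((a - b) - (b - y)).
 rewrite !expr2 in sA sB *; nra.
rewrite nintD; last 2 first.
- by apply: nnmD; [apply: nnmZ => //; apply: nnm_sqr; exact: measurable_funB|apply: nnm_cst; rewrite mulr_ge0// ltW].
- by apply: nnmD; apply: nnmZ => //; exact: nnm_indic.
rewrite nintD; last 2 first.
- by apply: nnmZ => //; apply: nnm_sqr; exact: measurable_funB.
- by apply: nnm_cst; rewrite mulr_ge0// ltW.
rewrite [X in (_ + X)%E]nintD; last 2 first.
- by apply: nnmZ => //; exact: nnm_indic.
- by apply: nnmZ => //; exact: nnm_indic.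
rewrite !nintZ//; try by [apply: nnm_sqr; exact: measurable_funB | exact: nnm_indic | apply: nnm_cst; exact: ltW].
rewrite !nint_indic//.
have -> : nint P (fun=> e) = e%:E by rewrite /nint integral_cst// [X in (_ * X)%E]probability_setT mule1.
rewrite -(EFinM 6 e).
apply: (@le_trans _ _ (3%:E * (3%:E * e%:E + 3%:E * q + 3%:E * e%:E) + (6 * e)%:E + (m%:R%:E * e%:E + m%:R%:E * e%:E))%E).
 by rewrite !leeD// lee_wpmul2l// lee_fin.
rewrite -/q; clearbody q.
have -> : (3%:E * (3%:E * e%:E + 3%:E * q + 3%:E * e%:E) = 9%:E * q + (18 * e)%:E)%E.
 case: q q0 {hAB} => [r _|_|//]; first by rewrite -?EFinM -?EFinD -?EFinM -?EFinD; congr EFin; ring.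
 by rewrite -!EFinM !gt0_muley ?lte_fin// ?addey ?addye// gt0_muley ?lte_fin.
rewrite -!EFinM -!EFinD -!addeA leeD2l// -!EFinD lee_fin.
have : c * e <= eta by rewrite mulrC -ler_pdivlMr// /e ge_min lexx orbT.
rewrite /c; nra.
Qed.

End ito.

Section gronwall.
Context {R : realType}.
Local Notation leb := (@lebesgue_measure R).
Local Notation M := (measurableTypeR R).

Lemma integral_expRN_le (l s T : R) : 0 < l -> s <= T ->
 (\int[leb]_(t in `[s, T]) (expR (- l * t))%:E <= (expR (- l * s) / l)%:E)%E.
Proof.
move=> l0; rewrite le_eqVlt => /orP[/eqP ->|sT].
 by rewrite set_itv1 integral_set1 lee_fin divr_ge0 ?expR_ge0// ltW.
pose F t : R := - (expR (- l * t) / l).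
have dF (t : R) : is_derive t (1 : R) F (expR (- l * t)).
 have dq : is_derive t (1 : R) (cst (- l) * (@id R)) (- l).
  by apply: is_derive_eq; rewrite /GRing.scale/= mulr0 addr0 mulr1.
 have dE := @is_derive1_comp _ expR (cst (- l) * (@id R)) t _ _ (is_derive_expR _) dq.
 rewrite (_ : F = - ((expR \o (cst (- l) * (@id R))) * cst l^-1)); last first.
  by [].
 apply: is_derive_eq; rewrite /GRing.scale/= !fctE/= mulr0 add0r.
 by field; rewrite gt_eqF.
rewrite (@continuous_FTC2 R _ F)//.
- rewrite -EFinB lee_fin /F opprK -[leRHS]add0r lerD2r oppr_le0.
 by nneg.
- apply: continuous_subspaceT => t; apply: (continuous_comp (f := fun t => - l * t)); last exact: continuous_expR.
 exact: mulrl_continuous.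
- have dFd (t : R) : derivable F t 1 by [].
 split; first by [].
  apply: cvg_at_right_filter; apply: differentiable_continuous; exact/derivable1_diffP.
 apply: cvg_at_left_filter; apply: differentiable_continuous; exact/derivable1_diffP.
- by move=> t _; rewrite derive1E; have [_ ->] := dF t.
Qed.

Definition leI (s t : R) : R := (s <= t)%R%:R.

Lemma meas_leI : meas (fun p : M * M => leI p.1 p.2).
Proof.
rewrite (_ : (fun p : M * M => _) = \1_[set p : M * M | (p.1 : R) <= (p.2 : R)]); last first.
 by apply/funext => p; rewrite indicE /leI; congr (nat_of_bool _)%:R; apply/idP/idP; rewrite inE.
apply: measurable_indic; rewrite (_ : [set p | _] = (fun p : M * M => (p.2 : R) - (p.1 : R)) @^-1` `[0, +oo[%classic); last first.
 by apply/seteqP; split=> p; rewrite /= in_itv/= andbT subr_ge0.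
rewrite -[X in measurable X]setTI; apply: measurable_funB => //; exact: measurable_itv.
Qed.

(* Integrating the inequality against [exp (- 2 K t)] absorbs the integral term. *)
Lemma gronwall (K T : R) (v a : M -> \bar R) : 0 < K -> 0 <= T ->
 meas v -> meas a ->
 (forall t, 0 <= v t)%E -> (forall t, 0 <= a t)%E ->
 (forall t, 0 <= t -> t <= T -> (v t <= a t + K%:E * \int[leb]_(s in `[0%R, t]) v s)%E) ->
 (\int[leb]_(t in `[0%R, T]) v t < +oo)%E ->
 (\int[leb]_(t in `[0%R, T]) v t <=
  (2 * expR (2 * K * T))%:E * \int[leb]_(t in `[0%R, T]) a t)%E.
Proof.
move=> K0 T0 mv ma v0 a0 va voo.
pose l := 2 * K; have l0 : 0 < l by rewrite mulr_gt0.
pose w (t : R) := expR (- l * t).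
have mw : meas (w : M -> R).
 apply: mcomp => //; exact: measurable_funM.
have w0 t : 0 <= w t by exact: expR_ge0.
have mwE D (f : M -> \bar R) : meas f -> measurable_fun D (fun t => (w t)%:E * f t)%E.
 by move=> mf; apply: measurable_funTS; apply: emeasurable_funM => //; exact: meas_EFin.
pose X := (\int[leb]_(t in `[0%R, T]) ((w t)%:E * v t))%E.
pose Y := (\int[leb]_(t in `[0%R, T]) ((w t)%:E * a t))%E.
have w1 t : 0 <= t -> w t <= 1.
 by move=> t0; rewrite /w -expR0 ler_expR mulNr oppr_le0 mulr_ge0// ltW.
have Xoo : (X < +oo)%E.
 apply: le_lt_trans voo; apply: ge0_le_integral => //.
 - by nneg.
 - exact: mwE.
 - exact: measurable_funTS.
 move=> t; rewrite /= in_itv/= => /andP[t0 _].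
 by rewrite -[leRHS]mul1e lee_wpmul2r// lee_fin w1.
have X0 : (0 <= X)%E by apply: integral_ge0 => t _; rewrite mule_ge0// lee_fin.
pose f (p : M * M) : \bar R :=
 ((w p.2 * \1_(`[0%R, T]%classic) p.2 * leI p.1 p.2 * \1_(`[0%R, +oo[%classic) p.1)%R%:E * v p.1)%E.
have mf : meas f.
 apply: emeasurable_funM; last by apply: (mcomp mv).
 apply: meas_EFin; apply: measurable_funM; [apply: measurable_funM; [apply: measurable_funM|]|].
 - by apply: (@measurableT_comp _ _ _ _ M _ w _ snd).
 - have i2 : meas (\1_(`[0%R, T]%classic) : M -> R) by mble.
  exact: (jmeas_snd i2).
 - exact: meas_leI.
 - have i1 : meas (\1_(`[0%R, +oo[%classic) : M -> R) by exact: measurable_indic.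
  exact: (jmeas_fst i1).
have f0 p : (0 <= f p)%E by rewrite mule_ge0// lee_fin !mulr_ge0.
have mG : meas (fun t : M => (\int[leb]_s f (s, t))%E).
 by apply: (measurable_fun_fubini_tonelli_G (m1 := leb) f).
have GE t : 0 <= t -> t <= T ->
  (\int[leb]_s f (s, t) = (w t)%:E * \int[leb]_(s in `[0%R, t]) v s)%E.
 move=> t0 tT; rewrite -ge0_integralZl//; last 2 first.
 - exact: measurable_funTS.
 - by nneg.
 rewrite [RHS]integral_mkcond; apply: eq_integral => s _.
 rewrite patchE /f/= /leI !indicE (mem_set (A := `[0%R, T]%classic)) ?mulr1/=; last by rewrite in_itv/= t0.
 case: ifPn => [/set_mem/=|/negP h].
  by rewrite in_itv/= => /andP[s0 st]; rewrite st mem_set/= ?in_itv/= ?s0// !mulr1.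
 have [s0|s0] := leP 0 s; last by rewrite memNset/= ?in_itv/= ?leNgt ?s0// mulr0 mul0e.
 have [st|ts] := leP s t; last by rewrite mulr0 mul0r mul0e.
 by exfalso; apply: h; rewrite inE/= in_itv/= s0.
have XY : (X <= Y + (1 / 2)%:E * X)%E.
 apply: (@le_trans _ _ (Y + K%:E * \int[leb]_(t in `[0%R, T]) \int[leb]_s f (s, t))%E).
  rewrite -ge0_integralZl//; last 3 first.
  - exact: measurable_funTS.
  - by move=> t _; exact: integral_ge0.
  - by nneg.
  rewrite -ge0_integralD//; last 4 first.
  - by nneg.
  - exact: mwE.
  - by move=> t _; rewrite mule_ge0 ?lee_fin ?(ltW K0)//; exact: integral_ge0.
  - by apply: measurable_funTS; apply: emeasurable_funM.
  apply: ge0_le_integral => //.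
  - by nneg.
  - exact: mwE.
  - by apply: emeasurable_funD; [exact: mwE|apply: measurable_funTS; apply: emeasurable_funM].
  move=> t; rewrite /= in_itv/= => /andP[t0 tT]; rewrite GE// muleCA -ge0_muleDr ?lee_fin//.
   by rewrite lee_wpmul2l ?lee_fin//; exact: va.
  by nneg.
 rewrite leeD2l//.
 apply: (@le_trans _ _ (K%:E * \int[leb]_t \int[leb]_s f (s, t))%E).
  rewrite lee_wpmul2l ?lee_fin ?(ltW K0)//; apply: ge0_subset_integral => //.
  by move=> t _; exact: integral_ge0.
 rewrite -(fubini_tonelli f mf f0).
 apply: (@le_trans _ _ (K%:E * (l^-1%:E * X))%E); last first.
  by rewrite muleA -EFinM /l invfM mulrCA mulfV ?gt_eqF// mulr1 mul1r.
 rewrite lee_wpmul2l ?lee_fin ?(ltW K0)// /X -ge0_integralZl//; last 3 first.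
 - exact: mwE.
 - by nneg.
 - by nneg.
 rewrite [leRHS]integral_mkcond; apply: ge0_le_integral => //.
 - by move=> s _; exact: integral_ge0.
 - exact: (measurable_fun_fubini_tonelli_F (m2 := leb) f).
 - apply/(measurable_restrictT (fun s => l^-1%:E * ((w s)%:E * v s))%E) => //.
  by apply: emeasurable_funM => //; exact: mwE.
 move=> s _; rewrite patchE /f /= /leI.
 case: ifPn => [/set_mem/=|/negP h].
  rewrite in_itv/= => /andP[s0 sT].
  apply: (@le_trans _ _ (\int[leb]_t (v s * (w t * \1_(`[s, T]%classic) t)%R%:E))%E).
   rewrite le_eqVlt; apply/orP; left; apply/eqP; apply: eq_integral => t _.
   rewrite muleC; congr (_ * _%:E)%E.
   rewrite (_ : \1_(`[0%R, +oo[%classic) s = 1); last by rewrite indicE mem_set//= in_itv/= s0.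
   rewrite mulr1 -mulrA; congr (_ * _); rewrite /leI !indicE !mem_setE !in_itv/=.
   have [st|_] := leP s t; last by rewrite mulr0.
   by rewrite (le_trans s0 st) mulr1.
  rewrite ge0_integralZl//; last 2 first.
  - by mble.
  - by nneg.
  rewrite muleA muleC lee_wpmul2r// -EFinM mulrC.
  apply: le_trans (integral_expRN_le l0 sT).
  rewrite [leRHS]integral_mkcond le_eqVlt; apply/orP; left; apply/eqP.
  by apply: eq_integral => t _; rewrite epatch_indic EFinM.
 rewrite integral0_eq// => t _.
 have [s0|s0] := leP 0 s; last by rewrite [X in _ * X](_ : _ = 0) ?mulr0 ?mul0e// indicE memNset//= in_itv/= leNgt s0.
 have [st|ts] := leP s t; last by rewrite mulr0 mul0r mul0e.
 rewrite [X in _ * X * _ * _](_ : _ = 0) ?mulr0 ?mul0r ?mul0e// indicE memNset//= in_itv/= => /andP[_ tT].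
 by apply: h; rewrite inE/= in_itv/= s0 (le_trans st tT).
have X2 : (X <= 2%:E * Y)%E.
 have : X \is a fin_num by rewrite ge0_fin_numE.
 move=> /fineK XE; move: XY; rewrite -XE -EFinM.
 have Y0 : (0 <= Y)%E by apply: integral_ge0 => t _; rewrite mule_ge0// lee_fin.
 case: Y Y0 => [y _|_ _|//]; last by rewrite gt0_muley ?leey// lte_fin.
 by rewrite -EFinM -EFinD !lee_fin; lra.
apply: (@le_trans _ _ ((expR (2 * K * T))%:E * X)%E).
 rewrite /X -ge0_integralZl//; last 2 first.
 - exact: mwE.
 - by nneg.
 apply: ge0_le_integral => //.
 - exact: measurable_funTS.
 - by apply: emeasurable_funM => //; exact: mwE.
 move=> t; rewrite /= in_itv/= => /andP[t0 tT]; rewrite muleA -EFinM -[leLHS]mul1e lee_wpmul2r//.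
 have h : 0 <= l * T + - l * (t : R) by rewrite mulNr -mulrBr mulr_ge0 ?subr_ge0// ltW.
 by rewrite lee_fin /w -expRD -[leLHS]expR0 ler_expR; exact: h.
rewrite (mulrC 2 (expR _)) EFinM -muleA lee_wpmul2l ?lee_fin ?expR_ge0//.
apply: le_trans X2 _; rewrite lee_wpmul2l ?lee_fin//.
apply: ge0_le_integral => //.
- by nneg.
- exact: mwE.
- exact: measurable_funTS.
move=> t; rewrite /= in_itv/= => /andP[t0 _].
by rewrite -[leRHS]mul1e lee_wpmul2r// lee_fin w1.
Qed.

Lemma gronwall_cst (K T A : R) (v : M -> \bar R) : 0 < K -> 0 <= T -> 0 <= A ->
 meas v -> (forall t, 0 <= v t)%E ->
 (forall t, 0 <= t -> t <= T -> (v t <= A%:E + K%:E * \int[leb]_(s in `[0%R, t]) v s)%E) ->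
 (\int[leb]_(t in `[0%R, T]) v t < +oo)%E ->
 forall t, 0 <= t -> t <= T -> (v t <= (A * (1 + 2 * K * T * expR (2 * K * T)))%:E)%E.
Proof.
move=> K0 T0 A0 mv v0 va voo t t0 tT.
have mst : meas (cst A%:E : M -> \bar R) by mble.
have := gronwall K0 T0 mv mst v0 (fun=> A0) va voo.
rewrite integral_cst//= [X in (_ * (_ * X))%E](_ : _ = T%:E); last first.
 rewrite lebesgue_measure_itv/= lte_fin; case: ltP => [_|h]; first by rewrite sube0.
 by congr EFin; lra.
move=> h; apply: le_trans (va t t0 tT) _.
rewrite mulrDr mulr1 EFinD leeD2l//.
apply: (@le_trans _ _ (K%:E * ((2 * expR (2 * K * T))%:E * (A%:E * T%:E)))%E).
 rewrite lee_wpmul2l ?lee_fin ?(ltW K0)//; apply: le_trans h.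
 apply: ge0_subset_integral => //; first exact: measurable_funTS.
 by move=> s /=; rewrite !in_itv/= => /andP[-> st]; exact: le_trans tT.
by rewrite -!EFinM lee_fin le_eqVlt; apply/orP; left; apply/eqP; ring.
Qed.

Lemma sqr_Rintegral_le (t : R) (f : M -> R) : 0 <= t -> meas f ->
 (((\int[leb]_(s in `[0%R, t]) f s)%R ^+ 2)%:E <=
  t%:E * \int[leb]_(s in `[0%R, t]) ((f s) ^+ 2)%:E)%E.
Proof.
move=> t0 mf.
have mfD (g : M -> R) : meas g -> measurable_fun `[0, t] (EFin \o g).
 by move=> mg; apply: measurable_funTS; exact: meas_EFin.
have mabs : meas (fun s => `|f s|) by exact: mcomp.
have [t00|tn0] := eqVneq t 0.
 by rewrite t00 set_itv1 Rintegral_set1 expr0n mul0e.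
have tp : 0 < t by rewrite lt_neqAle eq_sym tn0.
set Q := (\int[leb]_(s in `[0%R, t]) ((f s) ^+ 2)%:E)%E.
have Q0 : (0 <= Q)%E by apply: integral_ge0 => s _; rewrite lee_fin sqr_ge0.
have lebt : leb `[0%R, t]%classic = t%:E by rewrite lebesgue_measure_itv/= lte_fin tp sube0.
have absle (c : R) : 0 <= c -> ((2 * c)%:E * \int[leb]_(s in `[0%R, t]) `|f s|%:E <= (c ^+ 2 * t)%:E + Q)%E.
 move=> c0.
 have -> : ((c ^+ 2 * t)%:E = \int[leb]_(s in `[0%R, t]) (c ^+ 2)%:E)%E.
  by rewrite integral_cst//= lebt EFinM.
 rewrite -ge0_integralZl//; last 2 first.
 - exact: (mfD (fun s => `|f s|)).
 - by nneg.
 rewrite -ge0_integralD//; last 3 first.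
 - by nneg.
 - by nneg.
 - by apply: mfD; exact: measurable_funX.
 apply: ge0_le_integral => //.
 - by nneg.
 - by apply: emeasurable_funM => //; exact: mfD.
 - by apply: emeasurable_funD => //; apply: mfD; exact: measurable_funX.
 move=> s _; rewrite -EFinM -EFinD lee_fin.
 have := sqr_ge0 (c - `|f s|); rewrite sqrrB real_normK ?num_real//; lra.
move: Q0 absle; case: Q => [q q0|_ _|//]; last by rewrite gt0_muley ?leey// lte_fin.
move=> absle.
have intf : leb.-integrable `[0, t] (EFin \o f).
 apply/integrableP; split; first exact: mfD.
 have := absle 1 ler01; rewrite mulr1 expr1n mul1r.
 case: (\int[leb]_(s in `[0%R, t]) `|f s|%:E)%E => [r _| |_] //; first by rewrite ltry.
 by rewrite gt0_muley ?lte_fin.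
pose x := (\int[leb]_(s in `[0%R, t]) `|f s|)%R.
have xE : (\int[leb]_(s in `[0%R, t]) `|f s|%:E)%E = x%:E.
 rewrite /x /Rintegral fineK//; apply: integrable_fin_num => //.
 by have := integrable_abse intf.
have x0 : 0 <= x by apply: Rintegral_ge0.
have fx : `|(\int[leb]_(s in `[0%R, t]) f s)%R| <= x by exact: le_normr_Rintegral.
have := absle (x / t) (divr_ge0 x0 t0); rewrite xE -EFinM -EFinM -EFinD !lee_fin => h.
rewrite -(real_normK (num_real (\int[leb]_(s in `[0%R, t]) f s)%R)).
apply: (@le_trans _ _ (x ^+ 2)); first by rewrite lerXn2r ?nnegrE.
have -> : x ^+ 2 = t * (2 * (x / t) * x - (x / t) ^+ 2 * t) by field; rewrite gt_eqF.
rewrite ler_wpM2l//; lra.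
Qed.

End gronwall.

Section time_integrals.
Context {R : realType} {disp} {Omega : measurableType disp} (P : probability Omega R).
Local Notation leb := (@lebesgue_measure R).
Local Notation M := (measurableTypeR R).

Lemma nint_cst (c : R) : nint P (fun=> c) = c%:E.
Proof. by rewrite /nint integral_cst// [X in (_ * X)%E]probability_setT mule1. Qed.

Lemma leb_itv0 (t : R) : 0 <= t -> leb `[0%R, t]%classic = t%:E.
Proof.
move=> t0; rewrite lebesgue_measure_itv/= lte_fin; case: ltP => [_|h]; first by rewrite sube0.
by congr EFin; lra.
Qed.

Definition tint (t : R) (f : M -> R) : \bar R :=
 nint leb (fun s => f s * \1_(`[0%R, t]%classic) s).

Lemma tintE t (f : M -> R) : (\int[leb]_(s in `[0%R, t]) (f s)%:E)%E = tint t f.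
Proof.
rewrite /tint integral_mkcond; apply: eq_integral => s _.
by rewrite epatch_indic EFinM.
Qed.

Lemma nnm_tint t (f : M -> R) : nnm f -> nnm (fun s : M => f s * \1_(`[0%R, t]%classic) s).
Proof. by move=> nf; apply: nnmM => //; exact: nnm_indic. Qed.

Lemma tint_ge0 t (f : M -> R) : (forall s, 0 <= f s) -> (0 <= tint t f)%E.
Proof. by move=> f0; apply: nint_ge0 => s; rewrite mulr_ge0. Qed.

Lemma le_tint t (f g : M -> R) : nnm f -> nnm g ->
 (forall s : R, 0 <= s -> s <= t -> f s <= g s) -> (tint t f <= tint t g)%E.
Proof.
move=> nf ng fg; apply: le_nint; [exact: nnm_tint|exact: nnm_tint|move=> s].
rewrite indicE; have [/set_mem/=|] := boolP (_ \in _); last by rewrite !mulr0.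
by rewrite in_itv/= => /andP[s0 st]; rewrite !mulr1; exact: fg.
Qed.

Lemma le_tint_time s t (f : M -> R) : nnm f -> s <= t -> (tint s f <= tint t f)%E.
Proof.
move=> [mf f0] st; rewrite -!tintE; apply: ge0_subset_integral => //.
- by apply: measurable_funTS; exact: meas_EFin.
- by nneg.
- by move=> x /=; rewrite !in_itv/= => /andP[-> xs]; exact: le_trans st.
Qed.

Lemma tint_cst t c : 0 <= t -> tint t (fun=> c) = (c * t)%:E.
Proof.
by move=> t0; rewrite -tintE integral_cst//= [X in (_ * X)%E](leb_itv0 t0) EFinM.
Qed.

Lemma tint_le_cst t c (f : M -> R) : 0 <= t -> 0 <= c -> nnm f ->
 (forall s : R, 0 <= s -> s <= t -> f s <= c) -> (tint t f <= (c * t)%:E)%E.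
Proof. by move=> t0 c0 nf fc; rewrite -tint_cst//; apply: le_tint => //; exact: nnm_cst. Qed.

Lemma jmeas_integral_swap t (f : R -> Omega -> R) : jmeas f -> (forall s om, 0 <= f s om) ->
 (\int[P]_om tint t (f ^~ om) = \int[leb]_(s in `[0%R, t]) nint P (f s))%E.
Proof.
move=> mH H0; pose g (p : M * Omega) : \bar R := (f p.1 p.2 * \1_(`[0%R, t]%classic) p.1)%:E.
have mf : meas g.
 apply: meas_EFin; apply: measurable_funM => //.
 by apply: jmeas_fst; exact: measurable_indic.
have f0 p : (0 <= g p)%E by rewrite lee_fin mulr_ge0.
transitivity (\int[leb]_s \int[P]_om g (s, om))%E; first by rewrite (fubini_tonelli g mf f0).
rewrite [RHS]integral_mkcond; apply: eq_integral => s _; rewrite patchE /g/= indicE.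
case: (_ \in _) => /=; last by apply: integral0_eq => om _; rewrite mulr0.
by apply: eq_nint => om; rewrite mulr1.
Qed.

Lemma meas_tint t (f : R -> Omega -> R) : jmeas f -> (forall s om, 0 <= f s om) ->
 meas (fun om => tint t (f ^~ om)).
Proof.
move=> mf f0; apply: (measurable_fun_fubini_tonelli_G (m1 := leb)
 (fun p : M * Omega => (f p.1 p.2 * \1_(`[0%R, t]%classic) p.1)%:E)).
 apply: meas_EFin; apply: measurable_funM => //.
 by apply: jmeas_fst; exact: measurable_indic.
by nneg.
Qed.

Lemma meas_nint_time (f : R -> Omega -> R) : jmeas f -> (forall s om, 0 <= f s om) ->
 meas (fun s : M => nint P (f s)).
Proof.
move=> mf f0; apply: (measurable_fun_fubini_tonelli_F (m2 := P) (fun p : M * Omega => (f p.1 p.2)%:E)).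
 by mble.
by nneg.
Qed.

Lemma jmeas_meas (f : R -> Omega -> R) s : jmeas f -> meas (f s).
Proof.
move=> mf; apply: (@measurableT_comp _ _ _ _ (M * Omega)%type _ (fun p : M * Omega => f p.1 p.2) _
 (fun om => (s, om))) => //; exact: measurable_fun_pair.
Qed.

Lemma jmeas_Rintegral (f : R -> Omega -> R) : jmeas f ->
 jmeas (fun t om => (\int[leb]_(s in `[0%R, t]) f s om)%R).
Proof.
move=> mf; pose g (q : (M * Omega) * M) : \bar R :=
 (f q.2 q.1.2 * (leI 0 q.2 * leI q.2 q.1.1))%:E.
have mg : meas g.
 apply: meas_EFin; apply: measurable_funM.
  apply: (mcomp (f := fun p : M * Omega => f p.1 p.2) (g := fun q : (M * Omega) * M => (q.2, q.1.2))) => //.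
  apply: measurable_fun_pair => //; apply: mcomp => //.
 apply: measurable_funM.
  apply: (mcomp (f := fun p : M * M => leI p.1 p.2) (g := fun q : (M * Omega) * M => (0, q.2))); first exact: meas_leI.
  exact: measurable_fun_pair.
 apply: (mcomp (f := fun p : M * M => leI p.1 p.2) (g := fun q : (M * Omega) * M => (q.2, q.1.1))); first exact: meas_leI.
 by apply: measurable_fun_pair => //; apply: mcomp.
rewrite /jmeas (_ : (fun p : M * Omega => _) =
  (fun p => fine (\int[leb]_s g^\+ (p, s) - \int[leb]_s g^\- (p, s))%E)); last first.
 apply/funext => p; rewrite /Rintegral integral_mkcond; congr fine.
 transitivity (\int[leb]_s g (p, s))%E.
  apply: eq_integral => s _; rewrite patchE /g /leI/=; case: ifPn => [/set_mem/=|/negP h].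
   by rewrite in_itv/= => /andP[-> ->]; rewrite !mulr1.
  rewrite -natrM mulnb; have [hh|_] := boolP (_ && _); last by rewrite mulr0.
  by case: h; rewrite inE/= in_itv.
 by rewrite integralE; congr (_ - _)%E; apply: eq_integral => s _; rewrite ?funeposE ?funenegE.
apply: (mcomp (f := fine)); first exact: fine_measurable.
apply: emeasurable_funB.
- apply: measurable_fun_fubini_tonelli_F; [exact: measurable_funepos|by move=> q; rewrite funepos_ge0].
- apply: measurable_fun_fubini_tonelli_F; [exact: measurable_funeneg|by move=> q; rewrite funeneg_ge0].
Qed.

Definition jmeasV {d} (X : R -> Omega -> 'rV[R]_d) : Prop :=
 meas (fun p : M * Omega => X p.1 p.2).

Lemma jmeasV_coord {d} (X : R -> Omega -> 'rV[R]_d) i : jmeasV X -> jmeas (fun s om => X s om 0 i).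
Proof. by mble. Qed.

Lemma jmeasV_comp {d d'} (T : measurableType d') (f : 'rV[R]_d -> T) (X : R -> Omega -> 'rV[R]_d) :
 meas f -> jmeasV X -> meas (fun p : M * Omega => f (X p.1 p.2)).
Proof. by move=> mf mX; exact: mcomp. Qed.

Lemma jmeasV_nsqB {d} (X Y : R -> Omega -> 'rV[R]_d) : jmeasV X -> jmeasV Y ->
 jmeas (fun s om => nsq (X s om - Y s om)).
Proof. by mble. Qed.

Lemma jmeas_nnm (f : R -> Omega -> R) om : jmeas f -> (forall s om, 0 <= f s om) ->
 nnm (f ^~ om : M -> R).
Proof. by move=> mf f0; split => //; exact: jmeas_section. Qed.

Lemma jmeasV_continuous {d} (X : R -> Omega -> 'rV[R]_d) :
 (forall s, meas (X s)) -> (forall om, continuous (X ^~ om)) -> jmeasV X.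
Proof.
move=> mX cX; apply: meas_rVP => i.
pose r (n : nat) (s : R) : R := (Num.floor (n.+1%:R * s))%:~R / n.+1%:R.
have rE n s : `|r n s - s| <= n.+1%:R^-1.
 rewrite /r; set y := n.+1%:R * _.
 have -> : s = y / n.+1%:R by rewrite /y [_ * s]mulrC mulfK.
 rewrite -mulrBl normrM [X in _ * X]ger0_norm ?invr_ge0//.
 rewrite ler_piMl ?invr_ge0// distrC ger0_norm ?subr_ge0 ?floor_le//.
 by have := floorD1_gt y; rewrite -[(_ + 1)]/(_ + 1) intrD; lra.
apply: (@measurable_fun_cvg _ _ _ _ (fun n p => X (r n p.1) p.2 0 i)).
 move=> n _ B mB; rewrite setTI.
 have -> : (fun p : M * Omega => X (r n p.1) p.2 0 i) @^-1` B =
   \bigcup_(z : int) ([set s : R | Num.floor (n.+1%:R * s) = z] `*`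
    ((fun om => X (z%:~R / n.+1%:R) om 0 i) @^-1` B)).
  apply/seteqP; split=> [[s om] h|[s om] [z _ [/= hz]]].
   by exists (Num.floor (n.+1%:R * s)).
  by rewrite /preimage/= /r hz.
 apply: countable_bigcupT_measurable => [|z]; first exact: countableP.
 apply: measurableX; last first.
  by rewrite -[X in measurable X]setTI; apply: (meas_coordf i (mX _)).
 rewrite (_ : [set _ | _] = `[ z%:~R / n.+1%:R, (z + 1)%:~R / n.+1%:R [%classic).
  exact: measurable_itv.
 apply/seteqP; split=> t /=; rewrite in_itv/= ler_pdivrMr// ltr_pdivlMr// mulrC.
  by move=> <-; rewrite floor_le floorD1_gt.
 by move=> h; apply/floor_def; exact: h.
move=> [s om] _ /=.
have rc : r n s @[n --> \oo] --> s.
 apply/cvgrPdist_le => e e0; near=> n.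
 rewrite distrC (le_trans (rE n s))//.
 near: n; move/cvgrPdist_le: (@cvg_harmonic R) => /(_ _ e0).
 by apply: filterS => n; rewrite sub0r normrN ger0_norm// invr_ge0.
apply: (@continuous_cvg _ _ _ _ _ _ (fun x : 'rV[R]_d => x 0 i)); first exact: coord_continuous.
by apply: (@continuous_cvg _ _ _ _ _ _ (X ^~ om)) => //; exact: cX.
Unshelve. all: by end_near. Qed.

End time_integrals.

Lemma sume_const {R : realType} n (x : \bar R) : (0 <= x -> \sum_(i < n) x = n%:R%:E * x)%E.
Proof.
move=> x0; elim: n => [|n IH]; first by rewrite big_ord0 mul0e.
by rewrite big_ord_recr/= IH -natr1 EFinD ge0_muleDl// mul1e.
Qed.

Section linear_combinations.
Context {R : realType} {disp} {T : measurableType disp} (m : {measure set T -> \bar R}).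
Implicit Types f g h : T -> \bar R.

Lemma ge0_integral_lin2 (a b : R) f g : 0 <= a -> 0 <= b ->
 (forall x, 0 <= f x)%E -> (forall x, 0 <= g x)%E ->
 meas f -> meas g ->
 (\int[m]_x (a%:E * f x + b%:E * g x) = a%:E * \int[m]_x f x + b%:E * \int[m]_x g x)%E.
Proof.
move=> a0 b0 f0 g0 mf mg; rewrite ge0_integralD//; last 4 first.
- by nneg.
- by mble.
- by nneg.
- by mble.
by rewrite !ge0_integralZl.
Qed.

Lemma ge0_integral_lin3 (a b c : R) f g h : 0 <= a -> 0 <= b -> 0 <= c ->
 (forall x, 0 <= f x)%E -> (forall x, 0 <= g x)%E -> (forall x, 0 <= h x)%E ->
 meas f -> meas g -> meas h ->
 (\int[m]_x (a%:E * f x + b%:E * g x + c%:E * h x) =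
  a%:E * \int[m]_x f x + b%:E * \int[m]_x g x + c%:E * \int[m]_x h x)%E.
Proof.
move=> a0 b0 c0 f0 g0 h0 mf mg mh; rewrite ge0_integralD//; last 4 first.
- by move=> x _; rewrite adde_ge0// mule_ge0.
- by mble.
- by nneg.
- by mble.
by rewrite ge0_integral_lin2// ge0_integralZl.
Qed.

End linear_combinations.

Section stability.
Context {R : realType} {d : nat} {disp} {Omega : measurableType disp} (P : probability Omega R) (F : R -> set (set Omega))
 (hF : is_filtration P F) (W : R -> Omega -> 'rV[R]_d) (hW : is_brownian_motion P F W) (b : 'rV[R]_d -> 'rV[R]_d)
 (sigma : 'rV[R]_d -> R) (L C : R).
Local Notation leb := (@lebesgue_measure R).
Local Notation M := (measurableTypeR R).

Definition lip_coefs : Prop :=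
 [/\ 0 < L, 0 <= C, forall x y, nsq (b x - b y) <= L * nsq (x - y),
   forall x y, (sigma x - sigma y) ^+ 2 <= L * nsq (x - y) & forall x, `|sigma x| <= C].
Context (hbs : lip_coefs).

Lemma continuous_of_nsq (f : 'rV[R]_d -> R) :
 (forall x y, (f x - f y) ^+ 2 <= L * nsq (x - y)) -> continuous f.
Proof.
have [L0 _ _ _ _] := hbs; move=> fL x; apply/(@cvgrPdist_le _ _ _ (nbhs x)) => e e0.
pose c := L * d%:R + 1; have c0 : 0 < c by rewrite ltr_wpDl// mulr_ge0// ltW.
apply/(@nbhs_ballP R 'rV[R]_d x); exists (e / c) => /=; first exact: divr_gt0.
move=> y; rewrite -ball_normE/= => /ltW xy; rewrite -ler_sqr ?nnegrE ?(ltW e0)// real_normK ?num_real//.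
apply: le_trans (fL x y) _; apply: (@le_trans _ _ (L * (d%:R * `|x - y| ^+ 2))).
 by rewrite ler_pM2l// nsq_le_norm.
rewrite mulrA; apply: (@le_trans _ _ (c * `|x - y| ^+ 2)); first by rewrite ler_wpM2r ?sqr_ge0// /c lerDl.
apply: (@le_trans _ _ (c * (e / c) ^+ 2)).
 by rewrite ler_pM2l// lerXn2r ?nnegrE// divr_ge0// ltW.
have -> : c * (e / c) ^+ 2 = e ^+ 2 / c by field; rewrite gt_eqF.
by rewrite ler_pdivrMr// ler_peMr ?sqr_ge0// /c lerDr mulr_ge0// ltW.
Qed.

Lemma continuous_sigma : continuous sigma.
Proof. by apply: continuous_of_nsq; case: hbs. Qed.

Lemma continuous_b i : continuous (fun x => b x 0 i).
Proof.
apply: continuous_of_nsq => x y; have [_ _ h _ _] := hbs; apply: le_trans (h x y).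
by have := sqr_coord_le (b x - b y) i; rewrite !mxE.
Qed.

Lemma meas_b : meas b.
Proof. by apply: meas_rVP => i; apply: meas_continuous; exact: continuous_b. Qed.

Lemma meas_sigma : meas sigma.
Proof. by apply: meas_continuous; exact: continuous_sigma. Qed.

Definition bcst : R := 2 * L + 2 * nsq (b 0).

Lemma bcst_ge0 : 0 <= bcst.
Proof. by have [/ltW L0 _ _ _ _] := hbs; rewrite addr_ge0 ?mulr_ge0// nsq_ge0. Qed.

Lemma nsq_b_le x : nsq (b x) <= bcst * (1 + nsq x).
Proof.
have [/ltW L0 _ h _ _] := hbs.
have := nsqD (b x - b 0) (b 0); rewrite subrK => h1; apply: le_trans h1 _.
have := h x 0; rewrite subr0 => h2; have := nsq_ge0 x; have := nsq_ge0 (b 0); rewrite /bcst; nra.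
Qed.

Lemma nnm_nsqB_path (X Y : R -> Omega -> 'rV[R]_d) om : jmeasV X -> jmeasV Y ->
 nnm (fun s : M => nsq (X s om - Y s om)).
Proof.
move=> mX mY; split=> [|s]; last exact: nsq_ge0.
by apply: (@jmeas_section _ _ _ (fun s om => nsq (X s om - Y s om))); exact: jmeasV_nsqB.
Qed.

Definition bounded_upto (T : R) (Y : R -> Omega -> 'rV[R]_d) : Prop :=
 forall om, exists B, forall s, 0 <= s -> s <= T -> nsq (Y s om) <= B.

Definition ito_part (x : 'rV[R]_d) (Z Y : R -> Omega -> 'rV[R]_d) t (i : 'I_d) om : R :=
 Y t om 0 i - x 0 i - \int[leb]_(s in `[0, t]) b (Z s om) 0 i.

Definition approx_sol (T : R) x (Z Y : R -> Omega -> 'rV[R]_d) : Prop :=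
 [/\ jmeasV Y, jmeasV Z, bounded_upto T Y, bounded_upto T Z &
  forall t, 0 <= t -> t <= T -> forall i,
   is_ito_integral P F (fun s w => W s w 0 i) (fun s w => sigma (Z s w)) t (ito_part x Z Y t i)].

Lemma integrable_b T Z t i om : t <= T -> jmeasV Z -> bounded_upto T Z ->
 leb.-integrable `[0, t] (EFin \o (fun s : M => b (Z s om) 0 i)).
Proof.
move=> tT mZ bZ; have [B hB] := bZ om; apply: measurable_bounded_integrable => //.
- by rewrite [X in (X < _)%E]lebesgue_measure_itv/= lte_fin; case: ifP => _; rewrite ?sube0 ltry.
- apply: measurable_funTS; apply: (@jmeas_section _ _ _ (fun s om => b (Z s om) 0 i)).
 exact: (jmeasV_comp (meas_coordf i meas_b) mZ).
exists (1 + bcst * (1 + B)); split; first exact: num_real.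
move=> c hc s /=; rewrite in_itv/= => /andP[s0 st]; apply/ltW/(le_lt_trans _ hc).
have h1 := le_trans (sqr_coord_le (b (Z s om)) i) (nsq_b_le (Z s om)).
have hs := hB s s0 (le_trans st tT); have := bcst_ge0.
rewrite -(real_normK (num_real (b (Z s om) 0 i))) in h1.
by have := sqr_ge0 (`|b (Z s om) 0 i| - 1); rewrite sqrrB1; nra.
Qed.

Section two_solutions.
Context (T : R) (x1 x2 : 'rV[R]_d) (Z1 Y1 Z2 Y2 : R -> Omega -> 'rV[R]_d) (T0 : 0 <= T) (h1 : approx_sol T x1 Z1 Y1)
 (h2 : approx_sol T x2 Z2 Y2).

Let N t om : 'rV[R]_d := \row_i (ito_part x1 Z1 Y1 t i om - ito_part x2 Z2 Y2 t i om).

Lemma drift_diff_le t om : 0 <= t -> t <= T ->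
 ((nsq (Y1 t om - Y2 t om))%:E <= (3 * nsq (x1 - x2) + 3 * nsq (N t om))%:E
   + (3 * T * L)%:E * tint t (fun s => nsq (Z1 s om - Z2 s om)))%E.
Proof.
move=> t0 tT; have [mY1 mZ1 bY1 bZ1 _] := h1; have [mY2 mZ2 bY2 bZ2 _] := h2.
have [/ltW L0 _ bL _ _] := hbs.
pose J : 'rV[R]_d := \row_i (\int[leb]_(s in `[0, t]) (b (Z1 s om) 0 i - b (Z2 s om) 0 i)).
have -> : Y1 t om - Y2 t om = (x1 - x2) + N t om + J.
 apply/rowP => i; rewrite !mxE RintegralB//; last 2 first.
 - exact: (integrable_b i om tT).
 - exact: (integrable_b i om tT).
 by rewrite /ito_part; ring.
have mbZ Z i : jmeasV Z -> meas (fun s : M => b (Z s om) 0 i).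
 move=> mZ; apply: (@jmeas_section _ _ _ (fun s om => b (Z s om) 0 i)).
 exact: (jmeasV_comp (meas_coordf i meas_b) mZ).
have hJ : ((nsq J)%:E <= (T * L)%:E * tint t (fun s => nsq (Z1 s om - Z2 s om)))%E.
 apply: (@le_trans _ _ (\sum_i (t%:E * tint t (fun s => (b (Z1 s om) 0 i - b (Z2 s om) 0 i) ^+ 2)%R)))%E.
  rewrite /nsq -sumEFin; apply: lee_sum => i _; rewrite mxE -tintE.
  by apply: sqr_Rintegral_le => //; apply: measurable_funB; exact: mbZ.
 rewrite -ge0_sume_distrr => [|i _]; last by apply: tint_ge0 => s; rewrite sqr_ge0.
 rewrite /tint -nint_sum => [|i]; last by apply: nnm_tint; apply: nnm_sqr; apply: measurable_funB; exact: mbZ.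
 rewrite EFinM -muleA; apply: lee_pmul => //.
  by apply: nint_ge0 => s; apply: sumr_ge0 => i _; rewrite mulr_ge0// sqr_ge0.
 rewrite -nintZ//; last first.
  by apply: nnm_tint; exact: nnm_nsqB_path.
 apply: le_nint.
 - by apply: nnm_sum => i; apply: nnm_tint; apply: nnm_sqr; apply: measurable_funB; exact: mbZ.
 - by apply: nnmZ => //; apply: nnm_tint; exact: nnm_nsqB_path.
 move=> s; rewrite -mulr_suml mulrA ler_wpM2r//; apply: le_trans (bL _ _).
 by apply: ler_sum => i _; rewrite !mxE.
apply: (@le_trans _ _ (3 * nsq (x1 - x2) + 3 * nsq (N t om) + 3 * nsq J)%:E).
 by rewrite lee_fin nsqD3.
rewrite [in leLHS]EFinD leeD2l// EFinM -[3 * T * L]mulrA [(3 * _)%:E]EFinM -muleA.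
by apply: lee_wpmul2l.
Qed.

Lemma jmeas_ito_part x Z Y i : approx_sol T x Z Y -> jmeas (fun t om => ito_part x Z Y t i om).
Proof.
move=> [mY mZ _ _ _]; apply: jmeasB.
 by apply: jmeasB; [exact: jmeasV_coord|exact: jmeas_snd].
by apply: (@jmeas_Rintegral _ _ _ (fun s om => b (Z s om) 0 i)); exact: (jmeasV_comp (meas_coordf i meas_b) mZ).
Qed.

Let mN : jmeas (fun t om => nsq (N t om)).
Proof.
apply: measurable_sum => i; under eq_fun do rewrite mxE; apply: measurable_funX.
by apply: measurable_funB; [exact: (jmeas_ito_part i h1)|exact: (jmeas_ito_part i h2)].
Qed.

Let jsig (Z : R -> Omega -> 'rV[R]_d) : jmeasV Z -> jmeas (fun s om => sigma (Z s om)).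
Proof. by move=> mZ; exact: (jmeasV_comp meas_sigma mZ). Qed.

Lemma ito_diff_le t : 0 <= t -> t <= T ->
 (nint P (fun om => nsq (N t om)) <=
  \sum_(i < d) 9%:E * \int[P]_om l2time t (psub (fun s om => sigma (Z1 s om)) (fun s om => sigma (Z2 s om))) om)%E.
Proof.
move=> t0 tT; have [mY1 mZ1 bY1 bZ1 I1] := h1; have [mY2 mZ2 bY2 bZ2 I2] := h2.
have [_ C0 _ _ sC] := hbs.
rewrite /nsq nint_sum => [|i]; last first.
 under eq_fun do rewrite mxE; apply: nnm_sqr; apply: measurable_funB.
  exact: (jmeas_meas t (jmeas_ito_part i h1)).
 exact: (jmeas_meas t (jmeas_ito_part i h2)).
apply: lee_sum => i _; under eq_nint do rewrite mxE.
apply: (ito_isometry_le hF hW t0 C0) => //; try exact: jsig.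
- exact: (jmeas_meas t (jmeas_ito_part i h1)).
- exact: (jmeas_meas t (jmeas_ito_part i h2)).
- exact: I1.
- exact: I2.
Qed.

Context (eta : R) (eta0 : 0 <= eta)
 (e1 : forall t, 0 <= t -> t <= T -> (nint P (fun om => nsq (Y1 t om - Z1 t om)) <= eta%:E)%E)
 (e2 : forall t, 0 <= t -> t <= T -> (nint P (fun om => nsq (Y2 t om - Z2 t om)) <= eta%:E)%E).

Let v t om := nsq (Y1 t om - Y2 t om).

Let zle t om : 0 <= t -> (tint t (fun s => nsq (Z1 s om - Z2 s om)) <=
 3%:E * tint t (v ^~ om) + 3%:E * tint t (fun s => nsq (Y1 s om - Z1 s om))
 + 3%:E * tint t (fun s => nsq (Y2 s om - Z2 s om)))%E.
Proof.
have [mY1 mZ1 _ _ _] := h1; have [mY2 mZ2 _ _ _] := h2.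
move=> t0; apply: nint_le_lin3E; try by [|apply: nnm_tint; exact: nnm_nsqB_path].
move=> s; rewrite !mulrA -!mulrDl ler_wpM2r// [in leLHS](_ : _ - _ =
 (Y1 s om - Y2 s om) + (Z1 s om - Y1 s om) + (Y2 s om - Z2 s om)); last by apply/rowP => i; rewrite !mxE; ring.
by apply: le_trans (nsqD3 _ _ _) _; rewrite (nsqC (Z1 s om)).
Qed.

Let mv : jmeas v. Proof. by have [? ? _ _ _] := h1; have [? ? _ _ _] := h2; exact: jmeasV_nsqB. Qed.

Let v0 s om : 0 <= v s om. Proof. exact: nsq_ge0. Qed.

Let nvpath om : nnm (v ^~ om : M -> R). Proof. exact: jmeas_nnm. Qed.

Let V (t : M) : \bar R := nint P (v t).

Let mV : meas V. Proof. exact: meas_nint_time. Qed.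

Let V0 t : (0 <= V t)%E. Proof. exact: nint_ge0. Qed.

Let ezle t (Y Z : R -> Omega -> 'rV[R]_d) : jmeasV Y -> jmeasV Z ->
 (forall t, 0 <= t -> t <= T -> (nint P (fun om => nsq (Y t om - Z t om)) <= eta%:E)%E) ->
 0 <= t -> t <= T -> (\int[P]_om tint t (fun s => nsq (Y s om - Z s om)) <= (eta * T)%:E)%E.
Proof.
move=> mY mZ e t0 tT; rewrite (jmeas_integral_swap P t (jmeasV_nsqB mY mZ)); last by nneg.
apply: (@le_trans _ _ (\int[leb]_(s in `[0%R, t]) eta%:E)%E).
 apply: ge0_le_integral => //.
 - by move=> s _; apply: nint_ge0 => om; exact: nsq_ge0.
 - apply: measurable_funTS; apply: (@meas_nint_time _ _ _ P (fun s om => nsq (Y s om - Z s om))).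
   exact: jmeasV_nsqB.
  by nneg.
 - by move=> s; rewrite /= in_itv/= => /andP[s0 st]; apply: e => //; exact: le_trans tT.
by rewrite (tintE t (fun=> eta)) tint_cst// lee_fin ler_wpM2l.
Qed.

Let mpath (Y Z : R -> Omega -> 'rV[R]_d) t : jmeasV Y -> jmeasV Z ->
 meas (fun om => tint t (fun s => nsq (Y s om - Z s om))).
Proof.
move=> mY mZ; apply: (@meas_tint _ _ _ t (fun s om => nsq (Y s om - Z s om))).
 exact: jmeasV_nsqB.
by nneg.
Qed.

Let Ez t : 0 <= t -> t <= T ->
 (\int[P]_om tint t (fun s => nsq (Z1 s om - Z2 s om)) <=
  (6 * eta * T)%:E + 3%:E * \int[leb]_(s in `[0%R, t]) V s)%E.
Proof.
have [mY1 mZ1 _ _ _] := h1; have [mY2 mZ2 _ _ _] := h2; move=> t0 tT.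
have tp (X Y : R -> Omega -> 'rV[R]_d) om : (0 <= tint t (fun s => nsq (X s om - Y s om)%R))%E.
 by apply: tint_ge0 => s; exact: nsq_ge0.
apply: (@le_trans _ _ (\int[P]_om (3%:E * tint t (v ^~ om) + 3%:E * tint t (fun s => nsq (Y1 s om - Z1 s om)%R)
 + 3%:E * tint t (fun s => nsq (Y2 s om - Z2 s om)%R)))%E).
 apply: ge0_le_integral => //.
 - exact: mpath.
 - by do 2 ?[apply: emeasurable_funD]; apply: emeasurable_funM => //; exact: mpath.
 - by move=> om _; exact: zle.
rewrite (@ge0_integral_lin3 _ _ _ _ _ _ _ (fun om => tint t (v ^~ om))
 (fun om => tint t (fun s => nsq (Y1 s om - Z1 s om)%R))
 (fun om => tint t (fun s => nsq (Y2 s om - Z2 s om)%R)))//; try exact: mpath; try by move=> om; apply: tint_ge0.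
rewrite (jmeas_integral_swap P t mv)//.
rewrite (_ : 6 * eta * T = 3 * (eta * T) + 3 * (eta * T)); last by ring.
have -> : ((3 * (eta * T) + 3 * (eta * T))%:E = 3%:E * (eta * T)%:E + 3%:E * (eta * T)%:E)%E by [].
rewrite -addeA [leRHS]addeC leeD2l//.
by rewrite leeD// lee_wpmul2l ?lee_fin//; exact: ezle.
Qed.

Let l2tz t om : (l2time t (psub (fun s om => sigma (Z1 s om)) (fun s om => sigma (Z2 s om))) om <=
 L%:E * tint t (fun s => nsq (Z1 s om - Z2 s om)))%E.
Proof.
have [mY1 mZ1 _ _ _] := h1; have [mY2 mZ2 _ _ _] := h2; have [/ltW L0 _ _ sL _] := hbs.
rewrite -nintZ//; last by apply: nnm_tint; exact: nnm_nsqB_path.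
apply: le_nint.
- apply: nnm_sqtime; apply: (@jmeas_section _ _ _ (psub (fun s om => sigma (Z1 s om)) (fun s om => sigma (Z2 s om)))).
 by apply: jmeasB; exact: jsig.
- by apply: nnmZ => //; apply: nnm_tint; exact: nnm_nsqB_path.
by move=> s; rewrite /sqtime /psub mulrA ler_wpM2r.
Qed.

Let EN t : 0 <= t -> t <= T -> (nint P (fun om => nsq (N t om)) <=
 (9 * d%:R * L)%:E * \int[P]_om tint t (fun s => nsq (Z1 s om - Z2 s om)))%E.
Proof.
have [mY1 mZ1 _ _ _] := h1; have [mY2 mZ2 _ _ _] := h2; have [/ltW L0 _ _ sL _] := hbs.
move=> t0 tT; apply: le_trans (ito_diff_le t0 tT) _.
rewrite sume_const; last by rewrite mule_ge0// integral_ge0// => om _; exact: l2time_ge0.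
rewrite [9 * d%:R]mulrC !EFinM -2!muleA lee_wpmul2l ?lee_fin//.
rewrite lee_wpmul2l ?lee_fin// -ge0_integralZl//; last 2 first.
- exact: mpath.
- by move=> om _; apply: tint_ge0 => s; exact: nsq_ge0.
apply: ge0_le_integral => //.
- by move=> om _; exact: l2time_ge0.
- by apply: meas_l2time; apply: jmeasB; exact: jsig.
- by apply: emeasurable_funM => //; exact: mpath.
Qed.

Let nN t : nnm (fun om => nsq (N t om)).
Proof. by split=> [|om]; [exact: (jmeas_meas t mN)|exact: nsq_ge0]. Qed.

Let EN_bound t : 0 <= t -> t <= T ->
 (nint P (fun om => nsq (N t om)) <= (d%:R * (9 * ((C + C) ^+ 2 * T)))%:E)%E.
Proof.
have [mY1 mZ1 _ _ _] := h1; have [mY2 mZ2 _ _ _] := h2; have [_ C0 _ _ sC] := hbs.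
move=> t0 tT; apply: le_trans (ito_diff_le t0 tT) _.
rewrite sume_const; last by rewrite mule_ge0// integral_ge0// => om _; exact: l2time_ge0.
rewrite EFinM lee_wpmul2l//.
rewrite EFinM lee_wpmul2l// -[leRHS]mule1 -(@probability_setT _ _ _ P) -integral_cst//.
have mp : meas (fun om => l2time t (psub (fun s om => sigma (Z1 s om)) (fun s om => sigma (Z2 s om))) om).
 by apply: meas_l2time; apply: jmeasB; exact: jsig.
apply: ge0_le_integral => //; first by move=> om _; exact: l2time_ge0.
move=> om _; apply: (@le_trans _ _ ((C + C) ^+ 2 * t)%:E).
 apply: l2time_le => //.
  apply: (@jmeas_section _ _ _ (psub (fun s om => sigma (Z1 s om)) (fun s om => sigma (Z2 s om)))).
  by apply: jmeasB; exact: jsig.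
 by move=> s _ _; apply: le_trans (ler_normB _ _) _; exact: lerD.
by rewrite lee_fin ler_wpM2l// sqr_ge0.
Qed.

Let nxn t : nnm (fun om => 3 * nsq (x1 - x2) + 3 * nsq (N t om)).
Proof.
apply: nnmD; first by apply: nnm_cst; rewrite mulr_ge0// nsq_ge0.
by apply: nnmZ => //; exact: nN.
Qed.

Let jxn : jmeas (fun t om => 3 * nsq (x1 - x2) + 3 * nsq (N t om)).
Proof. by mble. Qed.

Let ee om : \bar R := (tint T (fun s => nsq (Y1 s om - Z1 s om)%R) + tint T (fun s => nsq (Y2 s om - Z2 s om)%R))%E.

Let ee0 om : (0 <= ee om)%E.
Proof. by rewrite adde_ge0// tint_ge0// => s; exact: nsq_ge0. Qed.

Let mee : meas ee.
Proof. by have [? ? _ _ _] := h1; have [? ? _ _ _] := h2; apply: emeasurable_funD; exact: mpath. Qed.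

Let kap : R := 9 * T * L + 1.

Let kap0 : 0 < kap.
Proof. by have [/ltW L0 _ _ _ _] := hbs; rewrite ltr_wpDl// !mulr_ge0. Qed.

Let v_path t om : 0 <= t -> t <= T ->
 ((v t om)%:E <= ((3 * nsq (x1 - x2) + 3 * nsq (N t om))%:E + kap%:E * ee om) + kap%:E * tint t (v ^~ om))%E.
Proof.
have [mY1 mZ1 _ _ _] := h1; have [mY2 mZ2 _ _ _] := h2; have [/ltW L0 _ _ sL _] := hbs.
move=> t0 tT; apply: le_trans (drift_diff_le om t0 tT) _; rewrite -addeA leeD2l//.
apply: (@le_trans _ _ ((3 * T * L)%:E * (3%:E * ee om + 3%:E * tint t (v ^~ om)))%E).
 rewrite lee_wpmul2l ?lee_fin ?mulr_ge0//; apply: le_trans (zle om t0) _.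
 rewrite [leRHS]addeC -[leLHS]addeA leeD2l//.
 have -> : (3%:E * ee om = 3%:E * tint T (fun s => nsq (Y1 s om - Z1 s om)%R) + 3%:E * tint T (fun s => nsq (Y2 s om - Z2 s om)%R))%E.
  by rewrite [LHS]ge0_muleDr//; apply: tint_ge0 => s; exact: nsq_ge0.
 by rewrite leeD// lee_wpmul2l ?lee_fin//; apply: le_tint_time => //; exact: nnm_nsqB_path.
have tv0 : (0 <= tint t (v ^~ om))%E by exact: tint_ge0.
move: (ee om) (tint t _) (ee0 om) tv0 => p q p0 q0.
rewrite -!ge0_muleDr// muleA lee_wpmul2r ?adde_ge0// -EFinM lee_fin /kap; lra.
Qed.

Let V_finite : (\int[leb]_(s in `[0%R, T]) V s < +oo)%E.
Proof.
have [mY1 mZ1 bY1 _ _] := h1; have [mY2 mZ2 bY2 _ _] := h2.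
rewrite -(jmeas_integral_swap P T mv)//.
pose A : R := 3 * nsq (x1 - x2) + 3 * (d%:R * (9 * ((C + C) ^+ 2 * T))).
have A0 : 0 <= A.
 apply: addr_ge0; first by nneg.
 by nneg.
pose G := 2 * expR (2 * kap * T).
have G0 : 0 <= G by rewrite mulr_ge0// expR_ge0.
have nt om : nnm (fun t : M => 3 * nsq (x1 - x2) + 3 * nsq (N t om)).
 split=> [|t]; last by case: (nxn t).
 exact: (@jmeas_section _ _ _ (fun t om => 3 * nsq (x1 - x2) + 3 * nsq (N t om)) om jxn).
have G1 om : (tint T (v ^~ om) <= G%:E * (tint T (fun t => (3 * nsq (x1 - x2) + 3 * nsq (N t om))%R)
  + (kap * T)%:E * ee om))%E.
 rewrite -!tintE.
 have := @gronwall R kap T (fun t => (v t om)%:E)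
  (fun t => (3 * nsq (x1 - x2) + 3 * nsq (N t om))%:E + kap%:E * ee om)%E kap0 T0.
 have c0 : (0 <= kap%:E * ee om)%E by nneg.
 have -> : (\int[leb]_(t in `[0%R, T]) ((3 * nsq (x1 - x2) + 3 * nsq (N t om))%:E + kap%:E * ee om) =
   \int[leb]_(s in `[0%R, T]) (3 * nsq (x1 - x2) + 3 * nsq (N s om))%:E + (kap * T)%:E * ee om)%E.
  rewrite ge0_integralD//.
  - congr (_ + _)%E; by rewrite integral_cst// [X in (_ * X)%E](leb_itv0 T0) EFinM muleAC.
  - by nneg.
  - by apply: measurable_funTS; apply: meas_EFin; case: (nt om).
 apply.
 - by apply: meas_EFin; case: (nvpath om).
 - by apply: emeasurable_funD => //; apply: meas_EFin; case: (nt om).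
 - by nneg.
 - by move=> t; rewrite adde_ge0// lee_fin; case: (nt om).
 - by move=> t t0 tT; rewrite (tintE t (v ^~ om)); exact: v_path.
 rewrite (tintE T (v ^~ om)); have [B1 hB1] := bY1 om; have [B2 hB2] := bY2 om.
 apply: le_lt_trans (tint_le_cst (c := 2 * `|B1| + 2 * `|B2|) T0 _ (nvpath om) _) (ltry _).
  by nneg.
 move=> s s0 sT; apply: le_trans (nsqB _ _) _; rewrite lerD// ler_pM2l//.
  exact: le_trans (hB1 s s0 sT) (ler_norm _).
 exact: le_trans (hB2 s s0 sT) (ler_norm _).
have mt : meas (fun om => tint T (fun t => 3 * nsq (x1 - x2) + 3 * nsq (N t om))).
 by apply: (@meas_tint _ _ _ T (fun t om => 3 * nsq (x1 - x2) + 3 * nsq (N t om))) => // s om; case: (nxn s).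
have t0 om : (0 <= tint T (fun t => (3 * nsq (x1 - x2) + 3 * nsq (N t om))%R))%E.
 by apply: tint_ge0 => s; case: (nxn s).
apply: (@le_lt_trans _ _ (\int[P]_om (G%:E * (tint T (fun t => (3 * nsq (x1 - x2) + 3 * nsq (N t om))%R)
  + (kap * T)%:E * ee om)))%E).
 apply: ge0_le_integral => //.
 - by move=> om _; apply: tint_ge0.
 - exact: meas_tint.
 - by apply: emeasurable_funM => //; apply: emeasurable_funD => //; apply: emeasurable_funM.
have kapge := ltW kap0; have kT0 : 0 <= kap * T by nneg.
rewrite (eq_integral (fun om => (G%:E * tint T (fun t => (3 * nsq (x1 - x2) + 3 * nsq (N t om))%R) + (G * (kap * T))%:E * ee om)%E)); last first.
 by move=> om _; rewrite ge0_muleDr// ?mule_ge0// EFinM muleA.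
rewrite (@ge0_integral_lin2 _ _ _ _ _ _ (fun om => tint T (fun t => (3 * nsq (x1 - x2) + 3 * nsq (N t om))%R)) ee)// ?mulr_ge0//.
rewrite lte_add_pinfty// lte_mul_pinfty ?lee_fin// ?mulr_ge0//.
 rewrite (@jmeas_integral_swap _ _ _ P T (fun t om => 3 * nsq (x1 - x2) + 3 * nsq (N t om)))//; last first.
  by move=> s om; case: (nxn s).
 apply: (@le_lt_trans _ _ (\int[leb]_(s in `[0%R, T]) A%:E)%E); last by rewrite (tintE T (fun=> A)) tint_cst// ltry.
 apply: ge0_le_integral => //.
 - by move=> s _; apply: nint_ge0 => om; case: (nxn s).
 - apply: measurable_funTS; apply: (@meas_nint_time _ _ _ P (fun t om => 3 * nsq (x1 - x2) + 3 * nsq (N t om))) => // s om.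
  by case: (nxn s).
 move=> s; rewrite /= in_itv/= => /andP[s0 sT].
 rewrite nintD; [|by apply: nnm_cst; rewrite mulr_ge0// nsq_ge0|by apply: nnmZ => //; exact: nN].
 rewrite nint_cst nintZ// /A [leRHS]EFinD leeD2l//.
 by rewrite EFinM lee_wpmul2l ?lee_fin//; exact: EN_bound.
rewrite [X in (X < _)%E](_ : _ = \int[P]_om (1%:E * tint T (fun s => nsq (Y1 s om - Z1 s om)%R) + 1%:E * tint T (fun s => nsq (Y2 s om - Z2 s om)%R)))%E; last first.
 by apply: eq_integral => om _; rewrite !mul1e.
rewrite (@ge0_integral_lin2 _ _ _ _ _ _ (fun om => tint T (fun s => nsq (Y1 s om - Z1 s om)%R))
 (fun om => tint T (fun s => nsq (Y2 s om - Z2 s om)%R)))//; try by [exact: mpath | move=> om; apply: tint_ge0 => s; exact: nsq_ge0].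
by apply: lte_add_pinfty; (apply: (@le_lt_trans _ _ (1%:E * (eta * T)%:E)%E);
 [apply: lee_wpmul2l => //; exact: ezle|by rewrite -EFinM ltry]).
Qed.

Definition stab_kap : R := 3 * (27 * d%:R * L + 3 * T * L) + 1.
Definition stab_cst : R :=
 (3 + 6 * stab_kap * T) * (1 + 2 * stab_kap * T * expR (2 * stab_kap * T)).

Lemma stability t : 0 <= t -> t <= T ->
 (nint P (fun om => nsq (Y1 t om - Y2 t om)) <= (stab_cst * (nsq (x1 - x2) + eta))%:E)%E.
Proof.
have [mY1 mZ1 bY1 _ _] := h1; have [mY2 mZ2 bY2 _ _] := h2; have [/ltW L0 _ _ sL _] := hbs.
have sk0 : 0 < stab_kap by rewrite ltr_wpDl// !(mulr_ge0, addr_ge0).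
pose A := (3 + 6 * stab_kap * T) * (nsq (x1 - x2) + eta).
have A0 : 0 <= A by rewrite mulr_ge0// ?addr_ge0 ?nsq_ge0// !mulr_ge0// ltW.
have VA r : 0 <= r -> r <= T -> (V r <= A%:E + stab_kap%:E * \int[leb]_(s in `[0%R, r]) V s)%E.
 move=> r0 rT; pose zz om := tint r (fun s => nsq (Z1 s om - Z2 s om)).
 have zz0 om : (0 <= zz om)%E by apply: tint_ge0 => s; exact: nsq_ge0.
 have mzz : meas zz by exact: mpath.
 have T3 : 0 <= 3 * T * L by nneg.
 apply: (@le_trans _ _ (\int[P]_om ((3 * nsq (x1 - x2) + 3 * nsq (N r om))%:E + (3 * T * L)%:E * zz om))%E).
  apply: ge0_le_integral => //.
  - by nneg.
  - by apply: meas_EFin; exact: (jmeas_meas r mv).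
  - by apply: emeasurable_funD; [apply: meas_EFin; case: (nxn r)|apply: emeasurable_funM].
  - by move=> om _; exact: drift_diff_le.
 rewrite (eq_integral (fun om => (1%:E * (3 * nsq (x1 - x2) + 3 * nsq (N r om))%:E + (3 * T * L)%:E * zz om)%E)); last first.
  by move=> om _; rewrite mul1e.
 rewrite (@ge0_integral_lin2 _ _ _ _ _ _ (fun om => (3 * nsq (x1 - x2) + 3 * nsq (N r om))%:E) zz)//; last 2 first.
 - by nneg.
 - by apply: meas_EFin; case: (nxn r).
 rewrite mul1e.
 have -> : (\int[P]_x (3 * nsq (x1 - x2) + 3 * nsq (N r x))%:E = (3 * nsq (x1 - x2))%:E + 3%:E * nint P (fun om => nsq (N r om)))%E.
  rewrite [LHS]nintD; [|by apply: nnm_cst; rewrite mulr_ge0// nsq_ge0|by apply: nnmZ => //; exact: nN].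
  by rewrite nint_cst nintZ.
 have := EN r0 rT; have := Ez r0 rT; rewrite -/(zz _).
 have : (0 <= \int[P]_om zz om)%E by nneg.
 have : (0 <= \int[leb]_(s in `[0%R, r]) V s)%E by nneg.
 have : (\int[leb]_(s in `[0%R, r]) V s < +oo)%E.
  apply: le_lt_trans V_finite; apply: ge0_subset_integral => //; first exact: measurable_funTS.
  by move=> s /=; rewrite !in_itv/= => /andP[-> sr]; exact: le_trans rT.
 have : (0 <= nint P (fun om => nsq (N r om)))%E by apply: nint_ge0 => om; exact: nsq_ge0.
 rewrite /zz; case: (\int[leb]_(s in _) _)%E => [w| |] //.
 case: (\int[P]_om _)%E => [z| |] //.
 case: (nint P _) => [n| |] //.
 rewrite -!EFinM -!EFinD !lee_fin => n0 _ w0 z0 zw nz; rewrite /A /stab_kap.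
 have x0 := nsq_ge0 (x1 - x2); have dL : 0 <= (d%:R : R) * L by nneg.
 have TL : 0 <= T * L by nneg.
 pose kk := 27 * d%:R * L + 3 * T * L.
 have kk0 : 0 <= kk by rewrite addr_ge0// -!mulrA !mulr_ge0.
 have b1 : 3 * nsq (x1 - x2) + 3 * n + 3 * T * L * z <= 3 * nsq (x1 - x2) + kk * z by rewrite /kk; lra.
 have b2 : kk * z <= kk * (6 * eta * T + 3 * w) by rewrite ler_wpM2l.
 have eT : 0 <= eta * T by nneg.
 rewrite -/kk; apply: (le_trans b1); apply: (@le_trans _ _ (3 * nsq (x1 - x2) + kk * (6 * eta * T + 3 * w))); first lra.
 have k1 : 0 <= kk * (eta * T) by nneg.
 have k2 : 0 <= kk * (T * nsq (x1 - x2)) by nneg.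
 have k3 : 0 <= T * nsq (x1 - x2) by nneg.
 move: x0 k1 k2 k3 eT eta0; clearbody kk; move: (nsq (x1 - x2)) => x x0 k1 k2 k3 eT eta0'.
 rewrite -subr_ge0 [leRHS](_ : _ = 3 * eta + 18 * (kk * (T * x)) + 12 * (kk * (eta * T)) + 6 * (T * x) + 6 * (eta * T) + w); last by ring.
 by nneg.
move=> t0 tT; have := gronwall_cst sk0 T0 A0 mV V0 VA V_finite t0 tT.
by rewrite /A /stab_cst mulrAC.
Qed.

End two_solutions.
End stability.

Section euler.
Context {R : realType} {d : nat} {disp} {Omega : measurableType disp} (P : probability Omega R) (F : R -> set (set Omega))
 (hF : is_filtration P F) (W : R -> Omega -> 'rV[R]_d) (hW : is_brownian_motion P F W)
 (mW : forall t, meas (W t)) (cW : forall om, continuous (W ^~ om)) (b : 'rV[R]_d -> 'rV[R]_d)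
 (sigma : 'rV[R]_d -> R) (L C : R) (hbs : lip_coefs b sigma L C).
Local Notation leb := (@lebesgue_measure R).
Local Notation M := (measurableTypeR R).
Context (x : 'rV[R]_d) (h : R) (N : nat) (h0 : 0 < h).

Fixpoint euler (k : nat) (om : Omega) : 'rV[R]_d :=
 if k is k'.+1 then
  euler k' om + h *: b (euler k' om)
   + sigma (euler k' om) *: (W (k'.+1%:R * h) om - W (k'%:R * h) om)
 else x.

Definition euler_incr (k : nat) (t : R) (om : Omega) : 'rV[R]_d :=
 (Num.min (k.+1%:R * h) t - Num.min (k%:R * h) t) *: b (euler k om)
 + sigma (euler k om) *: (W (Num.min (k.+1%:R * h) t) om - W (Num.min (k%:R * h) t) om).

Definition euler_path (t : R) (om : Omega) : 'rV[R]_d := x + \sum_(k < N) euler_incr k t om.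

Definition euler_pc (s : R) (om : Omega) : 'rV[R]_d :=
 \1_(`]-oo, 0%R]%classic) s *: x +
 \sum_(k < N) \1_(`](k%:R * h), (k.+1%:R * h)]%classic) s *: euler k om.

Lemma grid_le (j k : nat) : (j <= k)%N -> j%:R * h <= k%:R * h.
Proof. by move=> jk; rewrite ler_pM2r// ler_nat. Qed.

Lemma Fmeas_euler k : Fmeas F (k%:R * h) (euler k).
Proof.
have mb := meas_b hbs; have ms := meas_sigma hbs.
have g0 j : 0 <= j%:R * h by nneg.
elim: k => [|k IH] /=; first exact: measurable_cst.
have IH' := Fmeas_mono hF (g0 k) (grid_le (leqnSn k)) IH.
apply: meas_rVD; last first.
 apply: meas_rVZ; first exact: (Fmeas_comp ms IH').
 exact: (Fmeas_dW hF hW (g0 _) (g0 _) (grid_le (leqnSn k)) (lexx _)).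
apply: meas_rVD => //; apply: meas_rVZ => //; exact: (Fmeas_comp mb IH').
Qed.

Lemma meas_euler k : meas (euler k).
Proof.
have g0 : 0 <= k%:R * h by nneg.
exact: (Fmeas_meas hF g0 (@Fmeas_euler k)).
Qed.

Lemma euler_incr_after k t om : t <= k%:R * h -> euler_incr k t om = 0.
Proof.
move=> tk; rewrite /euler_incr (min_idPr tk) (min_idPr (le_trans tk (grid_le (leqnSn k)))).
by rewrite !subrr scale0r scaler0 addr0.
Qed.

Lemma euler_incr_before k t om : k.+1%:R * h <= t -> euler_incr k t om = euler k.+1 om - euler k om.
Proof.
move=> kt; rewrite /euler_incr (min_idPl kt) (min_idPl (le_trans (grid_le (leqnSn k)) kt)) /=.
rewrite -mulrBl -natr1 addrAC subrr add0r mul1r.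
by rewrite natr1; apply/rowP => i; rewrite !mxE; ring.
Qed.

Lemma euler_sum_before n t om : n%:R * h <= t -> x + \sum_(k < n) euler_incr k t om = euler n om.
Proof.
elim: n => [|n IH] nt; first by rewrite big_ord0 addr0.
rewrite big_ord_recr/= addrA IH ?(le_trans (grid_le (leqnSn n)) nt)//.
by rewrite euler_incr_before// addrC subrK.
Qed.

Lemma euler_pathE k t om : (k < N)%N -> k%:R * h <= t -> t <= k.+1%:R * h ->
 euler_path t om = euler k om + (t - k%:R * h) *: b (euler k om)
  + sigma (euler k om) *: (W t om - W (k%:R * h) om).
Proof.
move=> kN kt tk; rewrite /euler_path.
have -> : \sum_(j < N) euler_incr j t om = \sum_(j < k.+1) euler_incr j t om.
 move: N kN; elim=> // n IH; rewrite ltnS leq_eqVlt => /orP[/eqP ->//|kn].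
 by rewrite big_ord_recr/= IH// euler_incr_after ?addr0// (le_trans tk)// grid_le.
rewrite big_ord_recr/= addrA euler_sum_before//.
by rewrite /euler_incr (min_idPr tk) (min_idPl kt) addrA.
Qed.

Lemma grid_exists s : 0 < s -> s <= N%:R * h ->
 exists k, [/\ (k < N)%N, k%:R * h < s & s <= k.+1%:R * h].
Proof.
move=> s0; elim: N => [|n IH]; first by rewrite mul0r leNgt s0.
have [/IH[k [kn a c]] _|ns sn] := leP s (n%:R * h); last by exists n.
by exists k; split => //; exact: ltnW.
Qed.

Lemma euler_indic_sum (V : lmodType R) (f : nat -> V) k s : (k < N)%N -> k%:R * h < s -> s <= k.+1%:R * h ->
 \sum_(j < N) \1_(`](j%:R * h), (j.+1%:R * h)]%classic) s *: f j = f k.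
Proof.
move=> kN ks sk; rewrite (bigD1 (Ordinal kN))//= [\1_(_) _](_ : _ = 1) ?scale1r; last first.
 by rewrite indicE mem_set//= in_itv/= ks sk.
rewrite big1 ?addr0// => j jk; rewrite [\1_(_) _](_ : _ = 0) ?scale0r//.
rewrite indicE memNset//= in_itv/= => /andP[js sj].
have /negP := jk; apply; apply/eqP/val_inj => /=; apply/eqP; rewrite eqn_leq.
have : (j%:R : R) < k.+1%:R by rewrite -(ltr_pM2r h0); exact: lt_le_trans js sk.
have : (k%:R : R) < j.+1%:R by rewrite -(ltr_pM2r h0); exact: lt_le_trans ks sj.
by rewrite !ltr_nat !ltnS => -> ->.
Qed.

Lemma euler_pcE k s om : (k < N)%N -> k%:R * h < s -> s <= k.+1%:R * h -> euler_pc s om = euler k om.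
Proof.
move=> kN ks sk; rewrite /euler_pc (euler_indic_sum (fun k => euler k om) kN ks sk).
rewrite indicE memNset/= ?scale0r ?add0r// in_itv/= => s0.
by have := lt_le_trans ks s0; rewrite ltNge mulr_ge0// ltW.
Qed.

Lemma euler_pc0 om : euler_pc 0 om = x.
Proof.
rewrite /euler_pc indicE mem_set/= ?in_itv//= scale1r big1 ?addr0// => k _.
rewrite indicE memNset ?scale0r//= in_itv/= => /andP[k0 _].
by move: k0; rewrite ltNge mulr_ge0// ltW.
Qed.

Lemma euler_path_neg t om : t <= 0 -> euler_path t om = x.
Proof.
move=> t0; rewrite /euler_path big1 ?addr0// => k _; apply: euler_incr_after.
by apply: le_trans t0 _; rewrite mulr_ge0// ltW.
Qed.

Lemma jmeasV_euler_pc : jmeasV euler_pc.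
Proof.
apply: meas_rVP => i; rewrite (_ : (fun _ => _) = fun p : M * Omega =>
 \1_(`]-oo, 0%R]%classic) p.1 * x 0 i + \sum_(k < N) \1_(`](k%:R * h), (k.+1%:R * h)]%classic) p.1 * euler k p.2 0 i).
 apply: measurable_funD.
  by apply: measurable_funM => //; apply: jmeas_fst; exact: measurable_indic.
 apply: measurable_sum => k; apply: measurable_funM.
  by apply: jmeas_fst; exact: measurable_indic.
 by apply: (@jmeas_snd _ _ _ (fun om => euler k om 0 i)); apply: meas_coordf; exact: meas_euler.
apply/funext => p; rewrite /euler_pc !mxE summxE; congr (_ + _).
by apply: eq_bigr => k _; rewrite mxE.
Qed.

Lemma meas_euler_path t : meas (euler_path t).
Proof.
have mb := meas_b hbs; have ms := meas_sigma hbs.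
apply: meas_rVP => i; under eq_fun do rewrite mxE summxE.
apply: measurable_funD => //; apply: measurable_sum => k.
apply: meas_coordf; apply: meas_rVD; apply: meas_rVZ => //.
- exact: (mcomp mb (meas_euler k)).
- exact: (mcomp ms (meas_euler k)).
- by mble.
Qed.

Lemma Fmeas_euler_path t : 0 <= t -> Fmeas F t (euler_path t).
Proof.
move=> t0; have mb := meas_b hbs; have ms := meas_sigma hbs.
have g0 j : 0 <= j%:R * h by nneg.
apply: meas_rVP => i; rewrite (_ : (fun _ => _) = fun om => x 0 i + \sum_(k < N) euler_incr k t om 0 i); last first.
 by apply/funext => om; rewrite mxE summxE.
apply: measurable_funD; first exact: measurable_cst.
apply: measurable_sum => k.
have [tk|kt] := leP t (k%:R * h).
 rewrite (_ : (fun _ => _) = fun=> 0); first exact: measurable_cst.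
 by apply/funext => om; rewrite euler_incr_after// mxE.
have E' := Fmeas_mono hF (g0 (k : nat)) (ltW kt) (@Fmeas_euler k).
apply: meas_coordf; apply: meas_rVD; apply: meas_rVZ => //.
- exact: (Fmeas_comp mb E').
- exact: (Fmeas_comp ms E').
- by apply: (Fmeas_dW hF hW); rewrite ?le_min ?g0 ?t0// ge_min lexx orbT.
Qed.

Lemma continuous_bigsum (T : topologicalType) (I : Type) (r : seq I) (f : I -> T -> R) :
 (forall k, continuous (f k)) -> continuous (fun t => \sum_(k <- r) f k t).
Proof.
move=> cf; elim: r => [|k r IH] t.
 by under eq_fun do rewrite big_nil; exact: cvg_cst.
by under eq_fun do rewrite big_cons; apply: cvgD; [exact: cf|exact: IH].
Qed.

Lemma continuous_rV (T : topologicalType) (f : T -> 'rV[R]_d) :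
 (forall i, continuous (fun t => f t 0 i)) -> continuous f.
Proof.
move=> cf t; apply/(@cvgrPdist_le _ _ _ (nbhs t)) => e e0.
have H : \forall s \near t, forall i : 'I_d, `|f t 0 i - f s 0 i| <= e.
 apply: filter_forall => i.
 by have /(@cvgrPdist_le _ _ _ (nbhs t)) := cf i t; apply.
apply: filterS H => s H; rewrite [`|_|]mx_normrE; apply: bigmax_le => [|[i j] _]; first exact: ltW.
by rewrite /= (ord1 i) !mxE.
Qed.

Lemma continuous_euler_path om : continuous (euler_path ^~ om).
Proof.
apply: continuous_rV => i.
have cm (c : R) : continuous (fun t : R => Num.min c t).
 by move=> t; apply: continuous_min; [exact: cst_continuous|exact: cvg_id].
have cWm (c : R) : continuous (fun t : R => W (Num.min c t) om 0 i).
 move=> t; apply: (@continuous_comp _ _ _ (fun t : R => Num.min c t) (fun s => W s om 0 i)); first exact: cm.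
 apply: (@continuous_comp _ _ _ (W ^~ om) (fun v : 'rV[R]_d => v 0 i)); first exact: cW.
 exact: coord_continuous.
rewrite (_ : (fun _ => _) = fun t => x 0 i + \sum_(k < N) ((Num.min (k.+1%:R * h) t - Num.min (k%:R * h) t) * b (euler k om) 0 i
  + sigma (euler k om) * (W (Num.min (k.+1%:R * h) t) om 0 i - W (Num.min (k%:R * h) t) om 0 i))); last first.
 by apply/funext => t; rewrite mxE summxE; congr (_ + _); apply: eq_bigr => k _; rewrite !mxE.
move=> t; apply: cvgD; first exact: cvg_cst.
apply: (@continuous_bigsum R 'I_N (index_enum _) (fun (k : 'I_N) t =>
 (Num.min (k.+1%:R * h) t - Num.min (k%:R * h) t) * b (euler k om) 0 i +
 sigma (euler k om) * (W (Num.min (k.+1%:R * h) t) om 0 i - W (Num.min (k%:R * h) t) om 0 i)) _ t) => k {}t.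
apply: cvgD; apply: cvgM; try exact: cvg_cst.
 by apply: cvgB; exact: cm.
by apply: cvgB; exact: cWm.
Qed.

Lemma continuous_bounded (T : R) (f : R -> R) : 0 <= T -> continuous f ->
 exists B, forall s, 0 <= s -> s <= T -> f s <= B.
Proof.
move=> T0 cf; have [c _ hc] := EVT_max T0 (continuous_subspaceT cf).
by exists (f c) => s s0 sT; apply: hc; rewrite in_itv/= s0.
Qed.

Lemma continuous_nsq (f : R -> 'rV[R]_d) : continuous f -> continuous (fun t => nsq (f t)).
Proof.
move=> cf; rewrite /nsq => t; apply: (@continuous_bigsum R 'I_d (index_enum _) (fun (k : 'I_d) t => (f t 0 k) ^+ 2) _ t) => k {}t.
have ck : (fun t => f t 0 k) @ t --> f t 0 k.
 by apply: (@continuous_comp _ _ _ f (fun v : 'rV[R]_d => v 0 k)); [exact: cf|exact: coord_continuous].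
exact: (cvgM ck ck).
Qed.

Lemma bounded_euler_path T : 0 <= T -> bounded_upto T euler_path.
Proof.
move=> T0 om; apply: continuous_bounded => //; apply: continuous_nsq; exact: continuous_euler_path.
Qed.

Lemma bounded_euler_pc T : T <= N%:R * h -> bounded_upto T euler_pc.
Proof.
move=> TN om; exists (nsq x + \sum_(k < N) nsq (euler k om)) => s s0 sT.
have [->|sn0] := eqVneq s 0; first by rewrite euler_pc0 lerDl sumr_ge0// => k _; exact: nsq_ge0.
have [|k [kN ks sk]] := grid_exists _ (le_trans sT TN); first by rewrite lt_neqAle eq_sym sn0.
rewrite (euler_pcE om kN ks sk) -[leLHS]add0r lerD ?nsq_ge0// (bigD1 (Ordinal kN))//= lerDl sumr_ge0// => j _.
exact: nsq_ge0.
Qed.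

Definition euler_simple (t : R) : simple_process := SimpleProcess N
 (fun k => Num.min (k%:R * h) t) (fun k om => if k%:R * h < t then sigma (euler k om) else 0).

Lemma is_simple_euler t : 0 <= t -> t <= N%:R * h -> is_simple_process F t (euler_simple t).
Proof.
have ms := meas_sigma hbs; have [_ C0 _ _ sC] := hbs.
move=> t0 tN; split => /=.
- by rewrite mul0r min_l.
- by rewrite min_r.
- by move=> k _; apply: le_min2 => //; exact: grid_le.
- move=> k _; have [kt|tk] := ltP (k%:R * h) t.
  have k0 : 0 <= k%:R * h by nneg.
  exact: (proj1 (FmeasP hF _ k0) (Fmeas_comp ms (@Fmeas_euler k))).
 by apply: (proj1 (FmeasP hF _ t0)); exact: measurable_cst.
- by exists C => k om _; case: ifP => _ //; rewrite normr0.
Qed.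

Lemma indic_oc (a c s : R) : \1_(`]a, c]%classic) s = ((a < s) && (s <= c))%:R :> R.
Proof. by rewrite indicE; congr (nat_of_bool _)%:R; apply/idP/idP; rewrite inE/= in_itv. Qed.

Lemma euler_simple_fun t s om : 0 < s -> s <= t -> t <= N%:R * h ->
 simple_fun (euler_simple t) s om = sigma (euler_pc s om).
Proof.
move=> s0 st tN; have [k [kN ks sk]] := grid_exists s0 (le_trans st tN).
rewrite (euler_pcE om kN ks sk) /simple_fun /=.
rewrite -[RHS](euler_indic_sum (V := R^o) (fun k => sigma (euler k om)) kN ks sk).
apply: eq_bigr => j _; rewrite !indic_oc le_min st andbT [RHS]mulrC.
have [jt|tj] := ltP (j%:R * h) t; first by [].
by rewrite mul0r !ltNge (le_trans st tj) mulr0.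
Qed.

Lemma drift_euler_pc t i om : 0 <= t -> t <= N%:R * h ->
 (\int[leb]_(s in `[0%R, t]) b (euler_pc s om) 0 i)%R =
 \sum_(k < N) (Num.min (k.+1%:R * h) t - Num.min (k%:R * h) t) * b (euler k om) 0 i.
Proof.
move=> t0 tN; have mbe : meas (fun s : M => b (euler_pc s om) 0 i).
 apply: (@jmeas_section _ _ _ (fun s om => b (euler_pc s om) 0 i)).
 exact: (jmeasV_comp (meas_coordf i (meas_b hbs)) jmeasV_euler_pc).
pose I k := `](k%:R * h), (k.+1%:R * h)]%classic : set M.
pose D := `]0%R, t]%classic : set M.
rewrite /Rintegral -integral_itv_obnd_cbnd; last by apply: measurable_funTS; exact: meas_EFin.
rewrite (_ : integral _ _ _ = \int[leb]_(s in D) (\sum_(k < N) (b (euler k om) 0 i)%:E * (\1_(I k) s)%:E))%E; last first.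
 apply: eq_integral => s; rewrite inE /= in_itv/= => /andP[s0 st].
 have [k [kN ks sk]] := grid_exists s0 (le_trans st tN).
 rewrite (euler_pcE om kN ks sk) -[in LHS](euler_indic_sum (V := R^o) (fun k => b (euler k om) 0 i) kN ks sk) -sumEFin.
 by apply: eq_bigr => j _; rewrite -EFinM [in RHS]mulrC.
have mD : leb D = t%:E.
 by rewrite lebesgue_measure_itv/= lte_fin; case: ltP => [_|h']; [rewrite sube0|congr EFin; lra].
have iI k : leb.-integrable D (fun s => (\1_(I k) s)%:E).
 apply: measurable_bounded_integrable.
 - exact: measurable_itv.
 - by rewrite [X in (X < _)%E]mD ltry.
 - by apply: measurable_funTS; apply: measurable_indic; exact: measurable_itv.
 exists 1; split; first exact: num_real.
 move=> c c1 s _ /=; apply/ltW/(le_lt_trans _ c1).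
 by rewrite indic_oc; case: (_ && _); rewrite ?normr1 ?normr0.
have hI (k : 'I_N) : leb.-integrable D (fun s => (b (euler k om) 0 i)%:E * (\1_(I k) s)%:E)%E.
 by apply: integrableZl; [exact: measurable_itv|exact: iI].
rewrite (@integral_sum _ _ _ leb D (measurable_itv _) 'I_N
 (fun k s => (b (euler k om) 0 i)%:E * (\1_(I k) s)%:E)%E hI).
rewrite (_ : (\sum_(k < N) _)%E = (\sum_(k < N) (Num.min (k.+1%:R * h) t - Num.min (k%:R * h) t) * b (euler k om) 0 i)%:E) //.
rewrite -sumEFin; apply: eq_bigr => k _; rewrite (@integralZl _ _ _ leb D _ _ (iI k)); last exact: measurable_itv.
rewrite integral_indic; [|exact: measurable_itv|exact: measurable_itv].
rewrite [RHS]EFinM muleC; congr (_ * _)%E.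
rewrite (_ : I k `&` D = `]Num.min (k%:R * h) t, Num.min (k.+1%:R * h) t]%classic); last first.
 have g0 : 0 <= k%:R * h by nneg.
 apply/seteqP; split=> s; rewrite /I /D /= !in_itv/= le_min gt_min.
  by move=> [/andP[-> ->] /andP[_ ->]].
 move=> /and3P[/orP[ks|ts] sk st]; first by rewrite ks sk st (le_lt_trans g0 ks).
 by move: ts; rewrite ltNge st.
rewrite [LHS]lebesgue_measure_itv/= lte_fin; case: ltP => //= h'.
rewrite (_ : Num.min (k.+1%:R * h) t = Num.min (k%:R * h) t) ?subrr//.
by apply/eqP; rewrite eq_le h' le_min2// grid_le.
Qed.

Lemma euler_simple_integral t i om : 0 <= t -> t <= N%:R * h ->
 simple_integral (euler_simple t) (fun s w => W s w 0 i) om = ito_part b x euler_pc euler_path t i om.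
Proof.
move=> t0 tN; rewrite /ito_part drift_euler_pc// /euler_path mxE summxE [x 0 i + _]addrC addrK -sumrB.
apply: eq_bigr => k _ /=; rewrite !mxE addrAC subrr add0r.
case: ltP => // tk; rewrite (min_idPr (le_trans tk (grid_le (leqnSn k)))).
by rewrite subrr !mulr0.
Qed.

Lemma approx_sol_euler T : 0 <= T -> T <= N%:R * h ->
 approx_sol P F W b sigma T x euler_pc euler_path.
Proof.
move=> T0 TN; split.
- by apply: jmeasV_continuous => [s|om]; [exact: meas_euler_path|exact: continuous_euler_path].
- exact: jmeasV_euler_pc.
- exact: bounded_euler_path.
- exact: bounded_euler_pc.
move=> t t0 tT i; have tN := le_trans tT TN; exists (fun=> euler_simple t); split.
- by move=> _; exact: is_simple_euler.
- move=> e e0; apply/cvge0P => // a a0; exists 0%N => n _; rewrite [X in P X](_ : _ = set0) ?measure0 ?lee_fin ?(ltW a0)//.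
 apply/seteqP; split=> // om /=; rewrite -integral_itv_obnd_cbnd; last first.
  apply: measurable_funTS; apply: meas_EFin; apply: measurable_funX; apply: measurable_funB.
   by mble.
  apply: (@jmeas_section _ _ _ (fun s om => sigma (euler_pc s om))).
  exact: (jmeasV_comp (meas_sigma hbs) jmeasV_euler_pc).
 rewrite integral0_eq ?lee_fin ?leNgt ?e0// => s; rewrite /= in_itv/= => /andP[s0 st].
 by rewrite euler_simple_fun// subrr expr0n.
- move=> e e0; apply/cvge0P => // a a0; exists 0%N => n _; rewrite [X in P X](_ : _ = set0) ?measure0 ?lee_fin ?(ltW a0)//.
 by apply/seteqP; split=> // om /=; rewrite euler_simple_integral// subrr normr0 lee_fin leNgt e0.
Qed.

Definition euler_rate : R := 1 + 2 * bcst b L + d%:R * C ^+ 2.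

Lemma euler_rate_ge0 : 0 <= euler_rate.
Proof. by have := bcst_ge0 hbs; rewrite /euler_rate => h'; apply: addr_ge0; [apply: addr_ge0 => //; exact: mulr_ge0|rewrite mulr_ge0 ?sqr_ge0]. Qed.

Lemma nnm_sigma_euler k : nnm (fun om => (sigma (euler k om)) ^+ 2).
Proof. by apply: nnm_sqr; exact: (mcomp (meas_sigma hbs) (meas_euler k)). Qed.

Lemma nint_sigma_euler k : (nint P (fun om => (sigma (euler k om)) ^+ 2)%R <= (C ^+ 2)%:E)%E.
Proof.
have [_ C0 _ _ sC] := hbs; rewrite -(nint_cst P); apply: le_nint; [exact: nnm_sigma_euler|exact/nnm_cst/sqr_ge0|].
by move=> om; rewrite -(real_normK (num_real (sigma _))) lerXn2r ?nnegrE.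
Qed.

Lemma nnm_nsq_euler k : nnm (fun om => nsq (euler k om)).
Proof. by split=> [|om]; [exact/meas_nsqf/meas_euler|exact: nsq_ge0]. Qed.

Lemma nint_sqr_step (f : Omega -> R) k t i : k%:R * h <= t -> Fmeas F (k%:R * h) f ->
 nint P (fun om => (f om + sigma (euler k om) * (W t om 0 i - W (k%:R * h) om 0 i)) ^+ 2) =
 (nint P (fun om => (f om) ^+ 2)%R + (t - k%:R * h)%:E * nint P (fun om => (sigma (euler k om)) ^+ 2)%R)%E.
Proof.
move=> kt Ff; rewrite /nint; apply: (isometry_step hF hW) => //; first by nneg.
exact: (Fmeas_comp (meas_sigma hbs) (@Fmeas_euler k)).
Qed.

Lemma euler_moment_step k : h <= 1 -> (nint P (fun om => 1 + nsq (euler k.+1 om))%R <=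
 (1 + euler_rate * h)%:E * nint P (fun om => 1 + nsq (euler k om))%R)%E.
Proof.
move=> h1; have [_ C0 _ _ _] := hbs; have bc := bcst_ge0 hbs.
have mE := meas_euler k.
have mb := meas_b hbs; have FE := @Fmeas_euler k.
have me := nnm_nsq_euler k.
have m1 : nnm (fun om => nsq (euler k om + h *: b (euler k om))).
 split=> [|om]; last exact: nsq_ge0.
 apply: meas_nsqf; apply: meas_rVD => //; apply: meas_rVZ => //.
 exact: (mcomp mb mE).
have n1 (c : R) : 0 <= c -> nnm (fun _ : Omega => c) by [].
have kh : k%:R * h <= k.+1%:R * h by exact: grid_le.
have -> : nint P (fun om => 1 + nsq (euler k.+1 om)) =
  (nint P (fun om => 1 + nsq (euler k om + h *: b (euler k om)))%R +
   (d%:R * h)%:E * nint P (fun om => (sigma (euler k om)) ^+ 2)%R)%E.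
 rewrite nintD; [|exact: n1|exact: nnm_nsq_euler].
 rewrite nintD; [|exact: n1|by []].
 suff -> : nint P (fun om => nsq (euler k.+1 om)) = (nint P (fun om => nsq (euler k om + h *: b (euler k om)))%R +
   (d%:R * h)%:E * nint P (fun om => (sigma (euler k om)) ^+ 2)%R)%E by rewrite addeA.
 rewrite /nsq nint_sum; last first.
  by move=> i; apply: nnm_sqr; apply: meas_coordf; exact: meas_euler.
 rewrite nint_sum; last first.
  move=> i; apply: nnm_sqr; apply: meas_coordf; apply: meas_rVD => //.
  by apply: meas_rVZ => //; exact: (mcomp mb mE).
 rewrite [X in (_ = _ + X)%E](_ : _ = \sum_(i < d) h%:E * nint P (fun om => (sigma (euler k om)) ^+ 2)%R)%E; last first.
  rewrite sume_const ?EFinM ?muleA// mule_ge0 ?lee_fin ?(ltW h0)//; apply: nint_ge0 => om; exact: sqr_ge0.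
 rewrite -big_split/=; apply: eq_bigr => i _.
 rewrite [in RHS](_ : h%:E = (k.+1%:R * h - k%:R * h)%:E); last by rewrite -natr1 mulrDl addrAC subrr add0r mul1r.
 rewrite -(nint_sqr_step i kh); last first.
  apply: meas_coordf; apply: meas_rVD => //; apply: meas_rVZ => //; exact: (Fmeas_comp mb FE).
 by apply: eq_nint => om; rewrite !mxE.
apply: (@le_trans _ _ (nint P (fun om => (1 + (1 + 2 * bcst b L) * h) * (1 + nsq (euler k om)))%R + (d%:R * h)%:E * (C ^+ 2)%:E)%E).
 apply: leeD; last by rewrite lee_wpmul2l ?lee_fin ?mulr_ge0 ?(ltW h0)//; exact: nint_sigma_euler.
 apply: le_nint; [exact: nnmD|by apply: nnmZ; [rewrite addr_ge0// mulr_ge0 ?(ltW h0)// addr_ge0// mulr_ge0|exact: nnmD]|].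
 move=> om; set e := euler k om.
 have hb := nsq_b_le hbs e; have := nsq_ge0 e; have := nsq_ge0 (b e).
 have hcs : nsq (e + h *: b e) <= (1 + h) * nsq e + (h + h ^+ 2) * nsq (b e).
  rewrite /nsq !mulr_sumr -big_split/=; apply: ler_sum => i _; rewrite !mxE.
  have := mulr_ge0 (ltW h0) (sqr_ge0 (e 0 i - b e 0 i)); rewrite sqrrB !expr2; lra.
 move: (nsq (e + _)) (nsq e) (nsq (b e)) (bcst b L) hcs hb bc => u v w B hcs hb bc w0 v0.
 have hw : (h + h ^+ 2) * w <= 2 * h * (B * (1 + v)).
  have hh : h * h <= h * 1 by rewrite ler_pM2l.
  have a1 : h + h ^+ 2 <= 2 * h by rewrite expr2; lra.
  apply: (@le_trans _ _ (2 * h * w)); first by rewrite ler_wpM2r.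
  by rewrite ler_wpM2l// mulr_ge0// ltW.
 nra.
rewrite nintZ//; last 2 first.
- by nneg.
- exact: nnmD.
have i1 : (1 <= nint P (fun om => 1 + nsq (euler k om))%R)%E.
 rewrite -(nint_cst P); apply: le_nint; [exact: n1|exact: nnmD|].
 by move=> om; rewrite lerDl nsq_ge0.
rewrite (_ : 1 + euler_rate * h = (1 + (1 + 2 * bcst b L) * h) + d%:R * h * C ^+ 2); last by rewrite /euler_rate; ring.
rewrite [in leRHS]EFinD ge0_muleDl ?lee_fin//; last 2 first.
- by nneg.
- by nneg.
rewrite leeD2l// -EFinM -[leLHS]mule1 lee_wpmul2l// lee_fin !mulr_ge0 ?(ltW h0)// sqr_ge0.
Qed.

Lemma euler_moment k : h <= 1 -> (nint P (fun om => 1 + nsq (euler k om))%R <=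
 ((1 + nsq x) * expR (euler_rate * (k%:R * h)))%:E)%E.
Proof.
move=> h1; have r0 := euler_rate_ge0; elim: k => [|k IH]; first by rewrite mul0r mulr0 expR0 mulr1 /= nint_cst.
apply: le_trans (euler_moment_step k h1) _.
apply: (@le_trans _ _ ((expR (euler_rate * h))%:E * ((1 + nsq x) * expR (euler_rate * (k%:R * h)))%:E)%E).
 apply: lee_pmul => //; last 1 first.
 - by rewrite lee_fin expR_ge1Dx.
 - by nneg.
 - by apply: nint_ge0 => om; rewrite addr_ge0// nsq_ge0.
rewrite -EFinM lee_fin (_ : k.+1%:R * h = k%:R * h + h); last by rewrite -natr1 mulrDl mul1r.
by rewrite [euler_rate * (_ + _)]mulrDr expRD mulrCA [X in _ <= _ * X]mulrC.
Qed.

Definition euler_cst (T : R) : R :=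
 2 * (bcst b L * ((1 + nsq x) * expR (euler_rate * T))) + 2 * (d%:R * C ^+ 2).

Lemma euler_path_pc_close T t : h <= 1 -> 0 <= t -> t <= T -> T <= N%:R * h ->
 (nint P (fun om => nsq (euler_path t om - euler_pc t om)) <= (h * euler_cst T)%:E)%E.
Proof.
move=> h1 t0 tT TN; have r0 := euler_rate_ge0; have bc := bcst_ge0 hbs.
have e0 : 0 <= h * euler_cst T.
 rewrite mulr_ge0 ?(ltW h0)// addr_ge0//; last by nneg.
 by nneg.
have [->|tn0] := eqVneq t 0.
 under eq_nint do rewrite euler_pc0 euler_path_neg// subrr nsq0.
 by rewrite nint_cst lee_fin.
have tp : 0 < t by rewrite lt_neqAle eq_sym tn0.
have [k [kN kt tk]] := grid_exists tp (le_trans tT TN).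
have kh0 : 0 <= k%:R * h by nneg.
have mb := meas_b hbs; have ms := meas_sigma hbs; have mE := meas_euler k.
pose dW om := W t om - W (k%:R * h) om.
rewrite (@eq_nint _ _ _ P _ (fun om => nsq ((t - k%:R * h) *: b (euler k om) + sigma (euler k om) *: dW om))); last first.
 move=> om; rewrite (euler_pathE _ kN (ltW kt) tk) (euler_pcE _ kN kt tk); congr nsq.
 by apply/rowP => i; rewrite !mxE; ring.
have nb : nnm (fun om => 1 + nsq (euler k om)) by apply: nnmD; [exact: nnm_cst|exact: nnm_nsq_euler].
have ndW : nnm (fun om => nsq (sigma (euler k om) *: dW om)).
 split=> [|om]; last exact: nsq_ge0.
 apply: meas_nsqf; apply: meas_rVZ; first exact: (mcomp ms mE).
 by mble.
have EdW : (nint P (fun om => nsq (sigma (euler k om) *: dW om)) <= (d%:R * (h * C ^+ 2))%:E)%E.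
 rewrite /nsq nint_sum; last first.
  move=> i; apply: nnm_sqr; apply: meas_coordf; apply: meas_rVZ; first exact: (mcomp ms mE).
  by mble.
 rewrite EFinM -sume_const; last by nneg.
 apply: lee_sum => i _.
 rewrite (@eq_nint _ _ _ _ _ (fun om => (0 + sigma (euler k om) * (W t om 0 i - W (k%:R * h) om 0 i)) ^+ 2)); last first.
  by move=> om; rewrite !mxE add0r.
 rewrite (nint_sqr_step (f := fun=> 0) i (ltW kt)); last exact: measurable_cst.
 rewrite (_ : nint P _ = 0)%E ?add0e; last by rewrite expr0n nint_cst.
 rewrite EFinM lee_pmul ?lee_fin//; last exact: nint_sigma_euler.
 - by nneg.
 - by apply: nint_ge0 => om; exact: sqr_ge0.
 - by move: tk; rewrite -natr1 mulrDl mul1r; lra.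
apply: le_trans (nint_le_lin2 (a := 2 * h ^+ 2 * bcst b L) (b := 2) _ nb ndW _ _ _ (euler_moment k h1) EdW) _ => //.
- split=> [|om]; last exact: nsq_ge0.
 apply: meas_nsqf; apply: meas_rVD; apply: meas_rVZ => //.
 + exact: (mcomp mb mE).
 + exact: (mcomp ms mE).
 + by mble.
- by nneg.
- move=> om; apply: le_trans (nsqD _ _) _; rewrite lerD2r -!mulrA ler_pM2l// nsqZ.
 rewrite [leRHS]mulrA -expr2; apply: ler_pM; rewrite ?sqr_ge0 ?nsq_ge0//; last exact: (nsq_b_le hbs).
 by rewrite lerXn2r ?nnegrE ?subr_ge0 ?(ltW h0) ?(ltW kt)//; move: tk; rewrite -natr1 mulrDl mul1r; lra.
rewrite lee_fin /euler_cst.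
have eT : expR (euler_rate * (k%:R * h)) <= expR (euler_rate * T).
 by rewrite ler_expR ler_wpM2l// ltW// (lt_le_trans kt tT).
have q : 2 * h ^+ 2 * bcst b L * ((1 + nsq x) * expR (euler_rate * (k%:R * h))) <=
  h * (2 * (bcst b L * ((1 + nsq x) * expR (euler_rate * T)))).
 have hh : h ^+ 2 <= h by rewrite expr2 ler_piMl// ltW.
 have x0 := nsq_ge0 x.
 rewrite (_ : 2 * h ^+ 2 * _ * _ = h ^+ 2 * (2 * (bcst b L * ((1 + nsq x) * expR (euler_rate * (k%:R * h)))))); last by ring.
 apply: ler_pM; rewrite ?sqr_ge0//; first by nneg.
 by rewrite ler_pM2l// ler_wpM2l// ler_wpM2l// addr_ge0.
by rewrite [leRHS]mulrDr; apply: lerD => //; rewrite le_eqVlt; apply/orP; left; apply/eqP; ring.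
Qed.

Lemma euler_path_increment k s t om : (k < N)%N -> k%:R * h <= s -> s < t -> t <= k.+1%:R * h ->
 euler_path t om - euler_path s om =
 (t - s) *: b (euler_pc t om) + sigma (euler_pc t om) *: (W t om - W s om).
Proof.
move=> kN ks st tk; rewrite (euler_pcE om kN (le_lt_trans ks st) tk).
rewrite (euler_pathE om kN (le_trans ks (ltW st)) tk) (euler_pathE om kN ks (le_trans (ltW st) tk)).
by apply/rowP => i; rewrite !mxE; ring.
Qed.

Lemma Fmeas_euler_pc k s t : (k < N)%N -> k%:R * h <= s -> s < t -> t <= k.+1%:R * h ->
 Fmeas F s (euler_pc t).
Proof.
move=> kN ks st tk; rewrite (_ : euler_pc t = euler k).
 by apply: (Fmeas_mono hF _ ks (@Fmeas_euler k)); rewrite mulr_ge0// ltW.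
by apply/funext => om; rewrite (euler_pcE om kN (le_lt_trans ks st) tk).
Qed.

End euler.

Section maximal_inequality.
Context {R : realType} {d : nat} {disp} {Omega : measurableType disp} (P : probability Omega R) (F : R -> set (set Omega))
 (hF : is_filtration P F) (W : R -> Omega -> 'rV[R]_d) (hW : is_brownian_motion P F W) (i : 'I_d) (tau : nat -> R)
 (phi : nat -> Omega -> R) (n : nat) (tau0 : 0 <= tau 0%N) (tauS : forall j, (j < n)%N -> tau j <= tau j.+1)
 (Fphi : forall j, (j < n)%N -> Fmeas F (tau j) (phi j)).
Local Notation M := (dsum W i tau phi).

Let small (a : R) (k : nat) : set Omega := [set om | forall l, (l <= k)%N -> `|M l om| < a].

Let tau_le j k : (j <= k)%N -> (k <= n)%N -> 0 <= tau j /\ tau j <= tau k.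
Proof.
have t0 k' : (k' <= n)%N -> 0 <= tau k'.
 by elim: k' => // k' IH kn; apply: le_trans (IH (ltnW kn)) (tauS _).
move=> jk kn; split; first exact/t0/(leq_trans jk).
elim: k jk kn => [|k IH]; first by rewrite leqn0 => /eqP ->.
rewrite leq_eqVlt => /orP[/eqP ->//|]; rewrite ltnS => jk kn.
by apply: le_trans (IH jk (ltnW kn)) (tauS _).
Qed.

Let Fsmall a k : (k <= n)%N -> F (tau k) (small a k).
Proof.
move=> kn.
have [tk0 _] := tau_le (leqnn k) kn.
have FM l : (l <= k)%N -> Fmeas F (tau k) (M l).
 move=> lk; have [tl0 tlk] := tau_le lk kn.
 apply: (Fmeas_mono hF tl0 tlk); apply: (Fmeas_dsum hF hW i tau0) => j jl;
  [apply: tauS|apply: Fphi]; exact: leq_trans (leq_trans jl lk) kn.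
rewrite -(F_sigma_algebraE hF tk0).
rewrite (_ : small a k = \bigcap_(l in [set l | (l <= k)%N]) ((fun om => `|M l om|) @^-1` `]-oo, a[%classic)); last first.
 by [].
have : measurable (\bigcap_(l in [set l | (l <= k)%N]) ((fun om : g_sigma_algebraType (F (tau k)) => `|M l om|) @^-1` `]-oo, a[%classic)).
 apply: bigcap_measurable; first by exists 0%N.
 move=> l lk; rewrite -[X in measurable X]setTI.
 have mM : measurable_fun [set: g_sigma_algebraType (F (tau k))] (fun om => `|M l om|).
  by apply: (mcomp (f := fun r : R => `|r|)) => //; exact: FM.
 by apply: mM => //; exact: measurable_itv.
by [].
Qed.

(* The sum is stopped as soon as it leaves the interval. *)
Lemma dsum_maximal (a : R) : 0 < a ->
 ((a ^+ 2)%:E * P [set om | exists2 j, (j <= n)%N & (a <= `|M j om|)%R] <=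
  \sum_(j < n) (tau j.+1 - tau j)%:E * nint P (fun om => (phi j om) ^+ 2)%R)%E.
Proof.
move=> a0; pose psi k om := phi k om * \1_(small a k) om.
have Fpsi j : (j < n)%N -> Fmeas F (tau j) (psi j).
 move=> jn; have [tj0 _] := tau_le (leqnn j) (ltnW jn).
 apply: measurable_funM; first exact: Fphi.
 by apply: (Fmeas_indic hF tj0); apply: Fsmall; exact: ltnW.
pose M' := dsum W i tau psi.
have inv om k : (small a k om /\ M' k om = M k om) \/ (a <= `|M' k om| /\ ~ small a k om).
 elim: k => [|k [[sk e]|[ak nsk]]].
 - by left; split; [move=> l; rewrite leqn0 => /eqP ->; rewrite /dsum big_ord0 normr0|rewrite /M' /dsum !big_ord0].
 - have e' : M' k.+1 om = M k.+1 om.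
   by move: e; rewrite /M' /dsum !big_ord_recr/= => ->; rewrite /psi indicE mem_set// mulr1.
  have [h|h] := ltP `|M k.+1 om| a.
   by left; split => // l; rewrite leq_eqVlt => /orP[/eqP ->//|]; rewrite ltnS; exact: sk.
  by right; split; [rewrite e'|move=> /(_ k.+1 (leqnn _)); rewrite ltNge h].
 - right; split; last by move=> h; apply: nsk => l lk; apply: h; exact: leqW.
  have pk : psi k om = 0 by rewrite /psi indicE memNset// mulr0.
  by move: ak; rewrite /M' /dsum big_ord_recr/= pk mul0r addr0.
have mM' : meas (M' n).
 have [tn0 _] := tau_le (leqnn n) (leqnn n).
 by apply: (Fmeas_meas hF tn0); exact: (Fmeas_dsum hF hW i tau0).
have nM : nnm (fun om => (M' n om) ^+ 2) by exact: nnm_sqr.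
have -> : [set om | exists2 j, (j <= n)%N & a <= `|M j om|] = [set om | a ^+ 2 <= (M' n om) ^+ 2].
 apply/seteqP; split=> om /=; rewrite -[M' n om ^+ 2]real_normK ?num_real// ler_sqr ?nnegrE ?(ltW a0)//.
  by move=> [j jn aj]; case: (inv om n) => [[/(_ j jn)]|[]//]; rewrite ltNge aj.
 move=> aM; case: (inv om n) => [[sn e]|[_ ns]]; first by exists n; rewrite -?e.
 by apply: contrapT => h; apply: ns => l ln; rewrite ltNge; apply/negP => al; apply: h; exists l.
apply: le_trans (nint_markov P nM _) _; first by nneg.
rewrite /nint (dsum_isometry hF hW i tau0 tauS Fpsi); apply: lee_sum => j _.
apply: lee_wpmul2l; first by rewrite lee_fin subr_ge0 tauS.
have [tj0 _] := tau_le (leqnn j) (ltnW (ltn_ord j)).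
have mp := Fmeas_meas hF tj0 (Fphi (ltn_ord j)).
apply: le_nint; [apply: nnm_sqr; exact: (Fmeas_meas hF tj0 (Fpsi j (ltn_ord j)))|exact: nnm_sqr|].
move=> om; rewrite /psi indicE; case: (_ \in _); first by rewrite mulr1.
by rewrite mulr0 expr0n sqr_ge0.
Qed.

End maximal_inequality.

Lemma sqr_sum_le {R : realType} (n : nat) (a : nat -> R) :
 (\sum_(l < n) a l) ^+ 2 <= n%:R * \sum_(l < n) (a l) ^+ 2.
Proof.
elim: n => [|n IH]; first by rewrite !big_ord0 expr0n mul0r.
rewrite !big_ord_recr/= sqrrD -natr1.
have : (\sum_(l < n) a l) * a n *+ 2 <= \sum_(l < n) (a l) ^+ 2 + n%:R * (a n) ^+ 2.
 have -> : n%:R * a n ^+ 2 = \sum_(l < n) a n ^+ 2 by rewrite sumr_const card_ord mulr_natl.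
 rewrite -big_split/= mulr_suml -sumrMnl.
 by apply: ler_sum => l _; have := sqr_ge0 (a l - a n); rewrite sqrrB; lra.
move: IH; move: (\sum_(l < n) a l) (\sum_(l < n) _) => S Q; nra.
Qed.

Lemma meas_exists_le {R : realType} {disp : measure_display} {T : measurableType disp}
 (n : nat) (A : nat -> set T) : (forall j, (j <= n)%N -> measurable (A j)) ->
 measurable [set x | exists2 j, (j <= n)%N & A j x].
Proof.
move=> mA; rewrite (_ : [set x | _] = \bigcup_(j in [set j | (j <= n)%N]) A j).
 by apply: bigcup_measurable => j; exact: mA.
by [].
Qed.

Lemma meas_ge_set {R : realType} {disp : measure_display} {T : measurableType disp}
 (a : R) (f : T -> R) : meas f -> measurable [set x | a <= f x].
Proof.
move=> mf; rewrite (_ : [set x | _] = f @^-1` `[a, +oo[%classic); last first.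
 by apply/seteqP; split=> x; rewrite /= in_itv/= andbT.
by rewrite -[X in measurable X]setTI; apply: mf => //; exact: measurable_itv.
Qed.

Lemma nsqBE {R : realType} {d : nat} (x y : 'rV[R]_d) : nsq (x - y) = \sum_(i < d) (x 0 i - y 0 i) ^+ 2.
Proof. by apply: eq_bigr => i _; rewrite !mxE. Qed.

Lemma nint_off_null {R : realType} {disp : measure_display} {T : measurableType disp}
 (m : {measure set T -> \bar R}) (N : set T) (f g : T -> R) : measurable N -> m N = 0%E ->
 nnm f -> nnm g -> (forall x, ~ N x -> f x = g x) -> nint m f = nint m g.
Proof.
move=> mN N0 [mf f0] [mg g0] fg; apply: ge0_ae_eq_integral => //.
- by mble.
- by mble.
- by nneg.
- by nneg.
exists N; split => // x /= h; apply: contrapT => nN; apply: h => _; by rewrite fg.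
Qed.

Lemma nint_fatou {R : realType} {disp : measure_display} {T : measurableType disp}
 (m : {measure set T -> \bar R}) (f : nat -> T -> R) (g : T -> R) (c : \bar R) (n0 : nat) :
 (forall n, nnm (f n)) -> (forall x, f n x @[n --> \oo] --> g x) ->
 (forall n, (n0 <= n)%N -> (nint m (f n) <= c)%E) -> (nint m g <= c)%E.
Proof.
move=> nf fg fc; have := @fatou _ _ _ m setT measurableT (fun n x => (f (n + n0)%N x)%:E) _ _.
have -> : (\int[m]_x limn_einf (fun n => (f (n + n0)%N x)%:E) = nint m g)%E.
 apply: eq_integral => x _.
 have cv : (f (n + n0)%N x)%:E @[n --> \oo] --> (g x)%:E.
  apply: cvg_EFin; first by near=> n.
  by have := fg x; rewrite -(cvg_shiftn n0).
 by rewrite is_cvg_limn_einfE; [exact/cvg_lim/cv|apply: cvgP; exact: cv].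
move=> h; apply: le_trans (h _ _) _.
- by move=> n; apply: meas_EFin; case: (nf (n + n0)%N).
- by move=> n x _; rewrite lee_fin; case: (nf (n + n0)%N).
rewrite limn_einf_lim; apply: lime_le; first exact: is_cvg_einfs.
near=> n; apply: le_trans (fc (n + n0)%N (leq_addl _ _)).
by apply: ereal_inf_lbound; exists n => //=.
Unshelve. all: by end_near. Qed.

Lemma cvg_nsqB {R : realType} {d : nat} (x y : 'rV[R]_d) (u : nat -> 'rV[R]_d) :
 (forall i, u n 0 i @[n --> \oo] --> y 0 i) -> nsq (x - u n) @[n --> \oo] --> nsq (x - y).
Proof.
move=> h; rewrite nsqBE; under eq_fun do rewrite nsqBE.
apply: (@cvg_big _ _ +%R 0 _ add_continuous) => i _.
have c : x 0 i - u n 0 i @[n --> \oo] --> x 0 i - y 0 i by apply: cvgB; [exact: cvg_cst|exact: h].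
exact: (cvgM c c).
Qed.

Lemma subr_via2 (V : zmodType) (u v p q : V) : u - v = - (p - u) + (p - q) + (q - v).
Proof. by rewrite opprB !addrA !subrK. Qed.

Section existence.
Context {R : realType} {d : nat} {disp} {Omega : measurableType disp} (P : probability Omega R) (F : R -> set (set Omega))
 (hF : is_filtration P F) (W : R -> Omega -> 'rV[R]_d) (hW : is_brownian_motion P F W)
 (mW : forall t, meas (W t)) (cW : forall om, continuous (W ^~ om)) (b : 'rV[R]_d -> 'rV[R]_d)
 (sigma : 'rV[R]_d -> R) (L C : R) (hbs : lip_coefs b sigma L C) (x : 'rV[R]_d).
Local Notation leb := (@lebesgue_measure R).

Definition mesh (n : nat) : R := (8 ^ n)%:R^-1.
Definition msteps (n : nat) : nat := (8 ^ n * 8 ^ n)%N.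
Local Notation Y n := (euler_path W b sigma x (mesh n) (msteps n)).
Local Notation Z n := (euler_pc W b sigma x (mesh n) (msteps n)).

Lemma mesh_gt0 n : 0 < mesh n.
Proof. by rewrite invr_gt0 ltr0n expn_gt0. Qed.

Lemma mesh_le m n : (n <= m)%N -> mesh m <= mesh n.
Proof. by move=> nm; rewrite lef_pV2 ?posrE ?ltr0n ?expn_gt0// ler_nat leq_exp2l. Qed.

Lemma mesh_le1 n : mesh n <= 1.
Proof. by rewrite -invr1 lef_pV2 ?posrE ?ltr0n ?expn_gt0// ler1n expn_gt0. Qed.

Lemma msteps_mesh n : (msteps n)%:R * mesh n = (8 ^ n)%:R.
Proof. by rewrite /msteps natrM /mesh mulfK// pnatr_eq0 expn_eq0. Qed.

Lemma horizon_le (T n : nat) : (T <= n)%N -> T%:R <= (msteps n)%:R * mesh n.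
Proof.
by move=> Tn; rewrite msteps_mesh ler_nat (leq_trans Tn)// ltnW// ltn_expl.
Qed.

Lemma euler_cauchy (T : nat) : exists2 K : R, 0 <= K &
 forall n m, (T <= n)%N -> (n <= m)%N -> forall t, 0 <= t -> t <= T%:R ->
 [/\ (nint P (fun om => nsq (Y n t om - Y m t om)) <= (K * mesh n)%:E)%E,
   (nint P (fun om => nsq (Z n t om - Z m t om)) <= (K * mesh n)%:E)%E &
   (nint P (fun om => nsq (Y n t om - Z n t om)) <= (K * mesh n)%:E)%E].
Proof.
pose e := @euler_cst R d b L C x T%:R; pose s := @stab_cst R d L T%:R.
have [/ltW L0 _ _ _ _] := hbs.
have e0 : 0 <= e.
 have := euler_rate_ge0 hbs; have := bcst_ge0 hbs => bc r0; rewrite /e /euler_cst addr_ge0//.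
  by nneg.
 by nneg.
have s0 : 0 <= s.
 have k0 : 0 <= stab_kap (d := d) L T%:R.
  by rewrite /stab_kap addr_ge0// mulr_ge0// addr_ge0// mulr_ge0// mulr_ge0.
 rewrite /s /stab_cst mulr_ge0// addr_ge0// mulr_ge0 ?expR_ge0// ?mulr_ge0//.
have se0 : 0 <= s * e by nneg.
exists (3 * (s * e) + 6 * e); first by nneg.
move=> n m Tn nm t t0 tT.
have Tm := leq_trans Tn nm.
have T0 : (0 : R) <= T%:R by [].
have h0 := mesh_gt0.
have mn0 := ltW (h0 n).
have close p r : (T <= p)%N -> (n <= p)%N -> 0 <= r -> r <= T%:R ->
  (nint P (fun om => nsq (Y p r om - Z p r om)) <= (mesh n * e)%:E)%E.
 move=> Tp np r0 rT; apply: le_trans (euler_path_pc_close hF hW mW hbs x (h0 p) (mesh_le1 p) r0 rT (horizon_le Tp)) _.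
 by rewrite lee_fin ler_wpM2r// mesh_le.
have Yn := approx_sol_euler hF hW mW cW hbs x (h0 n) T0 (horizon_le Tn).
have Ym := approx_sol_euler hF hW mW cW hbs x (h0 m) T0 (horizon_le Tm).
have yy : (nint P (fun om => nsq (Y n t om - Y m t om)) <= (s * e * mesh n)%:E)%E.
 apply: le_trans (stability hF hW hbs T0 Yn Ym (mulr_ge0 mn0 e0) (fun r => close n r Tn (leqnn n)) (fun r => close m r Tm nm) t0 tT) _.
 by rewrite subrr nsq0 add0r lee_fin -/s; rewrite le_eqVlt; apply/orP; left; apply/eqP; ring.
have [mYn mZn _ _ _] := Yn; have [mYm mZm _ _ _] := Ym.
have nn (U V : R -> Omega -> 'rV[R]_d) : jmeasV U -> jmeasV V -> nnm (fun om => nsq (U t om - V t om)).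
 by move=> mU mV; split=> [|om]; [exact: (jmeas_meas t (jmeasV_nsqB mU mV))|exact: nsq_ge0].
split.
- by apply: le_trans yy _; rewrite lee_fin ler_wpM2r//; lra.
- have h3 := (nint_le_lin3 (m := P) (a := 3) (b := 3) (c := 3) (nn _ _ mZn mZm) (nn _ _ mYn mZn) (nn _ _ mYn mYm) (nn _ _ mYm mZm)
  _ _ _ _ (close n t Tn (leqnn n) t0 tT) yy (close m t Tm nm t0 tT)).
 apply: le_trans (h3 _ _ _ _) _ => //.
  move=> om; rewrite [in leLHS](_ : Z n t om - Z m t om = (Z n t om - Y n t om) + (Y n t om - Y m t om) + (Y m t om - Z m t om)).
   by apply: le_trans (nsqD3 _ _ _) _; rewrite (nsqC (Z n t om)).
  by apply/rowP => i; rewrite !mxE; ring.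
 by rewrite lee_fin le_eqVlt; apply/orP; left; apply/eqP; ring.
- apply: le_trans (close n t Tn (leqnn n) t0 tT) _; rewrite lee_fin mulrC ler_wpM2r//; lra.
Qed.

Lemma fine_interval (T p m l : nat) : (T <= p)%N -> (p <= m)%N -> (l < T * 8 ^ m)%N ->
 exists k, [/\ (k < msteps p)%N, k%:R * mesh p <= l%:R * mesh m & l.+1%:R * mesh m <= k.+1%:R * mesh p].
Proof.
move=> Tp pm lT; pose q := (8 ^ (m - p))%N.
have q0 : (0 < q)%N by rewrite expn_gt0.
have e8 : (8 ^ m = 8 ^ p * q)%N by rewrite -expnD subnKC.
have em : mesh p = q%:R * mesh m.
 rewrite /mesh e8 natrM invfM mulrCA mulfV ?mulr1// pnatr_eq0 -lt0n//.
have m0 := mesh_gt0 m.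
exists (l %/ q)%N; split.
- rewrite ltn_divLR// /msteps -mulnA -e8; apply: leq_trans lT _.
 by rewrite leq_mul2r (leq_trans Tp) ?orbT// ltnW// ltn_expl.
- by rewrite em mulrA -natrM ler_pM2r// ler_nat leq_divM.
- by rewrite em mulrA -natrM ler_pM2r// ler_nat ltn_ceil.
Qed.

Definition ediff (n : nat) (t : R) (om : Omega) : 'rV[R]_d := Y n t om - Y n.+1 t om.

Definition bad_level (T n m : nat) : set Omega :=
 [set om | exists2 j, (j <= T * 8 ^ m)%N &
   (2 + 2 * d%:R) * (2 ^+ n)^-1 ^+ 2 <= nsq (ediff n (j%:R * mesh m) om)].

Lemma meas_bad_level T n m : measurable (bad_level T n m).
Proof.
apply: (@meas_exists_le R) => j _.
apply: meas_ge_set; apply: meas_nsqf.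
by apply: meas_rVB; apply: (meas_euler_path hF hW mW hbs); exact: mesh_gt0.
Qed.

Lemma bad_level_le (T : nat) : exists2 K : R, 0 <= K &
 forall n m, (T <= n)%N -> (n < m)%N -> (P (bad_level T n m) <= (K * (2 ^+ n)^-1)%:E)%E.
Proof.
have [K K0 hK] := euler_cauchy T; have [/ltW L0 _ bL sL _] := hbs.
pose K2 := L * K * T%:R * (T%:R + d%:R).
have K20 : 0 <= K2 by rewrite /K2 !mulr_ge0.
exists K2 => // n m Tn nm; have nm' := ltnW nm.
pose J := (T * 8 ^ m)%N; pose h := mesh m; have h0 : 0 < h by exact: mesh_gt0.
pose tau (l : nat) : R := l%:R * h.
have Jh : J%:R * h = T%:R by rewrite /J natrM /h /mesh mulfK// pnatr_eq0 expn_eq0.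
pose zb l om : 'rV[R]_d := b (Z n (tau l.+1) om) - b (Z n.+1 (tau l.+1) om).
pose phi l om := sigma (Z n (tau l.+1) om) - sigma (Z n.+1 (tau l.+1) om).
have tau0 : 0 <= tau 0%N by rewrite /tau mul0r.
have tauS j : tau j < tau j.+1 by rewrite /tau ltr_pM2r// ltr_nat.
have tauT l : (l < J)%N -> 0 <= tau l.+1 /\ tau l.+1 <= T%:R.
 by move=> lJ; split; [rewrite mulr_ge0// ltW|rewrite -Jh ler_pM2r// ler_nat].
have mZ p t : meas (Z p t).
 have mZ := jmeasV_euler_pc hF hW hbs x (msteps p) (mesh_gt0 p).
 by apply: meas_rVP => i; exact: (jmeas_meas t (jmeasV_coord i mZ)).
have FZ p l : (T <= p)%N -> (p <= m)%N -> (l < J)%N -> Fmeas F (tau l) (Z p (tau l.+1)).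
 move=> Tp pm lJ; have [k [kN a c]] := fine_interval Tp pm lJ.
 exact: (Fmeas_euler_pc hF hW hbs x (mesh_gt0 p) kN a (tauS l) c).
have incr p l om : (T <= p)%N -> (p <= m)%N -> (l < J)%N -> Y p (tau l.+1) om - Y p (tau l) om =
  h *: b (Z p (tau l.+1) om) + sigma (Z p (tau l.+1) om) *: (W (tau l.+1) om - W (tau l) om).
 move=> Tp pm lJ; have [k [kN a c]] := fine_interval Tp pm lJ.
 rewrite (euler_path_increment _ _ _ _ (mesh_gt0 p) om kN a (tauS l) c); congr (_ *: _ + _).
 by rewrite /tau -mulrBl -natr1 addrAC subrr add0r mul1r.
have Tn1 := leq_trans Tn (leqnSn n).
have Fphi j : (j < J)%N -> Fmeas F (tau j) (phi j).
 have ms := meas_sigma hbs; move=> jJ; apply: measurable_funB.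
  exact: (Fmeas_comp ms (FZ n j Tn nm' jJ)).
 exact: (Fmeas_comp ms (FZ n.+1 j Tn1 nm jJ)).
have DE j om i : (j <= J)%N -> ediff n (tau j) om 0 i = \sum_(l < j) h * zb l om 0 i + dsum W i tau phi j om.
 move=> jJ.
 have d0 : ediff n (tau 0%N) om 0 i = 0.
  by rewrite /ediff /tau mul0r !euler_path_neg ?subrr ?mxE//; exact: mesh_gt0.
 have := sum_telescope_upto (fun j => ediff n (tau j) om 0 i) j; rewrite d0 subr0 => <-.
 rewrite /dsum -big_split/=.
 apply: eq_bigr => l _; have lJ := leq_trans (ltn_ord l) jJ.
 rewrite /ediff !mxE (_ : _ - _ = (Y n (tau l.+1) om - Y n (tau l) om) 0 i - (Y n.+1 (tau l.+1) om - Y n.+1 (tau l) om) 0 i).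
  by rewrite (incr n)// (incr n.+1)// /zb /phi !mxE; ring.
 by rewrite !mxE; ring.
pose a : R := (2 ^+ n)^-1; have a0 : 0 < a by rewrite invr_gt0 exprn_gt0.
pose Q om := T%:R * \sum_(l < J) h * nsq (zb l om).
pose B0 := [set om | a ^+ 2 <= Q om].
pose Bi i := [set om | exists2 j, (j <= J)%N & a <= `|dsum W i tau phi j om|].
have mzb l : meas (zb l).
 by have mb := meas_b hbs; apply: meas_rVB; apply: (mcomp mb).
have nzb l : nnm (fun om => nsq (zb l om)) by split=> [|om]; [exact: meas_nsqf|exact: nsq_ge0].
have nQ : nnm Q by apply: nnmZ => //; apply: nnm_sum => l; apply: nnmZ => //; exact: ltW.
have mB0 : measurable B0. by apply: meas_ge_set; case: nQ.
have mdsum i j : (j <= J)%N -> meas (dsum W i tau phi j).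
 move=> jJ; have tj0 : 0 <= tau j by rewrite mulr_ge0// ltW.
 apply: (Fmeas_meas hF tj0); apply: (Fmeas_dsum hF hW) => // l lj; first exact: ltW.
 exact: Fphi (leq_trans lj jJ).
have mBi i : measurable (Bi i).
 apply: (@meas_exists_le R) => j jJ.
 by apply: meas_ge_set; apply: mcomp => //; exact: mdsum.
have sub om : bad_level T n m om -> B0 om \/ exists i, Bi i om.
 move=> [j jJ hj]; apply: contrapT => /not_orP[/negP nB0 /forallNP nBi].
 have {}nB0 : Q om < a ^+ 2 by rewrite ltNge.
 move: hj; rewrite leNgt => /negP; apply.
 pose A : 'rV[R]_d := \row_i \sum_(l < j) h * zb l om 0 i.
 pose Mv : 'rV[R]_d := \row_i dsum W i tau phi j om.
 rewrite (_ : ediff _ _ _ = A + Mv); last first.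
  by apply/rowP => i; rewrite [RHS]mxE [X in _ = X + _]mxE [X in _ = _ + X]mxE; exact: DE.
 apply: le_lt_trans (nsqD _ _) _.
 have hA : nsq A <= Q om.
  rewrite /nsq /Q; apply: (@le_trans _ _ (\sum_i (T%:R * \sum_(l < J) h * zb l om 0 i ^+ 2))).
   apply: ler_sum => i _; rewrite mxE; apply: le_trans (sqr_sum_le _ (fun l => h * zb l om 0 i)) _.
   apply: (@le_trans _ _ (J%:R * \sum_(l < J) (h * zb l om 0 i) ^+ 2)).
    apply: ler_pM => //; first by nneg.
     by rewrite ler_nat.
    rewrite -(subnKC (jJ : (j <= J)%N)) big_split_ord/= lerDl; apply: sumr_ge0 => l _; exact: sqr_ge0.
   rewrite -Jh -mulrA ler_wpM2l// mulr_sumr le_eqVlt; apply/orP; left; apply/eqP.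
   by apply: eq_bigr => l _; ring.
  rewrite -mulr_sumr ler_wpM2l// exchange_big/=; apply: ler_sum => l _.
  by rewrite mulr_sumr.
 have hM : nsq Mv <= d%:R * a ^+ 2.
  rewrite /nsq; apply: (@le_trans _ _ (\sum_(i < d) a ^+ 2)); last by rewrite sumr_const card_ord mulr_natl.
  apply: ler_sum => i _; rewrite mxE -real_normK ?num_real// lerXn2r ?nnegrE ?(ltW a0)//.
  by rewrite leNgt; apply/negP => /ltW h'; apply: (nBi i); exists j.
 rewrite -/a; lra.
have eX (X : R) : \sum_(l < J) h * X = T%:R * X by rewrite sumr_const card_ord -[_ *+ J]mulr_natl mulrA Jh.
have PB0 : ((a ^+ 2)%:E * P B0 <= (T%:R * (T%:R * (L * (K * mesh n))))%:E)%E.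
 apply: le_trans (nint_markov P nQ (exprn_gt0 2 a0)) _.
 rewrite nintZ//; last by apply: nnm_sum => l; apply: nnmZ => //; exact: ltW.
 rewrite EFinM lee_wpmul2l// nint_sum => [|l]; last by apply: nnmZ => //; exact: ltW.
 apply: (@le_trans _ _ (\sum_(l < J) (h * (L * (K * mesh n)))%:E)%E).
  apply: lee_sum => l _; rewrite nintZ ?(ltW h0)// EFinM lee_wpmul2l ?lee_fin ?(ltW h0)//.
  have [tl0 tlT] := tauT l (ltn_ord l); have [_ hz _] := hK n n.+1 Tn (leqnSn n) _ tl0 tlT.
  apply: (nint_le_lin1 _ _ L0 _ hz) => //; last by move=> om; exact: bL.
  by split=> [|om]; [apply: meas_nsqf; exact: meas_rVB|exact: nsq_ge0].
 by rewrite sumEFin lee_fin eX.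
have PBi i : ((a ^+ 2)%:E * P (Bi i) <= (T%:R * (L * (K * mesh n)))%:E)%E.
 apply: le_trans (dsum_maximal hF hW i tau0 (fun j _ => ltW (tauS j)) Fphi a0) _.
 apply: (@le_trans _ _ (\sum_(l < J) (h * (L * (K * mesh n)))%:E)%E).
  apply: lee_sum => l _; rewrite (_ : tau l.+1 - tau l = h); last first.
   by rewrite /tau -mulrBl -natr1 addrAC subrr add0r mul1r.
  rewrite EFinM lee_wpmul2l ?lee_fin ?(ltW h0)//.
  have [tl0 tlT] := tauT l (ltn_ord l); have [_ hz _] := hK n n.+1 Tn (leqnSn n) _ tl0 tlT.
  have ms := meas_sigma hbs.
  apply: (nint_le_lin1 _ _ L0 _ hz) => //; last by move=> om; exact: sL.
  + by apply: nnm_sqr; apply: measurable_funB; apply: (mcomp ms).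
  + by split=> [|om]; [apply: meas_nsqf; exact: meas_rVB|exact: nsq_ge0].
 by rewrite sumEFin lee_fin eX.
have Pbad : (P (bad_level T n m) <= P B0 + \sum_(i < d) P (Bi i))%E.
 rewrite -(nint_indic P (meas_bad_level T n m)) -(nint_indic P mB0).
 under eq_bigr do rewrite -(nint_indic P (mBi _)).
 have nI i : nnm (\1_(Bi i) : Omega -> R) by [].
 rewrite -nint_sum// -nintD//; last exact: nnm_sum.
 apply: le_nint; [exact/nnm_indic/meas_bad_level|by apply: nnmD; [exact: nnm_indic|exact: nnm_sum]|].
 move=> om; rewrite [leLHS]indicE; case: (boolP (om \in _)) => [/set_mem/sub[h'|[i hi]]|_].
 - by rewrite indicE mem_set// lerDl sumr_ge0.
 - by rewrite (bigD1 i)//= [\1_(Bi i) om]indicE mem_set// addrCA lerDl addr_ge0// sumr_ge0.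
 - by nneg.
have a2 : 0 < a ^+ 2 by nneg.
have key : ((a ^+ 2)%:E * P (bad_level T n m) <= (K2 * mesh n)%:E)%E.
 apply: (@le_trans _ _ ((a ^+ 2)%:E * (P B0 + \sum_(i < d) P (Bi i)))%E); first by rewrite lee_wpmul2l ?lee_fin ?(ltW a2).
 rewrite ge0_muleDr//; last by apply: sume_ge0.
 rewrite ge0_sume_distrr//.
 apply: (@le_trans _ _ ((T%:R * (T%:R * (L * (K * mesh n))))%:E + \sum_(i < d) (T%:R * (L * (K * mesh n)))%:E)%E).
  by apply: leeD => //; apply: lee_sum.
 rewrite sumEFin sumr_const card_ord -EFinD lee_fin -[_ *+ d]mulr_natl /K2 le_eqVlt; apply/orP; left; apply/eqP; ring.
have -> : K2 * (2 ^+ n)^-1 = (a ^+ 2)^-1 * (K2 * mesh n).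
 rewrite /a /mesh (_ : 8 = 2 ^ 3)%N// -expnM natrX mulnC exprM exprVn invrK.
 by field; rewrite expf_neq0.
by rewrite EFinM lee_pdivlMl.
Qed.

Definition bad (T n : nat) : set Omega := \bigcup_m bad_level T n (n.+1 + m).

Lemma meas_bad T n : measurable (bad T n).
Proof. by apply: bigcup_measurable => m _; exact: meas_bad_level. Qed.

Lemma bad_le (T : nat) : exists2 K : R, 0 <= K &
 forall n, (T <= n)%N -> (P (bad T n) <= (K * (2 ^+ n)^-1)%:E)%E.
Proof.
have [K K0 hK] := bad_level_le T; exists K => // n Tn.
have cv : P (bad_level T n (n.+1 + m)) @[m --> \oo] --> P (bad T n).
 apply: nondecreasing_cvg_mu; [by move=> m; exact: meas_bad_level|exact: meas_bad|].
 apply/nondecreasing_seqP => m; apply/subsetPset => om [j jJ hj]; exists (j * 8)%N.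
  by rewrite addnS expnS mulnA [(T * 8)%N]mulnC -mulnA mulnC leq_mul2l.
 rewrite addnS (_ : (j * 8)%:R * mesh _ = j%:R * mesh (n.+1 + m))//.
 by rewrite /mesh expnS !natrM invfM -mulrA mulrA; field; rewrite pnatr_eq0 expn_eq0.
rewrite -(cvg_lim _ cv)//; apply: lime_le; first by apply: cvgP; exact: cv.
by near=> m; apply: hK => //; exact: leq_addr.
Unshelve. all: by end_near. Qed.

Lemma continuous_ediff n om : continuous (fun t => nsq (ediff n t om)).
Proof.
apply: continuous_nsq => t; apply: cvgB; exact: continuous_euler_path.
Qed.

Lemma bad_small T n om : ~ bad T n om -> forall t, t <= T%:R ->
 nsq (ediff n t om) <= (2 + 2 * d%:R) * (2 ^+ n)^-1 ^+ 2.
Proof.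
move=> nb t tT; set c := (_ * _).
have [tn|t0] := ltP t 0.
 rewrite /ediff !euler_path_neg ?(ltW tn)//; try exact: mesh_gt0.
 by rewrite subrr nsq0 /c mulr_ge0 ?sqr_ge0// addr_ge0// mulr_ge0.
pose r (m : nat) : R := (Num.truncn (t * (8 ^ (n.+1 + m))%:R))%:R * mesh (n.+1 + m).
have rt m : t - mesh (n.+1 + m) <= r m /\ r m <= t.
 have y0 : 0 <= t * (8 ^ (n.+1 + m))%:R by nneg.
 have /andP[a1 a2] := truncn_itv y0.
 split; last by rewrite /r /mesh ler_pdivrMr.
 by rewrite lerBlDr /r -[X in _ + X]mul1r -mulrDl natr1 /mesh ler_pdivlMr// ltW.
have rc : r m @[m --> \oo] --> t.
 apply/cvgrPdist_le => e e0; near=> m.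
 have [a1 a2] := rt m; rewrite ger0_norm ?subr_ge0//.
 have : mesh (n.+1 + m) <= e.
  apply: (@le_trans _ _ (m.+1%:R^-1)).
   rewrite /mesh lef_pV2 ?posrE// ler_nat; apply: leq_trans (ltnW (ltn_expl _ (isT : 1 < 8)%N)).
   by rewrite addSn ltnS leq_addl.
  near: m; move/cvgrPdist_le: (@cvg_harmonic R) => /(_ _ e0).
  by apply: filterS => m; rewrite sub0r normrN ger0_norm// invr_ge0.
 by move: a1; lra.
have cv : nsq (ediff n (r m) om) @[m --> \oo] --> nsq (ediff n t om).
 by apply: (@continuous_cvg _ _ _ _ _ _ (fun t => nsq (ediff n t om))) => //; exact: continuous_ediff.
rewrite -(cvg_lim _ cv)//; apply: limr_le; first by apply: cvgP; exact: cv.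
near=> m; rewrite leNgt; apply/negP => /ltW h; apply: nb; exists m => //.
exists (Num.truncn (t * (8 ^ (n.+1 + m))%:R)) => //.
rewrite -(ler_nat R) natrM; have [_ a2] := rt m.
by rewrite -ler_pdivrMr//; exact: le_trans a2 tT.
Unshelve. all: by end_near. Qed.

Definition bad_null : set Omega := \bigcup_T lim_sup_set (fun k => bad T (k + T)).

Lemma meas_bad_null : measurable bad_null.
Proof.
apply: bigcup_measurable => T _; apply: bigcap_measurable; first by [].
by move=> k _; apply: bigcup_measurable => j _; exact: meas_bad.
Qed.

Lemma bad_null0 : P bad_null = 0%E.
Proof.
apply/eqP; rewrite -measure_le0.
apply: le_trans (measure_sigma_subadditive P (A := bad_null) (F := fun T => lim_sup_set (fun k => bad T (k + T))) _ _ _) _ => //.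
- move=> T; apply: bigcap_measurable; first by [].
 by move=> k _; apply: bigcup_measurable => j _; exact: meas_bad.
- exact: meas_bad_null.
rewrite eseries0// => T _ _; apply: lim_sup_set_cvg0; first by move=> k; exact: meas_bad.
have [K K0 hK] := bad_le T.
apply: (@le_lt_trans _ _ (\sum_(0 <= i <oo) ((2 * K) / (2 ^ i.+1)%:R)%:E)%E); last first.
 by apply: le_lt_trans (epsilon_trick0 _ _) (ltry _); rewrite mulr_ge0.
apply: lee_nneseries => k _ //; apply: le_trans (hK _ (leq_addl _ _)) _.
rewrite lee_fin (_ : 2 * K / (2 ^ k.+1)%:R = K * (2 ^+ k)^-1).
 by rewrite ler_wpM2l// lef_pV2 ?posrE ?exprn_gt0// ler_weXn2l ?leq_addr// ler1n.
by rewrite natrX exprS; field; rewrite expf_neq0.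
Qed.

Lemma good_close om : ~ bad_null om -> forall T : nat, exists n0, forall n, (n0 <= n)%N ->
 forall t, t <= T%:R -> nsq (ediff n t om) <= (2 + 2 * d%:R) * (2 ^+ n)^-1 ^+ 2.
Proof.
move=> nb T.
have : ~ lim_sup_set (fun k => bad T (k + T)) om by move=> h; apply: nb; exists T.
rewrite /lim_sup_set /bigcap /= => /existsNP[n0 /not_implyP[_ hn0]].
exists (n0 + T)%N => n n0n t tT; apply: (bad_small _ tT).
move=> hb; apply: hn0; exists (n - T)%N => /=; first by rewrite leq_subRL ?(leq_trans (leq_addl _ _) n0n)// addnC.
by rewrite subnK// (leq_trans (leq_addl _ _) n0n).
Qed.

Lemma geometric_cauchy (u : nat -> R) (c : R) (n0 : nat) : 0 <= c ->
 (forall n, (n0 <= n)%N -> `|u n - u n.+1| <= c * (2 ^+ n)^-1) ->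
 cvgn u /\ forall n, (n0 <= n)%N -> `|u n - limn u| <= 2 * c * (2 ^+ n)^-1.
Proof.
move=> c0 h.
have step n k : (n0 <= n)%N -> `|u n - u (n + k)%N| <= 2 * c * (2 ^+ n)^-1 - 2 * c * (2 ^+ (n + k))^-1.
 move=> nn; elim: k => [|k IH]; first by rewrite addn0 subrr normr0 subrr.
 rewrite addnS (_ : u n - _ = (u n - u (n + k)%N) + (u (n + k)%N - u (n + k).+1)); last by ring.
 apply: le_trans (ler_normD _ _) _.
 have := h (n + k)%N (leq_trans nn (leq_addr _ _)).
 rewrite [(2 ^+ (n + k).+1)]exprS invfM; lra.
have p2n (n : nat) : (n%:R : R) <= 2 ^+ n by rewrite -natrX ler_nat ltnW// ltn_expl.
have cv : cvgn u.
 apply/cauchy_cvgP/cauchy_exP => e e0; pose N := (n0 + (Num.truncn (2 * c / e)).+1)%N.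
 have N0 : (n0 <= N)%N by exact: leq_addr.
 have ce : 2 * c * (2 ^+ N)^-1 < e.
  rewrite ltr_pdivrMr// [ltRHS]mulrC -ltr_pdivrMr//; apply: lt_le_trans (truncnS_gt _) (le_trans _ (p2n N)).
  by rewrite ler_nat leq_addl.
 exists (u N); exists N => // n /= Nn; rewrite /ball/=.
 rewrite -(subnKC Nn); apply: le_lt_trans (step N _ N0) _; apply: le_lt_trans ce.
 by rewrite gerBl mulr_ge0 ?mulr_ge0// invr_ge0 ltW.
split => // n nn.
have cn : `|u n - u k| @[k --> \oo] --> `|u n - limn u|.
 by apply: cvg_norm; apply: cvgB; [exact: cvg_cst|exact: cv].
rewrite -(cvg_lim _ cn)//; apply: limr_le; first by apply: cvgP; exact: cn.
near=> k; have nk : (n <= k)%N by near: k; exact: nbhs_infty_ge.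
rewrite -(subnKC nk); apply: le_trans (step n _ nn) _.
by rewrite gerBl mulr_ge0 ?mulr_ge0// invr_ge0 ltW.
Unshelve. all: by end_near. Qed.

Definition sol (t : R) (om : Omega) : 'rV[R]_d :=
 if om \in bad_null then x else \row_i limn (fun n => Y n t om 0 i).

Definition sol_cst : R := 4 * ((2 + 2 * d%:R) * d%:R).

Lemma sol_close om : ~ bad_null om -> forall T : nat, exists n0, forall n, (n0 <= n)%N ->
 forall t, t <= T%:R -> nsq (Y n t om - sol t om) <= sol_cst * (2 ^+ n)^-1 ^+ 2 /\
  forall i, (Y k t om 0 i) @[k --> \oo] --> sol t om 0 i.
Proof.
move=> nb T; have [n0 h] := good_close nb T; exists n0 => n nn t tT.
pose c := Num.sqrt (2 + 2 * d%:R : R).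
have c0 : 0 <= c by exact: sqrtr_ge0.
have cc : c ^+ 2 = 2 + 2 * d%:R by rewrite sqr_sqrtr// addr_ge0// mulr_ge0.
have hi i k : (n0 <= k)%N -> `|Y k t om 0 i - Y k.+1 t om 0 i| <= c * (2 ^+ k)^-1.
 move=> nk; have q0 : 0 <= c * (2 ^+ k)^-1 by nneg.
 rewrite -ler_sqr ?nnegrE// real_normK ?num_real// exprMn cc.
 by have := sqr_coord_le (ediff k t om) i; rewrite !mxE => h1; apply: le_trans h1 (h k nk t tT).
have solE i : sol t om 0 i = limn (fun n => Y n t om 0 i) by rewrite /sol memNset// mxE.
have gc i := geometric_cauchy c0 (hi i).
split=> [|i]; last by rewrite solE; case: (gc i).
rewrite nsqBE /sol_cst; apply: (@le_trans _ _ (\sum_(i < d) (2 * c * (2 ^+ n)^-1) ^+ 2)).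
 apply: ler_sum => i _; rewrite -real_normK ?num_real// solE lerXn2r ?nnegrE//.
  by nneg.
 by have [_] := gc i; apply.
by rewrite sumr_const card_ord -mulr_natl !exprMn cc le_eqVlt; apply/orP; left; apply/eqP; ring.
Qed.

Lemma Fmeas_bad_null t : 0 <= t -> F t bad_null.
Proof.
move=> t0; apply: (F_mono hF (lexx 0) t0).
by have [_ _ _ h] := hF; apply: h; [exact: meas_bad_null|exact: bad_null0].
Qed.

Lemma Fmeas_sol t : 0 <= t -> Fmeas F t (sol t).
Proof.
move=> t0; apply: meas_rVP => i.
apply: (@measurable_fun_cvg _ (g_sigma_algebraType (F t)) _ _
 (fun n om => \1_bad_null om * x 0 i + (1 - \1_bad_null om) * Y n t om 0 i)).
 have mN : Fmeas F t (\1_bad_null : Omega -> R) by apply: (Fmeas_indic hF t0); exact: Fmeas_bad_null.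
 move=> n; apply: measurable_funD; apply: measurable_funM => //.
  by mble.
 by apply: meas_coordf; apply: (Fmeas_euler_path hF hW hbs) => //; exact: mesh_gt0.
move=> om _; rewrite /sol indicE; case: (boolP (om \in bad_null)) => [_|/negP nb] /=.
 by under eq_fun do rewrite subrr mul0r addr0 mul1r; exact: cvg_cst.
under eq_fun do rewrite subr0 mul0r add0r mul1r.
have {}nb : ~ bad_null om by move=> h; apply: nb; rewrite inE.
have [n0 hn0] := sol_close nb (Num.truncn t).+1.
have [_ /(_ i)] := hn0 n0 (leqnn _) t (ltW (truncnS_gt t)).
by rewrite /sol memNset.
Qed.

Lemma sol_neg t om : t <= 0 -> sol t om = x.
Proof.
move=> t0; rewrite /sol; case: ifP => // _; apply/rowP => i; rewrite mxE.
rewrite (_ : (fun n => _) = fun=> x 0 i); first exact: lim_cst.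
by apply/funext => n; rewrite euler_path_neg//; exact: mesh_gt0.
Qed.

Lemma meas_sol t : meas (sol t).
Proof.
have [t0|t0] := leP t 0; last exact: (Fmeas_meas hF (ltW t0) (Fmeas_sol (ltW t0))).
by rewrite (_ : sol t = fun=> x)//; apply/funext => om; exact: sol_neg.
Qed.

Lemma continuous_sol om : continuous (sol ^~ om).
Proof.
case: (boolP (om \in bad_null)) => [b0|/negP nb].
 by rewrite (_ : sol ^~ om = fun=> x); [exact: cst_continuous|apply/funext => t; rewrite /sol b0].
have {}nb : ~ bad_null om by move=> h; apply: nb; rewrite inE.
move=> t; apply/(@cvgrPdist_le _ _ _ (nbhs t)) => e e0.
have e3 : e / 3 + e / 3 + e / 3 = e by field.
have [n0 hn0] := sol_close nb (Num.truncn t).+1.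
pose K := sol_cst + 1.
have K0 : 0 < K by rewrite ltr_wpDl// /sol_cst mulr_ge0// mulr_ge0// addr_ge0// mulr_ge0.
pose N := (n0 + (Num.truncn (3 * K / e)).+1)%N.
have N0 : (n0 <= N)%N by exact: leq_addr.
have KN : K * (2 ^+ N)^-1 <= e / 3.
 rewrite ler_pdivrMr ?exprn_gt0//.
 have : 3 * K / e < 2 ^+ N.
  apply: lt_le_trans (truncnS_gt _) _; apply: (@le_trans _ _ (N%:R)); first by rewrite ler_nat leq_addl.
  by rewrite -natrX ler_nat ltnW// ltn_expl.
 rewrite ltr_pdivrMr//; lra.
have close s : s <= (Num.truncn t).+1%:R -> `|Y N s om - sol s om| <= e / 3.
 move=> sT; apply: le_trans (norm_le_enorm _) (le_trans _ KN).
 have q0 : 0 <= K * (2 ^+ N)^-1 by nneg.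
 apply: enorm_le_of_nsq => //; have [h _] := hn0 N N0 s sT; apply: le_trans h _.
 rewrite exprMn ler_wpM2r ?sqr_ge0// /K.
 have : 0 <= sol_cst by rewrite /sol_cst mulr_ge0// mulr_ge0// addr_ge0// mulr_ge0.
 by rewrite sqrrD1; set k := sol_cst; have := sqr_ge0 k; lra.
have cY : \forall s \near t, `|Y N t om - Y N s om| <= e / 3.
 have : continuous (Y N ^~ om) by exact: continuous_euler_path.
 by move=> /(_ t) /(@cvgrPdist_le _ _ _ (nbhs t)); apply; rewrite divr_gt0.
have ct : \forall s \near t, s <= (Num.truncn t).+1%:R.
 by apply: filterS (lt_nbhsl (truncnS_gt t)) => s /ltW.
near=> s.
have -> : sol t om - sol s om = - (Y N t om - sol t om) + (Y N t om - Y N s om) + (Y N s om - sol s om).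
 exact: subr_via2.
apply: le_trans (ler_normD _ _) _; apply: (@le_trans _ _ (`|- (Y N t om - sol t om)| + `|Y N t om - Y N s om| + `|Y N s om - sol s om|)).
 by rewrite lerD2r ler_normD.
rewrite normrN; have h1 := close t (ltW (truncnS_gt t)).
have h2 : `|Y N t om - Y N s om| <= e / 3 by near: s.
have h3 : `|Y N s om - sol s om| <= e / 3 by apply: close; near: s.
by apply: le_trans (lerD (lerD h1 h2) h3) _; rewrite e3.
Unshelve. all: by end_near. Qed.

(* Fatou *)
Lemma euler_sol_close (T : nat) : exists2 K : R, 0 <= K &
 forall n, (T <= n)%N -> forall t, 0 <= t -> t <= T%:R ->
 (nint P (fun om => nsq (Y n t om - sol t om)) <= (K * mesh n)%:E)%E.
Proof.
have [K K0 hK] := euler_cauchy T; exists K => // n Tn t t0 tT.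
have mY k : meas (Y k t).
 by apply: (meas_euler_path hF hW mW hbs); exact: mesh_gt0.
have mN := meas_bad_null.
pose f m om := nsq (Y n t om - Y m t om) * \1_(~` bad_null) om.
have nf m : nnm (f m).
 apply: nnmM; last by apply: nnm_indic; exact: measurableC.
 by split=> [|om]; [apply: meas_nsqf; exact: meas_rVB|exact: nsq_ge0].
have nl : nnm (fun om => nsq (Y n t om - sol t om) * \1_(~` bad_null) om).
 apply: nnmM; last by apply: nnm_indic; exact: measurableC.
 by split=> [|om]; [apply: meas_nsqf; apply: meas_rVB => //; exact: meas_sol|exact: nsq_ge0].
rewrite (@nint_off_null _ _ _ P bad_null _ (fun om => nsq (Y n t om - sol t om) * \1_(~` bad_null) om) mN bad_null0 _ nl); last 2 first.
- by split=> [|om]; [apply: meas_nsqf; apply: meas_rVB => //; exact: meas_sol|exact: nsq_ge0].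
- by move=> om nb; rewrite indicE mem_set// mulr1.
apply: (nint_fatou (n0 := n) nf) => [om|m nm].
 rewrite /f indicE; case: (boolP (om \in _)) => [/set_mem nb|_]; last first.
  by under eq_fun do rewrite /= mulr0; rewrite mulr0; exact: cvg_cst.
 rewrite mulr1; under eq_fun do rewrite /= mulr1.
 have [n0 /(_ n0 (leqnn _) t tT)[_ h]] := sol_close nb T.
 exact: cvg_nsqB.
have [h _ _] := hK n m Tn nm t t0 tT; apply: le_trans h; apply: le_nint => //.
 by split=> [|om]; [apply: meas_nsqf; exact: meas_rVB|exact: nsq_ge0].
by move=> om; rewrite /f ler_piMr ?nsq_ge0// indicE; case: (_ \in _).
Qed.

End existence.

Lemma coordB {R : realType} {d : nat} (x y : 'rV[R]_d) i : (x - y) 0 i = x 0 i - y 0 i.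
Proof. by rewrite !mxE. Qed.

Section convergence_criteria.
Context {R : realType} {disp} {Omega : measurableType disp} (P : probability Omega R).

Lemma measure_eq_off (N A B : set Omega) : measurable N -> P N = 0%E ->
 measurable A -> measurable B -> (forall om, ~ N om -> A om <-> B om) -> P A = P B.
Proof.
move=> mN N0 mA mB AB; rewrite -(nint_indic P mA) -(nint_indic P mB).
apply: (nint_off_null mN N0); [exact: nnm_indic|exact: nnm_indic|].
by move=> om /AB h; rewrite !indicE; congr (nat_of_bool _)%:R; apply/idP/idP => /set_mem/h/mem_set.
Qed.

Lemma emarkov (f : Omega -> \bar R) (e : R) : 0 < e -> meas f ->
 (forall om, 0 <= f om)%E ->
 (e%:E * P [set om | (e%:E <= f om)%E] <= \int[P]_om f om)%E.
Proof.
move=> e0 mf f0.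
have mA : measurable [set om | (e%:E <= f om)%E] by rewrite -[X in measurable X]setTI; exact: emeasurable_fun_c_infty.
rewrite -(nint_indic P mA) -(nintZ P (ltW e0)); last exact: nnm_indic.
apply: ge0_le_integral => //.
- by nneg.
- by mble.
move=> om _; rewrite indicE; case: (boolP (_ \in _)) => [/set_mem h|_]; first by rewrite mulr1.
by rewrite mulr0.
Qed.

Lemma cvg0_of_L1 (Y : nat -> Omega -> \bar R) : (forall n, meas (Y n)) ->
 (forall n om, 0 <= Y n om)%E ->
 (forall e : R, 0 < e -> exists N, forall n, (N <= n)%N -> (\int[P]_om Y n om <= e%:E)%E) ->
 cvg0_in_probability P Y.
Proof.
move=> mY Y0 h e e0; apply/cvge0P => // a a0.
have [N hN] := h (e * a) (mulr_gt0 e0 a0); exists N => n Nn.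
have := le_trans (emarkov e0 (mY n) (Y0 n)) (hN n Nn).
by rewrite EFinM lee_pmul2l// lte_fin.
Qed.

Lemma cvg0_of_L2 (D : nat -> Omega -> R) : (forall n, meas (D n)) ->
 (forall e : R, 0 < e -> exists N, forall n, (N <= n)%N -> (nint P (fun om => (D n om) ^+ 2)%R <= e%:E)%E) ->
 cvg0_in_probability P (fun n om => `|D n om|%:E).
Proof.
move=> mD h e e0; have e2 : 0 < e ^+ 2 by nneg.
have := @cvg0_of_L1 (fun n om => ((D n om) ^+ 2)%:E) _ _ h (e ^+ 2) e2.
rewrite (_ : (fun n => P [set w | (`|D n w|%:E >= e%:E)%E]) = (fun n => P [set om | ((e ^+ 2)%:E <= ((D n om) ^+ 2)%:E)%E])).
 apply; last by nneg.
 by mble.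
apply/funext => n; congr (P _); apply/seteqP.
by split=> om /=; rewrite !lee_fin -[D n om ^+ 2]real_normK ?num_real// ler_sqr ?nnegrE// ltW.
Qed.

End convergence_criteria.

Section is_solution_sol.
Context {R : realType} {d : nat} {disp} {Omega : measurableType disp} (P : probability Omega R) (F : R -> set (set Omega))
 (hF : is_filtration P F) (W : R -> Omega -> 'rV[R]_d) (hW : is_brownian_motion P F W)
 (mW : forall t, meas (W t)) (cW : forall om, continuous (W ^~ om)) (b : 'rV[R]_d -> 'rV[R]_d)
 (sigma : 'rV[R]_d -> R) (L C : R) (hbs : lip_coefs b sigma L C) (x : 'rV[R]_d).
Local Notation leb := (@lebesgue_measure R).
Local Notation M := (measurableTypeR R).
Local Notation Y n := (euler_path W b sigma x (@mesh R n) (msteps n)).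
Local Notation Z n := (euler_pc W b sigma x (@mesh R n) (msteps n)).
Local Notation X := (sol W b sigma x).

Lemma jmeasV_sol : jmeasV X.
Proof. by apply: jmeasV_continuous => [t|om]; [exact: (meas_sol hF hW mW cW hbs)|exact: (continuous_sol cW)]. Qed.

Lemma bounded_sol T : 0 <= T -> bounded_upto T X.
Proof. by move=> T0 om; apply: continuous_bounded => //; apply: continuous_nsq; exact: (continuous_sol cW). Qed.

Lemma mesh_small (e : R) : 0 < e -> exists N, forall n, (N <= n)%N -> (@mesh R n) <= e.
Proof.
move=> e0; exists (Num.truncn e^-1).+1 => n Nn.
rewrite /mesh -[e]invrK lef_pV2 ?posrE ?invr_gt0 ?ltr0n ?expn_gt0//.
apply: le_trans (ltW (truncnS_gt _)) _; rewrite ler_nat; apply: leq_trans Nn _.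
by rewrite ltnW// ltn_expl.
Qed.

Lemma euler_pc_sol_close (T : nat) : exists2 K : R, 0 <= K &
 forall n, (T <= n)%N -> forall t, 0 <= t -> t <= T%:R ->
 (nint P (fun om => nsq (Y n t om - X t om)) <= (K * (@mesh R n))%:E)%E /\
 (nint P (fun om => nsq (Z n t om - X t om)) <= (K * (@mesh R n))%:E)%E.
Proof.
have [K K0 hK] := euler_cauchy hF hW mW cW hbs x T.
have [K' K'0 hK'] := euler_sol_close hF hW mW cW hbs x T.
exists (2 * K + 2 * K'); first by nneg.
move=> n Tn t t0 tT; have [_ _ hYZ] := hK n n Tn (leqnn n) t t0 tT.
have hYX := hK' n Tn t t0 tT; have m0 := ltW (@mesh_gt0 R n).
split; first by apply: le_trans hYX _; rewrite lee_fin ler_wpM2r//; lra.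
have mY : meas (Y n t) by apply: (meas_euler_path hF hW mW hbs); exact: mesh_gt0.
have mX := meas_sol hF hW mW cW hbs x t.
have mZ : meas (Z n t).
 have jZ := jmeasV_euler_pc hF hW hbs x (msteps n) (@mesh_gt0 R n).
 by apply: meas_rVP => i; exact: (jmeas_meas t (jmeasV_coord i jZ)).
have nn (U V : Omega -> 'rV[R]_d) : meas U -> meas V -> nnm (fun om => nsq (U om - V om)).
 by move=> mU mV; split=> [|om]; [apply: meas_nsqf; exact: meas_rVB|exact: nsq_ge0].
have h3 := nint_le_lin2 (m := P) (a := 2) (b := 2) (nn _ _ mZ mX) (nn _ _ mY mZ) (nn _ _ mY mX) _ _ _ hYZ hYX.
apply: le_trans (h3 _ _ _) _ => //.
 by move=> om; rewrite -(subrKA (Y n t om)); apply: le_trans (nsqD _ _) _; rewrite (nsqC (Z n t om)).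
by rewrite lee_fin !mulrDl !mulrA.
Qed.

Lemma is_solution_sol : is_solution P F W b sigma x X.
Proof.
have [/ltW L0 _ bL sL _] := hbs.
split.
- by apply: (Fmeas_adapted hF) => t t0; exact: (Fmeas_sol hF hW mW cW hbs).
- by move=> om; apply: continuous_subspaceT; exact: (continuous_sol cW).
- by move=> om; exact: sol_neg.
move=> t t0 i; pose T := (Num.truncn t).+1; have tT : t <= T%:R by exact/ltW/truncnS_gt.
have [K K0 hK] := euler_pc_sol_close T.
have jX := jmeasV_sol; have bX := bounded_sol t0.
have h0 n := @mesh_gt0 R n.
have jZ n := jmeasV_euler_pc hF hW hbs x (msteps n) (h0 n).
have tN n : (T <= n)%N -> t <= (msteps n)%:R * (@mesh R n) by move=> Tn; exact: le_trans tT (horizon_le Tn).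
have jsig (V : R -> Omega -> 'rV[R]_d) : jmeasV V -> jmeas (fun s om => sigma (V s om)).
 by move=> mV; exact: (jmeasV_comp (meas_sigma hbs) mV).
have Ez n : (T <= n)%N -> (\int[P]_om tint t (fun s => nsq (Z n s om - X s om)) <= (K * (@mesh R n) * t)%:E)%E.
 move=> Tn; rewrite (jmeas_integral_swap P t (jmeasV_nsqB (jZ n) jX)); last by nneg.
 have k0 : 0 <= K * (@mesh R n) by nneg.
 apply: (@le_trans _ _ (\int[leb]_(s in `[0%R, t]) (K * (@mesh R n))%:E)%E).
  apply: ge0_le_integral => //.
  - by move=> s _; apply: nint_ge0 => om; exact: nsq_ge0.
  - apply: measurable_funTS; apply: (@meas_nint_time _ _ _ P (fun s om => nsq (Z n s om - X s om))).
    exact: jmeasV_nsqB.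
   by nneg.
  - move=> s; rewrite /= in_itv/= => /andP[s0 st]; have [_] := hK n Tn s s0 (le_trans st tT); exact.
 by rewrite (tintE t (fun=> K * (@mesh R n))) tint_cst.
have mz n : meas (fun om => tint t (fun s => nsq (Z n s om - X s om))).
 apply: (@meas_tint _ _ _ t (fun s om => nsq (Z n s om - X s om))); first exact: jmeasV_nsqB.
 by nneg.
have tz0 n om : (0 <= tint t (fun s => nsq (Z n s om - X s om)%R))%E by apply: tint_ge0 => s; exact: nsq_ge0.
pose c := 2 + L * t + 2 * t * L.
have c0 : 0 <= c by rewrite /c !addr_ge0// !mulr_ge0.
have small e : 0 < e -> exists N, forall n, (N <= n)%N -> c * (K * (@mesh R n) * (1 + t)) <= e.
 move=> e0; pose k := c * K * (1 + t) + 1.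
 have k0 : 0 < k by rewrite ltr_wpDl// !mulr_ge0// addr_ge0.
 have [N hN] := mesh_small (divr_gt0 e0 k0); exists N => n /hN hn.
 apply: (@le_trans _ _ (k * (@mesh R n))); last by move: hn; rewrite ler_pdivlMr// mulrC.
 by rewrite (_ : c * _ = c * K * (1 + t) * @mesh R n); [rewrite ler_wpM2r ?(ltW (h0 n))// /k lerDl|ring].
exists (fun n => euler_simple W b sigma x (@mesh R (n + T)) (msteps (n + T)) t); split.
- by move=> n; apply: (is_simple_euler hF hW hbs) => //; apply: tN; exact: leq_addl.
- rewrite (_ : (fun n om => _) = (fun n om => l2time t (psub (fun s om => sigma (Z (n + T) s om)) (fun s om => sigma (X s om))) om)); last first.
  apply/funext => n; apply/funext => om; rewrite -l2timeE -!integral_itv_obnd_cbnd.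
  + apply: eq_integral => s; rewrite inE/= in_itv/= => /andP[s0 st].
   by rewrite (euler_simple_fun _ _ _ _ (h0 _) om s0 st)//; apply: tN; exact: leq_addl.
  + apply: measurable_funTS; apply: meas_EFin; apply: measurable_funX.
   by apply: (@jmeas_section _ _ _ (psub (fun s om => sigma (Z (n + T) s om)) (fun s om => sigma (X s om)))); apply: jmeasB; exact: jsig.
  + apply: measurable_funTS; apply: meas_EFin; apply: measurable_funX; apply: measurable_funB; first exact: meas_simple_fun.
   by apply: (@jmeas_section _ _ _ (fun s om => sigma (X s om))); exact: jsig.
 apply: cvg0_of_L1.
 + by move=> n; apply: meas_l2time; apply: jmeasB; exact: jsig.
 + by move=> n om; exact: l2time_ge0.
 move=> e e0; have [N hN] := small e e0; exists N => n Nn.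
 apply: (@le_trans _ _ (L%:E * (K * (@mesh R (n + T)) * t)%:E)%E); last first.
  rewrite -EFinM lee_fin; apply: le_trans (hN _ (leq_trans Nn (leq_addr T n))).
  have q := mulr_ge0 K0 (ltW (h0 (n + T)%N)); have : 0 <= L * t by nneg.
  by move=> Lt; rewrite mulrCA [leRHS]mulrCA ler_wpM2l// /c; nra.
 apply: le_trans (lee_wpmul2l _ (Ez _ (leq_addl n T))); last by nneg.
 rewrite -ge0_integralZl//.
 apply: ge0_le_integral => //.
 + by move=> om _; exact: l2time_ge0.
 + by apply: meas_l2time; apply: jmeasB; exact: jsig.
 + exact: emeasurable_funM.
 move=> om _; rewrite -nintZ//; last first.
  by apply: nnm_tint; split=> [|s]; [apply: (@jmeas_section _ _ _ (fun s om => nsq (Z (n + T) s om - X s om))); exact: jmeasV_nsqB|exact: nsq_ge0].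
 apply: le_nint.
 + by apply: nnm_sqtime; apply: (@jmeas_section _ _ _ (psub (fun s om => sigma (Z (n + T) s om)) (fun s om => sigma (X s om)))); apply: jmeasB; exact: jsig.
 + apply: nnmZ => //; apply: nnm_tint; split=> [|s]; last exact: nsq_ge0.
  by apply: (@jmeas_section _ _ _ (fun s om => nsq (Z (n + T) s om - X s om))); exact: jmeasV_nsqB.
 by move=> s; rewrite /sqtime /psub mulrA ler_wpM2r.
have mY n : meas (Y n t) by apply: (meas_euler_path hF hW mW hbs).
have mX := meas_sol hF hW mW cW hbs x t.
have mb := meas_coordf i (meas_b hbs).
pose J n om := (\int[leb]_(s in `[0, t]) (b (Z n s om) 0 i - b (X s om) 0 i))%R.
have jb n : jmeas (fun s om => b (Z n s om) 0 i - b (X s om) 0 i).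
 by apply: measurable_funB; [exact: (jmeasV_comp mb (jZ n))|exact: (jmeasV_comp mb jX)].
have DE n om : simple_integral (euler_simple W b sigma x (@mesh R (n + T)) (msteps (n + T)) t) (fun s w => W s w 0 i) om
  - (X t om 0 i - x 0 i - \int[leb]_(s in `[0, t]) b (X s om) 0 i)%R = (Y (n + T) t om - X t om) 0 i - J (n + T)%N om.
 have tn := tN (n + T)%N (leq_addl _ _).
 rewrite (euler_simple_integral hF hW hbs x (h0 _) i om t0 tn) /ito_part /J RintegralB//; last 2 first.
 - by apply: (integrable_b hbs i om (lexx t)) => //; exact: bounded_euler_pc.
 - exact: (integrable_b hbs i om (lexx t)).
 by rewrite coordB; ring.
rewrite (_ : (fun n om => _) = (fun n om => `|(Y (n + T) t om - X t om) 0 i - J (n + T)%N om|%:E)); last first.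
 by apply/funext => n; apply/funext => om; rewrite DE.
apply: cvg0_of_L2.
 move=> n; apply: measurable_funB; first by mble.
 exact: (jmeas_meas t (jmeas_Rintegral (jb _))).
move=> e e0; have [N hN] := small e e0; exists N => n Nn.
have Tn := leq_addl n T; move: (n + T)%N Tn (leq_trans Nn (leq_addr T n)) => {n Nn} n Tn Nn.
have nYX : nnm (fun om => nsq (Y n t om - X t om)).
 by split=> [|om]; [apply: meas_nsqf; exact: meas_rVB|exact: nsq_ge0].
apply: (@le_trans _ _ (\int[P]_om (2%:E * (nsq (Y n t om - X t om))%:E + (2 * t * L)%:E * tint t (fun s => nsq (Z n s om - X s om))))%E).
 apply: ge0_le_integral => //.
 - by nneg.
 - apply: meas_EFin; apply: measurable_funX; apply: measurable_funB; first by mble.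
  exact: (jmeas_meas t (jmeas_Rintegral (jb _))).
 - apply: emeasurable_funD; apply: emeasurable_funM => //.
  by mble.
 move=> om _; apply: (@le_trans _ _ (2 * nsq (Y n t om - X t om) + 2 * (J n om) ^+ 2)%:E).
  rewrite lee_fin; have := sqr_coord_le (Y n t om - X t om) i.
  have := sqr_ge0 ((Y n t om - X t om) 0 i + J n om); rewrite sqrrD sqrrB; lra.
 rewrite EFinD [(2 * nsq _)%:E]EFinM leeD2l// -mulrA [(2 * (J n om) ^+ 2)%:E]EFinM [(2 * (t * L))%:E]EFinM -muleA lee_wpmul2l//.
 have mbn := jmeas_section om (jb n).
 apply: le_trans (sqr_Rintegral_le t0 mbn) _; rewrite [(t * L)%:E]EFinM -muleA lee_wpmul2l ?lee_fin// tintE -nintZ//; last first.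
  by apply: nnm_tint; split=> [|s]; [apply: (@jmeas_section _ _ _ (fun s om => nsq (Z n s om - X s om))); exact: jmeasV_nsqB|exact: nsq_ge0].
 apply: le_nint.
 - by apply: nnm_tint; exact: nnm_sqr.
 - apply: nnmZ => //; apply: nnm_tint; split=> [|s]; last exact: nsq_ge0.
  by apply: (@jmeas_section _ _ _ (fun s om => nsq (Z n s om - X s om))); exact: jmeasV_nsqB.
 move=> s; rewrite mulrA ler_wpM2r//; apply: le_trans (bL _ _).
 by have := sqr_coord_le (b (Z n s om) - b (X s om)) i; rewrite coordB.
rewrite (@ge0_integral_lin2 _ _ _ P 2 (2 * t * L) (fun om => (nsq (Y n t om - X t om))%:E) (fun om => tint t (fun s => nsq (Z n s om - X s om))))//; last 3 first.
- by nneg.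
- by nneg.
- by mble.
have [hY _] := hK n Tn t t0 tT.
apply: (@le_trans _ _ (2%:E * (K * (@mesh R n))%:E + (2 * t * L)%:E * (K * (@mesh R n) * t)%:E)%E).
 by apply: leeD; apply: lee_wpmul2l; rewrite ?lee_fin ?mulr_ge0//; exact: Ez.
rewrite -!EFinM -EFinD lee_fin; apply: le_trans (hN n Nn).
have q := mulr_ge0 K0 (ltW (h0 n)); have Lt : 0 <= L * t by nneg.
rewrite (_ : _ + _ = K * (@mesh R n) * (2 + 2 * t * L * t)); last by ring.
rewrite [leRHS]mulrCA ler_wpM2l// /c; have : 0 <= L * t * t by nneg.
nra.
Qed.

End is_solution_sol.

Lemma continuous_path_max {R : realType} {d : nat} (y : R -> 'rV[R]_d) :
 continuous_path y -> continuous (fun t : R => y (Num.max 0 t)).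
Proof.
move=> /subspace_continuousP cy t.
have m0 : [set t : R | 0 <= t] (Num.max 0 t) by rewrite /= le_max lexx.
have cm : (fun s : R => Num.max 0 s) @ t --> (Num.max 0 t : R).
 by apply: continuous_max; [exact: cst_continuous|exact: cvg_id].
apply: cvg_trans (cy _ m0) => A hA.
have hA' : \forall s \near (Num.max 0 t : R), 0 <= s -> A (y s) by exact: hA.
have h := cm _ hA'; rewrite /nbhs /=.
apply: (@filterS _ (nbhs t) _ _ _ _ h) => s /=; apply.
by rewrite le_max lexx.
Qed.

Section regularization.
Context {R : realType} {d : nat} {disp} {Omega : measurableType disp} (P : probability Omega R) (F : R -> set (set Omega))
 (hF : is_filtration P F).

Lemma meas_simple_integral (W : R -> Omega -> 'rV[R]_d) t i S : is_simple_process F t S ->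
 (forall t, 0 <= t -> meas (W t)) ->
 meas (simple_integral S (fun s om => W s om 0 i)).
Proof.
move=> sS mW; apply: measurable_sum => k.
have [kS k0] := (ltn_ord k, stime_ge0 sS (ltnW (ltn_ord k))).
apply: measurable_funM; first exact: (Fmeas_meas hF k0 (Fmeas_simple_val hF sS kS)).
by apply: measurable_funB; apply: meas_coordf; apply: mW => //; exact: (stime_ge0 sS).
Qed.

Lemma ito_transfer (N : set Omega) (W1 W2 : R -> Omega -> 'rV[R]_d) (H : R -> Omega -> R) t i I :
 measurable N -> P N = 0%E ->
 (forall t, 0 <= t -> meas (W1 t)) -> (forall t, 0 <= t -> meas (W2 t)) ->
 (forall om, ~ N om -> forall t, 0 <= t -> W1 t om = W2 t om) ->
 meas I ->
 is_ito_integral P F (fun s w => W1 s w 0 i) H t I -> is_ito_integral P F (fun s w => W2 s w 0 i) H t I.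
Proof.
move=> mN N0 mW1 mW2 W12 mI [S [sS cS cI]]; exists S; split => // e e0.
rewrite (_ : (fun n => _) = (fun n => P [set w | (e%:E <= `|simple_integral (S n) (fun s w => W1 s w 0%R i) w - I w|%:E)%E])).
 exact: cI.
apply/funext => n; apply: (measure_eq_off mN N0).
- under eq_set do rewrite lee_fin.
 apply: meas_ge_set; apply: mcomp => //; apply: measurable_funB => //.
 exact: meas_simple_integral.
- under eq_set do rewrite lee_fin.
 apply: meas_ge_set; apply: mcomp => //; apply: measurable_funB => //.
 exact: meas_simple_integral.
move=> om nN /=; rewrite (_ : simple_integral (S n) (fun s w => W2 s w 0 i) om = simple_integral (S n) (fun s w => W1 s w 0 i) om)//.
apply: eq_bigr => k _; have k0 := stime_ge0 (sS n) (ltnW (ltn_ord k)).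
by rewrite !W12//; exact: (stime_ge0 (sS n)).
Qed.

Lemma regular_brownian_motion (W : R -> Omega -> 'rV[R]_d) : is_brownian_motion P F W ->
 exists (N : set Omega) (W' : R -> Omega -> 'rV[R]_d), [/\ measurable N /\ P N = 0%E,
  is_brownian_motion P F W', (forall t, meas (W' t)), (forall om, continuous (W' ^~ om)) &
  forall om, ~ N om -> forall t, 0 <= t -> W t om = W' t om].
Proof.
move=> hW; have [W0 [N [mN N0 hN]] aW iW] := hW.
pose W' t om := if om \in N then 0 else W (Num.max 0 t) om.
have mx0 t : 0 <= Num.max 0 t :> R by rewrite le_max lexx.
have WW om : ~ N om -> forall t, 0 <= t -> W t om = W' t om.
 by move=> nN t t0; rewrite /W' memNset// max_r.
have F0 t : 0 <= t -> F t N.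
 by move=> t0; have [_ _ h1 h2] := hF; apply: (h1 0 t (lexx _) t0); exact: h2.
have FW' t : 0 <= t -> Fmeas F t (W' t).
 move=> t0; apply: meas_rVP => i.
 rewrite (_ : (fun om => _) = (fun om => (1 - \1_N om) * W t om 0 i)); last first.
  apply/funext => om; rewrite /W' indicE max_r//; case: (_ \in _) => /=.
   by rewrite mxE subrr mul0r.
  by rewrite subr0 mul1r.
 apply: measurable_funM; first by apply: measurable_funB => //; apply: (Fmeas_indic hF t0); exact: F0.
 by apply: meas_coordf; exact: (Fmeas_W hF hW).
have mW' t : meas (W' t).
 rewrite (_ : W' t = W' (Num.max 0 t)); last first.
  by apply/funext => om; rewrite /W' (max_r (mx0 t)).
 exact: (Fmeas_meas hF (mx0 t) (FW' _ (mx0 t))).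
have cW' om : continuous (W' ^~ om).
 case: (boolP (om \in N)) => [iN|/negP nN].
  by rewrite (_ : W' ^~ om = fun=> 0); [exact: cst_continuous|apply/funext => t; rewrite /W' iN].
 rewrite (_ : W' ^~ om = fun t => W (Num.max 0 t) om).
  apply: (@continuous_path_max _ _ (W ^~ om)); apply: contrapT => nc; apply: nN; rewrite inE; exact: hN.
 by apply/funext => t; rewrite /W' (negbTE (introN idP nN)).
exists N, W'; split => //; split.
- case: W0 => A [mA A0 hA]; exists (A `|` N); split.
 + exact: measurableU.
 + by apply/eqP; rewrite -measure_le0 -(adde0 0%E) -{1}A0 -N0; exact: measureU2.
 + move=> om /= h; case: (pselect (N om)) => [|nN]; first by right.
  by left; apply: hA => /= h'; apply: h; rewrite -WW.
- apply: aeW => om; exact: continuous_subspaceT.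
- exact: (Fmeas_adapted hF).
move=> s t s0 st A B FA mB; rewrite -(iW s t s0 st A B FA mB).
have t0 : 0 <= t by exact: le_trans s0 (ltW st).
have mA := F_measurable hF s0 FA.
have mb (V : R -> Omega -> 'rV[R]_d) : (forall t, 0 <= t -> meas (V t)) ->
  measurable (A `&` [set w | forall i, B i ((V t w - V s w) 0 i)]).
 move=> mV; apply: measurableI => //.
 rewrite (_ : [set w | _] = (fun w => V t w - V s w) @^-1` (box B)); last by [].
 have mD : meas (fun w => V t w - V s w) by apply: meas_rVB; exact: mV.
 by rewrite -[X in measurable X]setTI; apply: mD => //; exact: meas_box.
apply: (measure_eq_off mN N0).
- by apply: mb => r _; exact: mW'.
- by apply: mb => r r0; exact: (meas_W hF hW).
by move=> om nN /=; rewrite !WW.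
Qed.

End regularization.

Section solutions.
Context {R : realType} {d : nat} {disp} {Omega : measurableType disp} (P : probability Omega R) (F : R -> set (set Omega))
 (hF : is_filtration P F) (W : R -> Omega -> 'rV[R]_d) (hW : is_brownian_motion P F W) (b : 'rV[R]_d -> 'rV[R]_d)
 (sigma : 'rV[R]_d -> R) (L C : R) (hbs : lip_coefs b sigma L C).
Local Notation leb := (@lebesgue_measure R).

Lemma is_solution_max (W' : R -> Omega -> 'rV[R]_d) x X : is_solution P F W' b sigma x X ->
 is_solution P F W' b sigma x (fun t => X (Num.max 0 t)).
Proof.
move=> [aX cX X0 iX]; split.
- by move=> t t0; rewrite max_r//; exact: aX.
- by move=> om; apply: continuous_subspaceT; exact: (@continuous_path_max _ _ (X ^~ om)).
- by move=> om; rewrite maxxx.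
move=> t t0 i; have [S [sS cS cI]] := iX t t0 i; exists S; split => //.
 rewrite (_ : (fun n om => _) = (fun n om => \int[leb]_(s in `[0%R, t])
   ((simple_fun (S n) s om - sigma (X s om)) ^+ 2)%:E)%E)//.
 apply/funext => n; apply/funext => om; apply: eq_integral => s; rewrite inE/= in_itv/= => /andP[s0 _].
 by rewrite max_r.
rewrite max_r// (_ : (fun n om => _) = (fun n om =>
  `|simple_integral (S n) (fun s w => W' s w 0%R i) om -
   (X t om 0 i - x 0 i - \int[leb]_(s in `[0, t]) b (X s om) 0 i)%R|%:E))//.
apply/funext => n; apply/funext => om; congr (`|_ - (_ - _)|%:E).
by apply: eq_Rintegral => s; rewrite inE/= in_itv/= => /andP[s0 _]; rewrite max_r.
Qed.

Lemma solution_approx_sol (W' : R -> Omega -> 'rV[R]_d) x X : is_solution P F W' b sigma x X ->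
 forall T, 0 <= T -> approx_sol P F W' b sigma T x (fun t => X (Num.max 0 t)) (fun t => X (Num.max 0 t)).
Proof.
move=> sX T T0; have [_ cX _ _] := sX; have [aX _ _ iX] := is_solution_max sX.
have c om : continuous (fun t : R => X (Num.max 0 t) om) by exact: (@continuous_path_max _ _ (X ^~ om)).
have mx0 t : 0 <= Num.max 0 t :> R by rewrite le_max lexx.
have j : jmeasV (fun t => X (Num.max 0 t)).
 apply: jmeasV_continuous => // t; have := adapted_Fmeas hF (mx0 t) aX.
 by rewrite (max_r (mx0 t)) => h; exact: (Fmeas_meas hF (mx0 t) h).
have bd : bounded_upto T (fun t => X (Num.max 0 t)).
 by move=> om; apply: continuous_bounded => //; exact: continuous_nsq.
by split => // t t0 _ i; exact: iX.
Qed.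

End solutions.

Section transfer.
Context {R : realType} {d : nat} {disp} {Omega : measurableType disp} (P : probability Omega R) (F : R -> set (set Omega))
 (hF : is_filtration P F) (b : 'rV[R]_d -> 'rV[R]_d) (sigma : 'rV[R]_d -> R) (L C : R) (hbs : lip_coefs b sigma L C).
Local Notation leb := (@lebesgue_measure R).

Lemma meas_solution_ito W x X t i : is_solution P F W b sigma x X -> 0 <= t ->
 meas (fun w => X t w 0 i - x 0 i - \int[leb]_(s in `[0, t]) b (X s w) 0 i).
Proof.
move=> sX t0; have := jmeas_ito_part hbs i (solution_approx_sol hF sX t0).
move/(jmeas_meas t); apply: eq_measurable_fun => om _; rewrite /ito_part max_r//.
by congr (_ - _); apply: eq_Rintegral => s; rewrite inE/= in_itv/= => /andP[s0 _]; rewrite max_r.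
Qed.

Lemma solution_transfer N (W1 W2 : R -> Omega -> 'rV[R]_d) x X : measurable N -> P N = 0%E ->
 (forall t, 0 <= t -> meas (W1 t)) -> (forall t, 0 <= t -> meas (W2 t)) ->
 (forall om, ~ N om -> forall t, 0 <= t -> W1 t om = W2 t om) ->
 is_solution P F W1 b sigma x X -> is_solution P F W2 b sigma x X.
Proof.
move=> mN N0 m1 m2 W12 sX; have [aX cX X0 iX] := sX; split => // t t0 i.
apply: (ito_transfer hF mN N0 m1 m2 W12 _ (iX t t0 i)); exact: (meas_solution_ito i sX t0).
Qed.

Lemma markov_semigroup_transfer N (W1 W2 : R -> Omega -> 'rV[R]_d) p : measurable N -> P N = 0%E ->
 (forall t, 0 <= t -> meas (W1 t)) -> (forall t, 0 <= t -> meas (W2 t)) ->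
 (forall om, ~ N om -> forall t, 0 <= t -> W1 t om = W2 t om) ->
 is_markov_semigroup P F W1 b sigma p -> is_markov_semigroup P F W2 b sigma p.
Proof.
move=> mN N0 m1 m2 W12 h x; have [[X sX] pX] := h x.
have W21 om : ~ N om -> forall t, 0 <= t -> W2 t om = W1 t om by move=> nN t t0; rewrite W12.
split; first by exists X; exact: (solution_transfer mN N0 m1 m2 W12).
by move=> Y sY; apply: pX; exact: (solution_transfer mN N0 m2 m1 W21).
Qed.

End transfer.

Section one_step_operator.
Context {R : realType} {d : nat} (b : 'rV[R]_d -> 'rV[R]_d) (sigma : 'rV[R]_d -> R) (mb : meas b)
 (ms : meas sigma).

Definition qop (h : R) (f : 'rV[R]_d -> \bar R) (x : 'rV[R]_d) : \bar R :=
 (\int[gauss (Num.sqrt h)]_v f (x + h *: b x + sigma x *: v)%R)%E.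

Lemma meas_qstep (h : R) :
 meas (fun p : 'rV[R]_d * 'rV[R]_d => p.1 + h *: b p.1 + sigma p.1 *: p.2).
Proof.
have m1 : meas (fun p : 'rV[R]_d * 'rV[R]_d => p.1) by exact: measurable_fst.
apply: meas_rVD; first by apply: meas_rVD => //; apply: meas_rVZ => //; exact: mcomp mb m1.
by apply: meas_rVZ => //; exact: mcomp ms m1.
Qed.

Lemma qop_ge0 h f : (forall x, 0 <= f x)%E -> forall x, (0 <= qop h f x)%E.
Proof. by move=> f0 x; exact: integral_ge0. Qed.

Lemma meas_qop h f : meas f -> (forall x, 0 <= f x)%E -> meas (qop h f).
Proof.
move=> mf f0; apply: (measurable_fun_fubini_tonelli_F (m2 := gauss (Num.sqrt h))
 (fun p : 'rV[R]_d * 'rV[R]_d => f (p.1 + h *: b p.1 + sigma p.1 *: p.2))) => //.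
exact: (mcomp mf (meas_qstep h)).
Qed.

End one_step_operator.

Section laws.
Context {R : realType} {d : nat} {disp} {Omega : measurableType disp} (P : probability Omega R) (F : R -> set (set Omega))
 (hF : is_filtration P F) (W : R -> Omega -> 'rV[R]_d) (hW : is_brownian_motion P F W)
 (mW : forall t, meas (W t)) (cW : forall om, continuous (W ^~ om)) (b : 'rV[R]_d -> 'rV[R]_d)
 (sigma : 'rV[R]_d -> R) (L C : R) (hbs : lip_coefs b sigma L C).
Local Notation X := (sol W b sigma).

Lemma euler_law x h k (f : 'rV[R]_d -> \bar R) : 0 < h -> meas f -> (forall y, 0 <= f y)%E ->
 (\int[P]_om f (euler W b sigma x h k om) = iter k (qop b sigma h) f x)%E.
Proof.
have mb := meas_b hbs; have ms := meas_sigma hbs.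
move=> h0; elim: k f => [|k IH] f mf f0 /=.
 by rewrite integral_cst// [X in (_ * X)%E]probability_setT mule1.
have k0 : 0 <= k%:R * h by nneg.
have kk : k%:R * h < k.+1%:R * h by rewrite ltr_pM2r// ltr_nat.
have := joint_law hF hW k0 kk (Fmeas_euler hF hW hbs x h0 (k := k)) (mcomp mf (meas_qstep mb ms h)).
move=> /(_ (fun p => f0 _)) /= ->.
rewrite (_ : k.+1%:R * h - k%:R * h = h); last by rewrite -mulrBl -natr1 addrAC subrr add0r mul1r.
rewrite -/(iter k.+1 _ f) iterSr -IH//; [exact: meas_qop|exact: qop_ge0].
Qed.

Lemma nsq_eq0 (y : 'rV[R]_d) : nsq y = 0 -> y = 0.
Proof.
move=> h; apply/rowP => i; rewrite mxE; apply/eqP; rewrite -sqrf_eq0 eq_le sqr_ge0 andbT -h.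
exact: sqr_coord_le.
Qed.

Lemma eq_law_of_nsq0 (U V : Omega -> 'rV[R]_d) A : meas U -> meas V ->
 (nint P (fun om => nsq (U om - V om)) <= 0)%E -> measurable A -> P (U @^-1` A) = P (V @^-1` A).
Proof.
move=> mU mV h mA; pose D om := nsq (U om - V om).
have nD : nnm D by split=> [|om]; [apply: meas_nsqf; exact: meas_rVB|exact: nsq_ge0].
have mN : measurable [set om | D om != 0].
 rewrite (_ : [set om | _] = D @^-1` (~` [set 0])); last by apply/seteqP; split=> om /= /eqP.
 by rewrite -[X in measurable X]setTI; case: nD => mD _; apply: mD => //; exact: measurableC.
have N0 : P [set om | D om != 0] = 0%E.
 have e0 : (\int[P]_om `|(D om)%:E| = 0)%E.
  apply/eqP; rewrite eq_le; apply/andP; split; last exact: integral_ge0.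
  apply: le_trans h; rewrite le_eqVlt; apply/orP; left; apply/eqP.
  by apply: eq_integral => om _; rewrite gee0_abs// lee_fin nsq_ge0.
 have [N [mN' N0 hN]] : ae_eq P setT (EFin \o D) (cst 0%E).
  by apply/ae_eq_integral_abs => //; apply: meas_EFin; case: nD.
 apply/eqP; rewrite -measure_le0 -N0 le_measure ?inE//.
 by move=> om /= Dn; apply: hN => /= h'; move: Dn; have [-> //] := h' I; rewrite eqxx.
apply: (measure_eq_off mN N0).
- by rewrite -[X in measurable X]setTI; exact: mU.
- by rewrite -[X in measurable X]setTI; exact: mV.
move=> om /= /negP; rewrite negbK => /eqP /nsq_eq0 /eqP; rewrite subr_eq0 => /eqP e.
by rewrite /preimage /= e.
Qed.

Lemma solution_stability t : 0 <= t -> exists2 K, 0 <= K & forall x y X' Y', is_solution P F W b sigma x X' ->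
 is_solution P F W b sigma y Y' -> (nint P (fun om => nsq (X' t om - Y' t om)) <= (K * nsq (x - y))%:E)%E.
Proof.
move=> t0; have [/ltW L0 _ _ _ _] := hbs; exists (@stab_cst R d L t).
 have k0 : 0 <= stab_kap (d := d) L t by rewrite /stab_kap addr_ge0// mulr_ge0// addr_ge0// !mulr_ge0.
 by rewrite /stab_cst mulr_ge0// addr_ge0// !mulr_ge0// expR_ge0.
move=> x y X' Y' sX sY.
have e0 (V : R -> Omega -> 'rV[R]_d) : forall s : R, 0 <= s -> s <= t -> (nint P (fun om => nsq (V s om - V s om)) <= 0%:E)%E.
 by move=> s _ _; under eq_nint do rewrite subrr nsq0; rewrite nint_cst.
have := stability hF hW hbs t0 (solution_approx_sol hF sX t0) (solution_approx_sol hF sY t0)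
 (lexx 0) (e0 _) (e0 _) t0 (lexx t).
by rewrite max_r// addr0.
Qed.

Lemma solution_law x X' : is_solution P F W b sigma x X' -> forall t, 0 <= t -> forall A, measurable A ->
 P (X' t @^-1` A) = P (X x t @^-1` A).
Proof.
move=> sX t t0 A mA; have [K _ h] := solution_stability t0.
have sS := is_solution_sol hF hW mW cW hbs x.
have [aX _ _ _] := sX; have [aS _ _ _] := sS.
apply: eq_law_of_nsq0 => //.
- exact: (Fmeas_meas hF t0 (adapted_Fmeas hF t0 aX)).
- exact: (Fmeas_meas hF t0 (adapted_Fmeas hF t0 aS)).
by have := h x x _ _ sX sS; rewrite subrr nsq0 mulr0.
Qed.

Lemma euler_sol_error t x : 0 < t -> exists2 K, 0 <= K & forall n, (0 < n)%N -> t / n%:R <= 1 ->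
 (nint P (fun om => nsq (X x t om - euler W b sigma x (t / n%:R) n om)) <= (K / n%:R)%:E)%E.
Proof.
move=> tp; have t0 := ltW tp; have [/ltW L0 _ _ _ _] := hbs.
pose e := @euler_cst R d b L C x t; pose s := @stab_cst R d L t.
have e0 : 0 <= e.
 have := euler_rate_ge0 hbs; have := bcst_ge0 hbs => bc r0; rewrite /e /euler_cst addr_ge0//.
  by nneg.
 by nneg.
have s0 : 0 <= s.
 have k0 : 0 <= stab_kap (d := d) L t by rewrite /stab_kap addr_ge0// mulr_ge0// addr_ge0// !mulr_ge0.
 by rewrite /s /stab_cst mulr_ge0// addr_ge0// !mulr_ge0// expR_ge0.
exists (s * (t * e)); first by nneg.
move=> n n0 tn1; pose h := t / n%:R.
have n0' : (0 : R) < n%:R by rewrite ltr0n.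
have h0 : 0 < h by rewrite divr_gt0.
have nh : n%:R * h = t by rewrite /h mulrC divfK// gt_eqF.
have tN : t <= n%:R * h by rewrite nh.
have sS := is_solution_sol hF hW mW cW hbs x.
have eX : forall r : R, 0 <= r -> r <= t -> (nint P (fun om => nsq (X x (Num.max (0:R) r) om - X x (Num.max (0:R) r) om)%R) <= (h * e)%:E)%E.
 move=> r _ _; under eq_nint do rewrite subrr nsq0.
 by rewrite nint_cst lee_fin mulr_ge0// ltW.
have := stability hF hW hbs t0 (solution_approx_sol hF sS t0)
 (approx_sol_euler hF hW mW cW hbs x h0 t0 tN) (mulr_ge0 (ltW h0) e0) eX
 (fun r r0 rt => euler_path_pc_close hF hW mW hbs x h0 tn1 r0 rt tN) t0 (lexx t).
rewrite max_r// subrr nsq0 add0r.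
rewrite (_ : euler_path W b sigma x h n t = euler W b sigma x h n); last first.
 by apply/funext => om; rewrite /euler_path euler_sum_before// nh.
by rewrite -/s (_ : s * (h * e) = s * (t * e) / n%:R)// /h; ring.
Qed.

End laws.

Section bounded_expectation.
Context {R : realType}.

Definition bm {disp} {T : measurableType disp} (f : T -> R) :=
 meas f /\ forall x, 0 <= f x <= 1.

Definition ex {disp} {T : measurableType disp} (m : probability T R) (f : T -> R) : R :=
 fine (nint m f).

Lemma bm_nnm disp (T : measurableType disp) (f : T -> R) : bm f -> nnm f.
Proof. by move=> [mf f01]; split=> // x; case/andP: (f01 x). Qed.

Lemma bm_comp disp (T : measurableType disp) disp' (T' : measurableType disp')
 (f : T -> R) (u : T' -> T) : bm f -> meas u -> bm (fun x => f (u x)).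
Proof. by move=> [mf f01] mu; split=> [|x //]; exact: mcomp mf mu. Qed.

Lemma nint_le1 disp (T : measurableType disp) (m : probability T R) (f : T -> R) : bm f ->
 (nint m f <= 1)%E.
Proof.
move=> bf; have [mf f01] := bf; rewrite -(nint_cst m 1).
by apply: le_nint => [||x]; [exact: bm_nnm|exact: nnm_cst|case/andP: (f01 x)].
Qed.

Lemma exE disp (T : measurableType disp) (m : probability T R) (f : T -> R) : bm f ->
 nint m f = (ex m f)%:E.
Proof.
move=> bf; rewrite /ex fineK// ge0_fin_numE; last by apply: nint_ge0; case: (bm_nnm bf).
by apply: (le_lt_trans (nint_le1 m bf)); rewrite ltry.
Qed.

Lemma ex_itv disp (T : measurableType disp) (m : probability T R) (f : T -> R) : bm f ->
 0 <= ex m f <= 1.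
Proof.
move=> bf; rewrite -!lee_fin -exE// nint_le1// andbT.
by apply: nint_ge0; case: (bm_nnm bf).
Qed.

Lemma eq_ex disp (T : measurableType disp) (m : probability T R) (f g : T -> R) : f =1 g ->
 ex m f = ex m g.
Proof. by move=> fg; rewrite /ex (eq_nint _ fg). Qed.

Lemma ex_dist disp (T : measurableType disp) (m : probability T R) (f g h : T -> R) (c : R) :
 bm f -> bm g -> nnm h -> (forall x, `|f x - g x| <= h x) -> (nint m h <= c%:E)%E ->
 `|ex m f - ex m g| <= c.
Proof.
move=> bf bg nh fgh hc.
have half (f1 f2 : T -> R) : bm f1 -> bm f2 -> (forall x, f1 x - f2 x <= h x) -> ex m f1 - ex m f2 <= c.
 move=> b1 b2 le12; rewrite lerBlDl -lee_fin EFinD -!exE//.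
 apply: (@le_trans _ _ (nint m (fun x => f2 x + h x))).
  apply: le_nint => [||x]; [exact: bm_nnm|apply: nnmD => //; exact: bm_nnm|].
  by rewrite -lerBlDl.
 rewrite nintD//; last exact: bm_nnm.
 exact: leeD2l.
rewrite ler_norml; apply/andP; split.
 rewrite lerNl opprB; apply: half => // x; apply: le_trans (fgh x).
 by rewrite distrC ler_norm.
by apply: half => // x; apply: le_trans (fgh x); exact: ler_norm.
Qed.

Lemma ex_dist_cst disp (T : measurableType disp) (m : probability T R) (f g : T -> R) (c : R) :
 bm f -> bm g -> 0 <= c -> (forall x, `|f x - g x| <= c) -> `|ex m f - ex m g| <= c.
Proof.
move=> bf bg c0 fgc; apply: (@ex_dist _ _ m f g (fun=> c)) => //.
by rewrite nint_cst.
Qed.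

Lemma ex_cst disp (T : measurableType disp) (m : probability T R) (c : R) : ex m (fun=> c) = c.
Proof. by rewrite /ex nint_cst. Qed.

Section pair.
Context d1 (T1 : measurableType d1) d2 (T2 : measurableType d2) (f : T1 * T2 -> R) (bf : bm f).

Lemma bm_section1 x : bm (fun y => f (x, y)).
Proof. by apply: bm_comp bf _; exact: measurable_pair1. Qed.

Lemma bm_section2 y : bm (fun x => f (x, y)).
Proof. by apply: bm_comp bf _; exact: measurable_pair2. Qed.

Lemma bm_ex2 (m : probability T2 R) : bm (fun x => ex m (fun y => f (x, y))).
Proof.
split=> [|x]; last by apply: ex_itv; exact: bm_section1.
have : meas (fun x => \int[m]_y (f (x, y))%:E)%E.
 apply: (@measurable_fun_fubini_tonelli_F _ _ _ _ _ _ (fun p => (f p)%:E)) => /=.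
  by apply: meas_EFin; case: bf.
 by move=> p; rewrite lee_fin; case: (bm_nnm bf).
move=> mF; apply: (@measurableT_comp _ _ _ _ _ _ fine) => //.
Qed.

Lemma ex_swap (m1 : probability T1 R) (m2 : probability T2 R) :
 ex m1 (fun x => ex m2 (fun y => f (x, y))) = ex m2 (fun y => ex m1 (fun x => f (x, y))).
Proof.
rewrite {1}/ex {2}/ex; congr fine.
transitivity (\int[m1]_x \int[m2]_y (f (x, y))%:E)%E.
 by apply: eq_integral => x _; rewrite -exE//; exact: bm_section1.
rewrite (@fubini_tonelli _ _ _ _ _ m1 m2 (fun p => (f p)%:E)).
- by apply: eq_integral => y _; rewrite -exE//; exact: bm_section2.
- by apply: meas_EFin; case: bf.
- by move=> p; rewrite lee_fin; case: (bm_nnm bf).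
Qed.

End pair.
End bounded_expectation.

Section gaussian_smoothing.
Context {R : realType} {d : nat}.
Local Notation gamma := (@gauss R d 1).
Implicit Types (f : 'rV[R]_d -> R) (c x : 'rV[R]_d).

Definition tilt c (v : 'rV[R]_d) : R := \prod_i expR (c 0 i * v 0 i - c 0 i ^+ 2 / 2).

Lemma tilt_ge0 c v : 0 <= tilt c v.
Proof. by apply: prodr_ge0 => i _; exact: expR_ge0. Qed.

Lemma meas_tilt c : meas (tilt c).
Proof.
apply: measurable_prod => i _; apply: mcomp; first exact: measurable_expR.
by mble.
Qed.

Lemma nnm_tilt c : nnm (tilt c).
Proof. by split; [exact: meas_tilt|exact: tilt_ge0]. Qed.

Lemma tilt_sqr c v : tilt c v ^+ 2 = expR (nsq c) * tilt (2 *: c) v.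
Proof.
rewrite /tilt /nsq expR_sum -prodrXl -big_split/=; apply: eq_bigr => i _.
rewrite !mxE -expRD expr2 -expRD; congr expR; move: (c 0 i) (v 0 i) => p q; by field.
Qed.

(* Cameron-Martin *)
Lemma nint_gauss_shift c f : nnm f ->
 nint gamma (fun v => f (v + c)) = nint gamma (fun v => f v * tilt c v).
Proof.
move=> [mf f0]; rewrite /nint !integral_gauss; first last.
- by nneg.
- by apply: meas_EFin; apply: mcomp => //; exact: meas_rVD.
- by move=> x; rewrite lee_fin mulr_ge0// tilt_ge0.
- by apply: meas_EFin; apply: measurable_funM => //; exact: meas_tilt.
rewrite -(@ge0_integral_translate R d c (fun v => (f v * tilt c v)%:E * (gauss_pdf 1 v)%:E)%E).
- apply: eq_integral => v _; rewrite -!EFinM; congr EFin.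
 rewrite -mulrA; congr (_ * _); rewrite /tilt /gauss_pdf -big_split/=.
 apply: eq_bigr => i _; rewrite !mxE !std_normal_pdfE mulrCA -expRD; congr (_ * expR _); by field.
- apply: emeasurable_funM; apply: meas_EFin; last exact: meas_gauss_pdf.
 by apply: measurable_funM => //; exact: meas_tilt.
- by move=> x; rewrite mule_ge0// lee_fin ?gauss_pdf_ge0// mulr_ge0// tilt_ge0.
Qed.

Lemma nint_tilt c : nint gamma (tilt c) = 1%E.
Proof.
rewrite -(nint_cst gamma 1).
have /= -> : nint gamma (fun=> 1) = nint gamma (fun v => 1 * tilt c v).
 by rewrite -(@nint_gauss_shift c (fun=> 1))//; split.
by apply: eq_nint => v; rewrite mul1r.
Qed.

Lemma expR_le_lin (u : R) : 0 <= u -> u <= 1 -> expR u <= 1 + 3 * u.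
Proof.
move=> u0 u1; have e2 : expR (- u / 2) >= 1 - u / 2.
 by rewrite -mulNr; apply: expR_ge1Dx.
have hh : 0 < 1 - u / 2 by lra.
have -> : expR u = (expR (- u / 2) ^+ 2)^-1.
 by rewrite expr2 -expRD -expRN; congr expR; field.
have -> : 1 + 3 * u = ((1 + 3 * u)^-1)^-1 by rewrite invrK.
rewrite lef_pV2 ?posrE ?invr_gt0 ?exprn_gt0 ?expR_gt0//; last by lra.
apply: (@le_trans _ _ ((1 - u / 2) ^+ 2)); last by rewrite lerXn2r ?nnegrE ?expR_ge0// ltW.
rewrite -[leLHS]mul1r ler_pdivrMr; last by lra.
rewrite -subr_ge0 (_ : _ - 1 = u * ((1 - u) * (2 - 3 / 4 * u))); last by field.
by rewrite mulr_ge0// mulr_ge0; lra.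
Qed.

Lemma ex_gauss_shift_le c g : 0 < enorm c -> enorm c <= 1 -> bm g ->
 ex gamma (fun v => g (v + c)) <= ex gamma g + 2 * enorm c.
Proof.
move=> ep e1 bg; have [mg g01] := bg; have ng := bm_nnm bg.
have bgs : bm (fun v : 'rV[R]_d => g (v + c)) by apply: bm_comp bg _; exact: meas_rVD.
pose e := enorm c; have e0 : e != 0 by nneg.
have q1 : nint gamma (fun v => tilt c v ^+ 2) = (expR (e ^+ 2))%:E.
 under eq_nint do rewrite tilt_sqr.
 by rewrite nintZ ?expR_ge0//; [rewrite nint_tilt mule1 sqr_enorm|exact: nnm_tilt].
have : (nint gamma (fun v => g v * tilt c v + (2 * e)^-1 * tilt c v)%R <=
  nint gamma (fun v => g v + ((e + (4 * e)^-1) + (4 * e)^-1 * tilt c v ^+ 2))%R)%E.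
 have nt := nnm_tilt c; have nt2 := nnm_sqr (meas_tilt c).
 apply: le_nint => [||v].
 - by apply: nnmD; [exact: nnmM|apply: nnmZ => //; rewrite invr_ge0 mulr_ge0// ltW].
 - apply: nnmD => //; apply: nnmD; first by apply: nnm_cst; rewrite addr_ge0 ?invr_ge0 ?mulr_ge0// ltW.
  by apply: nnmZ => //; rewrite invr_ge0 mulr_ge0// ltW.
 have /andP[gv0 gv1] := g01 v; move: (tilt c v) (g v) gv0 gv1 => r y y0 y1.
 have ei : 0 < (4 * e)^-1 by nneg.
 have e2 : (2 * e)^-1 = 2 * (4 * e)^-1 by field.
 have e4 : 4 * e * (4 * e)^-1 = 1 by rewrite divff// gt_eqF// mulr_gt0.
 rewrite e2; move: ei e4; move: ((4 * e)^-1) => k k0 ek.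
 have : y * (r - 1) <= e + k * (r - 1) ^+ 2.
  have h1 : r - 1 <= e + k * (r - 1) ^+ 2.
   have : 0 <= k * (r - 1 - 2 * e) ^+ 2 by nneg.
   rewrite (_ : k * _ = k * (r - 1) ^+ 2 - (4 * e * k) * (r - 1) + (4 * e * k) * e); last by ring.
   rewrite ek; lra.
  have h2 : 0 <= e + k * (r - 1) ^+ 2 by nneg.
  have [r1|r1] := leP 0 (r - 1); last by apply: le_trans h2; rewrite mulr_ge0_le0// ltW.
  by apply: le_trans h1; rewrite ler_piMl.
 nra.
have nt := nnm_tilt c; have n1 := nnmM ng nt.
have k1 : 0 <= (2 * e)^-1 by nneg.
rewrite (nintD _ n1 (nnmZ k1 nt)) -nint_gauss_shift// (nintZ _ k1 nt).
have k0 : 0 <= (4 * e)^-1 by nneg.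
have nn2 := nnmZ k0 (nnm_sqr (meas_tilt c)).
have nnc : nnm (fun _ : 'rV[R]_d => e + (4 * e)^-1) by apply: nnm_cst; rewrite addr_ge0// ltW.
rewrite nintD//; last by apply: nnmD.
rewrite nintD// nintZ//; last by apply: nnm_sqr; exact: meas_tilt.
rewrite q1 nint_cst nint_tilt !exE// mule1 -EFinM -!EFinD lee_fin -/e.
have e2 : e ^+ 2 <= 1 by rewrite expr_le1// ltW.
have := expR_le_lin (sqr_ge0 e) e2.
have -> : (2 * e)^-1 = 2 * (4 * e)^-1 by field.
have e4 : 4 * e * (4 * e)^-1 = 1 by rewrite divff// gt_eqF// mulr_gt0.
move: k0 e4; move: ((4 * e)^-1) (expR (e ^+ 2)) => k E k0 ek hE.
have : k * E <= k * (1 + 3 * e ^+ 2) by rewrite ler_wpM2l.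
have -> : k * (1 + 3 * e ^+ 2) = k + (4 * e * k) * e * (3 / 4) by field.
have ee : 0 <= e by nneg.
rewrite ek; lra.
Qed.

Lemma ex_gauss_shift c f : bm f ->
 `|ex gamma (fun v => f (v + c)) - ex gamma f| <= 2 * enorm c.
Proof.
move=> bf; have [mf f01] := bf.
have bs : bm (fun v : 'rV[R]_d => f (v + c)) by apply: bm_comp bf _; exact: meas_rVD.
have [e1|e1] := ltP 1 (enorm c).
 apply: (@le_trans _ _ 1); last by lra.
 have /andP[a0 a1] := ex_itv gamma bs; have /andP[b0 b1] := ex_itv gamma bf.
 by rewrite ler_norml; lra.
have [c0|c0] := eqVneq (enorm c) 0.
 have -> : c = 0 by apply: nsq_eq0; rewrite -sqr_enorm c0 expr0n.
 rewrite (_ : ex _ _ = ex gamma f) ?subrr ?normr0 ?mulr_ge0 ?enorm_ge0//.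
 by apply: eq_ex => v; rewrite addr0.
have ep : 0 < enorm c by rewrite lt_neqAle eq_sym c0 enorm_ge0.
have h1 := ex_gauss_shift_le ep e1 bf.
have eN : enorm (- c) = enorm c by rewrite !enormE nsqN.
have := @ex_gauss_shift_le (- c) _ _ _ bs; rewrite eN => /(_ ep e1).
have -> : ex gamma (fun v => f (v - c + c)) = ex gamma f by apply: eq_ex => v; rewrite subrK.
by move: h1; rewrite ler_norml; lra.
Qed.

Lemma enormZ (a : R) x : enorm (a *: x) = `|a| * enorm x.
Proof. by rewrite !enormE nsqZ sqrtrM ?sqr_ge0// sqrtr_sqr. Qed.

Definition gsm (s : R) f x : R := ex gamma (fun v => f (x + s *: v)).

Lemma meas_gsm_arg (s : R) :
 meas (fun p : 'rV[R]_d * 'rV[R]_d => p.1 + s *: p.2).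
Proof. by mble. Qed.

Lemma bm_gsm_arg s f : bm f -> bm (fun p : 'rV[R]_d * 'rV[R]_d => f (p.1 + s *: p.2)).
Proof. by move=> bf; apply: bm_comp bf _; exact: meas_gsm_arg. Qed.

Lemma bm_gsm s f : bm f -> bm (gsm s f).
Proof. by move=> bf; exact: (bm_ex2 (bm_gsm_arg s bf)). Qed.

Lemma gsm_lip (s : R) f x y : 0 < s -> bm f -> `|gsm s f x - gsm s f y| <= 2 / s * enorm (x - y).
Proof.
move=> s0 bf; pose g (v : 'rV[R]_d) := f (y + s *: v).
have bg : bm g by exact: (bm_section1 (bm_gsm_arg s bf)).
have := ex_gauss_shift (s^-1 *: (x - y)) bg.
have -> : ex gamma (fun v => g (v + s^-1 *: (x - y))) = gsm s f x.
 by apply: eq_ex => v; rewrite /g scalerDr scalerA divff ?gt_eqF// scale1r addrCA subrKC addrC.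
have s1 : 0 <= s^-1 by nneg.
by rewrite enormZ (ger0_norm s1) mulrA.
Qed.

Lemma gsm_comm r s f x : bm f -> gsm r (gsm s f) x = gsm s (gsm r f) x.
Proof.
move=> bf; rewrite /gsm.
rewrite (@ex_swap R _ _ _ _ (fun p : 'rV[R]_d * 'rV[R]_d => f (x + r *: p.1 + s *: p.2))).
 by apply: eq_ex => v; apply: eq_ex => w; rewrite -!addrA [_ + s *: v]addrC.
apply: bm_comp bf _; apply: meas_rVD; last exact: meas_rVZ.
by mble.
Qed.

Lemma gsm_mod_lip (s K : R) f x y : 0 <= K -> bm f -> (forall x y, `|f x - f y| <= K * enorm (x - y)) ->
 `|gsm s f x - gsm s f y| <= K * enorm (x - y).
Proof.
move=> K0 bf lf; apply: ex_dist_cst; [exact: (bm_section1 (bm_gsm_arg s bf))..|by rewrite mulr_ge0// enorm_ge0|].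
by move=> v; apply: le_trans (lf _ _) _; rewrite opprD addrACA subrr addr0.
Qed.

End gaussian_smoothing.

Section lipschitz_tests.
Context {R : realType} {d : nat} {disp} {Omega : measurableType disp} (P : probability Omega R).
Implicit Types (u : 'rV[R]_d -> R) (X Y Z : Omega -> 'rV[R]_d).

Lemma meas_enorm_comp Z : meas Z -> meas (fun om => enorm (Z om)).
Proof.
move=> mZ; have ms : meas (@Num.sqrt R).
 by apply: continuous_measurable_fun => x; exact: sqrt_continuous.
exact: (mcomp ms (meas_nsqf mZ)).
Qed.

Lemma nint_enorm_le Z e c : meas Z -> 0 < e ->
 (nint P (fun om => nsq (Z om)) <= c%:E)%E -> (nint P (fun om => enorm (Z om)) <= (e + c / (4 * e))%:E)%E.
Proof.
move=> mZ e0 hc; have e4 : 0 <= (4 * e)^-1 by nneg.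
have := @nint_le_lin2 _ _ _ P (fun om => enorm (Z om)) e (4 * e)^-1 (fun=> 1) (fun om => nsq (Z om)) 1 c.
rewrite mulr1 [c / _]mulrC; apply => //; rewrite ?nint_cst// ?(ltW e0)//.
- by split=> [|om]; [exact: meas_enorm_comp|exact: enorm_ge0].
- by split=> [|om]; [exact: meas_nsqf|exact: nsq_ge0].
- by move=> om; rewrite [_^-1 * _]mulrC; exact: enorm_le_eps.
Qed.

Lemma ex_dist_lip u (K e c : R) X Y : bm u -> 0 <= K -> (forall x y, `|u x - u y| <= K * enorm (x - y)) ->
 meas X -> meas Y -> 0 < e ->
 (nint P (fun om => nsq (X om - Y om)) <= c%:E)%E ->
 `|ex P (fun om => u (X om)) - ex P (fun om => u (Y om))| <= K * (e + c / (4 * e)).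
Proof.
move=> bu K0 lu mX mY e0 hc.
have nn : nnm (fun om => enorm (X om - Y om)).
 by split=> [|om]; [apply: meas_enorm_comp; exact: meas_rVB|exact: enorm_ge0].
apply: (@ex_dist _ _ _ P _ _ (fun om => K * enorm (X om - Y om))).
- exact: bm_comp bu mX.
- exact: bm_comp bu mY.
- exact: nnmZ.
- by [].
- rewrite nintZ// EFinM lee_wpmul2l ?lee_fin//.
 by apply: nint_enorm_le => //; exact: meas_rVB.
Qed.

End lipschitz_tests.

Section gaussian_moment.
Context {R : realType} {d : nat}.
Implicit Types u : 'rV[R]_d -> R.

Lemma nint_gauss_nsq : nint (@gauss R d 1) (@nsq R d) = d%:R%:E.
Proof.
rewrite /nsq nint_sum; last by move=> i; apply: nnm_sqr; exact: meas_coord.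
under eq_bigr do rewrite /nint integral_gauss_sqr.
by rewrite sume_const// mule1.
Qed.

Lemma gsm_double (s r : R) u x : 0 < s -> 0 <= r -> bm u ->
 `|gsm s (gsm r u) x - gsm s u x| <= 2 / s * r * (1 + d%:R).
Proof.
move=> s0 r0 bu; rewrite gsm_comm// {1}/gsm -[gsm s u x](ex_cst (@gauss R d 1)).
have bs := bm_gsm s bu; have sr : 0 <= 2 / s * r by nneg.
have /andP[b0 b1] := (bs.2 x).
have ne : nnm (@enorm R d) by split; [exact: (meas_enorm_comp (@measurable_id _ _ setT))|exact: enorm_ge0].
apply: (@ex_dist _ _ _ _ _ _ (fun v => 2 / s * r * enorm v)).
- exact: (bm_section1 (bm_gsm_arg r bs)).
- by split=> // v; rewrite b0.
- exact: nnmZ.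
- move=> v; apply: le_trans (gsm_lip _ _ s0 bu) _.
 by rewrite addrAC subrr add0r enormZ (ger0_norm r0) mulrA.
- rewrite nintZ// [leRHS]EFinM lee_wpmul2l ?lee_fin//.
 have h : (nint (@gauss R d 1) (@nsq R d) <= d%:R%:E)%E by rewrite nint_gauss_nsq.
 apply: le_trans (nint_enorm_le (@measurable_id _ _ setT) ltr01 h) _.
 by rewrite lee_fin mulr1 lerD2l ler_pdivrMr// ler_peMr// ler1n.
Qed.
End gaussian_moment.

Section euler_block.
Context {R : realType} {d : nat} {disp} {Omega : measurableType disp} (P : probability Omega R) (F : R -> set (set Omega))
 (hF : is_filtration P F) (W : R -> Omega -> 'rV[R]_d) (hW : is_brownian_motion P F W) (b : 'rV[R]_d -> 'rV[R]_d)
 (sigma : 'rV[R]_d -> R) (L C : R) (hbs : lip_coefs b sigma L C).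

Section block.
Context (x : 'rV[R]_d) (h : R) (h0 : 0 < h) (h1 : h <= 1).
Local Notation E := (euler W b sigma x h).

Definition frozen (c : R) (j m : nat) (om : Omega) : 'rV[R]_d :=
 E j om + (c * sigma (E j om)) *: (W ((j + m)%:R * h) om - W (j%:R * h) om).

Let mE k : meas (E k) := @meas_euler R d disp Omega P F hF W hW b sigma L C hbs x h h0 k.
Let FE k : Fmeas F (k%:R * h) (E k) := Fmeas_euler hF hW hbs x h0 (k := k).
Let ms := meas_sigma hbs.
Let mb := meas_b hbs.

Let phi c j l om := sigma (E (j + l)%N om) - c * sigma (E j om).
Let tau j l : R := (j + l)%:R * h.

Lemma meas_frozen c j m : meas (frozen c j m).
Proof.
apply: meas_rVD => //; apply: meas_rVZ.
 by apply: measurable_funM => //; exact: (mcomp ms (mE j)).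
by apply: (meas_dW hF hW); rewrite mulr_ge0// ltW.
Qed.

Lemma euler_frozenE c j m om i : (E (j + m)%N om - frozen c j m om) 0 i =
 h * (\sum_(l < m) b (E (j + l)%N om) 0 i) + dsum W i (tau j) (phi c j) m om.
Proof.
rewrite /dsum; elim: m => [|m IH].
 rewrite !big_ord0 mulr0 addr0 /frozen addn0 coordB [X in _ - X]mxE [X in _ - (_ + X)]mxE.
 by rewrite coordB subrr mulr0 addr0 subrr.
rewrite !big_ord_recr/= mulrDr addrACA -IH !coordB addnS/= /frozen.
have eW k : (k *: (W ((j + m).+1%:R * h) om - W (j%:R * h) om)) 0 i =
  k * (W ((j + m).+1%:R * h) om 0 i - W (j%:R * h) om 0 i) by rewrite [LHS]mxE coordB.
have eW' k : (k *: (W ((j + m)%:R * h) om - W (j%:R * h) om)) 0 i =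
  k * (W ((j + m)%:R * h) om 0 i - W (j%:R * h) om 0 i) by rewrite [LHS]mxE coordB.
rewrite addnS -/(E _) /phi /tau addnS.
rewrite [X in X - _]mxE [X in X + _ - _]mxE [X in _ - X]mxE [X in _ - X + _]mxE eW eW'.
have -> : (h *: b (E (j + m)%N om)) 0 i = h * b (E (j + m)%N om) 0 i by rewrite mxE.
have -> : (sigma (E (j + m)%N om) *: (W ((j + m).+1%:R * h) om - W ((j + m)%:R * h) om)) 0 i =
 sigma (E (j + m)%N om) * (W ((j + m).+1%:R * h) om 0 i - W ((j + m)%:R * h) om 0 i).
 by rewrite mxE coordB.
ring.
Qed.

Lemma nint_euler_frozen c j m (Mo S : R) : 0 <= Mo -> 0 <= S ->
 (forall l, (l < m)%N -> (nint P (fun om => 1 + nsq (E (j + l)%N om))%R <= Mo%:E)%E) ->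
 (forall l, (l < m)%N -> (nint P (fun om => (phi c j l om) ^+ 2)%R <= S%:E)%E) ->
 (nint P (fun om => nsq (E (j + m)%N om - frozen c j m om)) <=
  (2 * (m%:R * h) ^+ 2 * (bcst b L * Mo) + 2 * (d%:R * (m%:R * h) * S))%:E)%E.
Proof.
move=> Mo0 S0 hMo hS; have bc := bcst_ge0 hbs.
have jh k : 0 <= k%:R * h by nneg.
have tS k : tau j k <= tau j k.+1 by rewrite /tau ler_wpM2r ?(ltW h0)// ler_nat leq_add2l.
have Fp k : Fmeas F (tau j k) (phi c j k).
 apply: measurable_funB; first exact: (Fmeas_comp ms (@FE _)).
 apply: measurable_funM => //; apply: (@Fmeas_mono _ _ _ P F hF (j%:R * h)) => //.
  by rewrite /tau ler_wpM2r ?(ltW h0)// ler_nat leq_addr.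
 exact: (Fmeas_comp ms (@FE _)).
have md i : meas (dsum W i (tau j) (phi c j) m).
 apply: (Fmeas_meas hF (jh (j + m)%N)); apply: (Fmeas_dsum hF hW) => //; exact: jh.
have nb l : nnm (fun om => nsq (b (E (j + l)%N om))).
 by split=> [|om]; [apply: meas_nsqf; exact: mcomp mb (mE _)|exact: nsq_ge0].
have n1 : nnm (fun om => \sum_(l < m) nsq (b (E (j + l)%N om))) by apply: nnm_sum => l; exact: nb.
have n2 : nnm (fun om => \sum_(i < d) (dsum W i (tau j) (phi c j) m om) ^+ 2).
 by apply: nnm_sum => i; exact: nnm_sqr.
have := @nint_le_lin2 _ _ _ P (fun om => nsq (E (j + m)%N om - frozen c j m om)) (2 * (h ^+ 2 * m%:R)) 2 _ _
 (m%:R * (bcst b L * Mo)) (d%:R * ((m%:R * h) * S)) _ n1 n2.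
rewrite (_ : 2 * (h ^+ 2 * m%:R) * (m%:R * (bcst b L * Mo)) = 2 * (m%:R * h) ^+ 2 * (bcst b L * Mo)); last by ring.
rewrite -[d%:R * (m%:R * h) * S]mulrA; apply => //.
- split=> [|om]; last exact: nsq_ge0.
 by apply: meas_nsqf; apply: meas_rVB; [exact: mE|exact: meas_frozen].
- by nneg.
- move=> om; rewrite /nsq exchange_big/= !mulr_sumr -big_split/=; apply: ler_sum => i _.
 rewrite -/(frozen _ _ _ _) euler_frozenE -mulrA -mulrDr.
 set u := \sum_(l < m) b _ 0 i; set v := dsum _ _ _ _ _ _.
 have hu := @sqr_sum_le R m (fun l => b (E (j + l)%N om) 0 i).
 have : h ^+ 2 * u ^+ 2 <= h ^+ 2 * (m%:R * \sum_(l < m) (b (E (j + l)%N om) 0 i) ^+ 2).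
  by rewrite ler_wpM2l// sqr_ge0.
 rewrite mulrA -exprMn => hh; apply: (@le_trans _ _ (2 * ((h * u) ^+ 2 + v ^+ 2))); last by rewrite ler_pM2l// lerD2r.
 have := sqr_ge0 (h * u - v); rewrite sqrrB sqrrD; lra.
- rewrite nint_sum//; apply: (@le_trans _ _ (\sum_(l < m) (bcst b L * Mo)%:E)%E).
  apply: lee_sum => l _; apply: (@nint_le_lin1 _ _ _ P _ _ (fun om => 1 + nsq (E (j + l)%N om))) => //.
  + by split=> [|om]; [apply: measurable_funD => //; exact: meas_nsqf|rewrite addr_ge0// nsq_ge0].
  + by move=> om; exact: nsq_b_le hbs _.
  + exact: hMo.
 by rewrite sume_const ?lee_fin ?mulr_ge0// -EFinM.
- rewrite nint_sum; last by move=> i; exact: nnm_sqr.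
 apply: (@le_trans _ _ (\sum_(i < d) (m%:R * h * S)%:E)%E); last first.
  by rewrite sume_const ?lee_fin ?mulr_ge0 ?(ltW h0)// -EFinM.
 apply: lee_sum => i _; rewrite /nint (dsum_isometry hF hW) ?jh//.
 apply: (@le_trans _ _ (\sum_(l < m) (h * S)%:E)%E).
  apply: lee_sum => l _; rewrite /tau -mulrBl -natrB ?leq_add2l// subnDl subSnn mul1r EFinM.
  by rewrite lee_wpmul2l ?lee_fin ?(ltW h0)//; exact: hS.
 by rewrite sume_const ?lee_fin ?mulr_ge0 ?(ltW h0)//= mulrA.
Qed.

End block.

Lemma euler_one_frozen T : 0 <= T -> exists2 K : R, 0 <= K & forall x h j m, 0 < h -> h <= 1 -> (j + m)%:R * h <= T ->
 (nint P (fun om => nsq (euler W b sigma x h (j + m) om - frozen x h 1 j m om)) <=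
  (K * (1 + nsq x) * (m%:R * h) ^+ 2)%:E)%E.
Proof.
move=> T0; have [/ltW L0 C0 _ hs hC] := hbs; have bc := bcst_ge0 hbs.
pose B := bcst b L * expR (euler_rate (d := d) b L C * T).
have B0 : 0 <= B by rewrite mulr_ge0// expR_ge0.
pose A := 2 * T * B + 2 * (d%:R * C ^+ 2).
have A0 : 0 <= A by rewrite addr_ge0// mulr_ge0 ?mulr_ge0// sqr_ge0.
exists (2 * B + 2 * (d%:R * (L * A))); first by nneg.
move=> x h j m h0 h1 jmT; have n0 := nsq_ge0 x.
have n1 : 0 <= 1 + nsq x by nneg.
pose Mo := (1 + nsq x) * expR (euler_rate (d := d) b L C * T).
have Mo0 : 0 <= Mo by rewrite mulr_ge0// expR_ge0.
have bM : bcst b L * Mo = B * (1 + nsq x) by rewrite /B /Mo; ring.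
have hM l : (l <= j + m)%N -> (nint P (fun om => 1 + nsq (euler W b sigma x h l om))%R <= Mo%:E)%E.
 move=> lm; apply: le_trans (euler_moment hF hW hbs x h0 l h1) _.
 rewrite lee_fin ler_wpM2l// ler_expR ler_wpM2l ?(euler_rate_ge0 hbs)//.
 by apply: le_trans jmT; rewrite ler_wpM2r ?(ltW h0)// ler_nat.
have mE k : meas (euler W b sigma x h k) := @meas_euler R d disp Omega P F hF W hW b sigma L C hbs x h h0 k.
have ms := meas_sigma hbs.
have step0 l : (l < m)%N -> (nint P (fun om => nsq (euler W b sigma x h (j + l) om - euler W b sigma x h j om)) <=
  (A * (1 + nsq x) * (m%:R * h))%:E)%E.
 move=> lm; have := @nint_euler_frozen x h h0 0 j l Mo _ Mo0 (sqr_ge0 C).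
 have e0 om : nsq (euler W b sigma x h (j + l) om - frozen x h 0 j l om) =
   nsq (euler W b sigma x h (j + l) om - euler W b sigma x h j om) by rewrite /frozen mul0r scale0r addr0.
 rewrite (eq_nint _ e0) => H; apply: le_trans (H _ _) _.
 - by move=> k kl; apply: hM; rewrite leq_add2l (leq_trans (ltnW kl))// ltnW.
 - move=> k kl; rewrite -(nint_cst P (C ^+ 2)); apply: le_nint.
  + apply: nnm_sqr; apply: measurable_funB; first exact: (mcomp ms (mE _)).
   by apply: measurable_funM => //; exact: (mcomp ms (mE _)).
  + by apply: nnm_cst; exact: sqr_ge0.
  + by move=> om; rewrite mul0r subr0 -real_normK ?num_real// lerXn2r ?nnegrE.
 rewrite lee_fin bM.
 have lh : l%:R * h <= m%:R * h by rewrite ler_wpM2r ?(ltW h0)// ler_nat ltnW.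
 have lT : l%:R * h <= T by apply: le_trans jmT; apply: le_trans lh _; rewrite ler_wpM2r ?(ltW h0)// ler_nat leq_addl.
 have lh0 : 0 <= l%:R * h by nneg.
 apply: (@le_trans _ _ (A * (1 + nsq x) * (l%:R * h))); last by rewrite ler_wpM2l// mulr_ge0.
 rewrite /A; move: (l%:R * h) lT lh0 (1 + nsq x) n1 (lerDl 1 (nsq x)) => u uT u0 v v0; rewrite n0 => /idP v1.
 rewrite -subr_ge0 (_ : _ - _ = 2 * ((T - u) * (u * (B * v))) + 2 * ((v - 1) * (u * (d%:R * C ^+ 2)))); last by ring.
 by nneg.
have S0 : 0 <= L * (A * (1 + nsq x) * (m%:R * h)) by nneg.
apply: le_trans (@nint_euler_frozen x h h0 1 j m Mo (L * (A * (1 + nsq x) * (m%:R * h))) Mo0 S0 _ _) _.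
- by move=> l lm; apply: hM; rewrite leq_add2l ltnW.
- move=> l lm; apply: nint_le_lin1 (step0 l lm) => //.
 + apply: nnm_sqr; apply: measurable_funB; first exact: (mcomp ms (mE _)).
  by apply: measurable_funM => //; exact: (mcomp ms (mE _)).
 + by split=> [|om]; [apply: meas_nsqf; exact: meas_rVB|exact: nsq_ge0].
 + by move=> om; rewrite mul1r; exact: hs.
by rewrite lee_fin bM le_eqVlt; apply/orP; left; apply/eqP; ring.
Qed.

End euler_block.

Lemma ler_of_eps {R : realType} (a c k : R) : 0 <= k ->
 (forall e, 0 < e -> a <= c + k * e) -> a <= c.
Proof.
move=> k0 H; apply/ler_addgt0Pr => e e0.
have k1 : 0 < k + 1 by rewrite ltr_wpDl.
apply: le_trans (H (e / (k + 1)) _) _; first by nneg.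
by rewrite lerD2l mulrA ler_pdivrMr// mulrC ler_pM2l// lerDl.
Qed.

Lemma dist_via {R : realDomainType} (a b c e x y z : R) : `|a - c| <= x -> `|b - e| <= y ->
 `|e - c| <= z -> `|b - a| <= z + (x + y).
Proof. by rewrite !ler_norml; lra. Qed.

Lemma eq_refl_le {R : realDomainType} (a b : R) : a = b -> a <= b.
Proof. by move->. Qed.

Lemma dist_mid {R : realDomainType} (m m' a b x y : R) : m = m' -> `|m - a| <= x -> `|m' - b| <= y ->
 `|a - b| <= x + y.
Proof. by move=> <-; rewrite !ler_norml; lra. Qed.

Lemma smoothing_arith {R : realFieldType} (K t N D s q p : R) : 0 <= K -> 0 <= t -> 1 <= N -> 0 <= D ->
 0 < s -> 0 < q -> 0 < p -> p <= 1 ->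
 4 / p ^+ 4 * (K * N * (t * p ^+ 6)) + 2 * (p / 2) ^+ 4 * D / (s * (q * p ^+ 3)) +
 (4 / (p / 2) ^+ 4 * (K * N * (t * p ^+ 6)) + 2 * p ^+ 4 * D / (s * (q * p ^+ 3))) <=
 (68 * K * t + 4 * D / (s * q)) * N * p.
Proof.
move=> K0 t0 N1 D0 s0 q0 p0 p1.
have -> : 4 / p ^+ 4 * (K * N * (t * p ^+ 6)) = 4 * (K * t * N * p ^+ 2) by field; rewrite gt_eqF.
have -> : 4 / (p / 2) ^+ 4 * (K * N * (t * p ^+ 6)) = 64 * (K * t * N * p ^+ 2) by field; rewrite gt_eqF.
have -> : 2 * (p / 2) ^+ 4 * D / (s * (q * p ^+ 3)) = 8^-1 * (D / (s * q)) * p by field; rewrite !gt_eqF.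
have -> : 2 * p ^+ 4 * D / (s * (q * p ^+ 3)) = 2 * (D / (s * q)) * p by field; rewrite !gt_eqF.
have -> : 4 * D / (s * q) = 4 * (D / (s * q)) by rewrite mulrA.
have : 0 <= D / (s * q) by nneg.
move: (D / (s * q)) => B B0.
have a1 : K * t * N * p ^+ 2 <= K * t * N * p.
 have p2 : p ^+ 2 <= p by rewrite expr2 ler_piMl// ltW.
 have N0 : 0 <= N by apply: le_trans N1.
 by rewrite ler_wpM2l// mulr_ge0// mulr_ge0.
have a2 : B * p <= B * N * p by rewrite ler_wpM2r ?(ltW p0)// ler_peMr.
have a3 : 0 <= B * p by nneg.
rewrite (_ : (68 * K * t + 4 * B) * N * p = 68 * (K * t * N * p) + 4 * (B * N * p)); last by ring.
rewrite -!(mulrA _ B); move: (K * t * N * p ^+ 2) (K * t * N * p) (B * N * p) (B * p) a1 a2 a3 => *; lra.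
Qed.

Lemma cvg_smoothing_scale {R : realType} {d : nat} (x v : 'rV[R]_d) :
 (x + (2 ^+ k)^-1 ^+ 4 *: v) @[k --> \oo] --> x.
Proof.
suff : (x + (2 ^+ k)^-1 ^+ 4 *: v) @[k --> \oo] --> x + 0 *: v by rewrite scale0r addr0.
apply: cvgD; first exact: cvg_cst.
apply: cvgZl; rewrite (_ : 0 = (0 : R) ^+ 4); last by rewrite expr0n.
have c2 : (2 ^+ k)^-1 @[k --> \oo] --> (0 : R).
 under eq_fun do rewrite -exprVn.
 by apply: cvg_expr; rewrite ger0_norm ?invr_ge0// invf_lt1// ltr1n.
rewrite !exprS expr0 !mulr1; under eq_fun do rewrite !exprS expr0 mulr1.
by do 3 (apply: cvgM => //).
Qed.

Section strong_feller.
Context {R : realType} {d : nat} {disp} {Omega : measurableType disp} (P : probability Omega R) (F : R -> set (set Omega))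
 (hF : is_filtration P F) (W : R -> Omega -> 'rV[R]_d) (hW : is_brownian_motion P F W)
 (mW : forall t, meas (W t)) (cW : forall om, continuous (W ^~ om)) (b : 'rV[R]_d -> 'rV[R]_d)
 (sigma : 'rV[R]_d -> R) (L C : R) (hbs : lip_coefs b sigma L C) (s0 : R) (s0_gt0 : 0 < s0)
 (s0_le : forall x, s0 <= sigma x).
Local Notation X := (sol W b sigma).
Local Notation gamma := (@gauss R d 1).
Implicit Types (f u : 'rV[R]_d -> R).

Let ms := meas_sigma hbs.
Let mE x h k (h0 : 0 < h) : meas (euler W b sigma x h k) :=
 @meas_euler R d disp Omega P F hF W hW b sigma L C hbs x h h0 k.
Let mX x t : meas (X x t) := meas_sol hF hW mW cW hbs x t.

Lemma ex_frozen x h j m u : 0 < h -> (0 < m)%N -> bm u ->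
 ex P (fun om => u (frozen W b sigma x h 1 j m om)) =
 ex P (fun om => gsm (sigma (euler W b sigma x h j om) * Num.sqrt (m%:R * h)) u (euler W b sigma x h j om)).
Proof.
move=> h0 m0 bu; have [mu u01] := bu; rewrite {1 2}/ex; congr fine.
have jm : j%:R * h < (j + m)%:R * h by rewrite ltr_pM2r// ltr_nat -[ltnLHS]addn0 ltn_add2l.
have tE : (j + m)%:R * h - j%:R * h = m%:R * h by rewrite natrD mulrDl addrAC subrr add0r.
have bf : bm (fun p : 'rV[R]_d * 'rV[R]_d => u (p.1 + sigma p.1 *: p.2)).
 apply: bm_comp bu _; apply: meas_rVD => //; apply: meas_rVZ => //.
 exact: (mcomp ms).
have mf := meas_EFin bf.1.
have f0 p : (0%R <= (u (p.1 + sigma p.1 *: p.2))%:E)%E by rewrite lee_fin; case/andP: (u01 (p.1 + sigma p.1 *: p.2)).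
have := joint_law hF hW (mulr_ge0 (ler0n R j) (ltW h0)) jm
 (Fmeas_euler hF hW hbs x h0 (k := j)) mf f0.
rewrite /nint /= tE => H; transitivity (\int[P]_w (u (euler W b sigma x h j w +
 sigma (euler W b sigma x h j w) *: (W ((j + m)%:R * h) w - W (j%:R * h) w)))%:E)%E.
 by apply: eq_integral => om _; rewrite /frozen mul1r.
rewrite H; apply: eq_integral => om _; rewrite integral_gauss_scale; first last.
- by move=> v; exact: (f0 (euler W b sigma x h j om, v)).
- exact: meas_EFin (bm_section1 bf (euler W b sigma x h j om)).1.
- by rewrite sqrtr_gt0 mulr_gt0// ltr0n.
rewrite /gsm -exE; last first.
 by have := bm_section1 (bm_gsm_arg (sigma (euler W b sigma x h j om) * Num.sqrt (m%:R * h)) bu) (euler W b sigma x h j om).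
by apply: eq_integral => v _; rewrite scalerA.
Qed.

Lemma bm_gsm_var (c : R) u : bm u -> bm (fun y => gsm (sigma y * c) u y).
Proof.
move=> bu; apply: (@bm_ex2 _ _ _ _ _ (fun p : 'rV[R]_d * 'rV[R]_d => u (p.1 + (sigma p.1 * c) *: p.2))).
apply: bm_comp bu _; apply: meas_rVD => //; apply: meas_rVZ => //.
by apply: measurable_funM => //; exact: (mcomp ms).
Qed.

Lemma euler_smoothing t : 0 < t -> exists2 K : R, 0 <= K & forall x h j m δ r f, 0 < h -> h <= 1 ->
 (j + m)%:R * h <= t -> (0 < m)%N -> 0 < δ -> 0 <= r -> bm f ->
 `|ex P (fun om => gsm r (gsm δ f) (euler W b sigma x h (j + m) om)) -
  ex P (fun om => gsm δ f (euler W b sigma x h (j + m) om))| <=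
 4 / δ * (K * (1 + nsq x) * (m%:R * h)) + 2 * r * (1 + d%:R) / (s0 * Num.sqrt (m%:R * h)).
Proof.
move=> t0; have [K K0 HK] := euler_one_frozen hF hW hbs (ltW t0).
exists (1 + K); first by nneg.
move=> x h j m δ r f h0 h1 jmt m0 d0 r0 bf.
have bu := bm_gsm δ bf; have bw := bm_gsm r bu.
have l0 : 0 <= 2 / δ by nneg.
have lu y z := gsm_lip y z d0 bf.
have lw y z := gsm_mod_lip r y z l0 bu lu.
have e0 : 0 < m%:R * h by rewrite mulr_gt0// ltr0n.
have mfr := meas_frozen hF hW hbs x h0 1 j m.
have hc := HK x h j m h0 h1 jmt.
have H1 := ex_dist_lip bu l0 lu (mE x (j + m) h0) mfr e0 hc.
have H2 := ex_dist_lip bw l0 lw (mE x (j + m) h0) mfr e0 hc.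
have H3 : `|ex P (fun om => gsm r (gsm δ f) (frozen W b sigma x h 1 j m om)) -
  ex P (fun om => gsm δ f (frozen W b sigma x h 1 j m om))| <= 2 * r * (1 + d%:R) / (s0 * Num.sqrt (m%:R * h)).
 have q0 : 0 < Num.sqrt (m%:R * h) by rewrite sqrtr_gt0.
 have sq0 : 0 < s0 * Num.sqrt (m%:R * h) by nneg.
 rewrite !ex_frozen//; apply: ex_dist_cst.
 - exact: (bm_comp (bm_gsm_var _ bw) (mE x j h0)).
 - exact: (bm_comp (bm_gsm_var _ bu) (mE x j h0)).
 - by nneg.
 - move=> om; set y := euler _ _ _ _ _ _ _.
  have sy := s0_le y; have sy0 : 0 < sigma y by apply: lt_le_trans sy.
  apply: le_trans (gsm_double _ _ r0 bu) _; first by nneg.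
  rewrite [leLHS](_ : _ = 2 * r * (1 + d%:R) * (sigma y * Num.sqrt (m%:R * h))^-1); last by ring.
  rewrite ler_wpM2l ?mulr_ge0 ?addr_ge0// lef_pV2 ?posrE ?mulr_gt0//.
  by rewrite ler_pM2r.
have hb : 2 / δ * (m%:R * h + K * (1 + nsq x) * (m%:R * h) ^+ 2 / (4 * (m%:R * h))) <=
  2 / δ * ((1 + K) * (1 + nsq x) * (m%:R * h)).
 rewrite ler_wpM2l//; move: (m%:R * h) e0 (nsq_ge0 x) => e e0 n0.
 rewrite (_ : _ / (4 * e) = K * (1 + nsq x) * e / 4); last by field; rewrite gt_eqF.
 have : 0 <= K * (1 + nsq x) * e by nneg.
 have : 0 <= nsq x * e by nneg.
 nra.
have {}H1 := le_trans H1 hb; have {}H2 := le_trans H2 hb.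
have {H1 H2 H3} H := dist_via H1 H2 H3; apply: le_trans H _; clear.
apply: eq_refl_le; ring.
Qed.

Lemma sol_smoothing t : 0 < t -> exists2 K : R, 0 <= K & forall x k δ r f, 0 < δ -> 0 <= r -> bm f ->
 `|ex P (fun om => gsm r (gsm δ f) (X x t om)) - ex P (fun om => gsm δ f (X x t om))| <=
 4 / δ * (K * (1 + nsq x) * (t * (2 ^+ k)^-1 ^+ 6)) + 2 * r * (1 + d%:R) / (s0 * (Num.sqrt t * (2 ^+ k)^-1 ^+ 3)).
Proof.
move=> t0; have [K K0 HK] := euler_smoothing t0; exists K => // x k δ r f d0 r0 bf.
have [K' K'0 HK'] := euler_sol_error hF hW mW cW hbs x t0.
have bu := bm_gsm δ bf; have bw := bm_gsm r bu.
have l0 : 0 <= 2 / δ by nneg.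
have lu y z := gsm_lip y z d0 bf.
have lw y z := gsm_mod_lip r y z l0 bu lu.
apply: (@ler_of_eps _ _ _ (4 / δ * (5 / 4))); first by nneg.
move=> e e0; have e2 : 0 < e ^+ 2 by nneg.
have q0 : 0 <= K' / e ^+ 2 by nneg.
pose M := (Num.trunc (t + K' / e ^+ 2)).+1.
have hM : t + K' / e ^+ 2 < M%:R by rewrite /M truncnS_gt.
have M0 : (0 < M)%N by [].
pose n := (64 ^ k * M)%N; have n0 : (0 < n)%N by rewrite muln_gt0 expn_gt0.
have nM : (M%:R : R) <= n%:R by rewrite ler_nat leq_pmull// expn_gt0.
have nR : (0 : R) < n%:R by rewrite ltr0n.
have tn : t / n%:R <= 1.
 rewrite ler_pdivrMr// mul1r (le_trans _ nM)//; apply/ltW; apply: le_lt_trans hM.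
 by rewrite lerDl.
have Kn : K' / n%:R <= e ^+ 2.
 rewrite ler_pdivrMr// -ler_pdivrMl// mulrC (le_trans _ nM)//; apply/ltW; apply: le_lt_trans hM.
 by rewrite lerDr ltW.
have H := HK' n n0 tn.
have hE : (nint P (fun om => nsq (X x t om - euler W b sigma x (t / n%:R) n om)) <= (e ^+ 2)%:E)%E.
 by apply: le_trans H _; rewrite lee_fin.
have h0 : 0 < t / n%:R by nneg.
pose j := ((64 ^ k - 1) * M)%N.
have jM : (j + M = n)%N by rewrite /j /n -{2}[M]mul1n -mulnDl subnK// expn_gt0.
have H1 := ex_dist_lip bu l0 lu (mX x t) (mE x n h0) e0 hE.
have H2 := ex_dist_lip bw l0 lw (mX x t) (mE x n h0) e0 hE.
have := HK x (t / n%:R) j M δ r f h0 tn; rewrite jM.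
have nh : n%:R * (t / n%:R) = t by rewrite mulrC divfK// gt_eqF.
rewrite nh => /(_ (lexx t) M0 d0 r0 bf).
have eMh : M%:R * (t / n%:R) = t * (2 ^+ k)^-1 ^+ 6.
 rewrite /n natrM natrX (_ : 64%:R = 2 ^+ 6 :> R); last by rewrite -natrX.
 rewrite exprAC exprVn; field.
 by rewrite ?pnatr_eq0 ?expf_neq0 ?pnatr_eq0.
rewrite eMh (_ : Num.sqrt (t * _) = Num.sqrt t * (2 ^+ k)^-1 ^+ 3); last first.
 have p3 : 0 <= (2 ^+ k)^-1 ^+ 3 :> R by nneg.
 by rewrite sqrtrM ?(ltW t0)// (_ : 6%N = (3 * 2)%N)// exprM sqrtr_sqr (ger0_norm p3).
have eb : 2 / δ * (e + e ^+ 2 / (4 * e)) = 2 / δ * (5 / 4) * e by field; rewrite ?gt_eqF.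
rewrite eb in H1 H2 => H3; apply: le_trans (dist_via H1 H2 H3) _.
by rewrite lerD2l le_eqVlt; apply/orP; left; apply/eqP; ring.
Qed.

Lemma ex_cvg disp' (T : measurableType disp') (m : probability T R) (f : nat -> T -> R) (g : T -> R) :
 (forall n, bm (f n)) -> bm g -> (forall x, f n x @[n --> \oo] --> g x) ->
 ex m (f n) @[n --> \oo] --> ex m g.
Proof.
move=> bf bg fg.
have [|||||_ _ h] := @dominated_convergence _ _ _ m setT measurableT (fun n x => (f n x)%:E) (fun x => (g x)%:E) (fun=> 1%E).
- by move=> n; apply: meas_EFin; case: (bf n).
- by apply: meas_EFin; case: bg.
- by apply/aeW => x _; apply: cvg_EFin; [exact: nearW|exact: fg].
- by apply: finite_measure_integrable_cst.
- apply/aeW => n x _ /=; rewrite lee_fin.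
 by have /andP[a0 a1] := (bf x).2 n; rewrite ger0_norm.
by apply: fine_cvg; rewrite -/(nint m g) (exE m bg) in h.
Qed.

Lemma cvg_gsm_sol t x f : bm f -> continuous f ->
 ex P (fun om => gsm ((2 ^+ k)^-1 ^+ 4) f (X x t om)) @[k --> \oo] --> ex P (fun om => f (X x t om)).
Proof.
move=> bf cf; apply: ex_cvg => [n||om]; [exact: bm_comp (bm_gsm _ bf) (mX x t)|exact: bm_comp bf (mX x t)|].
rewrite -[f _](ex_cst gamma); apply: ex_cvg => [n||v].
- exact: (bm_section1 (bm_gsm_arg _ bf) (X x t om)).
- by split=> // v; case: bf.
- by apply: continuous_cvg; [exact: cf|exact: cvg_smoothing_scale].
Qed.

Lemma sol_gsm_close t : 0 < t -> exists2 K : R, 0 <= K & forall x k f, bm f -> continuous f ->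
 `|ex P (fun om => gsm ((2 ^+ k)^-1 ^+ 4) f (X x t om)) - ex P (fun om => f (X x t om))| <=
 K * (1 + nsq x) * (2 ^+ k)^-1.
Proof.
move=> t0; have [K K0 HK] := sol_smoothing t0.
have q0 : 0 < Num.sqrt t by rewrite sqrtr_gt0.
have sq0 : 0 < s0 * Num.sqrt t by nneg.
pose A := 68 * K * t; pose B := 4 * (1 + d%:R) / (s0 * Num.sqrt t).
have A0 : 0 <= A by rewrite !mulr_ge0// ltW.
have B0 : 0 <= B by rewrite divr_ge0 ?(ltW sq0)// mulr_ge0// addr_ge0.
exists (2 * (A + B)); first by nneg.
move=> x k f bf cf.
have n0 := nsq_ge0 x; have n1 : 0 <= 1 + nsq x by nneg.
have c0 : 0 <= (A + B) * (1 + nsq x) by nneg.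
pose u k := ex P (fun om => gsm ((2 ^+ k)^-1 ^+ 4) f (X x t om)).
have hu j : (0 <= j)%N -> `|u j - u j.+1| <= (A + B) * (1 + nsq x) * (2 ^+ j)^-1.
 move=> _; set p : R := (2 ^+ j)^-1.
 have pp : 0 < p by rewrite invr_gt0 exprn_gt0.
 have p1 : p <= 1 by rewrite invf_le1 ?exprn_gt0// exprn_ege1// ler1n.
 have eS : (2 ^+ j.+1)^-1 = p / 2 :> R by rewrite exprS invfM mulrC.
 have p4 : 0 < p ^+ 4 by nneg.
 have r4 : 0 < (p / 2) ^+ 4 by nneg.
 have := HK x j (p ^+ 4) ((p / 2) ^+ 4) f p4 (ltW r4) bf.
 have := HK x j ((p / 2) ^+ 4) (p ^+ 4) f r4 (ltW p4) bf.
 have eM : ex P (fun om => gsm ((p / 2) ^+ 4) (gsm (p ^+ 4) f) (X x t om)) =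
   ex P (fun om => gsm (p ^+ 4) (gsm ((p / 2) ^+ 4) f) (X x t om)).
  by apply: eq_ex => om; exact: gsm_comm.
 move=> h1 h2; rewrite /u eS -/p; apply: le_trans (dist_mid eM h2 h1) _; rewrite -/p.
 clear h1 h2 eM; rewrite /A /B; apply: smoothing_arith => //.
 - exact: ltW.
 - by rewrite lerDl.
have [_ /(_ k (leq0n k))] := geometric_cauchy c0 hu.
rewrite (cvg_lim _ (@cvg_gsm_sol t x f bf cf))// -/(u k) => h.
by apply: le_trans h _; rewrite !mulrA.
Qed.

Lemma semigroup_modulus t : 0 < t -> exists2 K : R, 0 <= K & forall k, exists2 D : R, 0 <= D &
 forall x y f, bm f -> continuous f ->
 `|ex P (fun om => f (X x t om)) - ex P (fun om => f (X y t om))| <=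
 K * (2 + nsq x + nsq y) * (2 ^+ k)^-1 + D * enorm (x - y).
Proof.
move=> t0; have [K K0 HK] := sol_gsm_close t0; exists K => // k.
have [K' K'0 HK'] := solution_stability hF hW hbs (ltW t0).
set p : R := (2 ^+ k)^-1; have pp : 0 < p ^+ 4 by rewrite exprn_gt0// invr_gt0 exprn_gt0.
have l0 : 0 <= 2 / p ^+ 4 by nneg.
exists (2 / p ^+ 4 * (1 + K' / 4)); first by nneg.
move=> x y f bf cf; have [->|xy] := eqVneq x y.
 rewrite !subrr normr0 addr_ge0// mulr_ge0 ?enorm_ge0//; last by nneg.
  by nneg.
 by rewrite invr_ge0 exprn_ge0.
have e0 : 0 < enorm (x - y).
 rewrite lt_neqAle enorm_ge0 andbT eq_sym; apply: contra_neq xy => h.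
 by apply/eqP; rewrite -subr_eq0; apply/eqP/nsq_eq0; rewrite -sqr_enorm h expr0n.
have lu y1 y2 := gsm_lip y1 y2 pp bf.
have := ex_dist_lip (bm_gsm _ bf) l0 lu (mX x t) (mX y t) e0
 (HK' x y _ _ (is_solution_sol hF hW mW cW hbs x) (is_solution_sol hF hW mW cW hbs y)).
have e1 : 2 / p ^+ 4 * (enorm (x - y) + K' * nsq (x - y) / (4 * enorm (x - y))) =
  2 / p ^+ 4 * (1 + K' / 4) * enorm (x - y).
 rewrite -sqr_enorm; move: (p ^+ 4) pp (enorm _) e0 => q q0 e e0; field.
 by rewrite !gt_eqF.
rewrite e1 => H.
have hx := HK x k f bf cf; have hy := HK y k f bf cf.
apply: le_trans (dist_via (le_trans (eq_refl_le (distrC _ _)) hy) (le_trans (eq_refl_le (distrC _ _)) hx) H) _.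
by rewrite -/p addrC lerD2r le_eqVlt; apply/orP; left; apply/eqP; ring.
Qed.

End strong_feller.

Section continuous_approximation.
Context {R : realType} {d : nat} (m1 m2 : probability 'rV[R]_d R).
Implicit Types (A B : set 'rV[R]_d) (f g : 'rV[R]_d -> R).

Definition l1dist f g : 'rV[R]_d -> R := fun x => `|f x - g x|.

Definition cont_approx A : Prop := measurable A /\ forall e : R, 0 < e -> exists f,
 [/\ bm f, continuous f, (nint m1 (l1dist \1_A f) <= e%:E)%E & (nint m2 (l1dist \1_A f) <= e%:E)%E].

Lemma bm_indic A : measurable A -> bm (\1_A : 'rV[R]_d -> R).
Proof. by move=> mA; split=> [|x]; [exact: measurable_indic|rewrite indicE; case: (_ \in _); rewrite ?lexx ler01]. Qed.

Lemma bm_l1dist f g : bm f -> bm g -> bm (l1dist f g).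
Proof.
move=> [mf f01] [mg g01]; split=> [|x].
 by apply: mcomp; [exact: normr_measurable|exact: measurable_funB].
rewrite normr_ge0/= ler_norml.
by have /andP[a0 a1] := f01 x; have /andP[b0 b1] := g01 x; apply/andP; split; lra.
Qed.

Lemma cont_approx0 : cont_approx set0.
Proof.
split=> // e e0; exists (fun=> 0).
have E : l1dist (\1_set0) (fun=> 0) =1 (fun=> 0 : R) by move=> x; rewrite /l1dist indic0 subrr normr0.
split; rewrite ?(eq_nint _ E) ?nint_cst ?lee_fin ?ltW//.
 by split=> // x; rewrite lexx ler01.
by move=> x; exact: cst_continuous.
Qed.

Lemma cont_approxC A : cont_approx A -> cont_approx (~` A).
Proof.
move=> [mA hA]; split=> [|e e0]; first exact: measurableC.
have [f [bf cf h1 h2]] := hA e e0; exists (fun x => 1 - f x).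
have E : l1dist \1_(~` A) (fun x => 1 - f x) =1 l1dist \1_A f.
 move=> x; rewrite /l1dist -[RHS]normrN !indicE in_setC; case: (x \in A) => /=; congr `|_|; ring.
split; rewrite ?(eq_nint _ E)//.
 split=> [|x]; first by apply: measurable_funB => //; case: bf.
 by have /andP[a0 a1] := bf.2 x; apply/andP; split; lra.
by move=> x; apply: continuousB; [exact: cst_continuous|exact: cf].
Qed.

Lemma cont_approxU A B : cont_approx A -> cont_approx B -> cont_approx (A `|` B).
Proof.
move=> [mA hA] [mB hB]; split=> [|e e0]; first exact: measurableU.
have e2 : 0 < e / 2 by nneg.
have [f [bf cf f1 f2]] := hA _ e2; have [g [bg cg g1 g2]] := hB _ e2.
exists (fun x => f x + g x - f x * g x).
have bh : bm (fun x => f x + g x - f x * g x).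
 split=> [|x].
  by apply: measurable_funB; [apply: measurable_funD|apply: measurable_funM]; case: bf; case: bg.
 have /andP[a0 a1] := bf.2 x; have /andP[b0 b1] := bg.2 x; apply/andP; split; nra.
have nA := bm_nnm (bm_l1dist (bm_indic mA) bf); have nB := bm_nnm (bm_l1dist (bm_indic mB) bg).
have nU := bm_nnm (bm_l1dist (bm_indic (measurableU _ _ mA mB)) bh).
have key x : l1dist \1_(A `|` B) (fun x => f x + g x - f x * g x) x <= 1 * l1dist \1_A f x + 1 * l1dist \1_B g x.
 rewrite !mul1r /l1dist.
 have -> : (\1_(A `|` B) x : R) - (f x + g x - f x * g x) =
   (\1_A x - f x) * (1 - \1_B x) + (\1_B x - g x) * (1 - f x).
  by rewrite !indicE in_setU; case: (x \in A); case: (x \in B) => /=; ring.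
 apply: le_trans (ler_normD _ _) _; rewrite !normrM.
 have /andP[a0 a1] := (bm_indic mB).2 x; have /andP[b0 b1] := bf.2 x.
 apply: lerD; apply: ler_piMr => //.
  by rewrite ger0_norm; lra.
 by rewrite ger0_norm; lra.
split=> //.
- by move=> x; apply: (continuousB (continuousD (cf x) (cg x)) (continuousM (cf x) (cg x))).
- have := nint_le_lin2 nU nA nB ler01 ler01 key f1 g1.
 by rewrite !mul1r -splitr.
- have := nint_le_lin2 nU nA nB ler01 ler01 key f2 g2.
 by rewrite !mul1r -splitr.
Qed.

Lemma measure_tail (m : probability 'rV[R]_d R) (A : nat -> set 'rV[R]_d) (e : R) : (forall n, measurable (A n)) -> 0 < e ->
 exists N, forall n, (N <= n)%N -> (m ((\bigcup_k A k) `\` \big[setU/set0]_(k < n) A k) <= e%:E)%E.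
Proof.
move=> mA e0; pose D n := (\bigcup_k A k) `\` \big[setU/set0]_(k < n) A k.
have mU : measurable (\bigcup_k A k) by exact: bigcup_measurable.
have mD n : measurable (D n).
 by apply: measurableD => //; exact: bigsetU_measurable.
have D0 : \bigcap_n D n = set0.
 apply/seteqP; split=> // x Dx; have [[k _ Akx] _] := Dx 0%N I.
 have [_] := Dx k.+1 I; apply; rewrite -bigcup_mkord; exists k => //=.
have : (m \o D) n @[n --> \oo] --> m (\bigcap_n D n).
 apply: nonincreasing_cvg_mu => //.
 - by apply: le_lt_trans (probability_le1 m (mD 0%N)) _; rewrite ltry.
 - by rewrite D0.
 - move=> n k nk; apply/subsetPset => x [Ux nx]; split=> //; apply: contra_not nx.
  by rewrite -!bigcup_mkord => -[j /= jn Aj]; exists j => //=; exact: leq_trans nk.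
rewrite D0 measure0 => /(cvge0P (fun n => measure_ge0 m (D n))) /(_ e e0) [N HN].
by exists N.
Qed.

Lemma cont_approx_bigcup (A : nat -> set 'rV[R]_d) : (forall n, cont_approx (A n)) -> cont_approx (\bigcup_k A k).
Proof.
move=> hA; have mA n : measurable (A n) by case: (hA n).
have fin n : cont_approx (\big[setU/set0]_(k < n) A k).
 elim: n => [|n IH]; last by rewrite big_ord_recr/=; exact: cont_approxU.
 by rewrite big_ord0; exact: cont_approx0.
split=> [|e e0]; first exact: bigcup_measurable.
have e2 : 0 < e / 2 by nneg.
have [N1 H1] := measure_tail m1 mA e2; have [N2 H2] := measure_tail m2 mA e2.
pose n := maxn N1 N2; pose B := \big[setU/set0]_(k < n) A k; pose U := \bigcup_k A k.
have [mB /(_ _ e2)[f [bf cf f1 f2]]] := fin n.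
have mU : measurable U by exact: bigcup_measurable.
have mUB : measurable (U `\` B) by exact: measurableD.
exists f; have key x : l1dist \1_U f x <= 1 * \1_(U `\` B) x + 1 * l1dist \1_B f x.
 rewrite !mul1r /l1dist (_ : \1_U x - f x = \1_(U `\` B) x + (\1_B x - f x)).
  by apply: le_trans (ler_normD _ _) _; rewrite lerD2r ger0_norm// indicE.
 rewrite addrA; congr (_ - _); rewrite !indicE in_setD.
 have BU : x \in B -> x \in U.
  by rewrite !inE /B -bigcup_mkord => -[k _ Ak]; exists k.
 by case: (x \in U) BU; case: (x \in B) => /=; rewrite ?addr0 ?add0r// => /(_ isT).
have nA := bm_nnm (bm_indic mUB); have nB := bm_nnm (bm_l1dist (bm_indic mB) bf).
have nU := bm_nnm (bm_l1dist (bm_indic mU) bf).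
split=> //.
- have := @nint_le_lin2 _ _ _ m1 _ _ _ _ _ (e / 2) (e / 2) nU nA nB ler01 ler01 key _ f1.
 by rewrite !mul1r -splitr; apply; rewrite nint_indic//; exact: H1 (leq_maxl _ _).
- have := @nint_le_lin2 _ _ _ m2 _ _ _ _ _ (e / 2) (e / 2) nU nA nB ler01 ler01 key _ f2.
 by rewrite !mul1r -splitr; apply; rewrite nint_indic//; exact: H2 (leq_maxr _ _).
Qed.

Lemma cont_approx_ray (i : 'I_d) (a : R) : cont_approx [set x | a < x 0 i].
Proof.
have mA : measurable [set x : 'rV[R]_d | a < x 0 i].
 have -> : [set x : 'rV[R]_d | a < x 0 i] = (fun x => x 0 i) @^-1` `]a, +oo[%classic.
  by apply/seteqP; split=> x /=; rewrite in_itv/= andbT.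
 by rewrite -[X in measurable X]setTI; apply: meas_coord => //; exact: measurable_itv.
split=> // e e0.
pose y (x : 'rV[R]_d) : R := `|x 0 i - a| + (x 0 i - a).
have y0 x : 0 <= y x by rewrite /y -lerBlDr sub0r -normrN ler_norm.
have cy : continuous y.
 move=> x; have cx : {for x, continuous (fun x' : 'rV[R]_d => x' 0 i - a)}.
  by apply: continuousB; [exact: coord_continuous|exact: cst_continuous].
 have cn : {for x, continuous (fun x' : 'rV[R]_d => `|x' 0 i - a|)}.
  by apply: continuous_comp; [exact: cx|exact: norm_continuous].
 exact: (continuousD cn cx).
pose f n (x : 'rV[R]_d) : R := 1 - expR (- (n%:R * y x)).
have cf n : continuous (f n).
 have ce : continuous (fun z : R => 1 - expR z).
  by move=> z; apply: cvgB; [exact: cvg_cst|exact: continuous_expR].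
 move=> x; have c1 : {for x, continuous (fun x' : 'rV[R]_d => - (n%:R * y x'))}.
  by apply: continuousN; apply: continuousM; [exact: cst_continuous|exact: cy].
 exact: (@continuous_comp _ _ _ (fun x' : 'rV[R]_d => - (n%:R * y x')) (fun z : R => 1 - expR z) x c1 (ce _)).
have bf n : bm (f n).
 split=> [|x]; first exact: meas_continuous.
 rewrite /f subr_ge0 lerBlDr lerDl expR_ge0 andbT -[leRHS]expR0 ler_expR oppr_le0.
 by nneg.
have fl x : l1dist \1_[set x | a < x 0 i] (f n) x @[n --> \oo] --> (0 : R).
 have [ax|ax] := ltP a (x 0 i).
  have yp : 0 < y x by rewrite /y ltr_wpDl// subr_gt0.
  have E n : l1dist \1_[set x | a < x 0 i] (f n) x = expR (- y x) ^+ n.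
   rewrite /l1dist indicE mem_set//= /f opprB addrCA subrr addr0 ger0_norm ?expR_ge0//.
   by rewrite -expRM_natl mulrN.
  under eq_fun do rewrite E.
  by apply: cvg_expr; rewrite ger0_norm ?expR_ge0// -[ltRHS]expR0 ltr_expR oppr_lt0.
 have yx : y x = 0 by rewrite /y ler0_norm ?subr_le0// addrC subrr.
 have E n : l1dist \1_[set x | a < x 0 i] (f n) x = 0.
  rewrite /l1dist indicE memNset/=; last by apply/negP; rewrite -leNgt.
  by rewrite /f yx mulr0 oppr0 expR0 subrr subrr normr0.
 by under eq_fun do rewrite E; exact: cvg_cst.
have b0 : bm (fun _ : 'rV[R]_d => 0 : R) by split=> // x; rewrite lexx ler01.
have bl n := bm_l1dist (bm_indic mA) (bf n).
have small (m : probability 'rV[R]_d R) : \forall n \near \oo, (nint m (l1dist \1_[set x : 'rV[R]_d | (a < x 0%R i)%R] (f n)) <= e%:E)%E.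
 have := ex_cvg (m := m) bl b0 fl; rewrite ex_cst => /cvgrPdist_le/(_ e e0).
 apply: filterS => n; rewrite sub0r normrN => H; rewrite exE// lee_fin.
 by apply: le_trans H; exact: ler_norm.
have [N _ HN] := small m1; have [N' _ HN'] := small m2.
exists (f (maxn N N')); split=> //; [apply: HN|apply: HN'] => /=; [exact: leq_maxl|exact: leq_maxr].
Qed.

Lemma meas_cont_approx A : measurable A -> cont_approx A.
Proof.
move: A; suff : @measurable _ 'rV[R]_d `<=` cont_approx by [].
have sa : sigma_algebra setT cont_approx.
 by split=> [|A|]; [exact: cont_approx0|rewrite setTD; exact: cont_approxC|exact: cont_approx_bigcup].
apply: smallest_sub => //; rewrite -bigcup_seq; apply: bigcup_sub => i _ _ [B mB <-]; rewrite setTI.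
suff : @measurable _ (measurableTypeR R) `<=` [set B | cont_approx (rV_coord i @^-1` B)] by apply.
rewrite [X in X `<=` _](RGenOInfty.measurableE R); apply: smallest_sub.
 split=> /=; first by rewrite preimage_set0; exact: cont_approx0.
 - by move=> C hC; rewrite setTD preimage_setC; exact: cont_approxC.
 - by move=> C hC; rewrite preimage_bigcup; exact: cont_approx_bigcup.
move=> _ [a ->] /=; have := cont_approx_ray i a; congr cont_approx.
by apply/seteqP; split=> x /=; rewrite in_itv/= andbT.
Qed.

End continuous_approximation.

Section strong_feller_borel.
Context {R : realType} {d : nat} {disp} {Omega : measurableType disp} (P : probability Omega R) (F : R -> set (set Omega))
 (hF : is_filtration P F) (W : R -> Omega -> 'rV[R]_d) (hW : is_brownian_motion P F W)
 (mW : forall t, meas (W t)) (cW : forall om, continuous (W ^~ om)) (b : 'rV[R]_d -> 'rV[R]_d)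
 (sigma : 'rV[R]_d -> R) (L C : R) (hbs : lip_coefs b sigma L C) (s0 : R) (s0_gt0 : 0 < s0)
 (s0_le : forall x, s0 <= sigma x).
Local Notation X := (sol W b sigma).

Let mX x t : meas (X x t) := meas_sol hF hW mW cW hbs x t.

Definition law (x : 'rV[R]_d) (t : R) (A : set 'rV[R]_d) : R := fine (P (X x t @^-1` A)).

Let mXA x t A : measurable A -> measurable (X x t @^-1` A).
Proof. by move=> mA; rewrite -[Y in measurable Y]setTI; exact: mX. Qed.

Lemma lawE x t A : measurable A -> law x t A = ex P (fun om => \1_A (X x t om)).
Proof.
move=> mA; rewrite /law /ex; congr fine; rewrite -nint_indic; last exact: mXA.
by [].
Qed.

Lemma law_modulus t : 0 < t -> exists2 K : R, 0 <= K & forall k, exists2 D : R, 0 <= D &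
 forall x y A, measurable A ->
 `|law x t A - law y t A| <= K * (2 + nsq x + nsq y) * (2 ^+ k)^-1 + D * enorm (x - y).
Proof.
move=> t0; have [K K0 HK] := semigroup_modulus hF hW mW cW hbs s0_gt0 s0_le t0.
exists K => // k; have [D D0 HD] := HK k; exists D => // x y A mA.
apply: (@ler_of_eps _ _ _ 2) => // e e0.
pose q z := distribution P (mfun_Sub (mem_set (mX z t))).
have [_ /(_ e e0)[f [bf cf f1 f2]]] := meas_cont_approx (q x) (q y) mA.
have bl := bm_l1dist (bm_indic mA) bf.
have close z : (nint (q z) (l1dist \1_A f) <= e%:E)%E ->
  `|ex P (fun om => f (X z t om)) - law z t A| <= e.
 move=> h; rewrite lawE//; apply: (@ex_dist _ _ _ P _ _ (fun om => l1dist \1_A f (X z t om))).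
 - exact: bm_comp bf (mX z t).
 - exact: bm_comp (bm_indic mA) (mX z t).
 - exact: bm_nnm (bm_comp bl (mX z t)).
 - by move=> om; rewrite distrC.
 - apply: le_trans h; rewrite /nint ge0_integral_distribution//.
  + by apply: meas_EFin; case: bl.
  + by move=> v; rewrite lee_fin; case: (bm_nnm bl).
have hx := close _ f1; have hy := close _ f2; have h := HD x y f bf cf.
rewrite [2 * e]mulr_natl mulr2n; apply: dist_via h.
 by rewrite distrC; exact: hy.
by rewrite distrC; exact: hx.
Qed.

Lemma enorm_le_norm (x : 'rV[R]_d) : enorm x <= (1 + d%:R) * `|x|.
Proof.
apply: enorm_le_of_nsq; first by nneg.
apply: le_trans (nsq_le_norm x) _; rewrite exprMn ler_wpM2r ?sqr_ge0//.
have : (0 : R) <= d%:R by [].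
by move: (d%:R) => n n0; nra.
Qed.

Lemma continuous_law t A : 0 < t -> measurable A -> continuous (fun x => law x t A).
Proof.
move=> t0 mA x; have [K K0 HK] := law_modulus t0.
apply/(@cvgrPdist_le _ _ _ (nbhs x)) => e e0.
pose Q := K * (2 + nsq x + (2 * nsq x + 2 * d%:R)); have Q0 : 0 <= Q.
 by rewrite mulr_ge0// !addr_ge0 ?nsq_ge0 ?mulr_ge0 ?nsq_ge0.
have [k hk] : exists k, Q * (2 ^+ k)^-1 <= e / 2.
 have : Q * (2 ^+ k)^-1 @[k --> \oo] --> (0 : R).
  rewrite -(mulr0 Q); apply: cvgMr; under eq_fun do rewrite -exprVn.
  by apply: cvg_expr; rewrite ger0_norm ?invr_ge0// invf_lt1// ltr1n.
 have e2 : 0 < e / 2 by nneg.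
 move=> /cvgrPdist_le/(_ _ e2)[N _ /(_ N (leqnn N))]; rewrite sub0r normrN => h.
 by exists N; apply: le_trans h; exact: ler_norm.
have [D D0 HD] := HK k.
pose r := Num.min 1 (e / 2 / (D * (1 + d%:R) + 1)).
have D1 : 0 < D * (1 + d%:R) + 1 by nneg.
have r0 : 0 < r by rewrite lt_min ltr01 !divr_gt0.
apply/(@nbhs_ballP R 'rV[R]_d x); exists r => //= y; rewrite -ball_normE/= => xy.
have xy1 : `|x - y| <= 1 by rewrite (le_trans (ltW xy))// ge_min lexx.
have xy2 : `|x - y| <= e / 2 / (D * (1 + d%:R) + 1) by rewrite (le_trans (ltW xy))// ge_min lexx orbT.
apply: le_trans (HD x y A mA) _; rewrite [leRHS]splitr; apply: lerD.
 apply: le_trans hk; rewrite ler_wpM2r ?invr_ge0 ?exprn_ge0// /Q ler_wpM2l// lerD2l.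
 have -> : y = x - (x - y) by rewrite opprB addrC subrK.
 apply: le_trans (nsqB _ _) _; rewrite lerD2l ler_pM2l//.
 by apply: le_trans (nsq_le_norm _) _; rewrite ler_piMr// expr_le1.
apply: (@le_trans _ _ (D * ((1 + d%:R) * `|x - y|))); first by rewrite ler_wpM2l// enorm_le_norm.
rewrite mulrA; apply: (@le_trans _ _ ((D * (1 + d%:R) + 1) * `|x - y|)); first by rewrite ler_wpM2r// lerDl.
by rewrite mulrC -ler_pdivlMr.
Qed.

End strong_feller_borel.

Section gaussian_integrals.
Context {R : realType} {d : nat}.
Local Notation gamma := (@gauss R d 1).
Implicit Types (f g : 'rV[R]_d -> R) (v : 'rV[R]_d).

Definition pg f : Prop := meas f /\ exists K k, forall v, `|f v| <= K * (1 + nsq v) ^+ k.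

Definition lint f : R := Rintegral gamma setT f.

Lemma nsq1_ge1 v : 1 <= 1 + nsq v. Proof. by rewrite lerDl nsq_ge0. Qed.

Lemma pg_bound f : pg f -> exists2 K, 0 <= K & exists k, forall v, `|f v| <= K * (1 + nsq v) ^+ k.
Proof.
move=> [mf [K [k hf]]]; exists `|K| => //; exists k => v; apply: le_trans (hf v) _.
by rewrite ler_wpM2r ?ler_norm// exprn_ge0// (le_trans ler01)// nsq1_ge1.
Qed.

Lemma pg_le f g : meas f -> pg g -> (forall v, `|f v| <= `|g v|) -> pg f.
Proof. by move=> mf [_ [K [k hg]]] fg; split=> //; exists K, k => v; exact: le_trans (fg v) (hg v). Qed.

Lemma pgD f g : pg f -> pg g -> pg (fun v => f v + g v).
Proof.
move=> pf pg'; split; first by apply: measurable_funD; case: pf; case: pg'.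
have [K K0 [k hf]] := pg_bound pf; have [J J0 [j hg]] := pg_bound pg'.
exists (K + J), (maxn k j) => v; apply: le_trans (ler_normD _ _) _; rewrite mulrDl.
have n1 := nsq1_ge1 v; apply: lerD; [apply: le_trans (hf v) _|apply: le_trans (hg v) _];
 by rewrite ler_wpM2l// ler_weXn2l// (leq_maxl, leq_maxr).
Qed.

Lemma pgM f g : pg f -> pg g -> pg (fun v => f v * g v).
Proof.
move=> pf pg'; split; first by apply: measurable_funM; case: pf; case: pg'.
have [K K0 [k hf]] := pg_bound pf; have [J J0 [j hg]] := pg_bound pg'.
by exists (K * J), (k + j)%N => v; rewrite normrM exprD mulrACA ler_pM.
Qed.

Lemma pg_cst (c : R) : pg (fun=> c).
Proof. by split=> //; exists `|c|, 0%N => v; rewrite expr0 mulr1. Qed.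

Lemma pgZ (c : R) f : pg f -> pg (fun v => c * f v).
Proof. by move=> pf; apply: pgM => //; exact: pg_cst. Qed.

Lemma pg_nsq : pg (@nsq R d).
Proof.
split; first exact: meas_nsq.
by exists 1, 1%N => v; rewrite mul1r expr1 ger0_norm ?nsq_ge0// lerDr.
Qed.

Lemma pg_coord i : pg (fun v => v 0 i).
Proof.
split; first exact: meas_coord.
exists 1, 1%N => v; rewrite mul1r expr1; apply: le_trans (normr_coord_le v i) _.
by have := enorm_le_eps v ltr01; have := nsq_ge0 v; lra.
Qed.

Lemma pg_sum (I : Type) (r : seq I) (F : I -> 'rV[R]_d -> R) : (forall i, pg (F i)) ->
 pg (fun v => \sum_(i <- r) F i v).
Proof.
move=> h; elim: r => [|i r IH].
 by under eq_fun do rewrite big_nil; exact: pg_cst.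
by under eq_fun do rewrite big_cons; exact: pgD.
Qed.

Lemma pg_abs f : pg f -> pg (fun v => `|f v|).
Proof.
move=> [mf [K [k hf]]]; split; first by apply: mcomp => //; exact: normr_measurable.
by exists K, k => v; rewrite normr_id.
Qed.

Lemma pgX k f : pg f -> pg (fun v => f v ^+ k).
Proof.
move=> pf; elim: k => [|k IH]; first by under eq_fun do rewrite expr0; exact: pg_cst.
by under eq_fun do rewrite exprS; exact: pgM.
Qed.

Lemma nint_expR_nsq : exists c : R, nint gamma (fun v => expR (nsq v / 4)) = c%:E.
Proof.
pose c : R := normal_peak 1 / normal_peak (Num.sqrt 2).
exists (\prod_(i < d) c).
have := @integral_gauss_prod R d 1 (fun=> fun t => expR (t ^+ 2 / 4)) (fun=> c).
rewrite /nint => <-.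
- by apply: eq_integral => v _; rewrite -expR_sum -mulr_suml.
- move=> _; apply: mcomp; first exact: measurable_expR.
 by mble.
- by nneg.
move=> _; have s0 : Num.sqrt 2 != 0 :> R by nneg.
have pk : normal_peak (Num.sqrt 2) != 0 :> R by rewrite gt_eqF// normal_peak_gt0.
transitivity (\int[lebesgue_measure]_t (c%:E * (normal_pdf 0 (Num.sqrt 2) t)%:E))%E.
 apply: eq_integral => t _; rewrite -EFinM std_normal_pdfE normal_pdfE// /c; congr EFin.
 rewrite /normal_fun subr0 mulrCA -expRD sqr_sqrtr// [RHS]mulrA divfK//.
 by congr (_ * expR _); field.
rewrite ge0_integralZl_EFin//.
- by rewrite integral_normal_pdf mule1.
- by move=> t _; rewrite lee_fin normal_pdf_ge0.
- by apply: meas_EFin; exact: measurable_normal_pdf.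
- by rewrite divr_ge0// normal_peak_ge0.
Qed.

Lemma pg_integrable f : pg f -> gamma.-integrable setT (EFin \o f).
Proof.
move=> pf; have [K K0 [k hf]] := pg_bound pf; have [c hc] := nint_expR_nsq.
apply/integrableP; split; first by apply: meas_EFin; case: pf.
pose J : R := K * (4 ^+ k.+1 * (k.+1)`!%:R * expR (1 / 4)).
have J0 : 0 <= J by rewrite mulr_ge0// mulr_ge0 ?expR_ge0// mulr_ge0.
have me : meas (fun v : 'rV[R]_d => expR (nsq v / 4)).
 apply: mcomp; first exact: measurable_expR.
 by mble.
have ne : nnm (fun v : 'rV[R]_d => expR (nsq v / 4)) by nneg.
apply: (@le_lt_trans _ _ (nint gamma (fun v => J * expR (nsq v / 4)))); last first.
 by rewrite nintZ// hc -EFinM ltry.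
have nf : nnm (fun v => `|f v|).
 by split=> [|v //]; apply: mcomp; [exact: normr_measurable|case: pf].
apply: (le_nint gamma nf (nnmZ J0 ne)) => v; apply: le_trans (hf v) _; rewrite /J -[leRHS]mulrA ler_wpM2l//.
have n1 := nsq1_ge1 v; apply: (@le_trans _ _ ((1 + nsq v) ^+ k.+1)); first by rewrite ler_weXn2l.
have x0 : 0 <= (1 + nsq v) / 4 by nneg.
have := expR_ge_pow k x0; rewrite ler_pdivrMr ?ltr0n ?fact_gt0// expr_div_n ler_pdivrMr ?exprn_gt0//.
by rewrite mulrDl expRD => h; apply: le_trans h _; rewrite le_eqVlt; apply/orP; left; apply/eqP; ring.
Qed.

Lemma lintD f g : pg f -> pg g -> lint (fun v => f v + g v) = lint f + lint g.
Proof. by move=> pf pg'; rewrite /lint RintegralD//; exact: pg_integrable. Qed.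

Lemma lintZ (c : R) f : pg f -> lint (fun v => c * f v) = c * lint f.
Proof. by move=> pf; rewrite /lint RintegralZl//; exact: pg_integrable. Qed.

Lemma eq_lint f g : f =1 g -> lint f = lint g.
Proof. by move=> fg; rewrite /lint; congr Rintegral; apply/funext. Qed.

Lemma lint_sum (I : Type) (r : seq I) (F : I -> 'rV[R]_d -> R) : (forall i, pg (F i)) ->
 lint (fun v => \sum_(i <- r) F i v) = \sum_(i <- r) lint (F i).
Proof.
move=> h; elim: r => [|i r IH].
 rewrite big_nil (eq_lint (g := fun v => 0 * 0)); last by move=> v; rewrite big_nil mul0r.
 by rewrite lintZ ?mul0r//; exact: pg_cst.
rewrite big_cons -IH -lintD//; last exact: pg_sum.
by apply: eq_lint => v; rewrite big_cons.
Qed.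

Lemma nint_lint f : pg f -> (forall v, 0 <= f v) -> nint gamma f = (lint f)%:E.
Proof.
move=> pf f0; rewrite /lint /Rintegral fineK//.
by apply: integrable_fin_num => //; exact: pg_integrable.
Qed.

Lemma lint_eq_nint f (c : R) : (forall v, 0 <= f v) -> nint gamma f = c%:E -> lint f = c.
Proof. by move=> f0 h; rewrite /lint /Rintegral -/(nint gamma f) h. Qed.

Lemma lint_ge0 f : (forall v, 0 <= f v) -> 0 <= lint f.
Proof. by move=> f0; rewrite /lint; apply: Rintegral_ge0. Qed.

Lemma le_lint f g : pg f -> pg g -> (forall v, f v <= g v) -> lint f <= lint g.
Proof.
move=> pf pg' fg; rewrite -subr_ge0.
have -> : lint g - lint f = lint (fun v => g v + (-1) * f v) by rewrite lintD ?lintZ ?mulN1r//; exact: pgZ.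
by apply: lint_ge0 => v; rewrite mulN1r subr_ge0.
Qed.

Lemma lint_cst (c : R) : lint (fun=> c) = c.
Proof. have h1 : lint (fun=> 1) = 1 by apply: lint_eq_nint => // ; rewrite nint_cst.
rewrite -[RHS]mulr1 -h1 -lintZ; last exact: pg_cst.
by apply: eq_lint => v; rewrite mulr1. Qed.

Definition moment (k : nat) : R := lint (fun v => (1 + nsq v) ^+ k).

Lemma pg_pow k : pg (fun v => (1 + nsq v) ^+ k).
Proof. by apply: pgX; apply: pgD; [exact: pg_cst|exact: pg_nsq]. Qed.

Lemma moment_ge0 k : 0 <= moment k.
Proof. by apply: lint_ge0 => v; rewrite exprn_ge0// (le_trans ler01)// nsq1_ge1. Qed.

Lemma lint_abs_le f K k : pg f -> (forall v, `|f v| <= K * (1 + nsq v) ^+ k) -> `|lint f| <= K * moment k.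
Proof.
move=> pf hf; rewrite /moment -lintZ; last exact: pg_pow.
have pK : pg (fun v => K * (1 + nsq v) ^+ k) by apply: pgZ; exact: pg_pow.
rewrite ler_norml; apply/andP; split; last first.
 by apply: le_lint => // v; exact: le_trans (ler_norm _) (hf v).
rewrite -mulN1r -lintZ//; apply: le_lint => //; first exact: pgZ.
by move=> v; rewrite mulN1r lerNl; apply: le_trans (hf v); rewrite -normrN ler_norm.
Qed.

Definition flip (e : 'I_d -> bool) v : 'rV[R]_d := \row_i ((-1) ^+ e i * v 0 i).

Lemma nsq_flip e v : nsq (flip e v) = nsq v.
Proof. by apply: eq_bigr => i _; rewrite mxE exprMn sqrr_sign mul1r. Qed.

Lemma lint_flip e f : meas f -> lint (fun v => f (flip e v)) = lint f.
Proof.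
move=> mf; rewrite /lint /Rintegral; congr fine; rewrite integralE [RHS]integralE.
have mE := meas_EFin mf.
congr (_ - _)%E.
- rewrite [RHS](integral_gauss_signs e)//; last exact: measurable_funepos.
 by apply: eq_integral => v _; rewrite !funeposE.
- rewrite [RHS](integral_gauss_signs e)//; last exact: measurable_funeneg.
 by apply: eq_integral => v _; rewrite !funenegE.
Qed.

Lemma lint_odd e f : pg f -> (forall v, f (flip e v) = - f v) -> lint f = 0.
Proof.
move=> pf h; have := @lint_flip e f pf.1; rewrite (eq_lint h).
have -> : lint (fun v => - f v) = - lint f.
 by rewrite -mulN1r -lintZ//; apply: eq_lint => v; rewrite mulN1r.
by lra.
Qed.

Lemma lint_coord i : lint (fun v => v 0 i) = 0.
Proof.
apply: (@lint_odd (fun=> true)) => [|v]; first exact: pg_coord.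
by rewrite mxE expr1 mulN1r.
Qed.

Lemma lint_coord_sqr i : lint (fun v => v 0 i ^+ 2) = 1.
Proof. by apply: lint_eq_nint => [v|]; [exact: sqr_ge0|exact: integral_gauss_sqr]. Qed.

Lemma lint_coord4 i : lint (fun v => v 0 i ^+ 4) = 3.
Proof.
apply: lint_eq_nint => [v|]; first by nneg.
apply: (@integral_gauss_coord R d i (fun t => t ^+ 4)); last exact: normal_moment4.
 by mble.
by nneg.
Qed.

Lemma lint_coord22 i j : i != j -> lint (fun v => v 0 i ^+ 2 * v 0 j ^+ 2) = 1.
Proof.
move=> ij; apply: lint_eq_nint => [v|]; first by nneg.
pose f (k : 'I_d) (t : R) := if (k == i) || (k == j) then t ^+ 2 else 1.
have := @integral_gauss_prod R d 1 f (fun=> 1).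
rewrite big1// /nint => <- //.
- apply: eq_integral => v _; congr EFin.
 rewrite (bigD1 i)//= (bigD1 j) 1?eq_sym//= /f eqxx/= eqxx orbT mulrA big1 ?mulr1//.
 by move=> k /andP[ki kj]; rewrite (negbTE ki) (negbTE kj).
- by move=> k; rewrite /f; case: (_ || _) => //; exact: exprn_measurable.
- by move=> k t; rewrite /f; case: (_ || _) => //; exact: sqr_ge0.
- move=> k; rewrite /f; case: (_ || _); first exact: normal_moment2.
 by rewrite -normal_moment0; apply: eq_integral => t _; rewrite expr0.
Qed.

Lemma flip1 i v k : flip (pred1 i) v 0 k = if k == i then - v 0 k else v 0 k.
Proof. by rewrite mxE /=; case: eqP => _; rewrite ?expr1 ?expr0 ?mulN1r ?mul1r. Qed.

Lemma lint_coordM i j : lint (fun v => v 0 i * v 0 j) = (i == j)%:R.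
Proof.
have [<-|ij] := eqVneq i j; first exact: lint_coord_sqr.
apply: (@lint_odd (pred1 i)) => [|v]; first by apply: pgM; exact: pg_coord.
by rewrite !flip1 eqxx eq_sym (negbTE ij) mulNr.
Qed.

Lemma lint_coordM_nsq i j : lint (fun v => v 0 i * v 0 j * nsq v) = (i == j)%:R * (d%:R + 2).
Proof.
have pM : pg (fun v => v 0 i * v 0 j * nsq v).
 by apply: pgM; [apply: pgM; exact: pg_coord|exact: pg_nsq].
have [eij|ij] := eqVneq i j; last first.
 rewrite mul0r; apply: (@lint_odd (pred1 i)) => // v.
 by rewrite nsq_flip !flip1 eqxx eq_sym (negbTE ij) !mulNr.
subst j; rewrite mul1r.
have -> : lint (fun v => v 0 i * v 0 i * nsq v) = \sum_k lint (fun v => v 0 i ^+ 2 * v 0 k ^+ 2).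
 rewrite -lint_sum => [|k]; last by apply: pgM; apply: pgX; exact: pg_coord.
 by apply: eq_lint => v; rewrite -mulr_sumr -expr2.
rewrite (bigD1 i)//= (eq_lint (g := fun v => v 0 i ^+ 4)); last by move=> v; rewrite -exprD.
rewrite lint_coord4 (eq_bigr (fun=> 1)); last by move=> k ki; rewrite lint_coord22// eq_sym.
rewrite sumr_const (_ : #|_| = d.-1); last first.
 by rewrite cardC1 card_ord.
have dp : (0 < d)%N by case: (i) => m; case: d.
by rewrite -{2}(prednK dp) -natr1; ring.
Qed.

End gaussian_integrals.

Section scalar_expansions.
Context {R : realType}.

Definition rej (l : R) : R := 1 - Num.min 1 (expR l).

Lemma rej_ge0 l : 0 <= rej l.
Proof. by rewrite subr_ge0 ge_min lexx. Qed.

Lemma rej_le1 l : rej l <= 1.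
Proof. by rewrite lerBlDr lerDl le_min ler01 expR_ge0. Qed.

Lemma rej_pos l : 0 <= l -> rej l = 0.
Proof. by move=> l0; rewrite /rej min_l ?subrr// -expR0 ler_expR. Qed.

Lemma rej_neg l : l <= 0 -> rej l = 1 - expR l.
Proof. by move=> l0; rewrite /rej min_r// -[leRHS]expR0 ler_expR. Qed.

Lemma rej_le_abs l : rej l <= `|l|.
Proof.
have [l0|l0] := leP 0 l; first by rewrite rej_pos.
rewrite (rej_neg (ltW l0)) (ltr0_norm l0); have := expR_ge1Dx l; lra.
Qed.

Lemma expR_neg_le (l : R) : l <= 0 -> expR l <= 1 + l + l ^+ 2.
Proof.
move=> l0; have := expR_ge1Dx (- l); have e0 := expR_gt0 l.
have ee : expR l * expR (- l) = 1 by rewrite -expRD subrr expR0.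
move: (expR l) (expR (- l)) e0 ee => p q p0 pq hq.
have [l1|l1] := leP (- l) 1; last first.
 have : p <= 1.
  rewrite -(ler_pM2r (_ : 0 < q)); last by lra.
  by rewrite pq mul1r; lra.
 by nra.
have : p * (1 - l) <= 1 by rewrite -pq ler_pM2l//; lra.
have : 0 <= - l * l ^+ 2 by rewrite mulr_ge0 ?sqr_ge0// oppr_ge0.
move=> h1 h2; have h3 : p * (1 - l) <= (1 + l + l ^+ 2) * (1 - l).
 apply: le_trans h2 _; rewrite (_ : _ * (1 - l) = 1 + - l * l ^+ 2); last by ring.
 by rewrite lerDl.
by rewrite -(ler_pM2r (_ : 0 < 1 - l)); lra.
Qed.

Definition negp (l : R) : R := (`|l| - l) / 2.

Lemma rej_negp l : `|rej l - negp l| <= l ^+ 2.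
Proof.
rewrite /negp; have [l0|l0] := leP 0 l.
 by rewrite (rej_pos l0) (ger0_norm l0) subrr mul0r subrr normr0 sqr_ge0.
rewrite (rej_neg (ltW l0)) (ltr0_norm l0).
have -> : (- l - l) / 2 = - l by field.
have h1 := expR_ge1Dx l; have h2 := expR_neg_le (ltW l0).
by rewrite ler_norml; apply/andP; split; lra.
Qed.

Lemma negp_lip (l m : R) : `|negp l - negp m| <= `|l - m|.
Proof.
rewrite /negp -mulrBl normrM [`|2^-1|]ger0_norm// ler_pdivrMr// opprB addrACA.
have -> : `|l| + m + (- l - `|m|) = (`|l| - `|m|) - (l - m) by ring.
apply: le_trans (ler_normB _ _) _; rewrite mulr_natr mulr2n lerD2r.
exact: ler_dist_dist.
Qed.

Lemma ln_bounds (q : R) : 0 < 1 + q -> `|ln (1 + q) - q| <= q ^+ 2 / (1 + q).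
Proof.
move=> p0; have h1 := le_ln1Dx (_ : -1 < q).
have h2 : - ln (1 + q) <= - (q / (1 + q)).
 rewrite -lnV ?posrE//.
 rewrite [X in ln X](_ : _ = 1 + (- (q / (1 + q)))); last by field; rewrite gt_eqF.
 apply: le_ln1Dx; rewrite ltrN2 ltr_pdivrMr// mul1r; lra.
have e : q / (1 + q) = q - q ^+ 2 / (1 + q) by field; rewrite gt_eqF.
have : 0 <= q ^+ 2 / (1 + q) by nneg.
move: h2; rewrite e; move: (q ^+ 2 / _) => u h2 u0.
by rewrite ler_norml; apply/andP; split; lra.
Qed.

End scalar_expansions.

Section taylor.
Context {R : realType} {d : nat}.
Implicit Types (x w : 'rV[R]_d).

Definition dotp (x w : 'rV[R]_d) : R := \sum_i x 0 i * w 0 i.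

Lemma dotp_le x w : `|dotp x w| <= (\sum_i `|x 0 i|) * enorm w.
Proof.
apply: le_trans (ler_norm_sum _ _ _) _; rewrite mulr_suml; apply: ler_sum => i _.
by rewrite normrM ler_wpM2l// normr_coord_le.
Qed.

Lemma sum_abs_le x : \sum_i `|x 0 i| <= d%:R * enorm x.
Proof.
apply: (@le_trans _ _ (\sum_(i < d) enorm x)); first by apply: ler_sum => i _; exact: normr_coord_le.
by rewrite sumr_const card_ord mulr_natl.
Qed.

Context (f : 'rV[R]_d -> R) (K : R) (df : forall x, differentiable f x) (K0 : 0 <= K)
 (gf : forall x y, enorm (grad f x - grad f y) <= K * enorm (x - y)).

Lemma derive_dotp x w : 'D_w f x = dotp (grad f x) w.
Proof.
have ew : w = \sum_i w 0 i *: delta_mx 0 i.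
 by rewrite [LHS]matrix_sum_delta big_ord1; apply: eq_bigr => i _.
rewrite deriveE// [X in 'd f x X]ew linear_sum /dotp; apply: eq_bigr => i _.
by rewrite linearZ/= mxE /partial deriveE// mulrC.
Qed.

Lemma taylor_bound x w : `|f (x + w) - f x - dotp (grad f x) w| <= d%:R * K * nsq w.
Proof.
pose phi (s : R) := f (x + s *: w).
have E s : (fun h : R => h^-1 *: (phi (h *: 1 + s) - phi s)) = (fun h : R => h^-1 *: (f (h *: w + (x + s *: w)) - f (x + s *: w))).
 apply/funext => h; congr (_ *: (f _ - _)).
 by rewrite -[h *: 1]/(h * 1) mulr1 scalerDl addrCA.
have dphi (s : R) : is_derive s 1 phi ('D_w f (x + s *: w)).
 have h1 : derivable phi s 1.
  rewrite /derivable /=; have := @diff_derivable _ _ _ f (x + s *: w) w (df _).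
  by rewrite /derivable/= -E.
 have h2 : 'D_1 phi s = 'D_w f (x + s *: w) by rewrite /derive /= -E.
 exact: DeriveDef h1 h2.
have cphi : {within `[0, 1], continuous phi}.
 apply: continuous_subspaceT => s; apply: differentiable_continuous.
 by apply/derivable1_diffP; case: (dphi s).
have [c c01] := MVT ltr01 (fun s _ => dphi s) cphi.
rewrite /phi scale1r scale0r addr0 subr0 mulr1 => ->; rewrite derive_dotp.
have -> : dotp (grad f (x + c *: w)) w - dotp (grad f x) w = dotp (grad f (x + c *: w) - grad f x) w.
 by rewrite /dotp -sumrB; apply: eq_bigr => i _; rewrite coordB mulrBl.
apply: le_trans (dotp_le _ _) _; have e0 := enorm_ge0 w.
apply: (@le_trans _ _ (d%:R * (K * enorm w) * enorm w)); last by rewrite -sqr_enorm expr2 !mulrA.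
rewrite ler_wpM2r//; apply: le_trans (sum_abs_le _) _; rewrite ler_wpM2l//.
apply: le_trans (gf _ _) _; rewrite ler_wpM2l// addrAC subrr add0r enormZ.
move: c01; rewrite in_itv/= => /andP[c0 c1].
by rewrite (ger0_norm (ltW c0)) ler_piMl// ltW.
Qed.

End taylor.

Section langevin_coefficients.
Context {R : realType} {d : nat}.
Implicit Types (x y v w : 'rV[R]_d).
Context (V g : 'rV[R]_d -> R) (beta D C1 C2 C3 m1 M1 M2 : R).

Definition langevin_hyps : Prop :=
 [/\ [/\ 0 < beta, 0 <= D, 0 <= C1, 0 <= C2 & 0 <= C3],
   [/\ 0 < m1, 0 <= M2, forall x, m1 <= g x <= M1 & forall x, enorm (grad g x) <= M2],
   [/\ forall x, differentiable V x, forall x y, enorm (grad V x - grad V y) <= D * enorm (x - y) &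
     forall x y, enorm (g x *: grad V x - g y *: grad V y) <= C3 * enorm (x - y)] &
   [/\ forall x, differentiable g x, forall x y, `|g x - g y| <= C1 * enorm (x - y) &
     forall x y, enorm (grad g x - grad g y) <= C2 * enorm (x - y)]].

Context (hyps : langevin_hyps).

Definition ldrift x : 'rV[R]_d := - (g x *: grad V x) + beta^-1 *: grad g x.
Definition lsig x : R := Num.sqrt (2 * beta^-1 * g x).

Let b0 : 0 < beta. Proof. by case: hyps => -[]. Qed.
Let D0 : 0 <= D. Proof. by case: hyps => -[]. Qed.
Let C10 : 0 <= C1. Proof. by case: hyps => -[]. Qed.
Let C20 : 0 <= C2. Proof. by case: hyps => -[]. Qed.
Let C30 : 0 <= C3. Proof. by case: hyps => -[]. Qed.
Let m10 : 0 < m1. Proof. by case: hyps => _ []. Qed.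
Let M20 : 0 <= M2. Proof. by case: hyps => _ []. Qed.
Let gm x : m1 <= g x. Proof. by case: hyps => _ [_ _ /(_ x)/andP[]]. Qed.
Let gM x : g x <= M1. Proof. by case: hyps => _ [_ _ /(_ x)/andP[]]. Qed.
Let ggM x : enorm (grad g x) <= M2. Proof. by case: hyps => _ []. Qed.
Let dV x : differentiable V x. Proof. by case: hyps => _ _ []. Qed.
Let gV x y : enorm (grad V x - grad V y) <= D * enorm (x - y). Proof. by case: hyps => _ _ []. Qed.
Let ggV x y : enorm (g x *: grad V x - g y *: grad V y) <= C3 * enorm (x - y). Proof. by case: hyps => _ _ []. Qed.
Let dg x : differentiable g x. Proof. by case: hyps => _ _ _ []. Qed.
Let gl x y : `|g x - g y| <= C1 * enorm (x - y). Proof. by case: hyps => _ _ _ []. Qed.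
Let ggl x y : enorm (grad g x - grad g y) <= C2 * enorm (x - y). Proof. by case: hyps => _ _ _ []. Qed.
Let g0 x : 0 < g x. Proof. exact: lt_le_trans (gm x). Qed.

Definition sig_min : R := Num.sqrt (2 * beta^-1 * m1).
Definition sig_max : R := Num.sqrt (2 * beta^-1 * M1).

Lemma lsig_sqr x : lsig x ^+ 2 = 2 * beta^-1 * g x.
Proof. by rewrite /lsig sqr_sqrtr// mulr_ge0 ?mulr_ge0 ?invr_ge0// ltW. Qed.

Lemma sig_min_gt0 : 0 < sig_min.
Proof. by rewrite sqrtr_gt0 mulr_gt0// mulr_gt0// invr_gt0. Qed.

Lemma sig_min_le x : sig_min <= lsig x.
Proof. by rewrite ler_wsqrtr// ler_wpM2l// mulr_ge0// invr_ge0 ltW. Qed.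

Lemma lsig_gt0 x : 0 < lsig x. Proof. exact: lt_le_trans sig_min_gt0 (sig_min_le x). Qed.

Lemma lsig_le_max x : lsig x <= sig_max.
Proof. by rewrite ler_wsqrtr// ler_wpM2l// mulr_ge0// invr_ge0 ltW. Qed.

Lemma sig_max_ge0 : 0 <= sig_max. Proof. exact: sqrtr_ge0. Qed.

Lemma lip_langevin : exists L, lip_coefs ldrift lsig L sig_max.
Proof.
pose L1 := 2 * C3 ^+ 2 + 2 * (beta^-1 * C2) ^+ 2.
pose L2 := (2 * beta^-1 * C1 / sig_min) ^+ 2.
exists (1 + L1 + L2); have sm := sig_min_gt0.
have L10 : 0 <= L1 by rewrite addr_ge0// mulr_ge0// sqr_ge0.
have L20 : 0 <= L2 by rewrite sqr_ge0.
have bi : 0 <= beta^-1 by nneg.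
split; [by lra|exact: sig_max_ge0| | |].
- move=> x y; have n0 := nsq_ge0 (x - y).
 have -> : ldrift x - ldrift y = - (g x *: grad V x - g y *: grad V y) + beta^-1 *: (grad g x - grad g y).
  by apply/rowP => i; rewrite /ldrift !mxE; ring.
 apply: le_trans (nsqD _ _) _; rewrite nsqN nsqZ.
 have h1 := le_nsq_of_enorm (ggV x y); have h2 := le_nsq_of_enorm (ggl x y).
 apply: (@le_trans _ _ (L1 * nsq (x - y))); last by rewrite ler_wpM2r// /L1; lra.
 rewrite (_ : L1 * _ = 2 * (C3 ^+ 2 * nsq (x - y)) + 2 * (beta^-1 ^+ 2 * (C2 ^+ 2 * nsq (x - y)))); last by rewrite /L1; ring.
 by apply: lerD; rewrite ler_pM2l// ler_wpM2l// sqr_ge0.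
- move=> x y; have n0 := nsq_ge0 (x - y).
 apply: (@le_trans _ _ (L2 * nsq (x - y))); last by rewrite ler_wpM2r//; lra.
 have sp : 0 < lsig x + lsig y by rewrite addr_gt0// lsig_gt0.
 have e : lsig x - lsig y = 2 * beta^-1 * (g x - g y) / (lsig x + lsig y).
  apply: (mulIf (lt0r_neq0 sp)); rewrite divfK ?gt_eqF//.
  by rewrite mulrBr -!lsig_sqr; ring.
 rewrite -sqr_enorm /L2 -exprMn -real_normK ?num_real//; apply: lerXn2r; rewrite ?nnegrE//.
  by nneg.
 rewrite e normrM normfV (gtr0_norm sp) normrM (ger0_norm (_ : 0 <= 2 * beta^-1)) ?mulr_ge0//.
 rewrite (_ : _ * enorm (x - y) = 2 * beta^-1 * (C1 * enorm (x - y)) / sig_min); last by ring.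
 apply: ler_pM; rewrite ?invr_ge0 ?(ltW sp)//.
 + by nneg.
 + by rewrite ler_wpM2l// mulr_ge0.
 + by rewrite lef_pV2 ?posrE//; apply: le_trans (sig_min_le x) _; rewrite lerDl ltW// lsig_gt0.
- by move=> x; rewrite ger0_norm ?lsig_le_max// ltW// lsig_gt0.
Qed.

Definition logratio (s : R) x v : R := let x' := x + (s * lsig x) *: v in
 - beta * (V x' - V x) - d%:R / 2 * ln (g x' / g x) + nsq v / 2 * (1 - g x / g x').

Definition lam x v : R :=
 lsig x * (- beta * dotp (grad V x) v + dotp (grad g x) v / g x * ((nsq v - d%:R) / 2)).

Definition gradN x : R := 1 + \sum_i `|grad V x 0 i|.

Lemma gradN_ge1 x : 1 <= gradN x.
Proof. by rewrite lerDl sumr_ge0. Qed.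

Lemma dotpZr x (a : R) v : dotp x (a *: v) = a * dotp x v.
Proof. by rewrite /dotp mulr_sumr; apply: eq_bigr => i _; rewrite mxE mulrCA. Qed.

Lemma square_bounds (n e : R) : 0 <= n -> 0 <= e ->
 [/\ n <= (1 + n) ^+ 2, n / 2 <= (1 + n) ^+ 2, n * n / 2 <= (1 + n) ^+ 2 &
   n * ((n + e) / 2) <= (1 + e) * (1 + n) ^+ 2].
Proof.
move=> n0 e0; have nn : 0 <= n * n by nneg.
by split; nra.
Qed.

Lemma logratio_close : exists2 C, 0 <= C & forall s x v, 0 < s -> s <= 1 ->
 `|logratio s x v - s * lam x v| <= s ^+ 2 * (C * (1 + nsq v) ^+ 2).
Proof.
pose S := sig_max ^+ 2; have S0 : 0 <= S by rewrite sqr_ge0.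
pose T := C1 ^+ 2 * S / m1 ^+ 2; have T0 : 0 <= T by rewrite divr_ge0 ?sqr_ge0// mulr_ge0// sqr_ge0.
pose A := beta * (d%:R * D * S); have A0 : 0 <= A by rewrite mulr_ge0 ?(ltW b0)// mulr_ge0// mulr_ge0.
pose B := d%:R * C2 * S / m1; have B0 : 0 <= B by rewrite divr_ge0 ?(ltW m10)// mulr_ge0// mulr_ge0.
exists (A + d%:R * T + T + B * (1 + d%:R)).
 apply: addr_ge0; last by nneg.
 by nneg.
move=> s x v s0 s1; set w := (s * lsig x) *: v; set n := nsq v.
have n0 : 0 <= n by exact: nsq_ge0.
have nw : nsq w <= s ^+ 2 * S * n.
 rewrite /w nsqZ exprMn ler_wpM2r// ler_wpM2l ?sqr_ge0//.
 by rewrite lerXn2r ?nnegrE ?sig_max_ge0 ?(ltW (lsig_gt0 x))// lsig_le_max.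
pose q := (g (x + w) - g x) / g x.
have q1 : 1 + q = g (x + w) / g x by rewrite /q mulrBl divff ?gt_eqF// addrC subrK.
have qp : 0 < 1 + q by rewrite q1 divr_gt0.
pose Q := q ^+ 2 / (1 + q).
have Q0 : 0 <= Q by rewrite divr_ge0 ?sqr_ge0// ltW.
have QT : Q <= s ^+ 2 * T * n.
 have -> : Q = (g (x + w) - g x) ^+ 2 / (g x * g (x + w)).
  by rewrite /Q q1 /q; field; rewrite !gt_eqF.
 rewrite ler_pdivrMr ?mulr_gt0//.
 have h1 : (g (x + w) - g x) ^+ 2 <= C1 ^+ 2 * nsq w.
  rewrite -sqr_enorm -exprMn -real_normK ?num_real// lerXn2r ?nnegrE ?mulr_ge0 ?enorm_ge0//.
  by have := gl (x + w) x; rewrite addrAC subrr add0r.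
 apply: le_trans h1 _; apply: (@le_trans _ _ (s ^+ 2 * T * n * m1 ^+ 2)).
  have -> : s ^+ 2 * T * n * m1 ^+ 2 = C1 ^+ 2 * (s ^+ 2 * S * n).
   by rewrite /T; field; rewrite gt_eqF.
  by rewrite ler_wpM2l// sqr_ge0.
 have sT : 0 <= s ^+ 2 * T * n by nneg.
 by rewrite ler_wpM2l// expr2; apply: ler_pM => //; exact: ltW.
have hln := ln_bounds qp; rewrite -/Q in hln.
have eV := taylor_bound dV D0 gV x w; have eg := taylor_bound dg C20 ggl x w.
pose rV := V (x + w) - V x - dotp (grad V x) w; pose rg := g (x + w) - g x - dotp (grad g x) w.
have e1 : logratio s x v - s * lam x v =
  - beta * rV - d%:R / 2 * (ln (1 + q) - q) - n / 2 * Q + rg / g x * ((n - d%:R) / 2).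
 have eqq : 1 - g x / g (x + w) = q - Q by rewrite /Q q1 /q; field; rewrite !gt_eqF.
 rewrite /logratio /= -/w eqq q1 /rV /rg /lam /w !dotpZr -/w /q -/n.
 clear QT hln eqq eV eg; clearbody Q; field.
 by nneg.
have bV : `|- beta * rV| <= s ^+ 2 * (A * n).
 rewrite normrM normrN (gtr0_norm b0).
 apply: (@le_trans _ _ (beta * (d%:R * D * (s ^+ 2 * S * n)))).
  rewrite ler_wpM2l ?(ltW b0)//; apply: le_trans eV _.
  by rewrite ler_wpM2l// mulr_ge0.
 by rewrite le_eqVlt; apply/orP; left; apply/eqP; rewrite /A; ring.
have bg : `|rg / g x| <= s ^+ 2 * (B * n).
 rewrite normrM normfV (gtr0_norm (g0 x)) ler_pdivrMr//.
 apply: (@le_trans _ _ (s ^+ 2 * (B * n) * m1)); last by rewrite ler_wpM2l// mulr_ge0 ?sqr_ge0// mulr_ge0.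
 have -> : s ^+ 2 * (B * n) * m1 = d%:R * C2 * (s ^+ 2 * S * n) by rewrite /B; field; rewrite gt_eqF.
 by apply: le_trans eg _; rewrite ler_wpM2l// mulr_ge0.
have bl : `|d%:R / 2 * (ln (1 + q) - q)| <= s ^+ 2 * (d%:R / 2 * T * n).
 rewrite normrM ger0_norm ?divr_ge0//.
 apply: (@le_trans _ _ (d%:R / 2 * (s ^+ 2 * T * n))).
  by rewrite ler_wpM2l ?divr_ge0//; exact: le_trans hln QT.
 by rewrite le_eqVlt; apply/orP; left; apply/eqP; ring.
have bQ : `|n / 2 * Q| <= s ^+ 2 * (T * n * n / 2).
 rewrite ger0_norm; last by nneg.
 apply: (@le_trans _ _ (n / 2 * (s ^+ 2 * T * n))); first by rewrite ler_wpM2l ?divr_ge0.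
 by rewrite le_eqVlt; apply/orP; left; apply/eqP; ring.
have bgd : `|rg / g x * ((n - d%:R) / 2)| <= s ^+ 2 * (B * n * ((n + d%:R) / 2)).
 rewrite (normrM (rg / g x)) [leRHS]mulrA; apply: ler_pM => //.
 rewrite (normrM _ 2^-1) (ger0_norm (_ : 0 <= 2^-1))// ler_wpM2r//.
 by apply: le_trans (ler_normB _ _) _; rewrite !ger0_norm.
rewrite e1; apply: le_trans (ler_normD _ _) _; apply: le_trans (lerD (ler_normB _ _) bgd) _.
apply: le_trans (lerD (lerD (ler_normB _ _) bQ) (lexx _)) _.
apply: le_trans (lerD (lerD (lerD bV bl) (lexx _)) (lexx _)) _.
rewrite -!mulrDr ler_wpM2l ?sqr_ge0//.
have dd : (0 : R) <= d%:R by [].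
have [k1 k2 k3 k4] := square_bounds n0 dd.
have p1 : A * n <= A * (1 + n) ^+ 2 by exact: (ler_wpM2l A0 k1).
have p2 : d%:R / 2 * T * n <= d%:R * T * (1 + n) ^+ 2.
 rewrite (_ : _ * n = d%:R * T * (n / 2)); last by ring.
 exact: (ler_wpM2l (mulr_ge0 dd T0) k2).
have p3 : T * n * n / 2 <= T * (1 + n) ^+ 2.
 rewrite (_ : _ / 2 = T * (n * n / 2)); last by ring.
 exact: (ler_wpM2l T0 k3).
have p4 : B * n * ((n + d%:R) / 2) <= B * (1 + d%:R) * (1 + n) ^+ 2.
 rewrite -mulrA -[leRHS]mulrA; exact: (ler_wpM2l B0 k4).
rewrite (_ : (_ + _ + _ + _) * (1 + n) ^+ 2 = A * (1 + n) ^+ 2 + d%:R * T * (1 + n) ^+ 2 +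
 T * (1 + n) ^+ 2 + B * (1 + d%:R) * (1 + n) ^+ 2); last by ring.
by apply: lerD => //; apply: lerD => //; apply: lerD.
Qed.

Lemma enorm_le_1nsq v : enorm v <= 1 + nsq v.
Proof. by have := enorm_le_eps v (ltr01 : 0 < 1 :> R); have := nsq_ge0 v; lra. Qed.

Lemma lam_le : exists2 C, 0 <= C & forall x v, `|lam x v| <= C * gradN x * (1 + nsq v) ^+ 2.
Proof.
have S0 := sig_max_ge0; pose A := d%:R * M2 / m1.
have A0 : 0 <= A by rewrite divr_ge0 ?(ltW m10)// mulr_ge0.
have eA : A * m1 = d%:R * M2 by rewrite /A divfK// gt_eqF.
clearbody A; exists (sig_max * (beta + A * (1 + d%:R))).
 by nneg.
move=> x v; have N1 := gradN_ge1 x; have n0 := nsq_ge0 v; have ev := enorm_le_1nsq v.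
have n1 : 0 <= 1 + nsq v by nneg.
rewrite /lam normrM (gtr0_norm (lsig_gt0 x)).
rewrite (_ : _ * gradN x * _ = sig_max * ((beta + A * (1 + d%:R)) * (gradN x * (1 + nsq v) ^+ 2))); last by ring.
apply: ler_pM => //; [exact: ltW (lsig_gt0 x)|exact: lsig_le_max|].
apply: le_trans (ler_normD _ _) _; rewrite [leRHS]mulrDl; apply: lerD.
 rewrite normrM normrN (gtr0_norm b0) ler_wpM2l ?(ltW b0)//.
 apply: le_trans (dotp_le _ _) _; apply: (@le_trans _ _ (gradN x * (1 + nsq v))).
  by apply: ler_pM; rewrite ?enorm_ge0 ?sumr_ge0// /gradN lerDr.
 by rewrite ler_wpM2l ?(le_trans ler01)// ler_eXnr// lerDl.
apply: (@le_trans _ _ (A * (1 + d%:R) * (1 * (1 + nsq v) ^+ 2))); last first.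
 by rewrite ler_wpM2l ?mulr_ge0 ?addr_ge0// ler_wpM2r// exprn_ge0.
have h1 : `|dotp (grad g x) v / g x| <= A * (1 + nsq v).
 rewrite normrM normfV (gtr0_norm (g0 x)) ler_pdivrMr//.
 apply: (@le_trans _ _ (A * (1 + nsq v) * m1)); last by rewrite ler_wpM2l// mulr_ge0.
 apply: le_trans (dotp_le _ _) _.
 rewrite mulrAC eA.
 apply: ler_pM; rewrite ?enorm_ge0 ?sumr_ge0//.
 by apply: le_trans (sum_abs_le _) _; rewrite ler_wpM2l.
have h2 : `|(nsq v - d%:R) / 2| <= (1 + d%:R) * (1 + nsq v).
 have dd : (0 : R) <= d%:R by [].
 rewrite normrM (ger0_norm (_ : 0 <= 2^-1))// ler_pdivrMr//.
 apply: le_trans (ler_normB _ _) _; rewrite !ger0_norm//.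
 by have : 0 <= nsq v * d%:R by [rewrite mulr_ge0|]; nra.
rewrite normrM; apply: le_trans (ler_pM (normr_ge0 _) (normr_ge0 _) h1 h2) _.
by rewrite le_eqVlt; apply/orP; left; apply/eqP; ring.
Qed.

Lemma rej_close : exists2 C, 0 <= C & forall s x v, 0 < s -> s <= 1 ->
 `|logratio s x v| <= s * (C * gradN x ^+ 2 * (1 + nsq v) ^+ 4) /\
 `|rej (logratio s x v) - s * negp (lam x v)| <= s ^+ 2 * (C * gradN x ^+ 2 * (1 + nsq v) ^+ 4).
Proof.
have [A A0 hA] := logratio_close; have [B B0 hB] := lam_le.
exists ((A + B) + (A + B) ^+ 2 + A); first by nneg.
move=> s x v s0 s1; have N1 := gradN_ge1 x; have n0 := nsq_ge0 v.
have {}hA := hA s x v s0 s1; have {}hB := hB x v.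
move: (lam x v) (logratio s x v) hA hB => l L hL hl; pose n := 1 + nsq v.
have n1 : 1 <= n by rewrite /n; lra.
rewrite -/n in hL hl *; move: (gradN x) N1 n n1 hL hl => N N1 n n1 hL hl.
have NN : N <= N ^+ 2 by rewrite expr2 ler_peMr// (le_trans ler01).
have n2 : 1 <= n ^+ 2 by rewrite exprn_ege1.
have n4 : n ^+ 4 = n ^+ 2 * n ^+ 2 by rewrite -exprD.
have hb : `|L| <= s * ((A + B) * (N * n ^+ 2)).
 rewrite (_ : L = (L - s * l) + s * l); last by ring.
 apply: le_trans (ler_normD _ _) _; rewrite normrM (gtr0_norm s0).
 have h1 : s ^+ 2 * (A * n ^+ 2) <= s * (A * (N * n ^+ 2)).
  rewrite expr2 -mulrA ler_wpM2l ?(ltW s0)//; apply: (@le_trans _ _ (A * n ^+ 2)).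
   by rewrite ler_piMl// mulr_ge0// (le_trans ler01).
  by rewrite ler_wpM2l// ler_peMl// (le_trans ler01).
 have h2 : s * `|l| <= s * (B * (N * n ^+ 2)) by rewrite ler_wpM2l ?(ltW s0)// mulrA.
 rewrite mulrDl mulrDr; apply: lerD => //; exact: le_trans hL h1.
have AB0 : 0 <= A + B by nneg.
have Nn : 0 <= N * n ^+ 2 by rewrite mulr_ge0// (le_trans ler01).
have q0 : 0 <= N ^+ 2 * n ^+ 4 by nneg.
have hq : N * n ^+ 2 <= N ^+ 2 * n ^+ 4.
 rewrite n4; apply: ler_pM => //; rewrite ?(le_trans ler01)//.
 by rewrite ler_peMl// (le_trans ler01).
split.
 apply: le_trans hb _; rewrite ler_wpM2l ?(ltW s0)// -[leRHS]mulrA.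
 by apply: ler_pM => //; rewrite -addrA lerDl addr_ge0// sqr_ge0.
have h3 : `|L| ^+ 2 <= s ^+ 2 * ((A + B) ^+ 2 * (N ^+ 2 * n ^+ 4)).
 apply: (@le_trans _ _ ((s * ((A + B) * (N * n ^+ 2))) ^+ 2)).
  have hh : 0 <= s * ((A + B) * (N * n ^+ 2)) by nneg.
  by apply: lerXn2r; rewrite ?nnegrE//; exact: hb.
 by rewrite le_eqVlt; apply/orP; left; apply/eqP; rewrite n4; ring.
have h4 : s ^+ 2 * (A * n ^+ 2) <= s ^+ 2 * (A * (N ^+ 2 * n ^+ 4)).
 rewrite ler_wpM2l ?sqr_ge0// ler_wpM2l//; apply: le_trans hq.
 by rewrite ler_peMl// (le_trans ler01).
rewrite (_ : rej L - s * negp l = (rej L - negp L) + (negp L - negp (s * l))); last first.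
 by rewrite /negp normrM (gtr0_norm s0); field.
apply: le_trans (ler_normD _ _) _.
apply: le_trans (lerD (rej_negp L) (le_trans (negp_lip _ _) hL)) _.
rewrite -real_normK ?num_real//; apply: le_trans (lerD h3 h4) _.
rewrite -mulrDr ler_wpM2l ?sqr_ge0// -mulrDl -[leRHS]mulrA ler_wpM2r// lerD2r lerDr//.
Qed.

Let mV : meas V.
Proof. by apply: meas_continuous => x; exact: differentiable_continuous. Qed.
Let mg : meas g.
Proof. by apply: meas_continuous => x; exact: differentiable_continuous. Qed.

Lemma meas_lsig : meas lsig.
Proof. by have [L h] := lip_langevin; exact: meas_sigma h. Qed.

Lemma meas_proposal s : meas (fun p : 'rV[R]_d * 'rV[R]_d => p.1 + (s * lsig p.1) *: p.2).
Proof.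
apply: meas_rVD => //; apply: meas_rVZ => //; apply: measurable_funM => //.
by apply: (mcomp meas_lsig).
Qed.

Lemma meas_logratio s : meas (fun p : 'rV[R]_d * 'rV[R]_d => logratio s p.1 p.2).
Proof.
have mp := meas_proposal s.
have m1' (f : 'rV[R]_d -> R) : meas f ->
  meas (fun p : 'rV[R]_d * 'rV[R]_d => f p.1) by move=> mf; exact: mcomp mf measurable_fst.
have m2' (f : 'rV[R]_d -> R) : meas f ->
  meas (fun p : 'rV[R]_d * 'rV[R]_d => f (p.1 + (s * lsig p.1) *: p.2)).
 by move=> mf; exact: mcomp mf mp.
have mi : meas (fun x => (g x)^-1).
 by apply: meas_continuous => x; apply: continuousV; [rewrite gt_eqF|exact: differentiable_continuous].
apply: measurable_funD; last first.
 apply: measurable_funM.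
  by mble.
 by apply: measurable_funB => //; apply: measurable_funM; [exact: m1'|exact: (m2' _ mi)].
apply: measurable_funB.
 by apply: measurable_funM => //; apply: measurable_funB; [exact: m2'|exact: m1'].
apply: measurable_funM => //; apply: (@measurableT_comp _ _ _ _ _ _ (@ln R)) => //.
by apply: measurable_funM; [exact: m2'|exact: (m1' _ mi)].
Qed.

Lemma meas_rej : meas (@rej R).
Proof.
apply: measurable_funB => //; apply: measurable_minr => //; exact: measurable_expR.
Qed.

Lemma pg_rej s x : pg (fun v => rej (logratio s x v)).
Proof.
apply: (@pg_le R d _ (fun=> 1)); [|exact: pg_cst|].
 apply: (mcomp meas_rej).
 exact: (mcomp (meas_logratio s) (measurable_pair1 x)).
by move=> v; rewrite normr1 ger0_norm ?rej_ge0 ?rej_le1.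
Qed.

Lemma pg_lam x : pg (lam x).
Proof.
have pd (y : 'rV[R]_d) : pg (dotp y) by apply: pg_sum => i; apply: pgZ; exact: pg_coord.
apply: pgZ; apply: pgD; first exact: pgZ.
apply: pgM; first by under eq_fun do rewrite mulrC; exact: pgZ.
under eq_fun do rewrite mulrC; apply: pgZ; apply: pgD; [exact: pg_nsq|exact: pg_cst].
Qed.

Lemma pg_negp_lam x : pg (fun v => negp (lam x v)).
Proof.
rewrite /negp; under eq_fun do rewrite mulrC; apply: pgZ; apply: pgD; first exact: pg_abs (pg_lam x).
by under eq_fun do rewrite -mulN1r; apply: pgZ; exact: pg_lam.
Qed.

Lemma lint_lam x i : lint (fun v => lam x v * v 0 i) = lsig x * (- beta * grad V x 0 i + grad g x 0 i / g x).
Proof.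
pose c1 j := lsig x * (- beta * grad V x 0 j - grad g x 0 j / g x * (d%:R / 2)).
pose c2 j := lsig x * (grad g x 0 j / g x / 2).
have p2 j : pg (fun v : 'rV[R]_d => v 0 j * v 0 i) by apply: pgM; exact: pg_coord.
have p3 j : pg (fun v : 'rV[R]_d => v 0 j * v 0 i * nsq v) by apply: pgM => //; exact: pg_nsq.
rewrite (eq_lint (g := fun v => \sum_j (c1 j * (v 0 j * v 0 i) + c2 j * (v 0 j * v 0 i * nsq v)))); last first.
 move=> v; rewrite /lam /dotp; set n := nsq v; clearbody n.
 transitivity (\sum_j (lsig x * (- beta * (grad V x 0 j * v 0 j)) * v 0 i +
   lsig x * (grad g x 0 j * v 0 j / g x * ((n - d%:R) / 2)) * v 0 i)).
  by rewrite big_split/= -!mulr_suml -!mulr_sumr -!mulr_suml mulrDr mulrDl.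
 by apply: eq_bigr => j _; rewrite /c1 /c2; field; rewrite gt_eqF.
rewrite lint_sum => [|j]; last by apply: pgD; apply: pgZ.
under eq_bigr => j _.
 rewrite lintD; [|exact: pgZ|exact: pgZ].
 rewrite !lintZ// lint_coordM lint_coordM_nsq; over.
rewrite (bigD1 i)//= eqxx !mul1r !mulr1 big1 ?addr0.
 by rewrite /c1 /c2; field; rewrite gt_eqF.
by move=> j /negbTE ->; rewrite mul0r !mulr0 addr0.
Qed.

Lemma lint_negp_lam x i : lsig x * lint (fun v => negp (lam x v) * v 0 i) = - ldrift x 0 i.
Proof.
have pc := pg_coord i; have pl := pg_lam x; have pa := pg_abs pl.
have h1 : lint (fun v => `|lam x v| * v 0 i) = 0.
 apply: (@lint_odd R d (fun=> true)) => [|v]; first exact: pgM.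
 have -> : lam x (flip (fun=> true) v) = - lam x v.
  have -> : flip (fun=> true) v = (-1) *: v by apply/rowP => j; rewrite !mxE expr1.
  by rewrite /lam !dotpZr nsqZ sqrrN expr1n mul1r; ring.
 by rewrite normrN mxE expr1 mulN1r mulrN.
rewrite (eq_lint (g := fun v => 2^-1 * (`|lam x v| * v 0 i) + (- 2^-1) * (lam x v * v 0 i))); last first.
 by move=> v; rewrite /negp; field.
rewrite lintD; [|by apply: pgZ; exact: pgM|by apply: pgZ; exact: pgM].
rewrite !lintZ; [|exact: pgM|exact: pgM].
rewrite h1 mulr0 add0r lint_lam.
rewrite [X in _ = - X](_ : _ = - (g x * grad V x 0 i) + beta^-1 * grad g x 0 i); last by rewrite /ldrift !mxE.
transitivity (- 2^-1 * lsig x ^+ 2 * (- beta * grad V x 0 i + grad g x 0 i / g x)); first by ring.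
by rewrite lsig_sqr; field; rewrite !gt_eqF.
Qed.

Definition rej1 (s : R) x i : R := lint (fun v => rej (logratio s x v) * v 0 i).
Definition rej2 (s : R) x i : R := lint (fun v => rej (logratio s x v) * v 0 i ^+ 2).
Definition defect (s : R) x i : R := ldrift x 0 i + lsig x * (rej1 s x i / s).

Lemma rej2_ge0 s x i : 0 <= rej2 s x i.
Proof. by apply: lint_ge0 => v; rewrite mulr_ge0 ?rej_ge0// sqr_ge0. Qed.

Lemma defect_le : exists2 C, 0 <= C & forall s x i, 0 < s -> s <= 1 ->
 `|defect s x i| <= s * (C * gradN x ^+ 2) /\ rej2 s x i <= s * (C * gradN x ^+ 2).
Proof.
have [C C0 hC] := rej_close; have M5 := moment_ge0 (d := d) 5 : 0 <= moment 5 :> R.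
exists ((1 + sig_max) * (C * moment (R := R) (d := d) 5)).
 by rewrite mulr_ge0 ?addr_ge0 ?sig_max_ge0// mulr_ge0.
move=> s x i s0 s1; have N2 : 0 <= gradN x ^+ 2 by nneg.
have pr := pg_rej s x; have pn := pg_negp_lam x; have pc := pg_coord i.
have CM0 : 0 <= C * gradN x ^+ 2 * moment (R := R) (d := d) 5 by nneg.
split; last first.
 have h2 : `|rej2 s x i| <= s * (C * gradN x ^+ 2) * moment (R := R) (d := d) 5.
  apply: lint_abs_le; first by apply: pgM => //; exact: pgX.
  move=> v; have [h _] := hC s x v s0 s1.
  rewrite normrM (ger0_norm (rej_ge0 _)) (ger0_norm (sqr_ge0 _)) [(1 + nsq v) ^+ 5]exprSr mulrA.
  apply: ler_pM; rewrite ?rej_ge0 ?sqr_ge0//.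
   by apply: le_trans (rej_le_abs _) _; rewrite -mulrA.
  by apply: le_trans (sqr_coord_le v i) _; rewrite lerDr.
 apply: le_trans (ler_norm _) _; apply: le_trans h2 _; rewrite -mulrA ler_wpM2l ?(ltW s0)//.
 rewrite (_ : (1 + sig_max) * _ * _ = (1 + sig_max) * (C * gradN x ^+ 2 * moment (R := R) (d := d) 5)); last by ring.
 by rewrite ler_peMl// lerDl sig_max_ge0.
pose Q := lint (fun v => negp (lam x v) * v 0 i).
have dE : defect s x i = lsig x / s * (rej1 s x i - s * Q).
 rewrite /defect; have := lint_negp_lam x i; rewrite -/Q => h.
 rewrite (_ : ldrift x 0 i = - (lsig x * Q)); last by rewrite h opprK.
 by field; rewrite gt_eqF.
have h1 : `|rej1 s x i - s * Q| <= s ^+ 2 * (C * gradN x ^+ 2) * moment (R := R) (d := d) 5.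
 have -> : rej1 s x i - s * Q = lint (fun v => (rej (logratio s x v) - s * negp (lam x v)) * v 0 i).
  rewrite (eq_lint (g := fun v => rej (logratio s x v) * v 0 i + (- s) * (negp (lam x v) * v 0 i))); last by move=> v; ring.
  rewrite lintD; [|exact: pgM|by apply: pgZ; exact: pgM].
  by rewrite lintZ ?mulNr//; exact: pgM.
 apply: lint_abs_le.
  apply: pgM => //; apply: pgD => //; under eq_fun do rewrite -mulNr; exact: pgZ.
 move=> v; have [_ h] := hC s x v s0 s1; rewrite normrM [(1 + nsq v) ^+ 5]exprSr mulrA.
 apply: ler_pM => //; first by rewrite -mulrA.
 by apply: le_trans (normr_coord_le v i) _; exact: enorm_le_1nsq.
have sx := lsig_gt0 x.
rewrite dE normrM (ger0_norm (_ : 0 <= lsig x / s)); last by nneg.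
apply: (@le_trans _ _ (lsig x / s * (s ^+ 2 * (C * gradN x ^+ 2) * moment (R := R) (d := d) 5))).
 by rewrite ler_wpM2l// divr_ge0// ltW.
rewrite (_ : lsig x / s * _ = s * (lsig x * (C * gradN x ^+ 2 * moment (R := R) (d := d) 5))); last by field; rewrite gt_eqF.
rewrite ler_wpM2l ?(ltW s0)//.
rewrite (_ : (1 + sig_max) * _ * _ = (1 + sig_max) * (C * gradN x ^+ 2 * moment (R := R) (d := d) 5)); last by ring.
by rewrite ler_wpM2r//; apply: le_trans (lsig_le_max x) _; rewrite lerDr.
Qed.

End langevin_coefficients.

Lemma mule_regroup {R : realType} (r a p c k : R) (y : \bar R) : a * (r * p) = c * k ->
 (r%:E * (a%:E * y * p%:E) = c%:E * (k%:E * y))%E.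
Proof.
move=> h; rewrite (muleC (a%:E * y)%E) !muleA -!EFinM -h; congr (_%:E * _)%E; ring.
Qed.

Section metropolis.
Context {R : realType} {d : nat} (V g : 'rV[R]_d -> R) (beta D C1 C2 C3 m1 M1 M2 : R)
 (hyps : langevin_hyps V g beta D C1 C2 C3 m1 M1 M2) (Z : R) (Z0 : 0 < Z).
Local Notation gamma := (@gauss R d 1).
Local Notation leb := (@lebesgue_rV R d).
Local Notation sig := (lsig g beta).
Local Notation ell := (logratio V g beta).

Definition gdens (x : 'rV[R]_d) : R := expR (- (beta * V x)) / Z.

Context (mu : probability 'rV[R]_d R)
 (muE : forall f : 'rV[R]_d -> \bar R, meas f -> (forall x, 0 <= f x)%E -> (\int[mu]_x f x = \int[leb]_x (f x * (gdens x)%:E))%E).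

Let sg x : 0 < sig x := lsig_gt0 hyps x.
Let mV : meas V.
Proof.
by apply: meas_continuous => x; apply: differentiable_continuous; case: hyps => _ _ [].
Qed.

Lemma gdens_gt0 x : 0 < gdens x.
Proof. by rewrite divr_gt0// expR_gt0. Qed.

Lemma meas_gdens : meas gdens.
Proof.
apply: measurable_funM => //; apply: mcomp; first exact: measurable_expR.
by apply: mcomp => //; apply: measurable_funM.
Qed.

Lemma gauss_pdfE (v : 'rV[R]_d) : gauss_pdf 1 v = normal_peak 1 ^+ d * expR (- (nsq v / 2)).
Proof.
rewrite /gauss_pdf /nsq mulr_suml -sumrN expR_sum -[d in X in X * _]card_ord -prodr_const -big_split/=.
by apply: eq_bigr => i _; rewrite std_normal_pdfE.
Qed.

Definition pkernel s (x z : 'rV[R]_d) : R :=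
 gdens x * gauss_pdf 1 ((s * sig x)^-1 *: (z - x)) / (s * sig x) ^+ d.

Definition skernel s (x z : 'rV[R]_d) : R := Num.min (pkernel s x z) (pkernel s z x).

Lemma skernelC s x z : skernel s x z = skernel s z x.
Proof. by rewrite /skernel minC. Qed.

Definition acc s x v : R := 1 - rej (ell s x v).

Lemma accE s x v : acc s x v = Num.min 1 (expR (ell s x v)).
Proof. by rewrite /acc /rej opprB addrC subrK. Qed.

Lemma acc_ge0 s x v : 0 <= acc s x v.
Proof. by rewrite subr_ge0 rej_le1. Qed.

Lemma expR_half_ln (q : R) : 0 < q -> expR (- (d%:R / 2 * ln q)) = (Num.sqrt q ^+ d)^-1.
Proof.
move=> q0; have sq : 0 < Num.sqrt q by rewrite sqrtr_gt0.
rewrite expRN; congr (_^-1); rewrite -{1}(sqr_sqrtr (ltW q0)) lnXn//.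
rewrite (_ : _ * _ = d%:R * ln (Num.sqrt q)); last by rewrite mulr2n; field.
by rewrite expRM_natl lnK.
Qed.

Lemma acc_kernel s x v : 0 < s ->
 acc s x v * (gdens x * gauss_pdf 1 v) = (s * sig x) ^+ d * skernel s x (x + (s * sig x) *: v).
Proof.
move=> s0; set z := x + _; have c0 : 0 < s * sig x by nneg.
have cd0 : 0 < (s * sig x) ^+ d by nneg.
have gx : 0 < g x by have [_ [m10 _ /(_ x)/andP[+ _] _] _ _] := hyps; exact: lt_le_trans.
have gz : 0 < g z by have [_ [m10 _ /(_ z)/andP[+ _] _] _ _] := hyps; exact: lt_le_trans.
have bp : 0 < beta by have [[]] := hyps.
have A0 : 0 <= gdens x * gauss_pdf 1 v by rewrite mulr_ge0 ?gauss_pdf_ge0// ltW// gdens_gt0.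
have kxz : (s * sig x) ^+ d * pkernel s x z = gdens x * gauss_pdf 1 v.
 rewrite /pkernel (_ : z - x = (s * sig x) *: v); last by rewrite /z addrC addKr.
 rewrite scalerA mulVf ?gt_eqF// scale1r.
 by rewrite mulrC divfK// gt_eqF.
have kzx : (s * sig x) ^+ d * pkernel s z x = expR (ell s x v) * (gdens x * gauss_pdf 1 v).
 have q0 : 0 < g z / g x by nneg.
 have rr : (sig x / sig z) = (Num.sqrt (g z / g x))^-1.
  have e0 : (sig x / sig z) ^+ 2 = (g z / g x)^-1.
   by rewrite expr_div_n !(lsig_sqr hyps); field; rewrite !gt_eqF.
  by rewrite -sqrtrV ?(ltW q0)// -e0 sqrtr_sqr ger0_norm// divr_ge0// ltW.
 have e1 : (s * sig z)^-1 *: (x - z) = - (sig x / sig z) *: v.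
  rewrite /z opprD addNKr scalerN scalerA scaleNr; congr (- (_ *: _)).
  by rewrite -/z; field; rewrite !gt_eqF.
 have e2 : nsq (- (sig x / sig z) *: v) = g x / g z * nsq v.
  rewrite nsqZ sqrrN expr_div_n !(lsig_sqr hyps); congr (_ * _).
  by field; rewrite !gt_eqF.
 rewrite /pkernel e1 !gauss_pdfE e2 /gdens.
 rewrite (_ : expR (ell s x v) = expR (- (beta * V z)) / expR (- (beta * V x)) *
   (sig x / sig z) ^+ d * (expR (nsq v / 2) * expR (- (g x / g z * nsq v / 2)))); last first.
  rewrite rr exprVn -expR_half_ln// -expRN -!expRD /logratio -/z; congr expR; by field; rewrite gt_eqF.
 rewrite [expR (- (nsq v / 2))]expRN; move: (normal_peak 1 ^+ d) => pk; rewrite !exprMn !exprVn.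
 have n1 : expR (nsq v / 2) != 0 by nneg.
 have n2 : expR (- (beta * V x)) != 0 by nneg.
 have n3 : sig z ^+ d != 0 by nneg.
 have n4 : s ^+ d != 0 by nneg.
 by field; rewrite ?n1 ?n2 ?n3 ?n4 ?gt_eqF.
by rewrite /skernel minr_pMr ?(ltW cd0)// kxz kzx accE minr_pMl// mul1r.
Qed.

Let mprop s := meas_proposal hyps s.

Lemma meas_acc s : meas (fun p : 'rV[R]_d * 'rV[R]_d => acc s p.1 p.2).
Proof.
by apply: measurable_funB => //; exact: (mcomp meas_rej (meas_logratio hyps s)).
Qed.

Lemma meas_pkernel s : meas (fun p : 'rV[R]_d * 'rV[R]_d => pkernel s p.1 p.2).
Proof.
have ms : meas (fun p : 'rV[R]_d * 'rV[R]_d => (s * sig p.1)^-1).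
 have mi : meas (fun x => (sig x)^-1).
  apply: meas_continuous => x; apply: continuousV; first by nneg.
  by have [L h] := lip_langevin hyps; exact: continuous_sigma h x.
 under eq_fun do rewrite invfM; apply: measurable_funM => //.
 exact: (mcomp mi measurable_fst).
apply: measurable_funM; last first.
 by under eq_fun do rewrite -exprVn; exact: (mcomp (exprn_measurable d) ms).
apply: measurable_funM; first exact: (mcomp meas_gdens measurable_fst).
apply: (mcomp (meas_gauss_pdf 1)); apply: meas_rVZ => //; exact: meas_rVB.
Qed.

Lemma meas_skernel s : meas (fun p : 'rV[R]_d * 'rV[R]_d => skernel s p.1 p.2).
Proof.
have mk := meas_pkernel s; apply: measurable_minr => //.
exact: (mcomp mk (measurable_swap (T1 := 'rV[R]_d) (T2 := 'rV[R]_d))).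
Qed.

Lemma skernel_ge0 s x z : 0 < s -> 0 <= skernel s x z.
Proof.
move=> s0; have p0 y w : 0 <= pkernel s y w.
 apply: divr_ge0; first by apply: mulr_ge0; [exact: ltW (gdens_gt0 _)|exact: gauss_pdf_ge0].
 by nneg.
by rewrite le_min !p0.
Qed.

Section pair.
Context (s : R) (H : 'rV[R]_d * 'rV[R]_d -> \bar R) (s0 : 0 < s) (mH : meas H) (H0 : forall p, (0 <= H p)%E).

Lemma meas_acc_prop :
 meas (fun p : 'rV[R]_d * 'rV[R]_d => ((acc s p.1 p.2)%:E * H (p.1, (p.1 + (s * sig p.1) *: p.2)%R))%E).
Proof.
apply: emeasurable_funM; first by apply: meas_EFin; exact: meas_acc.
apply: (mcomp mH); apply/measurable_fun_pairP; split; first exact: measurable_fst.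
exact: mprop.
Qed.

Lemma integral_acc_prop :
 (\int[mu]_x \int[gamma]_v ((acc s x v)%:E * H (x, (x + (s * sig x) *: v)%R)) =
  \int[leb]_x \int[leb]_z ((skernel s x z)%:E * H (x, z)))%E.
Proof.
rewrite muE; first last.
- move=> x; apply: integral_ge0 => v _; rewrite mule_ge0// lee_fin; exact: acc_ge0.
- apply: (measurable_fun_fubini_tonelli_F (m2 := gamma) _ meas_acc_prop) => p.
 by rewrite mule_ge0// lee_fin; exact: acc_ge0.
apply: eq_integral => x _.
have mx : meas (fun v => ((acc s x v)%:E * H (x, (x + (s * sig x) *: v)%R))%E).
 exact: (mcomp meas_acc_prop (measurable_pair1 x)).
have p0 v : (0 <= (acc s x v)%:E * H (x, (x + (s * sig x) *: v)%R))%E by rewrite mule_ge0// lee_fin; exact: acc_ge0.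
rewrite integral_gauss// muleC -ge0_integralZl_EFin//; first last.
- by rewrite ltW// gdens_gt0.
- by apply: emeasurable_funM => //; apply: meas_EFin; exact: meas_gauss_pdf.
- by move=> v _; rewrite mule_ge0// lee_fin gauss_pdf_ge0.
have mk : meas (fun z => ((skernel s x z)%:E * H (x, z))%E).
 apply: emeasurable_funM; last exact: (mcomp mH (measurable_pair1 x)).
 by apply: meas_EFin; exact: (mcomp (meas_skernel s) (measurable_pair1 x)).
have k0 z : (0 <= (skernel s x z)%:E * H (x, z))%E by rewrite mule_ge0// lee_fin skernel_ge0.
have c0 : 0 < s * sig x by nneg.
rewrite -(ge0_integral_affine x c0 mk k0) -ge0_integralZl_EFin//; first last.
- by nneg.
- apply: (mcomp mk); apply: meas_rVD => //; exact: meas_rVZ.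
apply: eq_integral => v _; rewrite [(_ *: v + x)%R]addrC.
apply: mule_regroup; exact: acc_kernel.
Qed.

End pair.

Lemma reversible s (H : 'rV[R]_d * 'rV[R]_d -> \bar R) : 0 < s -> meas H ->
 (forall p, (0 <= H p)%E) ->
 (\int[mu]_x \int[gamma]_v ((acc s x v)%:E * H (x, (x + (s * sig x) *: v)%R)) =
  \int[mu]_x \int[gamma]_v ((acc s x v)%:E * H ((x + (s * sig x) *: v)%R, x)))%E.
Proof.
move=> s0 mH H0; pose sw (p : 'rV[R]_d * 'rV[R]_d) := (p.2, p.1).
have msw : meas sw by apply/measurable_fun_pairP; split; [exact: measurable_snd|exact: measurable_fst].
have mH' : meas (fun p => H (sw p)) by exact: (mcomp mH msw).
apply: (etrans (integral_acc_prop s0 mH H0)); apply: esym.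
apply: (etrans (@integral_acc_prop s (fun p => H (sw p)) s0 mH' (fun p => H0 (sw p)))); apply: esym.
pose G p := ((skernel s p.1 p.2)%:E * H (p.1, p.2))%E.
have mG : meas G.
 apply: emeasurable_funM; first by apply: meas_EFin; exact: meas_skernel.
 by under eq_fun do rewrite -surjective_pairing.
rewrite (@fubini_tonelli _ _ _ _ _ leb leb G mG) => [|p]; last by rewrite mule_ge0// lee_fin skernel_ge0.
by apply: eq_integral => z _; apply: eq_integral => x _; rewrite /G/= skernelC.
Qed.

Definition mop (s : R) (f : 'rV[R]_d -> \bar R) (x : 'rV[R]_d) : \bar R :=
 (\int[gamma]_v ((acc s x v)%:E * f (x + (s * sig x) *: v)%R + (rej (ell s x v))%:E * f x))%E.

Section mop_theory.
Context (s : R) (f : 'rV[R]_d -> \bar R) (s0 : 0 < s) (mf : meas f) (f0 : forall x, (0 <= f x)%E).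

Let meas_rejp : meas (fun p : 'rV[R]_d * 'rV[R]_d => ((rej (ell s p.1 p.2))%:E * f p.1)%E).
Proof.
apply: emeasurable_funM; last exact: (mcomp mf measurable_fst).
by apply: meas_EFin; exact: (mcomp meas_rej (meas_logratio hyps s)).
Qed.

Let meas_accp : meas (fun p : 'rV[R]_d * 'rV[R]_d => ((acc s p.1 p.2)%:E * f (p.1 + (s * sig p.1) *: p.2)%R)%E).
Proof. by apply: (@meas_acc_prop s (fun p => f p.2)); exact: (mcomp mf measurable_snd). Qed.

Let acc_f0 x v y : (0 <= (acc s x v)%:E * f y)%E. Proof. by rewrite mule_ge0// lee_fin acc_ge0. Qed.
Let rej_f0 x v y : (0 <= (rej (ell s x v))%:E * f y)%E. Proof. by rewrite mule_ge0// lee_fin rej_ge0. Qed.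

Lemma mop_ge0 x : (0 <= mop s f x)%E.
Proof. by apply: integral_ge0 => v _; exact: adde_ge0. Qed.

Lemma meas_mop : meas (mop s f).
Proof.
apply: (measurable_fun_fubini_tonelli_F (m2 := gamma) (fun p : 'rV[R]_d * 'rV[R]_d =>
  ((acc s p.1 p.2)%:E * f (p.1 + (s * sig p.1) *: p.2)%R + (rej (ell s p.1 p.2))%:E * f p.1)%E)).
 by mble.
by move=> p; exact: adde_ge0.
Qed.

Lemma mop_invariant : (\int[mu]_x mop s f x = \int[mu]_x f x)%E.
Proof.
have sec1 x : meas (fun v => ((acc s x v)%:E * f (x + (s * sig x) *: v)%R)%E).
 exact: (mcomp meas_accp (measurable_pair1 x)).
have sec2 x : meas (fun v => ((rej (ell s x v))%:E * f x)%E).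
 exact: (mcomp meas_rejp (measurable_pair1 x)).
have mA : meas (fun x => \int[gamma]_v ((acc s x v)%:E * f (x + (s * sig x) *: v)%R))%E.
 exact: (measurable_fun_fubini_tonelli_F (m2 := gamma) _ meas_accp).
have mB : meas (fun x => \int[gamma]_v ((rej (ell s x v))%:E * f x))%E.
 exact: (measurable_fun_fubini_tonelli_F (m2 := gamma) _ meas_rejp).
have macc x : meas (fun v => ((acc s x v)%:E * f x)%E).
 apply: emeasurable_funM => //; apply: meas_EFin.
 exact: (mcomp (meas_acc s) (measurable_pair1 x)).
have mC : meas (fun x => \int[gamma]_v ((acc s x v)%:E * f x))%E.
 apply: (measurable_fun_fubini_tonelli_F (m2 := gamma) (fun p => ((acc s p.1 p.2)%:E * f p.1)%E)) => //.
 apply: emeasurable_funM; last exact: (mcomp mf measurable_fst).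
 by apply: meas_EFin; exact: meas_acc.
transitivity (\int[mu]_x (\int[gamma]_v ((acc s x v)%:E * f (x + (s * sig x) *: v)%R) +
  \int[gamma]_v ((rej (ell s x v))%:E * f x)))%E.
 by apply: eq_integral => x _; rewrite /mop ge0_integralD.
rewrite ge0_integralD//; [|by move=> x _; exact: integral_ge0|by move=> x _; exact: integral_ge0].
rewrite (@reversible s (fun p => f p.2))//=; last exact: (mcomp mf measurable_snd).
rewrite -ge0_integralD//; [|by move=> x _; exact: integral_ge0|by move=> x _; exact: integral_ge0].
apply: eq_integral => x _; rewrite -ge0_integralD//.
transitivity (\int[gamma]_v f x)%E; last by rewrite integral_cst//= [X in (_ * X)%E](probability_setT gamma) mule1.
apply: eq_integral => v _; rewrite -ge0_muleDl ?lee_fin ?acc_ge0 ?rej_ge0//.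
by rewrite -EFinD /acc subrK mul1e.
Qed.

End mop_theory.
End metropolis.

Lemma sqr_sum_fin {R : realFieldType} {d : nat} (a : 'I_d -> R) :
 (\sum_i a i) ^+ 2 <= d%:R * \sum_i a i ^+ 2.
Proof.
rewrite expr2 big_distrlr/=.
apply: (@le_trans _ _ (\sum_i \sum_j (2^-1 * a i ^+ 2 + 2^-1 * a j ^+ 2))).
 apply: ler_sum => i _; apply: ler_sum => j _.
 by have := sqr_ge0 (a i - a j); rewrite sqrrB; lra.
have inner i : \sum_(j < d) (2^-1 * a i ^+ 2 + 2^-1 * a j ^+ 2) = d%:R * (2^-1 * a i ^+ 2) + 2^-1 * \sum_j a j ^+ 2.
 by rewrite big_split/= sumr_const card_ord -mulr_sumr mulr_natl.
rewrite (eq_bigr _ (fun i _ => inner i)) big_split/= sumr_const card_ord -!mulr_sumr -(mulr_natl _ d).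
by apply: eq_refl_le; field.
Qed.

Lemma sum_sqr_affine {R : realFieldType} {d : nat} (a : 'I_d -> R) (p q r : R) :
 \sum_i (p * a i ^+ 2 + q + r) = p * \sum_i a i ^+ 2 + d%:R * q + d%:R * r.
Proof. by rewrite !big_split/= !sumr_const card_ord !mulr_natl mulr_sumr. Qed.

Lemma coordD {R : realType} {d : nat} (x y : 'rV[R]_d) i : (x + y) 0 i = x 0 i + y 0 i.
Proof. by rewrite mxE. Qed.

Lemma coordZ {R : realType} {d : nat} (a : R) (x : 'rV[R]_d) i : (a *: x) 0 i = a * x 0 i.
Proof. by rewrite mxE. Qed.

Section invariance.
Context {R : realType} {d : nat} (V g : 'rV[R]_d -> R) (beta D C1 C2 C3 m1 M1 M2 : R)
 (hyps : langevin_hyps V g beta D C1 C2 C3 m1 M1 M2) (Z : R) (Z0 : 0 < Z).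
Local Notation gamma := (@gauss R d 1).
Local Notation leb := (@lebesgue_rV R d).
Local Notation sig := (lsig g beta).
Local Notation drift := (ldrift V g beta).
Local Notation ell := (logratio V g beta).
Local Notation N := (gradN V).
Local Notation dens := (gdens V beta Z).
Local Notation acc := (acc V g beta).

Context (mu : probability 'rV[R]_d R)
 (muE : forall f : 'rV[R]_d -> \bar R, meas f -> (forall x, 0 <= f x)%E -> (\int[mu]_x f x = \int[leb]_x (f x * (dens x)%:E))%E).

Context (mgV : forall i, meas (fun x => grad V x 0 i)).

Lemma exp_grad_moment i (c : R) : (nint mu (fun x => expR (c * grad V x 0 i))%R <=
 (expR (d%:R * D * c ^+ 2 / beta))%:E)%E.
Proof.
have [[bp D0 _ _ _] _ [dV gV _] _] := hyps.
pose w : 'rV[R]_d := - (c / beta) *: delta_mx 0 i.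
have nw : nsq w = (c / beta) ^+ 2.
 rewrite nsqZ sqrrN /nsq (bigD1 i)//= big1 ?addr0 ?mxE ?eqxx ?expr1n ?mulr1// => j ji.
 by rewrite mxE (negbTE ji) andbF expr0n.
have dw x : dotp (grad V x) w = - (c / beta) * grad V x 0 i.
 rewrite dotpZr /dotp (bigD1 i)//= big1 ?addr0 ?mxE ?eqxx ?mulr1// => j ji.
 by rewrite [delta_mx _ _ _ _]mxE (negbTE ji) andbF mulr0.
pose K := expR (d%:R * D * c ^+ 2 / beta).
have me : meas (fun x => expR (c * grad V x 0 i)).
 by apply: mcomp; [exact: measurable_expR|exact: measurable_funM].
have md := meas_gdens hyps Z; have d0 x := ltW (gdens_gt0 V beta Z0 x).
have key x : expR (c * grad V x 0 i) * dens x <= K * dens (x + w).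
 rewrite /gdens /K !mulrA ler_pM2r ?invr_gt0// -!expRD ler_expR.
 have := taylor_bound dV D0 gV x w; rewrite nw dw ler_norml => /andP[_ h].
 have h2 : beta * (V (x + w) - V x - - (c / beta) * grad V x 0 i) <= beta * (d%:R * D * (c / beta) ^+ 2).
  by rewrite ler_pM2l.
 have e1 : beta * (d%:R * D * (c / beta) ^+ 2) = d%:R * D * c ^+ 2 / beta by field; rewrite gt_eqF.
 have e2 : beta * (V (x + w) - V x - - (c / beta) * grad V x 0 i) = beta * V (x + w) - beta * V x + c * grad V x 0 i.
  by field; rewrite gt_eqF.
 by move: h2; rewrite e1 e2; lra.
rewrite /nint muE; [|exact: meas_EFin|by move=> x; rewrite lee_fin expR_ge0].
have mdw : meas (fun x : 'rV[R]_d => dens (x + w)).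
 by apply: (mcomp md); exact: meas_rVD.
apply: (@le_trans _ _ (nint leb (fun x : 'rV[R]_d => K * dens (x + w))%R)).
 rewrite [X in (X <= _)%E](_ : _ = nint leb (fun x : 'rV[R]_d => expR (c * grad V x 0%R i) * dens x)%R)//.
 apply: le_nint => //; first by split=> [|x]; [exact: measurable_funM|rewrite mulr_ge0 ?expR_ge0].
 by apply: nnmZ; [exact: expR_ge0|split].
have nd : nnm (fun x : 'rV[R]_d => dens (x + w)) by split.
rewrite (nintZ leb (expR_ge0 _) nd).
rewrite /nint (@ge0_integral_translate R d w (fun x => (dens x)%:E)); [|exact: meas_EFin|by move=> x; rewrite lee_fin].
have : (\int[mu]_x 1 = \int[leb]_x (1 * (dens x)%:E))%E by rewrite muE.
under [in X in _ = X -> _]eq_integral do rewrite mul1e.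
by move=> <-; rewrite integral_cst//= [X in (_ * (_ * X))%E](probability_setT mu) !mule1.
Qed.

Lemma gradN_moment : exists2 K : R, 0 <= K & (nint mu (fun x => N x ^+ 4)%R <= K%:E)%E.
Proof.
pose c := expR (d%:R * D * 1 ^+ 2 / beta).
have c0 : 0 <= c by exact: expR_ge0.
exists (8 * 1 + 8 * d%:R ^+ 3 * (d%:R * (24 * (c + c)))).
 by nneg.
pose G x i := 24 * (expR (1 * grad V x 0 i) + expR (-1 * grad V x 0 i)).
have me (k : R) i : nnm (fun x => expR (k * grad V x 0 i)).
 split=> [|x]; last exact: expR_ge0.
 by apply: mcomp; [exact: measurable_expR|exact: measurable_funM].
have nG i : nnm (G ^~ i) by apply: nnmZ => //; exact: nnmD.
have GE i : (nint mu (G ^~ i) <= (24 * (c + c))%:E)%E.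
 rewrite nintZ//; last exact: nnmD.
 rewrite EFinM lee_wpmul2l ?lee_fin// nintD// EFinD; apply: leeD; first exact: exp_grad_moment.
 by have := exp_grad_moment i (-1); rewrite sqrrN.
have nS : nnm (fun x => \sum_i G x i) by exact: nnm_sum.
have pw (u : R) : u ^+ 4 <= 24 * (expR (1 * u) + expR (-1 * u)).
 have e4 : `|u| ^+ 4 <= 24 * expR `|u|.
  by have := expR_ge_pow 3 (normr_ge0 u); rewrite ler_pdivrMr// mulrC.
 rewrite (_ : u ^+ 4 = `|u| ^+ 4); last by rewrite -[RHS]normrX ger0_norm// exprn_even_ge0.
 apply: le_trans e4 _; rewrite ler_pM2l// mul1r mulN1r; have [u0|u0] := leP 0 u.
  by rewrite ger0_norm// lerDl expR_ge0.
 by rewrite ltr0_norm// lerDr expR_ge0.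
have nN : nnm (fun x => N x ^+ 4).
 split=> [|x]; last by nneg.
 apply: (mcomp (exprn_measurable 4)); apply: measurable_funD => //.
 apply: measurable_sum => i; apply: mcomp => //; exact: normr_measurable.
have bound x : N x ^+ 4 <= 8 * 1 + 8 * d%:R ^+ 3 * \sum_i G x i.
 rewrite /gradN; set A := \sum_i `|_|.
 have a1 : (1 + A) ^+ 4 <= 8 * (1 + A ^+ 4).
  have := sqr_ge0 (1 - A); have := sqr_ge0 (1 - A ^+ 2); have := sqr_ge0 (1 + A).
  rewrite (_ : 4 = 2 * 2)%N// !exprM.
  have h1 : (1 + A) ^+ 2 <= 2 * (1 + A ^+ 2) by have := sqr_ge0 (1 - A); rewrite sqrrB sqrrD; lra.
  have h2 : ((1 + A) ^+ 2) ^+ 2 <= (2 * (1 + A ^+ 2)) ^+ 2.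
   by rewrite lerXn2r ?nnegrE ?sqr_ge0// mulr_ge0// addr_ge0// sqr_ge0.
  move=> _ _ _; apply: le_trans h2 _; have := sqr_ge0 (1 - A ^+ 2).
  move: (A ^+ 2) => B; rewrite exprMn sqrrB sqrrD; lra.
 have a2 : A ^+ 4 <= d%:R ^+ 3 * \sum_i G x i.
  rewrite (_ : 4 = 2 * 2)%N// exprM.
  have h1 := sqr_sum_fin (fun i => `|grad V x 0 i|).
  have h2 := sqr_sum_fin (fun i => `|grad V x 0 i| ^+ 2).
  apply: (@le_trans _ _ ((d%:R * \sum_i `|grad V x 0 i| ^+ 2) ^+ 2)).
   by rewrite lerXn2r ?nnegrE ?sqr_ge0// mulr_ge0// sumr_ge0// => i _; exact: sqr_ge0.
  rewrite exprMn [d%:R ^+ 3]exprSr -mulrA ler_wpM2l ?sqr_ge0//; apply: le_trans h2 _.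
  rewrite ler_wpM2l//; apply: ler_sum => i _; apply: le_trans (pw _).
  by rewrite -exprM -normrX ger0_norm// exprn_even_ge0.
 apply: le_trans a1 _; rewrite mulrDr lerD2l -mulrA ler_pM2l//.
apply: (nint_le_lin2 nN (nnm_cst ler01) nS _ _ bound) => //.
- by rewrite nint_cst.
- rewrite nint_sum//; apply: (@le_trans _ _ (\sum_(i < d) (24 * (c + c))%:E)%E); first exact: lee_sum.
 by rewrite sume_const ?lee_fin ?mulr_ge0 ?addr_ge0// -EFinM.
Qed.

Definition step_sqr (s : R) (x y v : 'rV[R]_d) : R :=
 acc s x v * nsq (x + (s * sig x) *: v - (y + s ^+ 2 *: drift y + sig y *: (s *: v))) +
 rej (ell s x v) * nsq (x - (y + s ^+ 2 *: drift y + sig y *: (s *: v))).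

Lemma step_alg (u h b0 b1 s c dc r xi sx : R) : h = s ^+ 2 -> c = s * sx ->
 (1 - r) * (u + c * xi - h * b1 - (c - dc) * xi) ^+ 2 + r * (u - h * b1 - (c - dc) * xi) ^+ 2 =
 (u - h * b1) ^+ 2 + 2 * (u - h * b1) * dc * xi + dc ^+ 2 * xi ^+ 2
  - 2 * c * (u - h * b1) * (r * xi) + (c ^+ 2 - 2 * c * dc) * (r * xi ^+ 2).
Proof. by move=> _ _; ring. Qed.

Lemma step_alg2 (u h b0 b1 c dc R1 m : R) : 0 <= h -> h <= 1 -> 0 <= m -> m <= 1 ->
 (u - h * b1) ^+ 2 + dc ^+ 2 - 2 * (u - h * b1) * (h * (R1 - b0)) + (c ^+ 2 - 2 * c * dc) * m <=
 (1 + h) * (u - h * (b1 - b0)) ^+ 2 + 2 * h * R1 ^+ 2 + 2 * dc ^+ 2 + 2 * c ^+ 2 * m.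
Proof.
move=> h0 h1 m0 m1'.
rewrite -subr_ge0 (_ : _ - _ = h * (u - h * (b1 - b0) + R1) ^+ 2 + h ^+ 2 * (R1 - b0) ^+ 2 +
  m * (c + dc) ^+ 2 + (1 - m) * dc ^+ 2 + h * (1 - h) * R1 ^+ 2); last by ring.
by nneg.
Qed.

Lemma pg_step_coord (A B E F' G : R) s x i : pg (fun v => A + B * v 0 i + E * v 0 i ^+ 2
 - F' * (rej (ell s x v) * v 0 i) + G * (rej (ell s x v) * v 0 i ^+ 2)) /\
 lint (fun v => A + B * v 0 i + E * v 0 i ^+ 2
 - F' * (rej (ell s x v) * v 0 i) + G * (rej (ell s x v) * v 0 i ^+ 2)) =
 A + E - F' * rej1 V g beta s x i + G * rej2 V g beta s x i.
Proof.
have p1 := pg_cst (d := d) A; have p2 := pgZ B (pg_coord (R := R) i).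
have p3 := pgZ E (pgX 2 (pg_coord (R := R) i)).
have p4 := pgZ (- F') (pgM (pg_rej hyps s x) (pg_coord i)).
have p5 := pgZ G (pgM (pg_rej hyps s x) (pgX 2 (pg_coord i))).
have q := pgD (pgD (pgD p1 p2) p3) p4.
have e (v : 'rV[R]_d) : A + B * v 0 i + E * v 0 i ^+ 2 - F' * (rej (ell s x v) * v 0 i) + G * (rej (ell s x v) * v 0 i ^+ 2) =
 A + B * v 0 i + E * v 0 i ^+ 2 + - F' * (rej (ell s x v) * v 0 i) + G * (rej (ell s x v) * v 0 i ^+ 2) by rewrite mulNr.
split; first by under eq_fun do rewrite e; exact: (pgD q p5).
rewrite (eq_lint e) (lintD q p5) (lintD (pgD (pgD p1 p2) p3) p4) (lintD (pgD p1 p2) p3) (lintD p1 p2).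
rewrite lint_cst (lintZ B (pg_coord (R := R) i)) (lintZ E (pgX 2 (pg_coord (R := R) i))) lint_coord lint_coord_sqr.
rewrite (lintZ (- F') (pgM (pg_rej hyps s x) (pg_coord i))) (lintZ G (pgM (pg_rej hyps s x) (pgX 2 (pg_coord i)))).
by rewrite mulr0 addr0 mulr1 mulNr.
Qed.

Lemma step_sqr_le : exists C, 0 <= C /\ exists2 K, 0 <= K & forall s x y, 0 < s -> s <= 1 ->
 pg (step_sqr s x y) /\
 lint (step_sqr s x y) <= (1 + C * s ^+ 2) * nsq (x - y) + s ^+ 2 * (s * K * N x ^+ 4).
Proof.
have [L [/ltW L0 S0 hb hs hS]] := lip_langevin hyps.
have [K1 K10 hK] := defect_le hyps.
pose S := sig_max beta M1.
exists (3 + 4 * L + 2 * d%:R * L); split; first by nneg.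
exists (2 * d%:R * (K1 ^+ 2 + S ^+ 2 * K1)); first by nneg.
move=> s x y s0 s1; set h := s ^+ 2.
have h0 : 0 <= h by rewrite sqr_ge0.
have h1 : h <= 1 by rewrite expr_le1// ltW.
pose c := s * sig x; pose dc := s * (sig x - sig y).
pose A i := (x - y) 0 i - h * drift y 0 i.
pose Fi i (v : 'rV[R]_d) := A i ^+ 2 + 2 * A i * dc * v 0 i + dc ^+ 2 * v 0 i ^+ 2
 - 2 * c * A i * (rej (ell s x v) * v 0 i) + (c ^+ 2 - 2 * c * dc) * (rej (ell s x v) * v 0 i ^+ 2).
have sumF v : step_sqr s x y v = \sum_i Fi i v.
 rewrite /step_sqr /acc /nsq !mulr_sumr -big_split/=; apply: eq_bigr => i _.
 rewrite /Fi /A -(@step_alg _ _ (drift x 0 i) _ s c dc _ _ (sig x) erefl erefl) coordB.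
 have -> : c - dc = s * sig y by rewrite /c /dc; ring.
 congr (_ * _ ^+ 2 + _ * _ ^+ 2); rewrite coordB.
  by rewrite !(coordD, coordZ) /h /c; ring.
 by rewrite !(coordD, coordZ) /h; ring.
have pF i : pg (Fi i) by case: (pg_step_coord (A i ^+ 2) (2 * A i * dc) (dc ^+ 2) (2 * c * A i) (c ^+ 2 - 2 * c * dc) s x i).
have lF i : lint (Fi i) = A i ^+ 2 + dc ^+ 2 - 2 * c * A i * rej1 V g beta s x i + (c ^+ 2 - 2 * c * dc) * rej2 V g beta s x i.
 by case: (pg_step_coord (A i ^+ 2) (2 * A i * dc) (dc ^+ 2) (2 * c * A i) (c ^+ 2 - 2 * c * dc) s x i).
split; first by rewrite (funext sumF); exact: pg_sum.
rewrite (eq_lint sumF) lint_sum//.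
pose al := x - y - h *: (drift y - drift x).
apply: (@le_trans _ _ (\sum_i ((1 + h) * al 0 i ^+ 2 + 2 * dc ^+ 2 + h * (2 * (s * (K1 ^+ 2 + S ^+ 2 * K1) * N x ^+ 4))))).
 apply: ler_sum => i _; rewrite lF.
 have [hd hm] := hK s x i s0 s1; set Rd := defect _ _ _ _ _ _ in hd.
 have N1 : 1 <= N x := gradN_ge1 V x.
 have N2 : 0 <= N x ^+ 2 by nneg.
 have N24 : N x ^+ 2 <= N x ^+ 4 by rewrite ler_weXn2l.
 have m0 := rej2_ge0 V g beta s x i.
 have mle1 : rej2 V g beta s x i <= 1.
  rewrite -(lint_coord_sqr (R := R) i); apply: le_lint; [exact: (pgM (pg_rej hyps s x) (pgX 2 (pg_coord i)))|exact: (pgX 2 (pg_coord i))|].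
  by move=> v; rewrite ler_piMl ?sqr_ge0// rej_le1.
 have ce : 2 * c * A i * rej1 V g beta s x i = 2 * A i * (h * (Rd - drift x 0 i)).
  by rewrite /Rd /defect /c /h; field; rewrite gt_eqF.
 rewrite ce; apply: le_trans (step_alg2 _ _ _ _ _ _ h0 h1 m0 mle1) _.
 have -> : al 0 i = (x - y) 0 i - h * (drift y 0 i - drift x 0 i) by rewrite /al !(coordB, coordZ).
 rewrite -!addrA lerD2l addrCA lerD2l.
 have b1 : 2 * h * Rd ^+ 2 <= h * (2 * (s * K1 ^+ 2 * N x ^+ 4)).
  have sq : Rd ^+ 2 <= (s * (K1 * N x ^+ 2)) ^+ 2.
   by rewrite -real_normK ?num_real// lerXn2r ?nnegrE// mulr_ge0 ?(ltW s0)// mulr_ge0.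
  have s2 : s ^+ 2 <= s by rewrite expr2 ler_piMl// ltW.
  rewrite (_ : 2 * h * Rd ^+ 2 = h * (2 * Rd ^+ 2)); last by ring.
  rewrite ler_wpM2l// ler_pM2l//; apply: le_trans sq _.
  rewrite (_ : _ ^+ 2 = s ^+ 2 * (K1 ^+ 2 * N x ^+ 4)); last by ring.
  rewrite -mulrA; apply: ler_wpM2r s2; apply: mulr_ge0; [exact: sqr_ge0|by rewrite exprn_even_ge0].
 have b2 : 2 * c ^+ 2 * rej2 V g beta s x i <= h * (2 * (s * (S ^+ 2 * K1) * N x ^+ 4)).
  have sS : sig x ^+ 2 <= S ^+ 2.
   by rewrite lerXn2r ?nnegrE ?sig_max_ge0 ?(ltW (lsig_gt0 hyps x))//; exact: (lsig_le_max hyps x).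
  have -> : 2 * c ^+ 2 * rej2 V g beta s x i = h * (2 * (sig x ^+ 2 * rej2 V g beta s x i)) by rewrite /c /h; ring.
  rewrite ler_wpM2l// ler_pM2l// (_ : s * _ * _ = S ^+ 2 * (s * (K1 * N x ^+ 4))); last by ring.
  apply: ler_pM; rewrite ?sqr_ge0//; apply: le_trans hm _.
  by rewrite ler_wpM2l ?(ltW s0)// ler_wpM2l.
 rewrite (_ : h * _ = h * (2 * (s * K1 ^+ 2 * N x ^+ 4)) + h * (2 * (s * (S ^+ 2 * K1) * N x ^+ 4))); last by ring.
 exact: lerD.
rewrite sum_sqr_affine -/(nsq al).
have hal : nsq al <= (1 + h + 2 * h * L) * nsq (x - y).
 have ha : nsq al <= (1 + h) * nsq (x - y) + (h + h ^+ 2) * nsq (drift y - drift x).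
  rewrite /nsq !mulr_sumr -big_split/=; apply: ler_sum => i _; rewrite /al !(coordB, coordZ).
  have := mulr_ge0 h0 (sqr_ge0 ((x 0 i - y 0 i) + (drift y 0 i - drift x 0 i))).
  move: (x 0 i) (y 0 i) (drift x 0 i) (drift y 0 i) => p1 p2 p3 p4 H.
  by rewrite -subr_ge0; apply: le_trans H _; apply: eq_refl_le; ring.
 apply: le_trans ha _; rewrite [leRHS]mulrDl lerD2l nsqC.
 have hh : h + h ^+ 2 <= 2 * h by rewrite expr2; nra.
 apply: le_trans (ler_wpM2r (nsq_ge0 _) hh) _; rewrite -[leRHS]mulrA.
 by apply: ler_wpM2l (hb x y); rewrite mulr_ge0.
have hsg : dc ^+ 2 <= h * (L * nsq (x - y)).
 by rewrite /dc exprMn ler_wpM2l//; exact: hs.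
rewrite (_ : h * (s * _ * _) = d%:R * (h * (2 * (s * (K1 ^+ 2 + S ^+ 2 * K1) * N x ^+ 4)))); last by ring.
rewrite lerD2r; apply: (@le_trans _ _ ((1 + h) * ((1 + h + 2 * h * L) * nsq (x - y)) + d%:R * (2 * (h * (L * nsq (x - y)))))).
 by apply: lerD; [rewrite ler_wpM2l// addr_ge0|rewrite ler_wpM2l// ler_pM2l].
rewrite -subr_ge0 (_ : _ - _ = (h * (1 - h) * (1 + 2 * L)) * nsq (x - y)); last by ring.
by nneg.
Qed.

Lemma qop_scale s (f : 'rV[R]_d -> \bar R) y : 0 < s -> meas f -> (forall x, 0 <= f x)%E ->
 qop drift sig (s ^+ 2) f y = (\int[gamma]_v f (y + s ^+ 2 *: drift y + sig y *: (s *: v))%R)%E.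
Proof.
move=> s0 mf f0; rewrite /qop sqrtr_sqr (gtr0_norm s0) integral_gauss_scale//.
apply: (mcomp mf); apply: meas_rVD => //; exact: meas_rVZ.
Qed.

Section comparison.
Context (f : 'rV[R]_d -> R) (s A B C K : R) (bf : bm f) (s0 : 0 < s) (A0 : 0 <= A) (B0 : 0 <= B) (C0 : 0 <= C) (K0 : 0 <= K)
 (fAB : forall x y, f y <= f x + (A + B * nsq (x - y)))
 (hstep : forall x y, pg (step_sqr s x y) /\ lint (step_sqr s x y) <= (1 + C * s ^+ 2) * nsq (x - y) + s ^+ 2 * (s * K * N x ^+ 4)).

Fixpoint majorant (n : nat) (x : 'rV[R]_d) : \bar R :=
 if n is n'.+1 then (mop V g beta s (majorant n') x +
  (B * (1 + C * s ^+ 2) ^+ n' * (s ^+ 2 * (s * K * N x ^+ 4)))%:E)%E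
 else (f x)%:E.

Let incr_ge0 n x : 0 <= B * (1 + C * s ^+ 2) ^+ n * (s ^+ 2 * (s * K * N x ^+ 4)).
Proof.
apply: mulr_ge0; first by nneg.
by nneg.
Qed.

Lemma majorant_ge0 n x : (0 <= majorant n x)%E.
Proof.
elim: n x => [|n IH] x; first by rewrite lee_fin; case: (bm_nnm bf).
by apply: adde_ge0; [exact: mop_ge0|rewrite lee_fin].
Qed.

Let mN4 : meas (fun x => N x ^+ 4).
Proof.
apply: (mcomp (exprn_measurable 4)); apply: measurable_funD => //.
apply: measurable_sum => i; apply: mcomp => //; exact: normr_measurable.
Qed.

Let mincr n : meas (fun x => (B * (1 + C * s ^+ 2) ^+ n * (s ^+ 2 * (s * K * N x ^+ 4)))%:E).
Proof. by apply: meas_EFin; do 3 (apply: measurable_funM => //). Qed.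

Lemma meas_majorant n : meas (majorant n).
Proof.
elim: n => [|n IH]; first by apply: meas_EFin; case: bf.
by apply: emeasurable_funD => //; apply: (meas_mop hyps) => // x; exact: majorant_ge0.
Qed.

Lemma iter_qop_le_majorant n x y : (iter n (qop drift sig (s ^+ 2)) (fun z => (f z)%:E) y <=
 majorant n x + (A + B * (1 + C * s ^+ 2) ^+ n * nsq (x - y))%:E)%E.
Proof.
have [L hl] := lip_langevin hyps; have mb := meas_b hl; have ms := meas_sigma hl.
have wm k : meas (iter k (qop drift sig (s ^+ 2)) (fun z => (f z)%:E)) /\
  forall z, (0 <= iter k (qop drift sig (s ^+ 2)) (fun z => (f z)%:E) z)%E.
 elim: k => [|k [IHm IH0]] /=.
  by split=> [|z]; [apply: meas_EFin; case: bf|rewrite lee_fin; case: (bm_nnm bf)].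
 by split; [exact: meas_qop|exact: qop_ge0].
elim: n x y => [|n IH] x y; first by rewrite /= expr0 mulr1 -EFinD lee_fin.
have [mw w0] := wm n; rewrite iterS qop_scale//.
set a := B * (1 + C * s ^+ 2) ^+ n.
have a0 : 0 <= a by rewrite mulr_ge0// exprn_ge0// addr_ge0// mulr_ge0// sqr_ge0.
have [pS lS] := hstep x y.
have S0 v : 0 <= step_sqr s x y v.
 by rewrite addr_ge0// mulr_ge0 ?nsq_ge0// ?rej_ge0//; exact: acc_ge0.
set y' := fun v : 'rV[R]_d => y + s ^+ 2 *: drift y + sig y *: (s *: v).
pose G v := ((acc s x v)%:E * majorant n (x + (s * sig x) *: v)%R + (rej (ell s x v))%:E * majorant n x)%E.
have G0 v : (0 <= G v)%E.
 by apply: adde_ge0; rewrite mule_ge0 ?majorant_ge0// lee_fin ?rej_ge0//; exact: acc_ge0.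
have mG : meas G.
 have h := measurable_pair1 (T2 := 'rV[R]_d) x.
 apply: emeasurable_funD; apply: emeasurable_funM => //.
 - by apply: meas_EFin; exact: (mcomp (meas_acc hyps s) h).
 - by apply: (mcomp (meas_majorant n)); apply: meas_rVD => //; exact: meas_rVZ.
 - by apply: meas_EFin; case: (pg_rej hyps s x).
have pR : pg (fun v => A + a * step_sqr s x y v) by apply: pgD; [exact: pg_cst|exact: pgZ].
have R0 v : 0 <= A + a * step_sqr s x y v by nneg.
apply: (@le_trans _ _ (\int[gamma]_v (G v + (A + a * step_sqr s x y v)%:E))%E).
 apply: ge0_le_integral => //.
 - by apply: (mcomp mw); apply: meas_rVD => //; do 2 (apply: meas_rVZ => //).
 - by apply: emeasurable_funD => //; apply: meas_EFin; case: pR.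
 - move=> v _; rewrite -[leLHS]mul1e (_ : 1%E = (acc s x v + rej (ell s x v))%:E); last by rewrite /acc subrK.
  have ac0 : (0 <= (acc s x v)%:E)%E by rewrite lee_fin acc_ge0.
  have rj0 : (0 <= (rej (ell s x v))%:E)%E by rewrite lee_fin rej_ge0.
  rewrite EFinD ge0_muleDl//.
  apply: le_trans (leeD (lee_wpmul2l ac0 (IH (x + (s * sig x) *: v) (y' v))) (lee_wpmul2l rj0 (IH x (y' v)))) _.
  have r1 (z : 'rV[R]_d) : 0 <= A + a * nsq z by nneg.
  rewrite -/a ge0_muleDr ?majorant_ge0 ?lee_fin ?r1//.
  rewrite [X in (_ + X <= _)%E]ge0_muleDr ?majorant_ge0 ?lee_fin ?r1//.
  rewrite addeACA -!EFinM -EFinD leeD2l// lee_fin /step_sqr -/(y' v) /acc.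
  move: (rej _) (nsq _) (nsq _) => r p q; apply: eq_refl_le; ring.
rewrite ge0_integralD//; [|by move=> v _; rewrite lee_fin|by apply: meas_EFin; case: pR].
rewrite -/(mop V g beta s (majorant n) x) -/(nint gamma (fun v => A + a * step_sqr s x y v)) nint_lint//.
rewrite lintD ?lint_cst ?lintZ//; [|exact: pg_cst|exact: pgZ].
rewrite (_ : majorant n.+1 x = (mop V g beta s (majorant n) x + (a * (s ^+ 2 * (s * K * N x ^+ 4)))%:E)%E)//.
rewrite -[leRHS]addeA -[X in (_ <= _ + X)%E]EFinD leeD2l// lee_fin.
rewrite (_ : B * _ ^+ n.+1 * _ = a * ((1 + C * s ^+ 2) * nsq (x - y))); last by rewrite /a exprSr; ring.
rewrite [leRHS]addrCA lerD2l [leRHS]addrC -mulrDr.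
exact: (ler_wpM2l a0 lS).
Qed.

Lemma integral_majorant K4 n : 0 <= K4 -> (nint mu (fun x => N x ^+ 4)%R <= K4%:E)%E ->
 (\int[mu]_x majorant n x <= (ex mu f + n%:R * (B * (1 + C * s ^+ 2) ^+ n * (s ^+ 2 * (s * K * K4))))%:E)%E.
Proof.
move=> K40 hK4; have q1 : 1 <= 1 + C * s ^+ 2 by rewrite lerDl mulr_ge0// sqr_ge0.
have mm := meas_majorant; have m0 := majorant_ge0.
have h0 : 0 <= s ^+ 2 * (s * K * K4) by nneg.
elim: n => [|n IH]; first by rewrite mul0r addr0 -exE.
rewrite /= ge0_integralD//; first last.
- by nneg.
- by apply: (meas_mop hyps).
- by move=> x _; exact: mop_ge0.
rewrite (mop_invariant hyps Z0 muE)//.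
have n4 : nnm (fun x => N x ^+ 4) by split=> // x; rewrite exprn_even_ge0.
have c0 : 0 <= B * (1 + C * s ^+ 2) ^+ n * (s ^+ 2 * (s * K)).
 apply: mulr_ge0; first by nneg.
 by nneg.
rewrite [X in (_ + X <= _)%E](_ : _ = nint mu (fun x => B * (1 + C * s ^+ 2) ^+ n * (s ^+ 2 * (s * K)) * N x ^+ 4)%R); last first.
 by apply: eq_integral => x _; rewrite !mulrA.
rewrite nintZ//; apply: le_trans (leeD IH (lee_wpmul2l _ hK4)) _; first by nneg.
rewrite -EFinM -EFinD lee_fin -addrA lerD2l -natr1 mulrDl mul1r.
have e : B * (1 + C * s ^+ 2) ^+ n * (s ^+ 2 * (s * K * K4)) <= B * (1 + C * s ^+ 2) ^+ n.+1 * (s ^+ 2 * (s * K * K4)).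
 by rewrite ler_wpM2r// ler_wpM2l// ler_weXn2l.
apply: lerD; first by rewrite ler_wpM2l.
by apply: le_trans e; rewrite !mulrA.
Qed.

End comparison.
End invariance.

Lemma le_succ_eventually {R : realType} (c : R) : exists N : nat, forall n, (N <= n)%N -> c <= n.+1%:R.
Proof.
exists (Num.bound `|c|) => n Nn; apply: le_trans (ler_norm c) _.
apply: le_trans (ltW (archi_boundP (normr_ge0 c))) _.
by rewrite ler_nat (leq_trans Nn).
Qed.

Lemma meas_real_cvg {R : realType} disp (T : measurableType disp) (f : nat -> T -> R) (g : T -> R) :
 (forall n, meas (f n)) -> (forall x, f n x @[n --> \oo] --> g x) -> meas g.
Proof. by move=> mf fg; apply: (measurable_fun_cvg mf) => x _; exact: fg. Qed.

Lemma integral_le_addcst {R : realType} disp (T : measurableType disp) (m : probability T R) (w f : T -> \bar R) (a c : R) :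
 0 <= a -> meas w -> (forall x, 0 <= w x)%E -> meas f -> (forall x, 0 <= f x)%E ->
 (forall x, w x <= f x + a%:E)%E -> (\int[m]_x f x <= c%:E)%E -> (\int[m]_x w x <= (c + a)%:E)%E.
Proof.
move=> a0 mw w0 mf f0 wf fc; apply: (@le_trans _ _ (\int[m]_x (f x + a%:E))%E).
 by apply: ge0_le_integral => //; exact: emeasurable_funD.
rewrite (ge0_integralD m)// -/(nint m (fun=> a)) nint_cst EFinD.
exact: leeD2r.
Qed.

Lemma mul_div_succ_le {R : realFieldType} (q e : R) : 0 <= q -> 0 < e -> q * (e / (q + 1)) <= e.
Proof.
move=> q0 e0; rewrite mulrA ler_pdivrMr ?ltr_wpDl// mulrDr mulr1 mulrC.
by rewrite lerDl ltW.
Qed.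

Lemma le_of_near_chain {R : realDomainType} (a1 a2 i q f K e : R) : `|a1 - a2| <= e -> a2 <= i + K * e ->
 i <= f + q -> q <= e -> a1 <= f + (K + 2) * e.
Proof. by rewrite ler_norml mulrDl; lra. Qed.

Lemma exprn_le_expR {R : realType} (u : R) n : 0 <= u -> (1 + u) ^+ n <= expR (n%:R * u).
Proof. by move=> u0; rewrite expRM_natl lerXn2r ?nnegrE ?expR_ge0 ?expR_ge1Dx// addr_ge0. Qed.

Section mixture.
Context dd dd' (Y : measurableType dd) (T : measurableType dd') {R : realType} (mu : probability Y R) (k : R.-pker Y ~> T).

Let l : R.-pker unit ~> Y := kprobability (measurable_cst (mu : pprobability Y R)).
Let k' : R.-spker (unit * Y)%type ~> T := kernel.kernel_snd k.

Definition mixture : set T -> \bar R := kcomp l k' tt.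

HB.instance Definition _ := Measure.on mixture.

Lemma mixtureE A : mixture A = (\int[mu]_y k y A)%E.
Proof. by []. Qed.

Let mixture_setT : mixture setT = 1%E.
Proof.
rewrite mixtureE; under eq_integral do rewrite prob_kernel.
by rewrite integral_cst// mul1e [LHS](probability_setT mu).
Qed.

HB.instance Definition _ := Measure_isProbability.Build _ _ R mixture mixture_setT.

Lemma integral_mixture (f : T -> \bar R) : meas f -> (forall z, 0 <= f z)%E ->
 (\int[mixture]_z f z = \int[mu]_y \int[k y]_z f z)%E.
Proof. by move=> mf f0; rewrite /mixture [LHS](integral_kcomp l k' tt f0 mf). Qed.

End mixture.

Section path_kernel.
Context {R : realType} dd dd' (Y : measurableType dd) (T : measurableType dd') {disp} {Omega : measurableType disp}
 (P : probability Omega R) (X : Y -> Omega -> T).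

Definition path_kernel (mX : forall y, meas (X y))
 (mP : forall A, measurable A -> meas (fun y => P (X y @^-1` A))) :
 Y -> {measure set T -> \bar R} := fun y => distribution P (mfun_Sub (mem_set (mX y))).

Context (mX : forall y, meas (X y))
 (mP : forall A, measurable A -> meas (fun y => P (X y @^-1` A))).

Lemma path_kernelE y A : path_kernel mX mP y A = P (X y @^-1` A).
Proof. by []. Qed.

Let meas_path_kernel A : measurable A -> meas (path_kernel mX mP ^~ A).
Proof. exact: mP. Qed.

HB.instance Definition _ := @isKernel.Build _ _ Y T R (path_kernel mX mP) meas_path_kernel.

Let path_kernel_prob y : path_kernel mX mP y setT = 1%E.
Proof. by rewrite path_kernelE preimage_setT probability_setT. Qed.

HB.instance Definition _ := @Kernel_isProbability.Build _ _ Y T R (path_kernel mX mP) path_kernel_prob.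

End path_kernel.
Section gibbs_invariance.
Context {R : realType} {d : nat} {disp} {Omega : measurableType disp} (P : probability Omega R) (F : R -> set (set Omega))
 (hF : is_filtration P F) (W : R -> Omega -> 'rV[R]_d) (hW : is_brownian_motion P F W)
 (mW : forall t, meas (W t)) (cW : forall om, continuous (W ^~ om)) (V g : 'rV[R]_d -> R)
 (beta D C1 C2 C3 m1 M1 M2 : R) (hyps : langevin_hyps V g beta D C1 C2 C3 m1 M1 M2) (Z : R) (Z0 : 0 < Z).
Local Notation sig := (lsig g beta).
Local Notation drift := (ldrift V g beta).
Local Notation X := (sol W drift sig).
Context (mu : probability 'rV[R]_d R)
 (muE : forall f : 'rV[R]_d -> \bar R, meas f -> (forall x, 0 <= f x)%E -> (\int[mu]_x f x = \int[@lebesgue_rV R d]_x (f x * (gdens V beta Z x)%:E))%E)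
 (mgV : forall i, meas (fun x => grad V x 0 i)).
Implicit Types f : 'rV[R]_d -> R.

Definition tsg f t x := ex P (fun om => f (X x t om)).
Definition tsgn f t n x := ex P (fun om => f (euler W drift sig x (t / n.+1%:R) n.+1 om)).

Let mX x t : meas (X x t).
Proof. by have [L hl] := lip_langevin hyps; exact: (meas_sol hF hW mW cW hl x t). Qed.

Let mE f t n x : 0 < t -> bm f -> bm (fun om => f (euler W drift sig x (t / n.+1%:R) n.+1 om)).
Proof.
move=> t0 bf; have [L hl] := lip_langevin hyps; apply: bm_comp bf _.
by apply: (@meas_euler R d disp Omega P F hF W hW drift sig _ _ hl); rewrite divr_gt0.
Qed.

Let wE f t n x : 0 < t -> bm f ->
 (tsgn f t n x)%:E = iter n.+1 (qop drift sig (t / n.+1%:R)) (fun z => (f z)%:E) x.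
Proof.
move=> t0 bf; have [L hl] := lip_langevin hyps.
rewrite -(euler_law hF hW hl) ?divr_gt0//; first last.
- by move=> y; rewrite lee_fin; case: (bm_nnm bf).
- by apply: meas_EFin; case: bf.
by rewrite -exE//; exact: mE.
Qed.

Let bw f t n : 0 < t -> bm f -> bm (tsgn f t n).
Proof.
move=> t0 bf; have [L hl] := lip_langevin hyps; have mb := meas_b hl; have ms := meas_sigma hl.
split=> [|x]; last by apply: ex_itv; exact: mE.
suff mi k h : meas (iter k (qop drift sig h) (fun z => (f z)%:E)) /\
  forall z, (0 <= iter k (qop drift sig h) (fun z => (f z)%:E) z)%E.
 apply/measurable_EFinP; rewrite (_ : EFin \o _ = iter n.+1 (qop drift sig (t / n.+1%:R)) (fun z => (f z)%:E)).
  by case: (mi n.+1 (t / n.+1%:R)).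
 by apply/funext => x; rewrite /= -[RHS](wE n x t0 bf).
elim: k => [|k [IHm IH0]] /=.
 by split=> [|z]; [apply: meas_EFin; case: bf|rewrite lee_fin; case: (bm_nnm bf)].
by split; [exact: meas_qop|exact: qop_ge0].
Qed.

Lemma euler_cvg_lip f K t x : 0 < t -> bm f -> 0 <= K -> (forall x y, `|f x - f y| <= K * enorm (x - y)) ->
 tsgn f t n x @[n --> \oo] --> tsg f t x.
Proof.
move=> t0 bf K0 lf; have [L hl] := lip_langevin hyps.
have [K' K'0 err] := euler_sol_error hF hW mW cW hl x t0.
apply/cvgrPdist_le => e e0; pose q := e / (2 * (K + 1)).
have K1 : 0 < K + 1 by rewrite ltr_wpDl.
have q0 : 0 < q by rewrite divr_gt0// mulr_gt0.
have eE : e = (K + 1) * (q + q) by rewrite /q; field; rewrite gt_eqF.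
clearbody q.
have [N1 h1] := le_succ_eventually t; have [N2 h2] := le_succ_eventually (K' / (4 * q ^+ 2)).
exists (maxn N1 N2) => // n /=; rewrite geq_max => /andP[/h1 n1 /h2 n2].
have np : 0 < n.+1%:R :> R by [].
have := err n.+1 isT; rewrite ler_pdivrMr// mul1r => /(_ n1) E.
have := ex_dist_lip bf K0 lf (mX x t) _ q0 E; rewrite -/(tsg f t x) -/(tsgn f t n x) => H.
apply: le_trans (H _) _.
 by apply: (@meas_euler R d disp Omega P F hF W hW drift sig _ _ hl); rewrite divr_gt0.
have c1 : K' / n.+1%:R / (4 * q) <= q.
 have q4 : 0 < 4 * q by nneg.
 have qq : 0 < 4 * q ^+ 2 by nneg.
 rewrite (ler_pdivrMr _ _ q4) (ler_pdivrMr _ _ np); move: n2; rewrite (ler_pdivrMr _ _ qq) => n2.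
 by apply: le_trans n2 _; apply: eq_refl_le; ring.
apply: (@le_trans _ _ (K * (q + q))); first by rewrite ler_wpM2l// lerD2l.
rewrite eE.
by rewrite ler_wpM2r ?lerDl// addr_ge0// ltW.
Qed.

Lemma bm_sol_lip f K t : 0 < t -> bm f -> 0 <= K -> (forall x y, `|f x - f y| <= K * enorm (x - y)) ->
 bm (tsg f t).
Proof.
move=> t0 bf K0 lf; split=> [|x]; last by apply: ex_itv; exact: bm_comp bf (mX x t).
apply: (@meas_real_cvg _ _ _ (tsgn f t)) => [n|x]; first by case: (bw n t0 bf).
exact: (euler_cvg_lip t0 bf K0 lf).
Qed.

Lemma ex_sol_lip_le f K t : 0 < t -> bm f -> 0 <= K -> (forall x y, `|f x - f y| <= K * enorm (x - y)) ->
 ex mu (tsg f t) <= ex mu f.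
Proof.
move=> t0 bf K0 lf; have [C [C0 [Ks Ks0 step]]] := step_sqr_le hyps.
have [K4 K40 hK4] := gradN_moment hyps Z0 muE mgV.
apply: (@ler_of_eps _ _ _ (K + 2)) => [|e e0]; first exact: addr_ge0.
pose A := K * e; pose B := K / (4 * e).
have A0 : 0 <= A by rewrite mulr_ge0// ltW.
have B0 : 0 <= B by rewrite divr_ge0// mulr_ge0// ltW.
have fAB x y : f y <= f x + (A + B * nsq (x - y)).
 rewrite -lerBlDl; apply: le_trans (ler_norm _) _; rewrite distrC; apply: le_trans (lf x y) _.
 apply: le_trans (ler_wpM2l K0 (enorm_le_eps _ e0)) _.
 by apply: eq_refl_le; rewrite /A /B; field; rewrite gt_eqF.
pose Q := B * expR (C * t) * t * (Ks * K4).
have Q0 : 0 <= Q by apply: mulr_ge0; [apply: mulr_ge0; [apply: mulr_ge0 => //; exact: expR_ge0|exact: ltW]|exact: mulr_ge0].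
have /cvgrPdist_le/(_ _ e0)[N1 _ h1] :
  ex mu (tsgn f t n) @[n --> \oo] --> ex mu (tsg f t).
 apply: ex_cvg => [n||x]; [exact: bw|exact: (bm_sol_lip t0 bf K0 lf)|exact: (euler_cvg_lip t0 bf K0 lf)].
have [N2 h2] := le_succ_eventually t.
pose r := e / (Q + 1); have r0 : 0 < r by rewrite divr_gt0// ltr_wpDl.
have [N3 h3] := le_succ_eventually (t / r ^+ 2).
pose n := maxn N1 (maxn N2 N3).
have n1 : t <= n.+1%:R by apply: h2; rewrite leq_max leq_max leqnn orbT.
have n2 : t / r ^+ 2 <= n.+1%:R by apply: h3; rewrite leq_max leq_max leqnn !orbT.
have := h1 n (leq_maxl _ _) => /= dw.
pose s := Num.sqrt (t / n.+1%:R).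
have s0 : 0 < s by rewrite sqrtr_gt0 divr_gt0.
have s2 : s ^+ 2 = t / n.+1%:R by rewrite sqr_sqrtr// divr_ge0// ltW.
have s1 : s <= 1 by rewrite -sqrtr1 ler_wsqrtr// ler_pdivrMr// mul1r.
have sr : s <= r.
 rewrite -[leRHS](gtr0_norm r0) -sqrtr_sqr ler_wsqrtr//.
 by rewrite ler_pdivrMr// mulrC -ler_pdivrMr// exprn_gt0.
have qE : qop drift sig (t / n.+1%:R) = qop drift sig (s ^+ 2) by rewrite s2.
have ns2 : n.+1%:R * s ^+ 2 = t by rewrite s2; field; rewrite gt_eqF.
clearbody n s.
have hstep x y := step s x y s0 s1.
have im := integral_majorant hyps Z0 muE mgV bf s0 B0 C0 Ks0 n.+1 K40 hK4.
set I := _ + n.+1%:R * _ in im.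
have wle : (nint mu (tsgn f t n) <= (I + A)%:E)%E.
 have hM x := iter_qop_le_majorant hyps mgV bf s0 A0 B0 C0 Ks0 fAB hstep n.+1 x x.
 have M0 x := majorant_ge0 V g beta bf s0 B0 C0 Ks0 n.+1 x.
 have mM := meas_majorant hyps mgV bf s0 B0 C0 Ks0 n.+1.
 move: (majorant V g beta f s B C Ks n.+1) im hM M0 mM => M im hM M0 mM.
 have w0 x : (0 <= (tsgn f t n x)%:E)%E by rewrite lee_fin; case: (bm_nnm (bw n t0 bf)).
 apply: (integral_le_addcst A0 (meas_EFin (bw n t0 bf).1) w0 mM M0 _ im) => x.
 have z : A + B * (1 + C * s ^+ 2) ^+ n.+1 * nsq (x - x) = A by rewrite subrr nsq0 mulr0 addr0.
 rewrite (wE n x t0 bf) qE -[X in (_ + X%:E)%E]z; exact: hM.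
have IQ : I <= ex mu f + Q * s.
 rewrite /I lerD2l.
 have g1 : (1 + C * s ^+ 2) ^+ n.+1 <= expR (C * t).
  rewrite (_ : C * t = n.+1%:R * (C * s ^+ 2)); last by rewrite -ns2 mulrCA.
  exact: (exprn_le_expR _ (mulr_ge0 C0 (sqr_ge0 s))).
 have gen (p q N : R) : N * (B * p * (q * (s * Ks * K4))) = B * (N * q * (Ks * K4) * s) * p by ring.
 rewrite gen ns2.
 rewrite (_ : Q * s = (B * (t * (Ks * K4) * s)) * expR (C * t)); last by rewrite /Q; ring.
 exact: (ler_wpM2l (mulr_ge0 B0 (mulr_ge0 (mulr_ge0 (ltW t0) (mulr_ge0 Ks0 K40)) (ltW s0))) g1).
have QS : Q * s <= e.
 apply: (@le_trans _ _ (Q * r)); first exact: (ler_wpM2l Q0 sr).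
 exact: mul_div_succ_le.
have W1 : ex mu (tsgn f t n) <= I + A by rewrite -lee_fin -(exE mu (bw n t0 bf)); exact: wle.
exact: (le_of_near_chain dw W1 IQ QS).
Qed.

Let bm1 f : bm f -> bm (fun x => 1 - f x).
Proof.
by move=> [mf f01]; split=> [|x]; [exact: measurable_funB|have /andP[] := f01 x; rewrite subr_ge0 lerBlDr lerDl => -> ->].
Qed.

Lemma ex_1B dd (T : measurableType dd) (m : probability T R) (f : T -> R) : bm f -> bm (fun x => 1 - f x) ->
 ex m (fun x => 1 - f x) = 1 - ex m f.
Proof.
move=> bf b1; apply/eqP; rewrite eq_sym subr_eq eq_sym; apply/eqP.
have := nintD m (bm_nnm b1) (bm_nnm bf); rewrite (exE m b1) (exE m bf) (eq_nint _ (g := fun=> 1)) => [|x]; last by rewrite subrK.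
by rewrite nint_cst -EFinD => -[].
Qed.

Lemma ex_sol_lip f K t : 0 < t -> bm f -> 0 <= K -> (forall x y, `|f x - f y| <= K * enorm (x - y)) ->
 ex mu (tsg f t) = ex mu f.
Proof.
move=> t0 bf K0 lf; apply: le_anti; rewrite (ex_sol_lip_le t0 bf K0 lf)/=.
have b1 := bm1 bf.
have l1 x y : `|(1 - f x) - (1 - f y)| <= K * enorm (x - y).
 by rewrite (_ : _ - _ = - (f x - f y)) ?normrN//; ring.
have bt := bm_sol_lip t0 bf K0 lf.
have := ex_sol_lip_le t0 b1 K0 l1; rewrite (ex_1B mu bf b1).
rewrite (eq_ex mu (g := fun x => 1 - tsg f t x)); last first.
 by move=> x; rewrite /tsg ex_1B//; [exact: bm_comp bf (mX x t)|exact: bm_comp b1 (mX x t)].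
by rewrite ex_1B ?lerD2l ?lerN2//; exact: bm1.
Qed.

Let sm k : R := (2 ^+ k)^-1 ^+ 4.

Let sm0 k : 0 < sm k.
Proof. by rewrite exprn_gt0// invr_gt0 exprn_gt0. Qed.

Lemma bm_sol_continuous f t : 0 < t -> bm f -> continuous f -> bm (tsg f t) /\ ex mu (tsg f t) = ex mu f.
Proof.
move=> t0 bf cf; have [L hl] := lip_langevin hyps.
have bg k := bm_gsm (sm k) bf.
have lg k x y := gsm_lip x y (sm0 k) bf.
have K0 k : 0 <= 2 / sm k by nneg.
have bt k := bm_sol_lip t0 (bg k) (K0 k) (lg k).
have ct x : tsg (gsm (sm k) f) t x @[k --> \oo] --> tsg f t x by exact: (cvg_gsm_sol hF hW mW cW hl bf cf).
have b : bm (tsg f t).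
 split=> [|x]; last by apply: ex_itv; exact: bm_comp bf (mX x t).
 by apply: (@meas_real_cvg _ _ _ (fun k => tsg (gsm (sm k) f) t)) => // k; case: (bt k).
split=> //; apply: (@cvg_unique _ _ (ex mu (tsg (gsm (sm k) f) t) @[k --> \oo])) => //.
 exact: ex_cvg.
rewrite (_ : (fun k => _) = (fun k => ex mu (gsm (sm k) f))); last by apply/funext => k; exact: (ex_sol_lip t0 (bg k) (K0 k) (lg k)).
apply: ex_cvg => // x; rewrite -[f _](ex_cst (@gauss R d 1)); apply: ex_cvg => [n||v].
- exact: (bm_section1 (bm_gsm_arg _ bf) x).
- by split=> [|?]; [exact: measurable_cst|case: bf].
- by apply: continuous_cvg; [exact: cf|exact: cvg_smoothing_scale].
Qed.

Lemma sol_law_neg t x A : t <= 0 -> P (X x t @^-1` A) = (\1_A x)%:E.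
Proof.
move=> t0; rewrite (_ : X x t @^-1` A = fun _ => A x); last first.
 by apply/funext => om; rewrite /preimage/= sol_neg.
rewrite indicE; have [Ax|nAx] := pselect (A x).
 by rewrite mem_set// (_ : (fun _ => _) = setT) ?probability_setT//; apply/seteqP; split.
by rewrite memNset// (_ : (fun _ => _) = set0) ?measure0//; apply/seteqP; split.
Qed.

Lemma meas_sol_law t A : measurable A -> meas (fun x => P (X x t @^-1` A)).
Proof.
move=> mA; have [L hl] := lip_langevin hyps; have [t0|t0] := ltP 0 t.
 have c := continuous_law hF hW mW cW hl (sig_min_gt0 hyps) (sig_min_le hyps) t0 mA.
 rewrite (_ : (fun x => _) = EFin \o (fun x => law P W drift sig x t A)).
  by apply/measurable_EFinP; exact: meas_continuous.
 by apply/funext => x; rewrite /= /law fineK// fin_num_measure//; rewrite -[Y in measurable Y]setTI; exact: mX.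
rewrite (_ : (fun x => _) = (fun x => (\1_A x)%:E)); last by apply/funext => x; exact: sol_law_neg.
by mble.
Qed.

Definition langevin_kernel t : R.-pker 'rV[R]_d ~> 'rV[R]_d :=
 path_kernel (fun x => mX x t) (@meas_sol_law t).

Lemma langevin_kernelE t x A : langevin_kernel t x A = P (X x t @^-1` A).
Proof. by []. Qed.

Lemma langevin_kernel_invariant t A : 0 <= t -> measurable A ->
 (\int[mu]_x langevin_kernel t x A = mu A)%E.
Proof.
move=> t0 mA; have [tp|tn] := ltP 0 t; last first.
 under eq_integral do rewrite langevin_kernelE (sol_law_neg _ _ tn).
 by rewrite integral_indic// setIT.
have bA := bm_indic (R := R) mA; have [mf f01] := bA.
pose nu : probability 'rV[R]_d R := mixture mu (langevin_kernel t).
suff H : nu A = mu A by [].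
have toR (m : probability 'rV[R]_d R) : m A = (ex m \1_A)%:E.
 by rewrite -exE// nint_indic.
rewrite (toR nu) (toR mu); congr EFin; apply/eqP; rewrite -subr_eq0 -normr_le0.
apply: (@ler_of_eps _ _ _ 2) => // e e0; rewrite add0r.
have [_ /(_ e e0)[f [bf cf f1 f2]]] := meas_cont_approx nu mu mA.
have [bt tE] := bm_sol_continuous tp bf cf.
have bl := bm_l1dist bA bf.
have h1 := ex_dist bA bf (bm_nnm bl) (fun x => lexx _) f1.
have h2 := ex_dist bA bf (bm_nnm bl) (fun x => lexx _) f2.
have E : ex nu f = ex mu f.
 rewrite -tE; congr fine; have fm := meas_EFin bf.1.
 have f0 z : (0 <= (f z)%:E)%E by rewrite lee_fin; case: (bm_nnm bf).
 rewrite /nint (integral_mixture mu (langevin_kernel t) fm f0); apply: eq_integral => x _.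
 rewrite /tsg -exE; last exact: bm_comp bf (mX x t).
 exact: (ge0_integral_distribution (mfun_Sub (mem_set (mX x t))) fm f0).
by move: h1 h2; rewrite E; rewrite !ler_norml; lra.
Qed.

End gibbs_invariance.

Lemma adde_balance {R : realDomainType} (a b c e u : \bar R) : a \is a fin_num -> b \is a fin_num ->
 c \is a fin_num -> (0 <= e -> e <= c -> 0 <= u -> a + c = b -> a + e = b + u -> u = 0)%E.
Proof.
move: a b c e u => [a||]// [b||]// [c||]// [e||]// [u||]// _ _ _; rewrite !lee_fin -!EFinD.
by move=> h1 h2 h3 [h4] [h5]; congr EFin; move: h1 h2 h3 h4 h5; lra.
Qed.

Lemma adde_eq_self {R : realDomainType} (a c : \bar R) : c \is a fin_num -> (c = a + c -> a = 0)%E.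
Proof.
by move: a c => [a||] [c||]// _; rewrite -?EFinD => -[h]; congr EFin; move: h; lra.
Qed.

Lemma sube_eq_adde {R : realDomainType} (a b c e : \bar R) : a \is a fin_num -> b \is a fin_num ->
 c \is a fin_num -> e \is a fin_num -> (a - b = c - e -> a + e = b + c)%E.
Proof.
move: a b c e => [a||]// [b||]// [c||]// [e||]// _ _ _ _.
by rewrite -!EFinN -!EFinD => -[h]; congr EFin; move: h; lra.
Qed.

Lemma hahn_measures {R : realType} disp (T : measurableType disp) (mu nu : probability T R) :
 exists (k1 k2 : {finite_measure set T -> \bar R}) (Q : set T), [/\ measurable Q, k1 (~` Q) = 0%E, k2 Q = 0%E &
  forall A, measurable A -> (mu A + k2 A = nu A + k1 A)%E].
Proof.
pose nm : {charge set T -> \bar R} := cadd (charge_of_finite_measure mu) (copp (charge_of_finite_measure nu)).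
have [Q [N PN]] := Hahn_decomposition nm.
have [[mQ _] [mN _] QN QN0] := PN.
exists (jordan_pos PN), (jordan_neg PN), Q; split=> // [||A mA].
- apply: (etrans (jordan_posE PN _)); rewrite cjordan_posE /crestr0 mem_set; last exact: measurableC.
 by rewrite /crestr setICl charge0.
- by apply: (etrans (jordan_negE PN _)); rewrite cjordan_negE /crestr0 mem_set// /crestr QN0 charge0 oppe0.
have fp := fin_num_measure (jordan_pos PN) A mA.
have fn := fin_num_measure (jordan_neg PN) A mA.
have fm := fin_num_measure mu A mA.
have fu := fin_num_measure nu A mA.
have : (mu A - nu A = jordan_pos PN A - jordan_neg PN A)%E.
 by apply: (etrans (jordan_decomp PN mA)); rewrite /cadd/= cscaleN1.
by move=> H; exact: (sube_eq_adde fm fu fp fn H).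
Qed.

Lemma ge0_integral_eq0 {R : realType} disp (T : measurableType disp) (m : {measure set T -> \bar R}) (f : T -> \bar R) :
 meas f -> (forall x, 0 <= f x)%E -> (\int[m]_x f x = 0)%E ->
 measurable [set x | f x != 0%E] /\ m [set x | f x != 0%E] = 0%E.
Proof.
move=> mf f0 i0; have mn : measurable [set x | f x != 0%E].
 by rewrite -[X in measurable X]setTI; exact: emeasurable_neq.
split=> //; have /(ae_eq_integral_abs m measurableT mf).1 : (\int[m]_x `|f x| = 0)%E.
 by rewrite -[RHS]i0; apply: eq_integral => x _; rewrite gee0_abs.
move=> [N [mN N0 sN]]; apply/eqP; rewrite eq_le measure_ge0 andbT; apply: (@le_trans _ _ (m N)); last by rewrite N0.
apply: le_measure; rewrite ?inE//.
by move=> x /= fx; apply: sN => /= /(_ I) h; rewrite h eqxx in fx.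
Qed.

Section unique_invariant.
Context {R : realType} {d : nat} (k : R.-pker 'rV[R]_d ~> 'rV[R]_d) (mu nu : probability 'rV[R]_d R)
 (ck : forall A, measurable A -> continuous (fun x => fine (k x A)))
 (full : forall w : 'rV[R]_d -> R, continuous w -> (forall x, 0 <= w x) -> nint mu w = 0%E -> forall x, w x = 0)
 (imu : forall A, measurable A -> (\int[mu]_x k x A = mu A)%E) (inu : forall A, measurable A -> (\int[nu]_x k x A = nu A)%E).

Lemma absorbing_trivial A : measurable A -> (forall x, ~ A x -> k x A = 0%E) ->
 (forall x, k x A = 0%E) \/ (forall x, k x A = 1%E).
Proof.
move=> mA hA; pose r x := fine (k x A).
have kT x : k x setT = 1%E by exact: prob_kernel.
have kr x : k x A = (r x)%:E.
 rewrite /r fineK// ge0_fin_numE//; apply: (@le_lt_trans _ _ 1%E); last exact: ltry.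
 by rewrite -(kT x); apply: le_measure; rewrite ?inE.
have br : bm r.
 split=> [|x]; first exact: meas_continuous (ck mA).
 rewrite -!lee_fin -kr measure_ge0/= -(kT x); apply: le_measure; rewrite ?inE//.
have bA := bm_indic (R := R) mA.
have rA x : r x <= \1_A x.
 rewrite indicE; have [Ax|nAx] := pselect (A x); first by rewrite mem_set//; case/andP: (br.2 x).
 by rewrite memNset// /r hA.
have nA : nnm (fun x => \1_A x - r x).
 by split=> [|x]; [apply: measurable_funB; [case: bA|case: br]|rewrite subr_ge0].
have i0 : nint mu (fun x => \1_A x - r x) = 0%E.
 have := nintD mu nA (bm_nnm br); rewrite (eq_nint _ (g := \1_A)) => [|x]; last by rewrite subrK.
 rewrite nint_indic// (_ : nint mu r = mu A); last by rewrite -[RHS]imu//; apply: eq_integral => x _; rewrite kr.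
 have bd : bm (fun x => \1_A x - r x).
  split=> [|x]; first by case: nA.
  rewrite subr_ge0 rA/=; have /andP[h _] := br.2 x; have /andP[_ h'] := bA.2 x.
  by move: h h'; rewrite lerBlDr; lra.
 rewrite (exE mu bd); have := fin_num_measure mu A mA.
 exact: adde_eq_self.
pose w x := r x * (1 - r x).
have cw : continuous w.
 move=> x; have c1 : {for x, continuous (fun y : 'rV[R]_d => 1 - r y)}.
  by apply: continuousB; [exact: cst_continuous|exact: ck].
 have c0 : {for x, continuous r} by exact: ck.
 by apply: continuousM; [exact: c0|exact: c1].
have w0 x : 0 <= w x by have /andP[h1 h2] := br.2 x; rewrite mulr_ge0// subr_ge0.
have wA x : w x <= \1_A x - r x.
 rewrite indicE; have /andP[h1 h2] := br.2 x; have [Ax|nAx] := pselect (A x).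
  by rewrite mem_set//= ler_piMl// subr_ge0.
 by rewrite memNset// /w (_ : r x = 0) ?mul0r ?subr0// /r hA.
have wz : forall x, w x = 0.
 apply: full => //; apply/eqP; rewrite eq_le nint_ge0// andbT -i0; apply: le_nint => //.
 by split=> //; exact: meas_continuous.
have r01 x : r x = 0 \/ r x = 1.
 by move/eqP: (wz x); rewrite mulf_eq0 subr_eq0 => /orP[]/eqP; [left|right].
have same x y : r x = 0 -> r y = 1 -> False.
 move=> rx ry; pose p (s : R) := r (x + s *: (y - x)).
 have cp : continuous p.
  move=> s; have c1 : {for s, continuous (fun s : R => x + s *: (y - x))}.
   by apply: continuousD; [exact: cst_continuous|exact: scalel_continuous].
  have c0 : {for x + s *: (y - x), continuous r} by exact: ck.
  exact: (continuous_comp c1 c0).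
 have p0 : p 0 = 0 by rewrite /p scale0r addr0.
 have p1 : p 1 = 1 by rewrite /p scale1r addrC subrK.
 have [//|||c _ pc] := @IVT R p 0 1 (2^-1).
 - exact: continuous_subspaceT.
 - by rewrite p0 p1 minEle maxEle ler01 invr_ge0 ler0n/= invf_le1// ler1n.
 - by have [h|h] := r01 (x + c *: (y - x)); move: pc; rewrite /p h; lra.
have [h|h] := pselect (exists x, r x = 1).
 right=> y; rewrite kr; have [x rx] := h; have [ry|->//] := r01 y.
 by case: (same y x ry rx).
by left=> y; rewrite kr; have [->//|ry] := r01 y; case: h; exists y.
Qed.

Lemma unique_invariant A : measurable A -> nu A = mu A.
Proof.
have [k1 [k2 [Q [mQ k1Q k2Q dec]]]] := hahn_measures mu nu.
have kT x : k x setT = 1%E by exact: prob_kernel.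
have intdec (f : 'rV[R]_d -> \bar R) : meas f -> (forall x, 0 <= f x)%E ->
  (\int[mu]_x f x + \int[k2]_x f x = \int[nu]_x f x + \int[k1]_x f x)%E.
 move=> mf f0.
 have h (a b : {measure set 'rV[R]_d -> \bar R}) : (\int[a]_x f x + \int[b]_x f x = \int[measure_add a b]_x f x)%E.
  by rewrite ge0_integral_measure_add.
 rewrite (h mu k2) (h nu k1).
 apply: eq_measure_integral => B mB _; exact: (etrans (measure_addE mu k2 B) (etrans (dec B mB) (esym (measure_addE nu k1 B)))).
have null_bigcup (m : {measure set 'rV[R]_d -> \bar R}) (G : nat -> set 'rV[R]_d) :
  (forall n, measurable (G n)) -> (forall n, m (G n) = 0%E) -> m (\bigcup_n G n) = 0%E.
 move=> mG G0; apply/negligibleP; first exact: bigcup_measurable.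
 by apply: negligible_bigcup => n; exists (G n); split.
have nullU (m : {measure set 'rV[R]_d -> \bar R}) (B1 B2 : set 'rV[R]_d) : measurable B1 -> measurable B2 ->
  m B1 = 0%E -> m B2 = 0%E -> m (B1 `|` B2) = 0%E.
 move=> b1 b2 z1 z2; apply/eqP; rewrite eq_le measure_ge0 andbT.
 by apply: (@le_trans _ _ (m B1 + m B2)%E); [exact: measureU2|rewrite z1 z2 adde0].
have nullUr (m : {measure set 'rV[R]_d -> \bar R}) (B1 B2 : set 'rV[R]_d) : measurable B1 -> measurable B2 ->
  m B1 = 0%E -> (m (B1 `|` B2) <= m B2)%E.
 by move=> b1 b2 z1; apply: (@le_trans _ _ (m B1 + m B2)%E); [exact: measureU2|rewrite z1 add0e].
have nullS (m : {measure set 'rV[R]_d -> \bar R}) (B1 B2 : set 'rV[R]_d) : measurable B1 -> measurable B2 ->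
  B1 `<=` B2 -> m B2 = 0%E -> m B1 = 0%E.
 move=> b1 b2 b12 z2; apply/eqP; rewrite eq_le measure_ge0 andbT; apply: (@le_trans _ _ (m B2)); last by rewrite z2.
 by apply: le_measure; rewrite ?inE.
pose good B := [/\ measurable B, k1 (~` B) = 0%E & k2 B = 0%E].
pose next B := B `&` [set x | k x (~` B) = 0%E].
have goodN B : good B -> good (next B).
 move=> [mB B1 B2]; have mBc := measurableC mB.
 have mk := measurable_kernel k _ mBc.
 have i0 : (\int[k1]_x k x (~` B) = 0)%E.
  have := intdec _ mk (fun x => measure_ge0 _ _); rewrite imu// inu//.
  have := dec _ mBc; rewrite B1 adde0.
  have le2 : (\int[k2]_x k x (~` B) <= k2 (~` B))%E.
   apply: (@le_trans _ _ (\int[k2]_x 1%E)%E).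
    apply: ge0_le_integral => // x _; rewrite -(kT x).
    by apply: le_measure; rewrite ?inE.
   rewrite integral_cst// mul1e -(setUv B).
   exact: (nullUr k2 B (~` B) mB mBc B2).
  have i1 : (0 <= \int[k1]_x k x (~` B))%E by nneg.
  have i2 : (0 <= \int[k2]_x k x (~` B))%E by nneg.
  move=> e1 e2; apply: (adde_balance _ _ _ i2 le2 i1 e1 e2); exact: fin_num_measure.
 have [mz z0] := ge0_integral_eq0 mk (fun x => measure_ge0 _ _) i0.
 have eN : ~` next B = ~` B `|` [set x | k x (~` B) != 0%E].
  by rewrite setCI; congr (_ `|` _); apply/seteqP; split=> x /= /eqP.
 split.
 - rewrite -[next B]setCK eN; apply: measurableC; exact: measurableU.
 - by rewrite eN; exact: (nullU k1 _ _ mBc mz B1 z0).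
 - apply: (nullS k2 _ B _ mB _ B2); last exact: subIsetl.
  by rewrite -[next B]setCK eN; apply: measurableC; exact: measurableU.
pose Bn n := iter n next Q.
have gB n : good (Bn n) by elim: n => [|n IH]; [split|exact: goodN].
pose C := \bigcup_n ~` Bn n.
have mC : measurable C by apply: bigcup_measurable => n _; apply: measurableC; case: (gB n).
have kC x : ~ C x -> k x C = 0%E.
 move=> nC; apply: null_bigcup => n; first by apply: measurableC; case: (gB n).
 have : Bn n.+1 x by apply: contrapT => h; apply: nC; exists n.+1.
 by rewrite /Bn iterS => -[].
have k1C : k1 C = 0%E.
 by apply: null_bigcup => n; [apply: measurableC|]; case: (gB n).
have k2C : k2 (~` C) = 0%E.
 apply: (nullS k2 _ Q (measurableC mC) mQ _ k2Q).
 by move=> x nC; apply: contrapT => h; apply: nC; exists 0%N.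
have eC : mu C = nu C.
 have val (m : probability 'rV[R]_d R) (c : R) : (\int[m]_x k x C = m C)%E -> (forall x, k x C = c%:E) -> m C = c%:E.
  move=> <- hc; rewrite (eq_integral (cst c%:E)) => [|x _]; last exact: hc.
  by rewrite integral_cst// [X in (_ * X)%E](probability_setT m) mule1.
 have [h|h] := absorbing_trivial mC kC.
  by rewrite (val mu 0 (imu mC) h) (val nu 0 (inu mC) h).
 by rewrite (val mu 1 (imu mC) h) (val nu 1 (inu mC) h).
move=> mA; have mCc := measurableC mC.
have k20 : k2 setT = 0%E.
 rewrite -(setUv C); apply: (nullU k2 _ _ mC mCc _ k2C).
 have h := dec _ mC; rewrite eC k1C adde0 in h.
 by apply: (@adde_eq_self _ (k2 C) (nu C)); [exact: fin_num_measure|rewrite addeC; exact: esym h].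
have k10 : k1 setT = 0%E.
 have h := dec _ measurableT.
 rewrite k20 adde0 [X in X = _](probability_setT mu) [X in _ = (X + _)%E](probability_setT nu) in h.
 by apply: (@adde_eq_self _ (k1 setT) 1%E) => //; rewrite addeC; exact: h.
have z (m : {measure set 'rV[R]_d -> \bar R}) : m setT = 0%E -> m A = 0%E.
 exact: (nullS m A setT mA measurableT).
by have := dec _ mA; rewrite (z k1 k10) (z k2 k20) !adde0.
Qed.

End unique_invariant.

Lemma lebesgue_rV_setT_neq0 {R : realType} {d : nat} : @lebesgue_rV R d setT <> 0%E.
Proof.
move=> z; have := @integral_gauss_pdf R d 1.
rewrite (_ : (\int[_]_x _)%E = 0%E) => [/eqP|]; first by rewrite eq_sym onee_eq0.
rewrite -(@integral_abs_eq0 _ _ R (lebesgue_rV d) setT (fun x => (gauss_pdf 1 x)%:E))//.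
 by apply: eq_integral => x _; rewrite gee0_abs// lee_fin gauss_pdf_ge0.
by apply: meas_EFin; exact: meas_gauss_pdf.
Qed.

Lemma lebesgue_rV_ball {R : realType} {d : nat} (B : set 'rV[R]_d) (a : 'rV[R]_d) (r : R) : 0 < r -> measurable B ->
 (forall x, `|x| <= r -> B (x + a)) -> @lebesgue_rV R d B <> 0%E.
Proof.
move=> r0 mB hB B0; apply: (@lebesgue_rV_setT_neq0 R d).
pose G (n : nat) : set 'rV[R]_d := [set x | B (n.+1%:R^-1 *: x + a)].
have mG n : measurable (G n).
 rewrite -[X in measurable X]setTI; have mf : meas (fun x : 'rV[R]_d => n.+1%:R^-1 *: x + a).
  by mble.
 exact: mf.
have G0 n : lebesgue_rV d (G n) = 0%E.
 have n0 : 0 < n.+1%:R^-1 :> R by nneg.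
 have mI : meas (fun x : 'rV[R]_d => (\1_B x)%:E : \bar R).
  by mble.
 have I0 (x : 'rV[R]_d) : (0 <= (\1_B x)%:E :> \bar R)%E by nneg.
 have h : ((n.+1%:R^-1 ^+ d)%:E * nint (lebesgue_rV d) \1_(G n) = nint (lebesgue_rV d) \1_B)%E.
  by rewrite -[RHS](ge0_integral_affine a n0 mI I0); congr (_ * _)%E.
 rewrite (etrans (nint_indic (lebesgue_rV d) mB) B0) in h.
 apply: (etrans (esym (nint_indic (lebesgue_rV d) (mG n)))).
 by move/eqP: h; rewrite mule_eq0 eqe gt_eqF ?exprn_gt0//= => /eqP.
have -> : setT = \bigcup_n G n.
 apply/esym/seteqP; split=> // x _; have [N hN] := le_succ_eventually (`|x| / r).
 exists N => //; apply: hB; rewrite normrZ ger0_norm ?invr_ge0// mulrC ler_pdivrMr// mulrC -ler_pdivrMr//.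
 exact: hN.
have nG := @negligible_bigcup _ _ _ (@lebesgue_rV R d) G.
apply/negligibleP; first exact: bigcup_measurable.
by apply: nG => n; exists (G n); split; [exact: mG|exact: G0|].
Qed.

Section full_support.
Context {R : realType} {d : nat} (rho : 'rV[R]_d -> R) (mu : probability 'rV[R]_d R) (mrho : meas rho)
 (rho0 : forall x, 0 < rho x)
 (muE : forall f : 'rV[R]_d -> \bar R, meas f -> (forall x, 0 <= f x)%E -> (\int[mu]_x f x = \int[@lebesgue_rV R d]_x (f x * (rho x)%:E))%E).

Lemma full_support (w : 'rV[R]_d -> R) : continuous w -> (forall x, 0 <= w x) -> nint mu w = 0%E ->
 forall x, w x = 0.
Proof.
move=> cw w0 iw a; apply/eqP; rewrite -[_ == _]negbK; apply/negP => wa.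
have mw := meas_continuous cw.
have mf : meas (fun x => (w x * rho x)%:E) by mble.
have f0 x : (0 <= (w x * rho x)%:E)%E by nneg.
have [mS S0] : measurable [set x | (w x * rho x)%:E != 0%E] /\ lebesgue_rV d [set x | (w x * rho x)%:E != 0%E] = 0%E.
 apply: ge0_integral_eq0 => //; transitivity (nint mu w) => //.
 by rewrite /nint muE//; exact: meas_EFin.
have wp : 0 < w a by rewrite lt_neqAle eq_sym wa w0.
have /cvgrPdist_lt/(_ _ wp)/nbhs_ballP[r /= r0 hr] := cw a.
apply: (@lebesgue_rV_ball _ _ _ a (r / 2) _ mS _ S0); first by nneg.
move=> x xr /=; rewrite eqe mulf_neq0 ?gt_eqF//.
have : ball a r (x + a).
 by rewrite -ball_normE/= opprD addrCA subrr addr0 normrN (le_lt_trans xr)// ltr_pdivrMr// ltr_pMr// ltr1n.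
by move=> /hr; rewrite ltr_norml => /andP[_]; lra.
Qed.

End full_support.

Section gibbs_measure.
Context {R : realType} {d : nat} (V : 'rV[R]_d -> R) (beta : R) (cV : continuous V)
 (iV : (lebesgue_rV d).-integrable setT (fun x => (expR (- (beta * V x)))%:E)).

Definition partition_cst := \int[lebesgue_rV d]_y expR (- (beta * V y)).

Let e x := expR (- (beta * V x)).

Let me : meas e.
Proof.
apply: mcomp; first exact: measurable_expR.
by apply: mcomp; [exact: oppr_measurable|apply: measurable_funM => //; exact: meas_continuous].
Qed.

Let Zfin : nint (lebesgue_rV d) e = partition_cst%:E.
Proof. by rewrite /partition_cst /Rintegral fineK//; exact: integrable_fin_num. Qed.

Lemma partition_cst_gt0 : 0 < partition_cst.
Proof.
have Z0 : 0 <= partition_cst by rewrite -lee_fin -Zfin; apply: nint_ge0 => x; exact: expR_ge0.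
rewrite lt_neqAle Z0 andbT; apply/eqP => z.
have [_] : measurable [set x | (e x)%:E != 0%E] /\ lebesgue_rV d [set x | (e x)%:E != 0%E] = 0%E.
 apply: ge0_integral_eq0; [exact: meas_EFin|by move=> x; rewrite lee_fin expR_ge0|].
 by rewrite -/(nint (lebesgue_rV d) e) Zfin -z.
rewrite (_ : [set x | _] = setT); first exact: lebesgue_rV_setT_neq0.
by apply/seteqP; split=> // x _ /=; rewrite eqe gt_eqF ?expR_gt0.
Qed.

Lemma gibbs_density_ge0 x : 0 <= gibbs_density beta V x.
Proof. by rewrite divr_ge0 ?expR_ge0// ltW// partition_cst_gt0. Qed.

Lemma meas_gibbs_density : meas (gibbs_density beta V).
Proof. by mble. Qed.

Lemma integral_gibbs_density : (\int[lebesgue_rV d]_x (gibbs_density beta V x)%:E = 1)%E.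
Proof.
rewrite (_ : (\int[_]_x _)%E = nint (lebesgue_rV d) (fun x => partition_cst^-1 * e x)%R); last first.
 by apply: eq_integral => x _; rewrite mulrC.
rewrite nintZ ?invr_ge0 ?(ltW partition_cst_gt0)//; last by split=> // x; exact: expR_ge0.
by rewrite Zfin -EFinM mulVf// gt_eqF// partition_cst_gt0.
Qed.

Definition gibbs_measure : probability 'rV[R]_d R :=
 dens_prob meas_gibbs_density gibbs_density_ge0 integral_gibbs_density.

Lemma integral_gibbs_measure f : meas f -> (forall x, 0 <= f x)%E ->
 (\int[gibbs_measure]_x f x = \int[lebesgue_rV d]_x (f x * (gdens V beta partition_cst x)%:E))%E.
Proof. exact: integral_dens_prob. Qed.

Lemma has_density_gibbs_measure : has_density gibbs_measure (gibbs_density beta V).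
Proof. by []. Qed.

End gibbs_measure.

Section langevin_invariant.
Context {R : realType} {d : nat} {disp} {Omega : measurableType disp} (P : probability Omega R) (F : R -> set (set Omega))
 (hF : is_filtration P F) (W : R -> Omega -> 'rV[R]_d) (hW : is_brownian_motion P F W) (V g : 'rV[R]_d -> R)
 (beta D C1 C2 C3 m1 M1 M2 : R) (hyps : langevin_hyps V g beta D C1 C2 C3 m1 M1 M2)
 (mgV : forall i, meas (fun x => grad V x 0 i))
 (iV : (lebesgue_rV d).-integrable setT (fun x => (expR (- (beta * V x)))%:E)).

Context (cV : continuous V).

Let mW t : 0 <= t -> meas (W t).
Proof.
move=> t0 _ A mA; rewrite setTI; have [_ h _ _] := hF; have [_ _ aW _] := hW.
by apply: (h t t0); exact: aW.
Qed.

Lemma langevin_invariant_distribution :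
 invariant_distribution P F W (ldrift V g beta) (lsig g beta) (gibbs_measure cV iV) /\
 forall nu : probability 'rV[R]_d R, invariant_distribution P F W (ldrift V g beta) (lsig g beta) nu ->
  forall A, measurable A -> nu A = gibbs_measure cV iV A.
Proof.
have [L hl] := lip_langevin hyps.
have [N [W' [[mN N0] hW' mW' cW' W12]]] := regular_brownian_motion hF hW.
have W21 om : ~ N om -> forall t, 0 <= t -> W' t om = W t om by move=> nN t t0; rewrite W12.
pose q t := langevin_kernel hF hW' mW' cW' hyps t.
have sS x := is_solution_sol hF hW' mW' cW' hl x.
have Mq : is_markov_semigroup P F W' (ldrift V g beta) (lsig g beta) q.
 move=> x; split; first by eexists; exact: sS.
 by move=> Y sY t t0 A mA; rewrite (solution_law hF hW' mW' cW' hl sY t0 mA).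
have muE := @integral_gibbs_measure R d V beta cV iV.
have Z0 := partition_cst_gt0 cV iV.
have imu t A := langevin_kernel_invariant hF hW' mW' cW' hyps Z0 muE mgV (t := t) (A := A).
split.
 exists q; last by move=> t t0 A mA; exact: imu.
 exact: (markov_semigroup_transfer hF hl mN N0 (fun t _ => mW' t) mW W21 Mq).
move=> nu [p Mp ip] A mA.
have Mp' := markov_semigroup_transfer hF hl mN N0 mW (fun t _ => mW' t) W12 Mp.
apply: (@unique_invariant R d (q 1)) => //.
- move=> B mB; exact: (continuous_law hF hW' mW' cW' hl (sig_min_gt0 hyps) (sig_min_le hyps) ltr01 mB).
- apply: (@full_support R d (gdens V beta (partition_cst V beta))) => //.
 + exact: (meas_gdens hyps).
 + by move=> x; exact: (gdens_gt0 V beta Z0).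
- by move=> B mB; exact: imu.
- move=> B mB; rewrite -(ip 1 ler01 B mB); apply: eq_integral => x _.
 by have [_ h] := Mp' x; rewrite (h _ (sS x) 1 ler01 B mB).
Qed.

End langevin_invariant.

Theorem theorem4p1 (R : realType) (d : nat) (hd : (1 <= d)%N)
  (disp : measure_display) (Omega : measurableType disp)
  (P : probability Omega R) (F : R -> set (set Omega))
  (hF : is_filtration P F)
  (W : R -> Omega -> 'rV[R]_d) (hW : is_brownian_motion P F W)
  (beta : R) (hbeta : 0 < beta)
  (V : 'rV[R]_d -> R) (V_smooth : smooth V) (V_confining : confining V)
  (D : R) (gradV_lip : forall x y, enorm (grad V x - grad V y) <= D * enorm (x - y))
  (C4 : R) (C4_gt0 : 0 < C4)
  (lapV_le : forall x,
    `|\sum_(i < d) partial i (partial i V) x| <= C4 * (1 + enorm x ^+ 2))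
  (g : 'rV[R]_d -> R) (g_diff : twice_differentiable g)
  (C1 : R) (C1_gt0 : 0 < C1)
  (g_lip : forall x y, `|g x - g y| <= C1 * enorm (x - y))
  (C2 : R) (C2_gt0 : 0 < C2)
  (gradg_lip : forall x y, enorm (grad g x - grad g y) <= C2 * enorm (x - y))
  (m1 M1 : R) (m1_gt0 : 0 < m1) (m1_lt_M1 : m1 < M1)
  (g_bnd : forall x, m1 < g x < M1)
  (C3 : R) (C3_gt0 : 0 < C3)
  (ggradV_lip : forall x y,
    enorm (g x *: grad V x - g y *: grad V y) <= C3 * enorm (x - y))
  (M2 M3 : R) (M2_gt0 : 0 < M2) (M3_gt0 : 0 < M3)
  (gradg_bnd : forall x, enorm (grad g x) < M2)
  (partialg_bnd : forall x (j : 'I_d), `|partial j g x| < M3)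
  (M4 : R) (M4_gt0 : 0 < M4)
  (partial2g_bnd : forall x (i : 'I_d), `|partial i (partial i g) x| < M4) :
  let b := fun x => - (g x *: grad V x) + beta^-1 *: grad g x in
  let sigma := fun x => Num.sqrt (2 * beta^-1 * g x) in
  exists mu : probability 'rV[R]_d R,
    [/\ has_density mu (gibbs_density beta V),
        invariant_distribution P F W b sigma mu &
        forall nu : probability 'rV[R]_d R,
          invariant_distribution P F W b sigma nu ->
          forall A : set 'rV[R]_d, measurable A -> nu A = mu A].
Proof.
move=> b sigma.
have [dg _] := g_diff.
have dV x : differentiable V x by exact: (V_smooth [::] x).
have hyps : langevin_hyps V g beta `|D| C1 C2 C3 m1 M1 M2.
 have absD (x y : 'rV[R]_d) : D * enorm (x - y) <= `|D| * enorm (x - y) by rewrite ler_wpM2r ?enorm_ge0 ?ler_norm.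
 split; first by split=> //; exact: ltW.
 - split=> //; first exact: ltW.
   by move=> x; have /andP[h1 h2] := g_bnd x; rewrite !ltW.
  by move=> x; exact: ltW.
 - by split=> // x y; exact: (le_trans (gradV_lip x y) (absD x y)).
 - by split.
have mgV i : meas (fun x => grad V x 0 i).
 rewrite (_ : (fun x => _) = partial i V); last by apply/funext => x; rewrite mxE.
 by apply: meas_continuous => x; apply: differentiable_continuous; exact: (V_smooth [:: i] x).
have [_ /(_ beta hbeta) iV] := V_confining.
have cV : continuous V by move=> x; exact: differentiable_continuous.
have [inv uniq] := langevin_invariant_distribution hF hW hyps mgV iV cV.
exists (gibbs_measure cV iV); split; [exact: has_density_gibbs_measure|exact: inv|exact: uniq].
Qed.
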